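(* Let $d\ge3$ be odd, let $V$ be a $d$-dimensional complex vector space, and let $\sigma$ be a $d$-admissible signature of size $n$. Assume that $n>d^2$ and let $I\in R_\sigma(V)$ be a Weyl generator. Then there exist $1\le p\le q\le n$ with $\min(q-p,\,n-(q-p))\ge d+1$ such that $I$ lies in the extended cluster of a seed $\Sigma_\sigma(p,q)$ (for some choice of the reduced Demazure weaves entering the definition of $\Sigma_\sigma(p,q)$).
   Context: **Signatures.** A signature of size $n$ and type $(a,b)$, $a+b=n\ge3$, is a map $\sigma:\mathbb Z\to\{1,-1\}$ with $\sigma(j+n)=\sigma(j)$, taking the value $1$ (''black'') $a$ times and $-1$ (''white'') $b$ times on $\{1,\dots,n\}$. It is $d$-admissible if for all $j\in\mathbb Z$ and $k\in\{0,\dots,d-1\}$ there is $j'\ge j$ with $\sum_{i=j}^{j'}\sigma(i)\equiv k \pmod d$. **Mixed wedge.** Fix a volume form $e\in\bigwedge^dV$ (defining $\det$) and identify $\bigwedge^dV$ with $\bigwedge^0V=\mathbb C$ via $e$. For $u=u_1\wedge\cdots\wedge u_p$ and $v\in\bigwedge^qV$ with $p+q\ge d$ put $u\cap v=\sum_\tau \mathrm{sgn}(\tau)\det(u_{\tau(1)}\wedge\cdots\wedge u_{\tau(d-q)}\wedge v)\,u_{\tau(d-q+1)}\wedge\cdots\wedge u_{\tau(p)}$, the sum over permutations $\tau$ of $\{1,\dots,p\}$ increasing on the first $d-q$ and on the last $p+q-d$ positions (extended bilinearly). The mixed wedge of $u\in\bigwedge^pV$, $v\in\bigwedge^qV$ is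 $u\curlywedge v=u\wedge v$ if $p+q\le d$ and $u\cap v$ if $p+q\ge d$ (these agree if $p+q=d$). A covector $u^*\in V^*$ is identified with the element $\psi(u^* )\in\bigwedge^{d-1}V$ such that $v\wedge\psi(u^* )=u^*(v)e$ for all $v\in V$. Iterated mixed wedges are evaluated from right to left. **Rings.** $V^\sigma$ is the product of $n$ factors, the $j$-th being $V$ if $\sigma(j)=1$ and $V^*$ if $\sigma(j)=-1$; its points are $\mathbf u=(u_1,\dots,u_n)$, and $u_{j+n}=u_j$. $\mathrm{SL}(V)$ acts naturally; $R_\sigma(V)=\mathbb C[V^\sigma]^{\mathrm{SL}(V)}$ and $K_\sigma$ is its fraction field. The Weyl generators of $R_\sigma(V)$ are: the determinants $\det(u_{i_1},\dots,u_{i_d})$ for black $i_1<\dots<i_d$ in $[1,n]$, the dual determinants $\det(u^*_{i_1},\dots,u^*_{i_d})$ for white $i_1<\dots<i_d$ in $[1,n]$ (with respect to the volume form on $V^*$ dual to $e$), and the pairings $u_j^*(u_i)$ for $i$ black, $j$ white. **Flags.** A decorated flag is $\mathcal G=(\mathcal G^1,\dots,\mathcal G^{d-1})$ with $0\ne\mathcal G^k\in\bigwedge^kV$ and $\mathcal G^{k+1}=\mathcal G^k\wedge v$ for some $v\in V$ ($1\le k<d-1$). Convention: $\mathcal G^0=1$, $\mathcal G^d=e$. Flags $\mathcal G,\mathcal H$ are in relative position $s_k$ if $\mathcal G^i=\mathcal H^i$ for $i\ne k$ and $\mathcal H^k$ is not proportional to $\mathcal G^k$; the crossing value $\langle\mathcal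 G,\mathcal H\rangle_k\in\mathbb C\setminus\{0\}$ is then defined by $\mathcal H^k=\mathcal G^{k-1}\wedge y$, $\mathcal G^k\wedge y=\langle\mathcal G,\mathcal H\rangle_k\,\mathcal G^{k+1}$ ($y\in V$). For generic $\mathbf u\in V^\sigma$, $j\in\mathbb Z$, $1\le k\le d-1$, let $j'\ge j$ be smallest with $\sum_{i=j}^{j'}\sigma(i)\equiv k\pmod d$ and $\mathcal F_j^k=u_j\curlywedge u_{j+1}\curlywedge\cdots\curlywedge u_{j'}$; then $\mathcal F_j=(\mathcal F_j^1,\dots,\mathcal F_j^{d-1})$ is a decorated flag, $\mathcal F_{j+n}=\mathcal F_j$. **Words.** Letters are in $\{1,\dots,d-1\}$; a marked word has some letters marked. Let $\rho_j=12\cdots(d-1)$ if $\sigma(j)=1$, $\rho_j=(d-1)\cdots21$ if $\sigma(j)=-1$, with only the last letter marked. For $p<q$ let $\beta(p,q)=\rho_p\rho_{p+1}\cdots\rho_{q-1}$. It is decorated by placing flags in the gaps between letters and at the ends: to the left of the $k$-th letter of $\rho_j$ stands $\mathcal F_{j,k}$, where, if $\sigma(j)=1$, $\mathcal F_{j,k}^i=\mathcal F_j^i$ for $i\ge k$ and $\mathcal F_{j+1}^i$ for $i<k$; if $\sigma(j)=-1$, $\mathcal F_{j,k}^i=\mathcal F_j^i$ for $i\le d-k$ and $\mathcal F_{j+1}^i$ for $i>d-k$; at the right end stands $\mathcal F_q$. Flags on the two sides of a letter $k$ are in relative position $s_k$, with crossing value $1$ if the letter is unmarked. **Demazure weaves.**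 A Demazure weave $\mathfrak w:\beta\rightrightarrows\beta'$ is a planar graph in a rectangle, read from top to bottom, given by a sequence of moves transforming the (marked) top word $\beta$ into the bottom word $\beta'$: $ii\to i$ (trivalent vertex), $ij\to ji$ with $|i-j|>1$ (4-valent vertex), $iji\to jij$ with $|i-j|=1$ (6-valent vertex). Edges are colored by letters. It is reduced if $\beta'$ is a reduced word in the symmetric group $S_d$. **Cycles.** Each marked top letter and each trivalent vertex $v$ defines a cycle $\gamma=\gamma_v$, a function from edges to $\mathbb Z_{\ge0}$: $\gamma=0$ on edges starting above $v$ and on other edges starting at the same level (in particular other top edges), $\gamma=1$ on the edge going down from $v$, and below $v$: at a trivalent vertex with incoming $a$ (left), $c$ (right), outgoing $b$: $\gamma(b)=\min(\gamma(a),\gamma(c))$; at a 4-valent vertex weights are carried along straight strands; at a 6-valent vertex with incoming $a,f,e$ (left to right) and outgoing $b,c,d$ (left to right): $\gamma(c)=\min(\gamma(a),\gamma(e))$, $\gamma(b)=\gamma(f)+\gamma(e)-\gamma(c)$, $\gamma(d)=\gamma(a)+\gamma(f)-\gamma(c)$. A cycle is frozen if it comes from a marked top letter or is nonzero on some bottom edge; otherwise mutable. **Quiver.** For numbers put $D(x,y,z;x',y',z')=\det\begin{pmatrix}1&1&1\\ x&y&z\\ x'&y'&z'\end{pmatrix}$. The intersection pairing is $\langle\gamma,\gamma'\rangle=\sum_v\langle\gamma,\gamma'\rangle_v$ over internal vertices, with $\langle\gamma,\gamma'\rangle_v=D(\gamma(a),\gamma(b),\gamma(c);\gamma'(a),\gamma'(b),\gamma'(c))$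 at trivalent vertices, $\frac12\big[D(\gamma(a),\gamma(c),\gamma(e);\gamma'(a),\gamma'(c),\gamma'(e))+D(\gamma(b),\gamma(d),\gamma(f);\gamma'(b),\gamma'(d),\gamma'(f))\big]$ at 6-valent vertices, $0$ at 4-valent vertices (here, at a trivalent vertex, $a$ and $c$ are the left and right incoming edges and $b$ is the outgoing edge; at a 6-valent vertex, $a,f,e$ are the incoming edges and $b,c,d$ the outgoing edges, each listed from left to right). The quiver $Q(\mathfrak w)$ has the cycles as vertices (frozen/mutable accordingly) and $\langle\gamma,\gamma'\rangle$ arrows from $\gamma$ to $\gamma'$ (negative means reversed); arrows between frozen vertices are kept. **Cluster variables.** For generic $\mathbf u$ the decoration of the top word extends uniquely to an assignment of decorated flags to all regions of $\mathfrak w$, with unique numbers $\Delta_\gamma\ne0$ (one per cycle), such that for each edge $e$ of color $k$ with left region $U$ and right region $W$, the flags are in relative position $s_k$ and $\langle\mathcal F_U,\mathcal F_W\rangle_k=\prod_\gamma\Delta_\gamma^{\gamma(e)}$. The $\Delta_\gamma$ are $\mathrm{SL}(V)$-invariant rational functions of $\mathbf u$, i.e. elements of $K_\sigma$. The seed of $\mathfrak w$ is $\Sigma(\mathfrak w)=(Q(\mathfrak w),\{\Delta_\gamma\})$. **The seeds $\Sigma_\sigma(p,q)$.** For $1\le p\le q\le n$ with $\min(q-p,\,n-(q-p))\ge d+1$ choose reduced Demazure weaves $\mathfrak w_1:\beta(p,q)\rightrightarrows\beta_1'$ and $\mathfrak w_2:\beta(q,p+n)\rightrightarrows\beta_2'$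 with $\beta_2'$ the reverse of $\beta_1'$ (both are reduced words for the longest element of $S_d$). The seeds $\Sigma(\mathfrak w_1),\Sigma(\mathfrak w_2)$ share the frozen variables $\mathbf z_0=\{\mathcal F_p^k\wedge\mathcal F_q^{d-k}:1\le k\le d-1\}$. The seed $\Sigma_\sigma(p,q)$ is their amalgamation along $\mathbf z_0$: take the union of both quivers, identify vertices carrying the same element of $\mathbf z_0$, add the arrow numbers between identified vertices, and declare the identified vertices mutable; its extended cluster is the union of the two extended clusters, i.e. the set of all $\Delta_\gamma$ for cycles $\gamma$ of $\mathfrak w_1$ and $\mathfrak w_2$. *)

(* Defs.v *)
From HB Require Import structures.
From mathcomp Require Import all_boot all_order all_fingroup all_algebra.
From mathcomp Require Export reals.
From mathcomp Require Export complex mpoly.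

Set Implicit Arguments.
Unset Strict Implicit.
Unset Printing Implicit Defensive.

Import Order.TTheory GRing.Theory Num.Theory.
Local Open Scope ring_scope.

(* [sigma j = true] encodes the value 1 (black), [false] the value -1 (white). *)
Record signature (n : nat) := Signature {
  color :> int -> bool;
  color_periodic : forall j : int, color (j + n%:Z) = color j;
  signature_size : (2 < n)%N
}.

Definition sgnc (c : bool) : int := if c then 1 else -1.

(* sigma(j) + ... + sigma(j + m) *)
Definition psum (sigma : int -> bool) (j : int) (m : nat) : int :=
  \sum_(i < m.+1) sgnc (sigma (j + i%:Z)).

Definition hits (d : nat) (sigma : int -> bool) (j : int) (k m : nat) : bool :=
  (psum sigma j m == k%:Z %[mod d%:Z])%Z.

Definition admissible (d n : nat) (sigma : signature n) : Prop :=
  forall (j : int) (k : nat), (k < d)%N -> exists m : nat, hits d sigma j k m.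

(* The least m with sigma(j) + ... + sigma(j+m) = k mod d. Searching below n * d
   suffices because [hits d sigma j k] is (n * d)-periodic: see [stopP]. *)
Definition stop (d n : nat) (sigma : signature n) (j : int) (k : nat) : nat :=
  find (hits d sigma j k) (iota 0 (n * d)).

Lemma hits_periodic d n (sigma : signature n) j k m :
  hits d sigma j k (m + n * d) = hits d sigma j k m.
Proof.
have perq q i : sigma (i + (n * q)%N%:Z) = sigma i.
  elim: q i => [|q IHq] i; first by rewrite muln0 addr0.
  by rewrite mulnSr PoszD addrA color_periodic IHq.
have block q : \sum_(i < n * q) sgnc (sigma (j + i%:Z)) =
    q%:Z * \sum_(i < n) sgnc (sigma (j + i%:Z)).
  elim: q => [|q IHq]; first by rewrite muln0 big_ord0 mul0r.
  rewrite mulnSr big_split_ord /= IHq -addn1 PoszD mulrDl mul1r; congr (_ + _).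
  by apply: eq_bigr => i _; rewrite PoszD addrCA addrC perq.
rewrite /hits /psum addnC -addnS big_split_ord /= block.
rewrite mulrC modzMDl; congr (_ == _); congr (modz _ _).
by apply: eq_bigr => i _; rewrite PoszD addrCA addrC perq.
Qed.

Lemma stopP d n (sigma : signature n) j k : admissible d sigma -> (k < d)%N ->
  hits d sigma j k (stop d sigma j k) /\
  forall m, hits d sigma j k m -> (stop d sigma j k <= m)%N.
Proof.
move=> adm kd; have [m0 hm0] := adm j k kd.
have nd_gt0 : (0 < n * d)%N.
  by rewrite muln_gt0 (leq_trans _ (signature_size sigma)) //= (leq_ltn_trans _ kd).
have hs : has (hits d sigma j k) (iota 0 (n * d)).
  apply/hasP; exists (m0 %% (n * d))%N; first by rewrite mem_iota ltn_mod.
  move: hm0; rewrite {1}(divn_eq m0 (n * d)).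
  elim: (m0 %/ _)%N => [|q IHq]; first by rewrite mul0n add0n.
  by rewrite mulSnr addnAC hits_periodic.
split.
  have := nth_find 0%N hs; rewrite nth_iota ?add0n //.
  by move: hs; rewrite has_find size_iota.
move=> m hm; rewrite leqNgt; apply/negP => lt_m.
have := before_find 0%N lt_m; rewrite nth_iota ?add0n ?hm //.
by apply: leq_trans lt_m _; rewrite -[leqRHS](size_iota 0) find_size.
Qed.

Section Exterior.
Variables (F : fieldType) (V : vectType F).
Local Notation d := (\dim (fullv : {vspace V})).

(* The exterior algebra of V, in the basis of the wedges
   b_S = b_(s_1) /\ ... /\ b_(s_k), S = {s_1 < ... < s_k}, attached to the basis
   [vbasis fullv] of V: the element x is the sum of the x(S) b_S. *)
Definition ext := {ffun {set 'I_d} -> F^o}.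

Definition eb (S : {set 'I_d}) : ext := [ffun T => (T == S)%:R].

Definition ext1 : ext := eb set0.

Definition graded (k : nat) (x : ext) : Prop :=
  forall S, x S != 0 -> #|S| = k.

Definition inV (v : V) : ext :=
  \sum_(i < d) coord (vbasis fullv) i v *: eb [set i].

(* Sign of the shuffle listing A increasingly, then B increasingly. *)
Definition shsgn (A B : {set 'I_d}) : F :=
  (-1) ^+ #|[set ab in setX A B | (ab.2 < ab.1)%N]|.

Definition wedge (x y : ext) : ext :=
  [ffun S : {set 'I_d} => \sum_(A : {set 'I_d} | A \subset S)
               shsgn A (S :\: A) * x A * y (S :\: A)].

Definition volume_form (e : ext) : Prop := graded d e /\ e != 0.

Variable e : ext.

(* The coefficient of the degree d part of x with respect to e. *)
Definition det (x : ext) : F := x [set: 'I_d] / e [set: 'I_d].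

(* u \cap v, expanding u in the decomposable elements b_S. A permutation tau
   as in the sum defining b_S \cap v amounts to the set A of the factors placed
   first; for v of degree q only those A with #|A| = d - q contribute, since
   [det] vanishes outside degree d. *)
Definition cap (x y : ext) : ext :=
  \sum_(S : {set 'I_d}) \sum_(A : {set 'I_d} | A \subset S)
     (x S * shsgn A (S :\: A) * det (wedge (eb A) y)) *: eb (S :\: A).

(* Elements come with their degree, degree d being identified with degree 0. *)
Definition mwedge (x y : nat * ext) : nat * ext :=
  if (x.1 + y.1 < d)%N then ((x.1 + y.1)%N, wedge x.2 y.2)
  else ((x.1 + y.1 - d)%N, cap x.2 y.2).

(* The element of degree d - 1 identified with a covector: see [psiP]. *)
Definition psi (f : 'Hom(V, F^o)) : ext :=
  \sum_(i < d) (shsgn [set i] (~: [set i]) * f (vbasis fullv)`_i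
                * e [set: 'I_d]) *: eb (~: [set i]).

Lemma psiP (f : 'Hom(V, F^o)) (v : V) :
  volume_form e -> wedge (inV v) (psi f) = f v *: e.
Proof.
move=> [he _]; apply/ffunP => S; rewrite !ffunE /=.
have inVE A : inV v A = \sum_(i < d) coord (vbasis fullv) i v * (A == [set i])%:R.
  by rewrite /inV sum_ffunE; apply: eq_bigr => i _; rewrite !ffunE.
have psiE A : psi f A = \sum_(i < d) shsgn [set i] (~: [set i])
    * f (vbasis fullv)`_i * e [set: 'I_d] * (A == ~: [set i])%:R.
  by rewrite /psi sum_ffunE; apply: eq_bigr => i _; rewrite !ffunE.
have [-> | ST] := eqVneq S [set: 'I_d]; last first.
  have -> : e S = 0.
    apply/eqP/negPn/negP => /he cS; case/negP: ST.
    by rewrite eqEcard subsetT cardsT card_ord cS leqnn.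
  rewrite scaler0; apply: big1 => A AS; rewrite inVE psiE.
  rewrite -mulrA [X in _ * X]big_distrlr /= big1 ?mulr0 // => i _.
  apply: big1 => j _.
  have [Ai | _] := eqVneq A [set i]; last by rewrite mulr0 mul0r.
  have [DA | _] := eqVneq (S :\: A) (~: [set j]); last by rewrite !mulr0.
  case/negP: ST; rewrite -subTset; apply/subsetP => x _.
  have [-> | xi] := eqVneq x i.
    by apply: (subsetP AS); rewrite Ai inE.
  have [xj | xj] := eqVneq x j; last first.
    have : x \in ~: [set j] by rewrite !inE.
    by rewrite -DA inE => /andP[].
  have : i \in ~: [set j] by rewrite !inE -xj eq_sym.
  by rewrite -DA Ai !inE eqxx.
have -> : f v = \sum_(i < d) coord (vbasis fullv) i v * f (vbasis fullv)`_i.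
  rewrite {1}(coord_vbasis (memvf v)) linear_sum.
  by apply: eq_bigr => i _; rewrite linearZ.
rewrite scaler_suml.
transitivity (\sum_(A : {set 'I_d}) \sum_(i < d) (if A == [set i] then
    coord (vbasis fullv) i v * f (vbasis fullv)`_i * e setT else 0)).
  rewrite big_mkcond; apply: eq_bigr => A _; rewrite subsetT setTD inVE psiE.
  rewrite -mulrA big_distrlr mulr_sumr; apply: eq_bigr => i _ /=.
  have [-> | _] := eqVneq A [set i]; last first.
    by apply/eqP; rewrite mulf_eq0 big1 ?eqxx ?orbT // => j _; rewrite mulr0 mul0r.
  rewrite mulr1 (bigD1 i) //= eqxx big1 ?addr0.
    rewrite mulr1 mulrCA !mulrA; congr (_ * _); congr (_ * _).
    by rewrite -mulrA /shsgn -expr2 sqrr_sign mulr1.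
  move=> j ji; rewrite (inj_eq (@setC_inj _)) (inj_eq set1_inj) eq_sym (negPf ji).
  by rewrite !mulr0.
rewrite exchange_big; apply: eq_bigr => i _ /=.
by rewrite -big_mkcond big_pred1_eq.
Qed.

Definition vdet (s : seq V) : F :=
  det (foldr (fun v x => wedge (inV v) x) ext1 s).

(* Determinant with respect to the volume form of V* dual to e; it satisfies
   dual_det f * det (v_1, ..., v_d) = \det (f_r (v_c)). *)
Definition dual_det (s : seq 'Hom(V, F^o)) : F :=
  e [set: 'I_d] * \det (\matrix_(r < d, c < d) ((s`_r) (vbasis fullv)`_c : F)).

(* G k stands for G^k, 0 <= k <= d. *)
Definition flag := nat -> ext.

Definition decorated_flag (G : flag) : Prop :=
  [/\ G 0%N = ext1, G d = e,
      forall k, (0 < k < d)%N -> graded k (G k) /\ G k != 0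
    & forall k, (0 < k < d.-1)%N -> exists v : V, G k.+1 = wedge (G k) (inV v)].

Definition relative_position (k : nat) (G H : flag) : Prop :=
  (forall i, (i <= d)%N -> i != k -> G i = H i) /\
  (forall a : F, H k <> a *: G k).

Definition crossing_value (k : nat) (G H : flag) (c : F) : Prop :=
  exists y : V, H k = wedge (G k.-1) (inV y) /\
                wedge (G k) (inV y) = c *: G k.+1.

End Exterior.

Section Points.
Variables (F : fieldType) (V : vectType F) (n : nat) (sigma : signature n).
Local Notation d := (\dim (fullv : {vspace V})).

Definition factor (c : bool) : Type := if c then V else 'Hom(V, F^o).

(* The i-th factor, i in {0, ..., n-1}, is the one with label i + 1. *)
Definition point := forall i : 'I_n, factor (sigma (i.+1)%:Z).

Lemma factor_index_subproof (j : int) : (`|((j - 1) %% n%:Z)%Z| < n)%N.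
Proof.
have n0 : (0 < n)%N by apply: leq_trans (signature_size sigma).
by rewrite -ltz_nat gez0_abs ?modz_ge0 ?ltz_pmod // eqz_nat -lt0n.
Qed.

(* The factor with label congruent to j modulo n. *)
Definition factor_index (j : int) : 'I_n := Ordinal (factor_index_subproof j).

Definition as_vec c : factor c -> V :=
  if c return factor c -> V then fun v => v else fun _ => 0.

Definition as_covec c : factor c -> 'Hom(V, F^o) :=
  if c return factor c -> 'Hom(V, F^o) then fun _ => 0 else fun f => f.

(* u_j, of interest when j is black, resp. white, and 0 otherwise. *)
Definition vec (u : point) (j : int) : V := as_vec (u (factor_index j)).
Definition covec (u : point) (j : int) : 'Hom(V, F^o) :=
  as_covec (u (factor_index j)).

Definition factor_coord c : factor c -> 'I_d -> F :=
  if c return factor c -> 'I_d -> F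
  then fun v k => coord (vbasis fullv) k v
  else fun f k => f (vbasis fullv)`_k.

Definition coords (u : point) : 'I_(n * d) -> F :=
  mxvec (\matrix_(i < n, k < d) factor_coord (u i) k) ord0.

(* C[V^sigma] and its fraction field, which contains K_sigma. *)
Definition coord_ring := {mpoly F[n * d]}.
Definition ratfun := {fraction coord_ring}.

Definition evalp (f : coord_ring) (u : point) : F := f.@[coords u].

(* For u in a nonempty Zariski open subset of V^sigma. *)
Definition generically (P : point -> Prop) : Prop :=
  exists2 f : coord_ring, f != 0 & forall u, evalp f u != 0 -> P u.

(* f is regular at u, with value x. *)
Definition has_value (f : ratfun) (u : point) (x : F) : Prop :=
  exists a b : coord_ring,
    [/\ f = tofrac a / tofrac b, evalp b u != 0 & x = evalp a u / evalp b u].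

Definition inSL (g : 'End(V)) : Prop :=
  \det (\matrix_(i < d, k < d) coord (vbasis fullv) k (g (vbasis fullv)`_i)) = 1.

Definition factor_act (g : 'End(V)) c : factor c -> factor c :=
  if c return factor c -> factor c then fun v => g v else fun f => (f \o g^-1)%VF.

(* f belongs to R_sigma(V); g acts on covectors by f |-> f o g^-1. *)
Definition SL_invariant (f : coord_ring) : Prop :=
  forall (g : 'End(V)) (u : point), inSL g ->
    evalp f (fun i => factor_act g (u i)) = evalp f u.

Variable e : ext V.

Definition weyl_generator (f : coord_ring) : Prop :=
  [\/ exists2 s : seq nat,
        [&& sorted ltn s, size s == d
          & all (fun i => (0 < i <= n)%N && sigma i%:Z) s]
        & forall u, evalp f u = vdet e [seq vec u i%:Z | i <- s],
      exists2 s : seq nat,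
        [&& sorted ltn s, size s == d
          & all (fun i => (0 < i <= n)%N && ~~ sigma i%:Z) s]
        & forall u, evalp f u = dual_det e [seq covec u i%:Z | i <- s]
    | exists2 ij : nat * nat,
        [&& (0 < ij.1 <= n)%N, (0 < ij.2 <= n)%N, sigma ij.1%:Z & ~~ sigma ij.2%:Z]
        & forall u, evalp f u = covec u ij.2%:Z (vec u ij.1%:Z)].

Definition factor_ext c : factor c -> nat * ext V :=
  if c return factor c -> nat * ext V
  then fun v => (1%N, inV v) else fun f => (d.-1, psi e f).

(* u_j (u_(j+1) (... u_(j+m))) for the mixed wedge. *)
Definition mixed_product (u : point) (j : int) (m : nat) : nat * ext V :=
  foldr (fun i x => mwedge e (factor_ext (u (factor_index (j + i%:Z)))) x)
        (0%N, ext1 V) (iota 0 m.+1).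

Definition Fflag (u : point) (j : int) : flag V := fun k =>
  if k == 0%N then ext1 V else if k == d then e
  else (mixed_product u j (stop d sigma j k)).2.

(* F_(j,k), the flag to the left of the k-th letter of rho_j. *)
Definition Fmid (u : point) (j : int) (k : nat) : flag V := fun i =>
  if (if sigma j then k <= i else i <= d - k)%N
  then Fflag u j i else Fflag u (j + 1) i.

(* Marked words; the boolean tells whether the letter is marked. *)
Definition mword := seq (nat * bool).

Definition rho (j : int) : mword :=
  zip (if sigma j then iota 1 d.-1 else rev (iota 1 d.-1))
      (rcons (nseq d.-2 false) true).

Definition beta (p q : nat) : mword :=
  flatten [seq rho j%:Z | j <- iota p (q - p)].

Definition beta_flags (u : point) (p q : nat) : seq (flag V) :=
  rcons (flatten [seq [seq Fmid u j%:Z k | k <- iota 1 d.-1] | j <- iota p (q - p)])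
        (Fflag u q%:Z).

End Points.

Variant vertex_kind := Trivalent | Fourvalent | Sixvalent.

Definition is_trivalent v := if v is Trivalent then true else false.

Definition in_valency v := if v is Sixvalent then 3%N else 2%N.

Definition out_valency v :=
  match v with Trivalent => 1%N | Fourvalent => 2%N | Sixvalent => 3%N end.

Definition vertex_letters (v : vertex_kind) (s : seq nat) : option (seq nat) :=
  match v, s with
  | Trivalent, [:: i; j] => if i == j then Some [:: i] else None
  | Fourvalent, [:: i; j] =>
      if ((i.+1 < j) || (j.+1 < i))%N then Some [:: j; i] else None
  | Sixvalent, [:: i; j; k] =>
      if (i == k) && ((i.+1 == j) || (j.+1 == i)) then Some [:: j; i; j] else None
  | _, _ => None
  end.

Definition vertex_weights (v : vertex_kind) (s : seq nat) : seq nat :=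
  match v, s with
  | Trivalent, [:: a; c] => [:: minn a c]
  | Fourvalent, [:: a; b] => [:: b; a]
  | Sixvalent, [:: a; f; e] =>
      let c := minn a e in [:: f + e - c; c; a + f - c]%N
  | _, _ => [::]
  end.

(* The moves from top to bottom; (v, k) is a vertex of kind v whose incoming
   edges start at position k (counted from 0) of the current word. The t-th
   slice of the weave is the word obtained after t moves. *)
Definition weave := seq (vertex_kind * nat).

Definition move0 := (Trivalent, 0%N).

Definition window (m : vertex_kind * nat) (s : seq nat) : seq nat :=
  take (in_valency m.1) (drop m.2 s).

Definition replace_window (m : vertex_kind * nat) (new s : seq nat) : seq nat :=
  take m.2 s ++ new ++ drop (m.2 + in_valency m.1) s.

Definition word_step (w : seq nat) (m : vertex_kind * nat) : seq nat :=
  replace_window m (odflt [::] (vertex_letters m.1 (window m w))) w.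

Definition slice (w : seq nat) (ms : weave) (t : nat) : seq nat :=
  foldl word_step w (take t ms).

Definition is_weave (w : seq nat) (ms : weave) (w' : seq nat) : Prop :=
  (forall t, (t < size ms)%N -> let m := nth move0 ms t in
     vertex_letters m.1 (window m (slice w ms t)) <> None) /\
  slice w ms (size ms) = w'.

(* The letter i acts as the transposition of the i-th and (i+1)-st elements. *)
Definition simple_refl (d i : nat) : 'S_d :=
  match insub i.-1, insub i with
  | Some x, Some y => tperm x y
  | _, _ => 1%g
  end.

Definition word_perm (d : nat) (w : seq nat) : 'S_d :=
  (\prod_(i <- w) simple_refl d i)%g.

Definition letters_in (d : nat) (w : seq nat) : bool :=
  all (fun i => 0 < i < d)%N w.

Definition reduced_word (d : nat) (w : seq nat) : Prop :=
  letters_in d w /\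
  forall w', letters_in d w' -> word_perm d w' = word_perm d w ->
    (size w <= size w')%N.

Section Cycles.
Variables (w : mword) (ms : weave).

Definition wslice (t : nat) : seq nat := slice (unzip1 w) ms t.

(* A cycle is encoded by the slice and the position of its topmost edge. *)
Definition cycles : seq (nat * nat) :=
  [seq (0%N, k) | k <- iota 0 (size w) & (nth (0%N, false) w k).2] ++
  [seq (t.+1, (nth move0 ms t).2) |
     t <- iota 0 (size ms) & is_trivalent (nth move0 ms t).1].

Definition weight_step (g : seq nat) (m : vertex_kind * nat) : seq nat :=
  replace_window m (vertex_weights m.1 (window m g)) g.

(* The values of the cycle c on the edges met by slice t, from left to right. *)
Definition weights (c : nat * nat) (t : nat) : seq nat :=
  if (t < c.1)%N then nseq (size (wslice t)) 0%N
  else foldl weight_step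
         (mkseq (fun k => nat_of_bool (k == c.2)) (size (wslice c.1)))
         (drop c.1 (take t ms)).

Definition frozen_cycle (c : nat * nat) : bool :=
  (c.1 == 0%N) || has (fun x => x != 0%N) (weights c (size ms)).

Definition D3 (s s' : seq nat) : rat :=
  \det (\matrix_(i < 3, j < 3) (nth 0%N (nth [::] [:: nseq 3 1%N; s; s'] i) j)%:R).

Definition pairing_at (c c' : nat * nat) (t : nat) : rat :=
  let m := nth move0 ms t in
  let top g := window m (weights g t) in
  let bot g := take (out_valency m.1) (drop m.2 (weights g t.+1)) in
  let i g := nth 0%N (top g) in
  let o g := nth 0%N (bot g) in
  match m.1 with
  | Trivalent => D3 [:: i c 0; o c 0; i c 1]%N [:: i c' 0; o c' 0; i c' 1]%N
  | Fourvalent => 0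
  | Sixvalent =>
      2%:R^-1 * (D3 [:: i c 0; o c 1; i c 2]%N [:: i c' 0; o c' 1; i c' 2]%N
               + D3 [:: o c 0; o c 2; i c 1]%N [:: o c' 0; o c' 2; i c' 1]%N)
  end.

Definition pairing (c c' : nat * nat) : rat :=
  \sum_(t < size ms) pairing_at c c' t.

Definition cycle_index := 'I_(size cycles).
Definition cycle_of (i : cycle_index) : nat * nat := nth (0%N, 0%N) cycles i.

End Cycles.

(* [arrows x y] is the number of arrows from x to y (negative: from y to x). *)
Record seed (K : Type) := Seed {
  vertex : finType;
  frozen : pred vertex;
  arrows : vertex -> vertex -> rat;
  variable : vertex -> K
}.

Definition in_extended_cluster (K : Type) (S : seed K) (x : K) : Prop :=
  exists v : vertex S, variable v = x.

Definition weave_seed (K : Type) (w : mword) (ms : weave)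
    (Delta : cycle_index w ms -> K) : seed K :=
  @Seed K (cycle_index w ms) (fun i => frozen_cycle w ms (cycle_of i))
    (fun i j => pairing w ms (cycle_of i) (cycle_of j)) Delta.

Section Amalgamation.
Variables (K : eqType) (S1 S2 : seed K) (z : seq K).

Definition glued (v1 : vertex S1) (v2 : vertex S2) : bool :=
  (variable v1 == variable v2) && (variable v1 \in z).

(* One representative of each class: the vertices of the first quiver, and those
   of the second one that are not identified with a vertex of the first one. *)
Definition amalgam_vertex : finType :=
  (vertex S1 + {v2 : vertex S2 | ~~ [exists v1, glued v1 v2]})%type.

Definition represents1 (x : amalgam_vertex) : pred (vertex S1) :=
  fun v1 => if x is inl v then v == v1 else false.

Definition represents2 (x : amalgam_vertex) : pred (vertex S2) :=
  fun v2 => match x with inl v => glued v v2 | inr v => val v == v2 end.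

Definition amalgamation : seed K :=
  @Seed K amalgam_vertex
    (fun x => match x with
              | inl v1 => frozen v1 && ~~ [exists v2, glued v1 v2]
              | inr v2 => frozen (val v2)
              end)
    (fun x y =>
       \sum_(v | represents1 x v) \sum_(v' | represents1 y v') arrows v v' +
       \sum_(v | represents2 x v) \sum_(v' | represents2 y v') arrows v v')
    (fun x => match x with inl v1 => variable v1 | inr v2 => variable (val v2) end).

End Amalgamation.

Section ClusterVariables.
Variables (F : fieldType) (V : vectType F) (e : ext V).
Variables (n : nat) (sigma : signature n).
Local Notation d := (\dim (fullv : {vspace V})).

(* [fl t g] is the flag in the g-th region, from the left, of slice t, [top]
   lists the flags of the top slice and [x] gives the numbers Delta_gamma. *)
Definition decoration (w : mword) (ms : weave) (top : seq (flag V))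
    (x : cycle_index w ms -> F) (fl : nat -> nat -> flag V) : Prop :=
  [/\ forall g, (g <= size w)%N -> fl 0%N g = nth (fun=> 0) top g,
      forall t, (t < size ms)%N -> let: (v, k) := nth move0 ms t in
        (forall g, (g <= k)%N -> fl t.+1 g = fl t g) /\
        (forall g, (k + in_valency v + g <= size (wslice w ms t))%N ->
           fl t.+1 (k + out_valency v + g)%N = fl t (k + in_valency v + g)%N),
      forall t g, (t <= size ms)%N -> (g <= size (wslice w ms t))%N ->
        decorated_flag e (fl t g)
    & forall t k, (t <= size ms)%N -> (k < size (wslice w ms t))%N ->
        let i := nth 0%N (wslice w ms t) k in
        relative_position i (fl t k) (fl t k.+1) /\
        crossing_value i (fl t k) (fl t k.+1)
          (\prod_c x c ^+ nth 0%N (weights w ms (cycle_of c) t) k)].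

Definition cluster_variables (p q : nat) (ms : weave)
    (Delta : cycle_index (beta V sigma p q) ms -> ratfun V n) : Prop :=
  generically (fun u : point V sigma =>
    exists (x : cycle_index (beta V sigma p q) ms -> F) (fl : nat -> nat -> flag V),
      (forall c, has_value (Delta c) u (x c) /\ x c != 0) /\
      decoration (beta_flags e u p q) x fl).

(* z is the list of the F_p^k /\ F_q^(d-k), 1 <= k <= d-1. *)
Definition shared_variables (p q : nat) (z : seq (ratfun V n)) : Prop :=
  size z = d.-1 /\
  forall k, (0 < k < d)%N -> generically (fun u : point V sigma =>
    has_value (nth 0 z k.-1) u
      (det e (wedge (Fflag e u p%:Z k) (Fflag e u q%:Z (d - k)%N)))).

Definition is_seed_pq (p q : nat) (S : seed (ratfun V n)) : Prop :=
  exists (ms1 ms2 : weave) (w1 w2 : seq nat)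
         (Delta1 : cycle_index (beta V sigma p q) ms1 -> ratfun V n)
         (Delta2 : cycle_index (beta V sigma q (p + n)) ms2 -> ratfun V n)
         (z : seq (ratfun V n)),
    [/\ [/\ is_weave (unzip1 (beta V sigma p q)) ms1 w1,
            is_weave (unzip1 (beta V sigma q (p + n))) ms2 w2,
            reduced_word d w1, reduced_word d w2 & w2 = rev w1],
        cluster_variables Delta1, cluster_variables Delta2,
        shared_variables p q z
      & S = amalgamation (weave_seed Delta1) (weave_seed Delta2) z].

End ClusterVariables.

(* Main.v *)
Require Import Defs.
From HB Require Import structures.
From mathcomp Require Import all_boot all_order all_fingroup all_algebra.
From mathcomp Require Import reals complex mpoly ring zify.
From mathcomp Require boolp.

Set Implicit Arguments.
Unset Strict Implicit.
Unset Printing Implicit Defensive.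

Import Order.TTheory GRing.Theory Num.Theory.
Local Open Scope ring_scope.

(** Everything is computed in coordinates. Since [d] is odd, the mixed wedge of a covector [f] with
    [y] is the contraction of [y] by [f] ([cap_psi]). Hence F_j^{k+1} = u_j /\ F_{j+1}^k at a black
    [j], while at a white [j] the level F_j^k is the contraction of F_{j+1}^{k+1} by u_j
    ([gF_black], [gF_white]).

    Why a generator is a cluster variable. Take one column rho_j of the top word. The letters on its
    right can be passed leftwards through it: the i-th letter of the column turns into the next one
    by one 6-valent and several 4-valent vertices, and the last one is absorbed at a trivalent
    vertex ([passing_all]). No letter that comes out is the first letter of the column, so the flag
    X now standing left of the column still has the line (black) or the hyperplane (white) given by
    u_j. Moreover a single cycle v is nonzero on the column, with value 1 on its last letter, so the
    crossing values along it are 1, ..., 1, Delta_v. If Y is the flag on the right of a black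
    column, this means X^{k+1} = u_j /\ Y^k for k < d-1 and u_j /\ Y^{d-1} = Delta_v e; white
    columns behave dually ([col_black], [col_white], [stage_flag]). Doing this for columns b_1 < ...
    < b_s from right to left, starting from F_a, gives Delta_v e = u_{b_1} /\ ... /\ u_{b_s} /\
    F_a^{d-s}, or the iterated contraction of F_a^s ([special_weave]). For s = d-1 the level of F_a
    is the vector or covector with label a and the result is a determinant; for s = 1 it is a
    pairing.

    Why the labels fit. They must lie in a window whose length and whose complement are at least
    d+1. Among d labels on a circle of n > d^2 points some cyclic gap is at least d+1; cutting there
    rotates the factors cyclically, which costs no sign because d is odd ([lact_rot],
    [det_in_seed]). For a pairing one of the two arcs between the labels is short enough
    ([pairing_in_seed]). The special weave is then completed to a prescribed reduced bottom word:
    d-1 columns already act as the longest element of the 0-Hecke monoid, and a normal form for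
    words shows that any word obtained from them can be moved to [top_word] or to its reverse
    ([reach_top], [reach_top_rev]).

    Why the variables exist. The decoration extends generically if at each trivalent vertex the two
    outer flags are generically in relative position, and for this one good point is enough. A chain
    of flags along the bottom word always lifts to the top ([chain_lift]). As the two bottom words
    are reverse to each other, the two lifted tops close up to a cyclic chain, from which a point u0
    is read off ([weaves_decorated]). Over the local ring of rational functions at u0 the decoration
    can be built downwards with invertible crossing values ([tri_nondegenerate],
    [weave_data_exists]), and it is finally specialised at generic points
    ([cluster_of_weave_data]). *)

(** * Exterior algebra in coordinates over a commutative ring *)

Section ExteriorAlgebra.
Variables (K : comUnitRingType) (d : nat).
Implicit Types (S A B C : {set 'I_d}) (u v w f : 'rV[K]_d) (a c : K).

(** A copy of [ext] over any commutative ring, since the generic decoration is computed over a local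
    ring. For a field and [d] the dimension of [V] it is convertible to [ext V], and so are [wdg],
    [base], [sh_sign] to [wedge], [eb], [shsgn]. *)
Definition extK := {ffun {set 'I_d} -> K^o}.
Implicit Types x y : extK.

Definition sh_sign A B : K := (-1) ^+ #|[set ab in setX A B | (ab.2 < ab.1)%N]|.

Lemma sh_signE A B :
  sh_sign A B = \prod_(a in A) \prod_(b in B) (-1) ^+ (b < a)%N.
Proof.
rewrite /sh_sign pair_big /= -sum1_card -prodrXr /= big_mkcond [RHS]big_mkcond /=.
apply: eq_bigr => [[a b] _]; rewrite !inE /=.
by case: (a \in A); case: (b \in B); case: ltnP.
Qed.

Lemma prod_setU A B (G : 'I_d -> K) : [disjoint A & B] ->
  \prod_(i in A :|: B) G i = (\prod_(i in A) G i) * \prod_(i in B) G i.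
Proof.
by move=> dAB; rewrite -bigU //=; apply: eq_bigl => i; rewrite !inE.
Qed.

Lemma sh_signUl A B C : [disjoint A & B] ->
  sh_sign (A :|: B) C = sh_sign A C * sh_sign B C.
Proof. by move=> dAB; rewrite !sh_signE prod_setU. Qed.

Lemma sh_signUr A B C : [disjoint B & C] ->
  sh_sign A (B :|: C) = sh_sign A B * sh_sign A C.
Proof.
move=> dBC; rewrite !sh_signE -big_split /=; apply: eq_bigr => a _.
by rewrite prod_setU.
Qed.

Lemma sh_sign0l A : sh_sign set0 A = 1.
Proof. by rewrite sh_signE big_set0. Qed.

Lemma sh_sign0r A : sh_sign A set0 = 1.
Proof. by rewrite sh_signE big1 // => i _; rewrite big_set0. Qed.

Lemma sh_sign1 (i j : 'I_d) : sh_sign [set i] [set j] = (-1) ^+ (j < i)%N.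
Proof. by rewrite sh_signE !big_set1. Qed.

Lemma sh_sign_sq A B : sh_sign A B * sh_sign A B = 1.
Proof. by rewrite /sh_sign -expr2 sqrr_sign. Qed.

Lemma sh_sign1C (i j : 'I_d) : i != j ->
  sh_sign [set i] [set j] = - sh_sign [set j] [set i].
Proof.
move=> ij; rewrite !sh_sign1; case: ltngtP => [_|_|/val_inj e]; rewrite ?expr0 ?expr1 ?opprK //.
by rewrite e eqxx in ij.
Qed.

Definition base S : extK := [ffun T => (T == S)%:R].
Definition one : extK := base set0.

Definition wdg x y : extK :=
  [ffun S : {set 'I_d} => \sum_(A : {set 'I_d} | A \subset S)
               sh_sign A (S :\: A) * x A * y (S :\: A)].

Definition iv v : extK := [ffun S => \sum_i v 0 i * (S == [set i])%:R].

Lemma wdgDl x x' y : wdg (x + x') y = wdg x y + wdg x' y.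
Proof.
apply/ffunP=> S; rewrite !ffunE -big_split /=; apply: eq_bigr => A _.
by rewrite !ffunE mulrDr mulrDl.
Qed.

Lemma wdgDr x y y' : wdg x (y + y') = wdg x y + wdg x y'.
Proof.
apply/ffunP=> S; rewrite !ffunE -big_split /=; apply: eq_bigr => A _.
by rewrite !ffunE mulrDr.
Qed.

Lemma wdgZl c x y : wdg (c *: x) y = c *: wdg x y.
Proof.
apply/ffunP=> S; rewrite !ffunE scaler_sumr; apply: eq_bigr => A _.
by rewrite !ffunE /GRing.scale /=; ring.
Qed.

Lemma wdgZr c x y : wdg x (c *: y) = c *: wdg x y.
Proof.
apply/ffunP=> S; rewrite !ffunE scaler_sumr; apply: eq_bigr => A _.
by rewrite !ffunE /GRing.scale /=; ring.
Qed.

Lemma wdg0l y : wdg 0 y = 0.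
Proof. by rewrite -[X in wdg X y](scale0r (0 : extK)) wdgZl scale0r. Qed.

Lemma wdg0r x : wdg x 0 = 0.
Proof. by rewrite -[X in wdg x X](scale0r (0 : extK)) wdgZr scale0r. Qed.

Lemma wdgNr x y : wdg x (- y) = - wdg x y.
Proof. by rewrite -scaleN1r wdgZr scaleN1r. Qed.

Lemma wdgNl x y : wdg (- x) y = - wdg x y.
Proof. by rewrite -scaleN1r wdgZl scaleN1r. Qed.

Lemma wdg_suml (I : Type) (r : seq I) (P : pred I) (F : I -> extK) y :
  wdg (\sum_(i <- r | P i) F i) y = \sum_(i <- r | P i) wdg (F i) y.
Proof.
by elim/big_rec2: _ => [|i z1 z2 _ <-]; rewrite ?wdg0l // wdgDl.
Qed.

Lemma wdg_sumr (I : Type) (r : seq I) (P : pred I) (F : I -> extK) x :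
  wdg x (\sum_(i <- r | P i) F i) = \sum_(i <- r | P i) wdg x (F i).
Proof.
by elim/big_rec2: _ => [|i z1 z2 _ <-]; rewrite ?wdg0r // wdgDr.
Qed.

Lemma wdg1r x : wdg x one = x.
Proof.
apply/ffunP=> S; rewrite !ffunE (bigD1 S) //= ffunE setDv eqxx sh_sign0r mul1r mulr1.
rewrite big1 ?addr0 // => A /andP[AS nAS]; rewrite ffunE -[_ == set0]negbK setD_eq0.
case: (boolP (S \subset A)) => SA; last by rewrite mulr0.
by case/eqP: nAS; apply/eqP; rewrite eqEsubset AS.
Qed.

Lemma wdg1l x : wdg one x = x.
Proof.
apply/ffunP=> S; rewrite !ffunE (bigD1 set0) ?sub0set //= ffunE setD0 eqxx sh_sign0l !mul1r.
rewrite big1 ?addr0 // => A /andP[AS nAS]; rewrite ffunE (negPf nAS).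
by rewrite mulr0 mul0r.
Qed.

(* Both sides are sums over the ways to split S into three parts. *)
Lemma wdgA x y z : wdg x (wdg y z) = wdg (wdg x y) z.
Proof.
apply/ffunP=> S; rewrite !ffunE.
transitivity (\sum_(A : {set 'I_d} | A \subset S) \sum_(B : {set 'I_d} | A \subset B)
   if B \subset S then sh_sign A (S :\: A) * sh_sign (B :\: A) (S :\: B)
      * x A * y (B :\: A) * z (S :\: B) else 0).
  apply: eq_bigr => A AS; rewrite ffunE mulr_sumr -big_mkcondr /=.
  rewrite (reindex_onto (fun B => B :\: A) (fun C => A :|: C)) /=; last first.
    move=> C CS; apply/setP=> i; rewrite !inE.
    have := subsetP CS i; rewrite inE.
    by case: (i \in C); case: (i \in A); case: (i \in S) => //= /(_ isT).
  apply: eq_big => B.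
    apply/andP/andP => [[/subsetP BS /eqP AB]|[AB BS]].
      have AB' : A \subset B by rewrite -AB subsetUl.
      split=> //; apply/subsetP=> i iB; case: (boolP (i \in A)) => [/(subsetP AS)//|iA].
      by have := BS i; rewrite !inE iA iB => /(_ isT).
    split; first by apply: setSD.
    by rewrite setUC setDE setUIl [~: A :|: A]setUC setUCr setIT (setUidPl AB).
  case/andP=> BS /eqP AB.
  have -> : S :\: A :\: (B :\: A) = S :\: B.
    by rewrite setDDl AB.
  by rewrite !mulrA; ring.
rewrite (exchange_big_dep xpredT) //=.
rewrite [RHS]big_mkcond /=; apply: eq_bigr => B _.
case: ifP => BS; last first.
  by rewrite big1 // => A /andP[].
rewrite ffunE mulr_sumr mulr_suml [LHS]big_mkcond [RHS]big_mkcond /=.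
apply: eq_bigr => A _; case: (boolP (A \subset B)) => AB; rewrite ?andbF //.
rewrite (subset_trans AB BS) /=.
have eS : S :\: A = (B :\: A) :|: (S :\: B).
  apply/setP=> i; rewrite !inE; have := subsetP BS i; have := subsetP AB i.
  by case: (i \in A); case: (i \in B); case: (i \in S) => //= h1 h2;
    first [have := h1 isT | have := h2 isT].
have d1 : [disjoint B :\: A & S :\: B].
  rewrite -setI_eq0; apply/eqP/setP=> i; rewrite !inE.
  by case: (i \in B); rewrite ?andbF.
have eB : B = A :|: (B :\: A).
  by rewrite -{1}(setID B A) (setIidPr AB).
have d2 : [disjoint A & B :\: A].
  by rewrite -setI_eq0; apply/eqP/setP=> i; rewrite !inE; case: (i \in A).
have eT : sh_sign B (S :\: B) = sh_sign A (S :\: B) * sh_sign (B :\: A) (S :\: B).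
  by rewrite {1}eB sh_signUl.
rewrite eS sh_signUr // eT; ring.
Qed.

Lemma ivD u v : iv (u + v) = iv u + iv v.
Proof.
apply/ffunP=> S; rewrite !ffunE -big_split; apply: eq_bigr => i _.
by rewrite mxE mulrDl.
Qed.

Lemma ivZ c v : iv (c *: v) = c *: iv v.
Proof.
apply/ffunP=> S; rewrite !ffunE scaler_sumr; apply: eq_bigr => i _.
by rewrite mxE /GRing.scale /= mulrA.
Qed.

Lemma iv0 : iv 0 = 0.
Proof. by rewrite -[X in iv X](scale0r 0) ivZ scale0r. Qed.

Lemma ivN v : iv (- v) = - iv v.
Proof. by rewrite -scaleN1r ivZ scaleN1r. Qed.

Lemma ivB u v : iv (u - v) = iv u - iv v.
Proof. by rewrite ivD ivN. Qed.

Lemma iv_sum (I : Type) (r : seq I) (P : pred I) (F : I -> 'rV_d) :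
  iv (\sum_(i <- r | P i) F i) = \sum_(i <- r | P i) iv (F i).
Proof. by elim/big_rec2: _ => [|i z1 z2 _ <-]; rewrite ?iv0 // ivD. Qed.

Lemma ivE v : iv v = \sum_i v 0 i *: base [set i].
Proof.
apply/ffunP=> S; rewrite !ffunE sum_ffunE; apply: eq_bigr => i _.
by rewrite !ffunE.
Qed.

Lemma ivE1 v i : iv v [set i] = v 0 i.
Proof.
rewrite ffunE (bigD1 i) //= eqxx mulr1 big1 ?addr0 // => j ji.
by rewrite (inj_eq set1_inj) eq_sym (negPf ji) mulr0.
Qed.

(* Right multiplication by a vector, coordinatewise. *)
Lemma wdg_ivE x v S : wdg x (iv v) S =
  \sum_(i in S) sh_sign (S :\ i) [set i] * x (S :\ i) * v 0 i.
Proof.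
rewrite ffunE.
transitivity (\sum_(A : {set 'I_d} | A \subset S) \sum_(i in S)
   if A == S :\ i then sh_sign (S :\ i) [set i] * x (S :\ i) * v 0 i else 0).
  apply: eq_bigr => A AS; rewrite ffunE mulr_sumr [RHS]big_mkcond /=.
  apply: eq_bigr => i _.
  have [eA|nA] := eqVneq (S :\: A) [set i].
    have iS : i \in S.
      have : i \in S :\: A by rewrite eA set11.
      by rewrite inE => /andP[].
    have eA2 : A = S :\ i by rewrite -eA setDDr setDv set0U (setIidPr AS).
    by rewrite iS -eA2 eqxx eA mulr1.
  rewrite !mulr0; case: ifP => // iS; case: eqP => // eA; case/eqP: nA.
  by rewrite eA setDDr setDv set0U; apply/setIidPr; rewrite sub1set.
rewrite exchange_big /=; apply: eq_bigr => i iS.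
by rewrite -big_mkcondr /= (big_pred1 (S :\ i)) // => A /=; rewrite andbC; case: eqP => //= ->; rewrite subsetDl.
Qed.

Lemma base_wdg1 (i j : 'I_d) : i != j ->
  wdg (base [set i]) (base [set j]) = sh_sign [set i] [set j] *: base [set i; j].
Proof.
move=> ij; apply/ffunP=> S; rewrite !ffunE.
have [->|nS] := eqVneq S [set i; j].
  have eD : [set i; j] :\: [set i] = [set j].
    by apply/setP=> k; rewrite !inE; case: (eqVneq k i) => //= ->; rewrite (negPf ij).
  rewrite (bigD1 [set i]) /=; last by rewrite sub1set !inE eqxx.
  rewrite eD !ffunE !eqxx !mulr1 big1 ?addr0 //.
    by rewrite /GRing.scale /= mulr1.
  by move=> A /andP[_ nA]; rewrite ffunE (negPf nA) mulr0 mul0r.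
rewrite /GRing.scale /= mulr0 big1 // => A AS; rewrite !ffunE.
have [eA|] := eqVneq A [set i]; last by rewrite mulr0 mul0r.
have [eD|] := eqVneq (S :\: A) [set j]; last by rewrite mulr0.
case/eqP: nS; rewrite -eD -eA setDE setUIr setUCr setIT.
by apply/esym/setUidPr.
Qed.

Lemma base_wdg_sq (i : 'I_d) : wdg (base [set i]) (base [set i]) = 0.
Proof.
apply/ffunP=> S; rewrite !ffunE big1 // => A AS; rewrite !ffunE.
have [eA|] := eqVneq A [set i]; last by rewrite mulr0 mul0r.
have [eD|] := eqVneq (S :\: A) [set i]; last by rewrite mulr0.
have : i \in S :\: A by rewrite eD set11.
by rewrite eA !inE eqxx.
Qed.

(** The terms of index (i, j) and (j, i) cancel and the diagonal ones vanish. Anticommutativity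
    follows from this, and not conversely, because 2 may be a zero divisor in [K]. *)
Lemma iv_wdg_sq v : wdg (iv v) (iv v) = 0.
Proof.
pose G (i j : 'I_d) := (v 0 i * v 0 j) *: wdg (base [set i]) (base [set j]).
have -> : wdg (iv v) (iv v) = \sum_i \sum_j G i j.
  rewrite {1}ivE wdg_suml; apply: eq_bigr => i _.
  rewrite ivE wdg_sumr; apply: eq_bigr => j _.
  by rewrite wdgZl wdgZr scalerA.
have GC i j : i != j -> G i j = - G j i.
  move=> ij; rewrite /G !base_wdg1 // 1?eq_sym // setUC sh_sign1C // [v 0 i * _]mulrC.
  by rewrite scaleNr scalerN.
have -> : \sum_i \sum_j G i j =
    \sum_(i < d) \sum_(j < d | (i < j)%N) G i j +
    \sum_(i < d) \sum_(j < d | (j < i)%N) G i j.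
  rewrite -big_split; apply: eq_bigr => i _ /=.
  rewrite (bigID (fun j : 'I_d => (i < j)%N)) /=; congr (_ + _).
  rewrite (bigD1 i) ?ltnn //= {1}/G base_wdg_sq scaler0 add0r.
  by apply: eq_bigl => j; rewrite -leqNgt ltn_neqAle andbC.
rewrite [X in _ + X](exchange_big_dep xpredT) //= -big_split big1 // => i _ /=.
rewrite -big_split big1 // => j ij /=.
by rewrite GC ?addNr // neq_ltn ij.
Qed.

Lemma iv_wdgC u v : wdg (iv u) (iv v) = - wdg (iv v) (iv u).
Proof.
apply/eqP; rewrite -addr_eq0; apply/eqP.
have := iv_wdg_sq (u + v); rewrite ivD wdgDl !wdgDr !iv_wdg_sq add0r addr0.
by [].
Qed.

Definition rw x v := wdg x (iv v).

Lemma rw_sq x v : rw (rw x v) v = 0.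
Proof. by rewrite /rw -wdgA iv_wdg_sq wdg0r. Qed.

Lemma rwC x u v : rw (rw x u) v = - rw (rw x v) u.
Proof. by rewrite /rw -!wdgA iv_wdgC wdgNr. Qed.

Lemma rwDr x u v : rw x (u + v) = rw x u + rw x v.
Proof. by rewrite /rw ivD wdgDr. Qed.
Lemma rwZr x c v : rw x (c *: v) = c *: rw x v.
Proof. by rewrite /rw ivZ wdgZr. Qed.
Lemma rwNr x v : rw x (- v) = - rw x v.
Proof. by rewrite /rw ivN wdgNr. Qed.
Lemma rwBr x u v : rw x (u - v) = rw x u - rw x v.
Proof. by rewrite rwDr rwNr. Qed.
Lemma rwDl x y v : rw (x + y) v = rw x v + rw y v.
Proof. exact: wdgDl. Qed.
Lemma rwZl x c v : rw (c *: x) v = c *: rw x v.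
Proof. exact: wdgZl. Qed.
Lemma rwNl x v : rw (- x) v = - rw x v.
Proof. exact: wdgNl. Qed.
Lemma rw0l v : rw 0 v = 0.
Proof. exact: wdg0l. Qed.
Lemma rw_sum x (I : Type) (r : seq I) (P : pred I) (F : I -> 'rV_d) :
  rw x (\sum_(i <- r | P i) F i) = \sum_(i <- r | P i) rw x (F i).
Proof. by rewrite /rw iv_sum wdg_sumr. Qed.

Lemma wdg_rw x y v : wdg x (rw y v) = rw (wdg x y) v.
Proof. exact: wdgA. Qed.

Definition pair_cv f v : K := \sum_i f 0 i * v 0 i.

(** Contraction on the last factor, whence the sign of the shuffle that puts [i] at the right
    end. *)
Definition ctr f x : extK :=
  [ffun S : {set 'I_d} => \sum_(i : 'I_d | i \notin S) f 0 i * sh_sign S [set i] * x (i |: S)].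

Lemma ctrD f x y : ctr f (x + y) = ctr f x + ctr f y.
Proof.
apply/ffunP=> S; rewrite !ffunE -big_split /=; apply: eq_bigr => i _.
by rewrite ffunE mulrDr.
Qed.

Lemma ctrZ f c x : ctr f (c *: x) = c *: ctr f x.
Proof.
apply/ffunP=> S; rewrite !ffunE scaler_sumr; apply: eq_bigr => i _.
by rewrite ffunE /GRing.scale /=; ring.
Qed.

Lemma ctr0 f : ctr f 0 = 0.
Proof. by rewrite -[X in ctr f X](scale0r (0 : extK)) ctrZ scale0r. Qed.

Lemma ctrN f x : ctr f (- x) = - ctr f x.
Proof. by rewrite -scaleN1r ctrZ scaleN1r. Qed.

Lemma ctr_one f : ctr f one = 0.
Proof.
apply/ffunP=> S; rewrite !ffunE big1 // => i _; rewrite ffunE.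
case: eqP => [e|_]; last by rewrite mulr0.
by have := setU11 i S; rewrite e inE.
Qed.

(** Contraction is an antiderivation counted from the right. The terms in which the index inserted
    by [v] is the one removed by [f] add up to the pairing, those outside S coming from the left
    side and those in S from the last summand; the other terms [T i j] agree up to the sign of
    exchanging [i] and [j]. *)
Lemma ctr_rw f x v : ctr f (rw x v) = pair_cv f v *: x - rw (ctr f x) v.
Proof.
apply/ffunP=> S; rewrite [LHS]ffunE [RHS]ffunE [X in _ = X + _]ffunE [X in _ = _ + X]ffunE.
rewrite wdg_ivE /=.
pose T i j := f 0 i * v 0 j * (sh_sign S [set i] * sh_sign ((i |: S) :\ j) [set j]
   * x ((i |: S) :\ j)).
have -> : \sum_(i | i \notin S) f 0 i * sh_sign S [set i] * rw x v (i |: S) =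
   \sum_(i | i \notin S) f 0 i * v 0 i * x S + \sum_(i | i \notin S) \sum_(j in S) T i j.
  rewrite -big_split /=; apply: eq_bigr => i iS; rewrite wdg_ivE big_setU1 //= mulrDr.
  have -> : (i |: S) :\ i = S by rewrite setU1K.
  congr (_ + _).
    by rewrite -[RHS]mulr1 -(sh_sign_sq S [set i]); ring.
  by rewrite mulr_sumr; apply: eq_bigr => j _; rewrite /T; ring.
have -> : \sum_(i in S) sh_sign (S :\ i) [set i] * ctr f x (S :\ i) * v 0 i =
   \sum_(j in S) f 0 j * v 0 j * x S - \sum_(j in S) \sum_(i | i \notin S) T i j.
  rewrite -sumrN -big_split /=; apply: eq_bigr => j jS; rewrite ffunE (bigD1 j) /=; last first.
    by rewrite !inE eqxx.
  rewrite setD1K // mulrDr mulrDl; congr (_ + _).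
    by rewrite -[RHS]mulr1 -(sh_sign_sq (S :\ j) [set j]); ring.
  rewrite mulr_sumr mulr_suml -sumrN; apply: eq_big => [i|i /andP[iS ij]].
    by rewrite !inE negb_and negbK; case: eqP => [->|_]; rewrite ?jS ?andbT.
  have {}iS : i \notin S by move: iS; rewrite !inE negb_and negbK (negPf ij).
  have -> : i |: S :\ j = (i |: S) :\ j.
    by apply/setP=> k; rewrite !inE; case: (eqVneq k i) => [->|]; rewrite ?ij.
  rewrite /T.
  have -> : sh_sign S [set i] = sh_sign (S :\ j) [set i] * sh_sign [set j] [set i].
    rewrite -sh_signUl ?[_ :|: [set j]]setUC ?setD1K //.
    by rewrite disjoint_sym disjoints1 !inE eqxx.
  have -> : sh_sign ((i |: S) :\ j) [set j] = sh_sign (S :\ j) [set j] * sh_sign [set i] [set j].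
    rewrite -sh_signUl; last first.
      by rewrite disjoint_sym disjoints1 !inE (negPf iS) andbF.
    congr (sh_sign _ _); apply/setP=> k; rewrite !inE.
    by case: (eqVneq k i) => [->|]; rewrite ?ij ?orbF ?orbT.
  have := sh_sign_sq [set i] [set j].
  rewrite [sh_sign [set j] [set i]]sh_sign1C 1?eq_sym //.
  move: (sh_sign [set i] _) => s e; set X := x _.
  have -> : forall a b c p, a * (b * p * X) * c = a * b * c * p * X by move=> *; ring.
  by rewrite -[LHS]mulr1 -e; ring.
rewrite exchange_big /= opprB addrA addrAC; congr (_ + _).
rewrite /GRing.scale /= /pair_cv mulr_suml [X in _ = X - _](bigID (fun i => i \in S)) /=.
by rewrite addrAC subrr add0r.
Qed.

Lemma ctr_ctr_rw f x v : ctr f (ctr f x) = 0 -> ctr f (ctr f (rw x v)) = 0.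
Proof. by move=> h; rewrite ctr_rw ctrD ctrN ctrZ ctr_rw h rw0l subr0 subrr. Qed.

Definition hdeg k x := forall S, x S != 0 -> #|S| = k.

Lemma homog_one : hdeg 0 one.
Proof. by move=> S; rewrite ffunE; case: (S =P set0) => [-> _|_ /eqP//]; rewrite cards0. Qed.

Lemma homogZ k c x : hdeg k x -> hdeg k (c *: x).
Proof.
by move=> h S; rewrite ffunE => xS; apply: h; apply: contraNneq xS => ->; rewrite /GRing.scale /= mulr0.
Qed.

Lemma homog_rw k x v : hdeg k x -> hdeg k.+1 (rw x v).
Proof.
move=> h S; rewrite /rw wdg_ivE; apply: contraNeq => cS.
rewrite big1 // => i iS; have [->|/h ci] := eqVneq (x (S :\ i)) 0.
  by rewrite mulr0 mul0r.
by case/eqP: cS; rewrite (cardsD1 i) iS ci.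
Qed.

Definition topc x : K := x [set: 'I_d].
Definition vol (t : K) : extK := t *: base [set: 'I_d].

Lemma homog_top x : hdeg d x -> x = vol (topc x).
Proof.
move=> h; apply/ffunP=> S; rewrite /vol !ffunE /GRing.scale /=.
have [->|nS] := eqVneq S setT; first by rewrite mulr1.
rewrite mulr0; apply/eqP; apply: contraR nS => /h cS.
by rewrite eqEcard subsetT cardsT card_ord cS leqnn.
Qed.

Lemma homog0 x : hdeg 0 x -> x = x set0 *: one.
Proof.
move=> h; apply/ffunP=> S; rewrite !ffunE /GRing.scale /=.
have [->|nS] := eqVneq S set0; first by rewrite mulr1.
by rewrite mulr0; apply/eqP; apply: contraR nS => /h/eqP; rewrite cards_eq0.
Qed.

Lemma homog1 x : hdeg 1 x -> exists v, x = iv v.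
Proof.
move=> h; exists (\row_i x [set i]); apply/ffunP=> S; rewrite ffunE.
have [/eqP/cards1P[i ->]|nS] := eqVneq #|S| 1%N.
  rewrite (bigD1 i) //= mxE eqxx mulr1 big1 ?addr0 // => j ji.
  by rewrite (inj_eq set1_inj) eq_sym (negPf ji) mulr0.
have [->|/h cS] := eqVneq (x S) 0; last by rewrite cS in nS.
rewrite big1 // => i _; case: eqP => [eS|]; last by rewrite mulr0.
by rewrite eS cards1 in nS.
Qed.

Lemma homog_ctr f k x : hdeg k.+1 x -> hdeg k (ctr f x).
Proof.
move=> h S; rewrite ffunE; apply: contraNeq => cS.
rewrite big1 // => i iS; have [->|/h] := eqVneq (x (i |: S)) 0.
  by rewrite mulr0.
by rewrite cardsU1 iS => -[/eqP]; rewrite (negPf cS).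
Qed.

Lemma homog_wdg k l x y : hdeg k x -> hdeg l y -> hdeg (k + l) (wdg x y).
Proof.
move=> hx hy S; rewrite ffunE; apply: contraNeq => cS.
rewrite big1 // => A AS; have [->|/hx cx] := eqVneq (x A) 0; first by rewrite mulr0 mul0r.
have [->|/hy cy] := eqVneq (y (S :\: A)) 0; first by rewrite mulr0.
by case/eqP: cS; rewrite -(cardsID A S) (setIidPr AS) cx cy.
Qed.

Lemma homog_iv v : hdeg 1 (iv v).
Proof.
move=> S; rewrite ffunE; apply: contraNeq => cS; rewrite big1 // => i _.
by case: eqP => [eS|]; rewrite ?mulr0 //; rewrite eS cards1 eqxx in cS.
Qed.

Lemma homog_vol t : hdeg d (vol t).
Proof.
apply: homogZ => S; rewrite ffunE; case: (S =P setT) => [-> _|_ /eqP//].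
by rewrite cardsT card_ord.
Qed.

End ExteriorAlgebra.

(** * Frames, Cramer's rule and braid matrices *)

Section Frames.
Variables (K : comUnitRingType) (d : nat).
Local Notation vect := 'rV[K]_d.
Local Notation E := (extK K d).
Local Notation unit c := (c \is a GRing.unit).
Implicit Types (x y : E) (u v w f : vect) (g : nat -> vect) (a c z : K) (s : seq vect).

Definition rws x s : E := foldl (@rw K d) x s.

Lemma rwsZ x c s : rws (c *: x) s = c *: rws x s.
Proof. by elim: s x => //= v s IH x; rewrite rwZl IH. Qed.

Lemma rwsD x y s : rws (x + y) s = rws x s + rws y s.
Proof. by elim: s x y => //= v s IH x y; rewrite rwDl IH. Qed.

Lemma rws0 s : rws 0 s = 0.
Proof. by elim: s => //= v s IH; rewrite rw0l. Qed.

Lemma rwsN x s : rws (- x) s = - rws x s.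
Proof. by rewrite -scaleN1r rwsZ scaleN1r. Qed.

Lemma rws_sum (I : Type) (r : seq I) (P : pred I) (G : I -> E) s :
  rws (\sum_(i <- r | P i) G i) s = \sum_(i <- r | P i) rws (G i) s.
Proof. by elim/big_rec2: _ => [|i z1 z2 _ <-]; rewrite ?rws0 // rwsD. Qed.

Lemma rws_rw x v s : rws (rw x v) s = (-1) ^+ size s *: rw (rws x s) v.
Proof.
elim: s x => [|w s IH] x /=; first by rewrite expr0 scale1r.
by rewrite rwC rwsN IH exprS mulN1r scaleNr.
Qed.

Lemma signZ_eq0 n x : (-1) ^+ n *: x = 0 -> x = 0.
Proof.
move=> /(congr1 (fun y => (-1) ^+ n *: y)).
by rewrite scalerA -expr2 sqrr_sign scale1r scaler0.
Qed.

Lemma rws_mem x v s : v \in s -> rw (rws x s) v = 0.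
Proof.
elim: s x => //= w s IH x; rewrite inE => /orP[/eqP->|]; last exact: IH.
by apply: (@signZ_eq0 (size s)); rewrite -rws_rw rw_sq rws0.
Qed.

Lemma rws_rw_mem x v s : v \in s -> rws (rw x v) s = 0.
Proof. by move=> vs; rewrite rws_rw rws_mem ?scaler0. Qed.

Lemma wdg_rws x y s : wdg x (rws y s) = rws (wdg x y) s.
Proof. by elim: s y => //= v s IH y; rewrite IH wdg_rw. Qed.

Lemma rws_unitZ c x s : c *: x = 0 -> unit c -> x = 0.
Proof. by move=> /(congr1 (fun y => c^-1 *: y)); rewrite scalerA scaler0 => h uc; rewrite -h mulVr ?scale1r. Qed.

(** The wedge g_0 /\ ... /\ g_{k-1}: level k of the flag spanned by the frame [g]. *)
Fixpoint W g k : E := if k is k'.+1 then rw (W g k') (g k') else one K d.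

Lemma W_rws g k m : W g (k + m) = rws (W g k) [seq g i | i <- iota k m].
Proof.
elim: m k => [|m IH] k /=; first by rewrite addn0.
by rewrite addnS -addSn IH.
Qed.

Lemma W_mkseq g k : W g k = rws (one K d) [seq g i | i <- iota 0 k].
Proof. exact: (W_rws g 0 k). Qed.

Lemma eq_W g g' k : (forall i, (i < k)%N -> g i = g' i) -> W g k = W g' k.
Proof.
elim: k => //= k IH e; rewrite IH ?e // => i ik; apply: e; exact: ltnW.
Qed.

Lemma homog_W g k : hdeg k (W g k).
Proof. by elim: k => [|k IH]; [exact: homog_one | exact: homog_rw]. Qed.

Lemma W_mem g i k : (i < k)%N -> rw (W g k) (g i) = 0.
Proof.
by move=> ik; rewrite W_mkseq rws_mem //; apply: map_f; rewrite mem_iota.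
Qed.

Definition rest g k m := [seq g i | i <- iota k m].

(** Cramer's numerator: the determinant of the frame with g_i replaced by [y], hence a multiple of
    the i-th dual covector. *)
Definition dual g i (y : vect) : K := topc (rws (rw (W g i) y) (rest g i.+1 (d - i.+1))).

Lemma topcZ c x : topc (c *: x) = c * topc x.
Proof. by rewrite /topc ffunE. Qed.

Lemma topc0 : topc (0 : E) = 0.
Proof. by rewrite /topc ffunE. Qed.

Lemma topcD x y : topc (x + y) = topc x + topc y.
Proof. by rewrite /topc ffunE. Qed.

Lemma dualZD g i c (y w : vect) : dual g i (c *: y + w) = c * dual g i y + dual g i w.
Proof. by rewrite /dual rwDr rwZr rwsD rwsZ topcD topcZ. Qed.

Lemma dual_sum g i (n : nat) (a : 'I_n -> K) (y : 'I_n -> vect) :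
  dual g i (\sum_j a j *: y j) = \sum_j a j * dual g i (y j).
Proof.
elim/big_rec2: _ => [|j y1 y2 _ <-]; last by rewrite dualZD.
by rewrite /dual /rw iv0 wdg0r rws0 topc0.
Qed.

Lemma dual_frame g (i j : nat) : (i < d)%N -> (j < d)%N ->
  dual g i (g j) = if i == j then topc (W g d) else 0.
Proof.
move=> id jd; rewrite /dual; case: ltngtP => ij.
- by rewrite rws_rw_mem ?topc0 //; apply: map_f; rewrite mem_iota ij subnKC.
- by rewrite W_mem // rws0 topc0.
- subst j; have -> : rw (W g i) (g i) = W g i.+1 by [].
  by rewrite -W_rws subnKC.
Qed.

(** Cramer's rule: the matrix of the normalised [dual] covectors is a right inverse of the matrix of
    the frame, hence a two-sided one over a commutative ring. *)
Lemma frame_span g (y : vect) : unit (topc (W g d)) ->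
  exists a : nat -> K, y = \sum_(i < d) a i *: g i.
Proof.
move=> uT; set t := topc _ in uT.
pose G : 'M[K]_d := \matrix_(i, j) g i 0 j.
pose P : 'M[K]_d := \matrix_(j, i) (dual g i (delta_mx 0 j) / t).
have rowG i : row i G = g i by apply/rowP=> j; rewrite !mxE.
have GP : G *m P = 1%:M.
  apply/matrixP=> i k; rewrite !mxE.
  transitivity (dual g k (g i) / t).
    rewrite [X in dual _ _ X]row_sum_delta dual_sum mulr_suml.
    by apply: eq_bigr => j _; rewrite !mxE mulrA.
  rewrite dual_frame // -/t; case: (eqVneq i k) => [->|nik].
    by rewrite eqxx divrr.
  by rewrite -(inj_eq val_inj) eq_sym in nik; rewrite (negPf nik) mul0r.
exists (fun i => if insub i is Some i' then (y *m P) 0 i' else 0).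
rewrite -{1}[y]mulmx1 -(mulmx1C GP) mulmxA mulmx_sum_row.
by apply: eq_bigr => i _; rewrite valK rowG.
Qed.

Lemma frame_sum_split g k (a : nat -> K) : (k <= d)%N ->
  rw (W g k) (\sum_(i < d) a i *: g i) = \sum_(k <= i < d) a i *: rw (W g k) (g i).
Proof.
move=> kd; rewrite rw_sum.
rewrite -(big_mkord xpredT (fun i => rw (W g k) (a i *: g i))).
rewrite (big_cat_nat (n := k)) //= big_nat_cond big1 ?add0r.
  by apply: eq_bigr => i _; rewrite rwZr.
by move=> i /andP[/andP[_ ik] _]; rewrite rwZr W_mem ?scaler0.
Qed.

(** Wedging with all remaining frame vectors except g_i leaves a_i times the determinant of the
    frame, up to sign. *)
Lemma frame_indep g k (a : nat -> K) : unit (topc (W g d)) -> (k <= d)%N ->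
  rw (W g k) (\sum_(i < d) a i *: g i) = 0 ->
  forall i, (k <= i < d)%N -> a i = 0.
Proof.
move=> uT kd; rewrite frame_sum_split // => e i /andP[ki id].
pose s := rest g k (i - k) ++ rest g i.+1 (d - i.+1).
have := congr1 (fun x => topc (rws x s)) e.
rewrite rws0 topc0 rws_sum (bigD1_seq i) ?mem_index_iota ?ki ?iota_uniq //=.
rewrite big_nat_cond big1 ?addr0 => [|j /andP[/andP[kj jd] ji]]; last first.
  rewrite rwsZ rws_rw_mem ?scaler0 // mem_cat.
  case: ltngtP ji => // ij _; apply/orP; [left|right]; apply: map_f; rewrite mem_iota.
    by rewrite kj subnKC.
  by rewrite ij subnKC.
rewrite rwsZ topcZ /s /rws foldl_cat -/(rws _ _) -/(rws _ _).
rewrite rws_rw -W_rws subnKC // rwsZ topcZ.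
have -> : rw (W g i) (g i) = W g i.+1 by [].
rewrite -W_rws subnKC // => h.
have u : unit ((-1) ^+ size (rest g k (i - k)) * topc (W g d)).
  by rewrite unitrM unitrX ?unitrN1.
by rewrite -[a i]mulr1 -(divrr u) mulrA h mul0r.
Qed.

Lemma W_reg g k c : unit (topc (W g d)) -> (k <= d)%N -> c *: W g k = 0 -> c = 0.
Proof.
move=> uT kd /(congr1 (fun x => topc (rws x (rest g k (d - k))))).
rewrite rwsZ rws0 topcZ topc0 -W_rws subnKC // => h.
by rewrite -[c]mulr1 -(divrr uT) mulrA h mul0r.
Qed.

(* The step of color [m.+1]: the two columns [m], [m.+1] are multiplied on the
   right by the braid matrix [[z, -1], [1, 0]]. *)
Definition bstep m z g : nat -> vect := fun i =>
  if i == m then z *: g m + g m.+1 else if i == m.+1 then - g m else g i.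

Lemma bstep0 m z g : bstep m z g m = z *: g m + g m.+1.
Proof. by rewrite /bstep eqxx. Qed.

Lemma bstep1 m z g : bstep m z g m.+1 = - g m.
Proof. by rewrite /bstep gtn_eqF // eqxx. Qed.

Lemma bstepN m z g i : i != m -> i != m.+1 -> bstep m z g i = g i.
Proof. by rewrite /bstep => /negPf-> /negPf->. Qed.

(** Only level m+1 moves, because (z g_m + g_{m+1}) /\ (- g_m) = g_m /\ g_{m+1} after wedging with
    W_m. *)
Lemma W_bstep m z g i : i != m.+1 -> W (bstep m z g) i = W g i.
Proof.
rewrite neq_ltn ltnS => /orP[im|].
  by apply: eq_W => j ji; rewrite /bstep; case: eqP => [?|_]; [lia|]; case: eqP => [?|//]; lia.
move=> mi; rewrite -(@subnKC m.+2 i) // !W_rws; congr (rws _ _).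
  have e : W (bstep m z g) m = W g m.
    by apply: eq_W => j jm; rewrite /bstep; case: eqP => [?|_]; [lia|]; case: eqP => [?|//]; lia.
  rewrite /= e /bstep !eqxx gtn_eqF // rwDr rwDl rwZr rwZl.
  by rewrite !rwNr rw_sq oppr0 scaler0 add0r rwC opprK.
apply/eq_in_map => j; rewrite mem_iota => /andP[mj _].
by rewrite /bstep !gtn_eqF // ltnW.
Qed.

Lemma W_bstep_eq m z g :
  W (bstep m z g) m.+1 = rw (W g m) (z *: g m + g m.+1).
Proof. by rewrite [LHS]/= W_bstep ?ltn_eqF // /bstep eqxx. Qed.

(** The braid relation for braid matrices. It drives the 6-valent vertices: the two outer parameters
    are exchanged and the middle one becomes z1 z3 - z2. *)
Lemma bstep_braid m z1 z2 z3 g i :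
  bstep m z3 (bstep m.+1 z2 (bstep m z1 g)) i =
  bstep m.+1 z1 (bstep m (z1 * z3 - z2) (bstep m.+1 z3 g)) i.
Proof.
have e0 : (m == m.+1) = false by lia.
have e1 : (m == m.+2) = false by lia.
have e2 : (m.+1 == m) = false by lia.
have e3 : (m.+1 == m.+2) = false by lia.
have e4 : (m.+2 == m) = false by lia.
have e5 : (m.+2 == m.+1) = false by lia.
rewrite /bstep !(eqxx, e0, e1, e2, e3, e4, e5).
case: (i =P m) => [->|im]; rewrite ?(eqxx, e0, e1, e2, e3, e4, e5).
  rewrite scalerDr scalerN !scalerA scalerBl mulrC !addrA.
  by congr (_ + _); rewrite addrAC.
case: (i =P m.+1) => [_|im1]; first by rewrite opprD scalerN.
by case: (i =P m.+2) => [_|//]; rewrite opprK.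
Qed.

End Frames.
Arguments W {K d} g k : simpl never.

(** * Decorated flags and their crossings *)

Section Flags.
Variables (K : comUnitRingType) (d : nat).
Local Notation vect := 'rV[K]_d.
Local Notation E := (extK K d).
Local Notation unit c := (c \is a GRing.unit).
Implicit Types (x y : E) (u v w f : vect) (g : nat -> vect) (a b c z : K).
Implicit Types (G H M U : nat -> E) (l : nat -> K) (i j k m : nat).

(** The scalars [l] are kept apart from the frame: a crossing then changes the frame by a braid
    matrix, which preserves the determinant, and one scalar. *)
Definition frep g l G :=
  [/\ unit (topc (W g d)), forall i, unit (l i) & forall i, (i <= d)%N -> G i = l i *: W g i].

Definition framed G := exists g l, frep g l G.

(** Relative position and crossing value in one. Over a field, non-proportionality at level k
    follows from [c] being nonzero ([dcross_position]). *)
Definition dcross k c G H :=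
  (forall i, (i <= d)%N -> i != k -> H i = G i) /\
  exists v, H k = rw (G k.-1) v /\ rw (G k) v = c *: G k.+1.

Definition propto G H :=
  forall i, (i <= d)%N -> exists2 c, unit c & H i = c *: G i.

Lemma propto_refl G : propto G G.
Proof. by move=> i _; exists 1; rewrite ?unitr1 ?scale1r. Qed.

Lemma propto_sym G H : propto G H -> propto H G.
Proof.
move=> h i id; have [c uc ->] := h i id; exists c^-1; first by rewrite unitrV.
by rewrite scalerA mulVr // scale1r.
Qed.

Lemma propto_trans G H M : propto G H -> propto H M -> propto G M.
Proof.
move=> h h' i id; have [c uc e] := h i id; have [c' uc' e'] := h' i id.
by exists (c' * c); rewrite ?unitrM ?uc ?uc' // e' e scalerA.
Qed.

Lemma frep_propto g l G H : frep g l G -> propto G H -> exists l', frep g l' H.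
Proof.
move=> [uT ul e] h.
have hh i : exists c, unit c /\ ((i <= d)%N -> H i = c *: G i).
  case: (leqP i d) => [/h[c uc ec]|_]; first by exists c.
  by exists 1; rewrite unitr1.
have [c hc] := boolp.choice hh.
exists (fun i => c i * l i); split=> // i.
  by rewrite unitrM ul (proj1 (hc i)).
by move=> id; rewrite (proj2 (hc i)) // e // scalerA.
Qed.

Lemma framed_reg G k c : framed G -> (k <= d)%N -> c *: G k = 0 -> c = 0.
Proof.
move=> [g [l [uT ul e]]] kd; rewrite e // scalerA => /(W_reg uT kd) h.
by rewrite -[c]mulr1 -(divrr (ul k)) mulrA h mul0r.
Qed.

Lemma framed_lreg G k a c : framed G -> (k <= d)%N -> a *: G k = c *: G k -> a = c.
Proof.
move=> fG kd e; apply/eqP; rewrite -subr_eq0; apply/eqP.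
by apply: (framed_reg fG kd); rewrite scalerBl e subrr.
Qed.

Definition setf G k x : nat -> E := fun i => if i == k then x else G i.

Lemma setfE G k x : setf G k x k = x. Proof. by rewrite /setf eqxx. Qed.
Lemma setfN G k x i : i != k -> setf G k x i = G i.
Proof. by rewrite /setf => /negPf->. Qed.

(** Every crossing is a braid step. The equation G^k /\ v = c G^{k+1} kills the coordinates of [v]
    beyond g_k and fixes the one on g_k; those before g_{k-1} disappear in G^{k-1} /\ v. What
    remains is a multiple of z g_{k-1} + g_k. The crossing value is recorded by the scalars
    alone. *)
Lemma frep_dcross g l G k c H : frep g l G -> (0 < k < d)%N -> unit c ->
  dcross k c G H ->
  exists z l', [/\ frep (bstep k.-1 z g) l' H, (forall i, i != k -> l' i = l i)
    & l k * l' k = c * (l k.-1 * l k.+1)].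
Proof.
move=> [uT ul e] /andP[]; case: k => // m _ kd uc [eH [v [eHk ec]]] /=.
have kd' := ltnW kd; have md := ltnW kd'.
have [a ea] := frame_span v uT.
(* The coordinate on g_{m+1} that the crossing equation forces on [v]. *)
pose r := c * l m.+2 / l m.+1.
have ur : unit r by rewrite !unitrM uc ul unitrV ul.
pose a' i := if i == m.+1 then a i - r else a i.
have ea' : v - r *: g m.+1 = \sum_(i < d) a' i *: g i.
  rewrite ea (bigD1 (Ordinal kd)) // [RHS](bigD1 (Ordinal kd)) //= /a' eqxx scalerBl.
  rewrite addrAC; congr (_ + _); apply: eq_bigr => i ik; case: eqP => // e1.
  by case/eqP: ik; apply/val_inj.
have h0 : rw (W g m.+1) (\sum_(i < d) a' i *: g i) = 0.
  rewrite -ea' rwBr rwZr.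
  have -> : rw (W g m.+1) (g m.+1) = W g m.+2 by [].
  move: ec; rewrite !e // rwZl scalerA => /(congr1 (fun x => (l m.+1)^-1 *: x)).
  rewrite !scalerA mulVr // scale1r => ->; rewrite -scalerBl /r.
  by rewrite mulrC subrr scale0r.
have h1 := frame_indep uT kd' h0.
have hv : rw (W g m) v = r *: rw (W g m) ((a m / r) *: g m + g m.+1).
  rewrite ea frame_sum_split // big_ltn // big_ltn // big_nat_cond big1.
    rewrite addr0 rwDr rwZr scalerDr scalerA mulrCA divrr // mulr1; congr (_ + _ *: _).
    by apply/eqP; rewrite -subr_eq0; have := h1 m.+1; rewrite leqnn kd /a' eqxx => ->.
  move=> i /andP[/andP[mi id] _].
  have := h1 i; rewrite id (ltnW mi) /a' gtn_eqF // => ->; rewrite ?scale0r //.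
exists (a m / r), (fun i => if i == m.+1 then l m * r else l i); split=> [|i /negPf->//|].
- split=> [|i|i id].
  + by rewrite W_bstep // gtn_eqF.
  + by case: (i =P m.+1) => _ //; rewrite -/r unitrM ul.
  + case: (eqVneq i m.+1) => [->|im]; last by rewrite eH // W_bstep // e.
    by rewrite W_bstep_eq eHk e //= rwZl hv scalerA.
- by rewrite eqxx /r; have h := divrr (ul m.+1); ring: h.
Qed.

Lemma dcross_frep g l G k c z a H : frep g l G -> (0 < k < d)%N ->
  (forall i, (i <= d)%N -> i != k -> H i = G i) ->
  H k = a *: W (bstep k.-1 z g) k -> c * (l k.-1 * l k.+1) = a * l k ->
  dcross k c G H.
Proof.
move=> [uT ul e] /andP[]; case: k => // m _ kd /= eH eHk ec; split=> //.
have kd' := ltnW kd; have md := ltnW kd'.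
exists ((a / l m) *: (z *: g m + g m.+1)); split.
  by rewrite eHk W_bstep_eq e // rwZl rwZr scalerA mulrC divrK.
rewrite !e // rwZl rwZr rwDr rwZr W_mem // scaler0 add0r !scalerA.
have -> : rw (W g m.+1) (g m.+1) = W g m.+2 by [].
by congr (_ *: _); have h := divrr (ul m); rewrite -[RHS]mulr1 -h; ring: ec.
Qed.

Lemma framed_dcross G k c H : framed G -> (0 < k < d)%N -> unit c ->
  dcross k c G H -> framed H.
Proof.
by move=> [g [l r]] kd uc h; have [z [l' [r' _ _]]] := frep_dcross r kd uc h; exists (bstep k.-1 z g), l'.
Qed.

Lemma dcross_exists G k z : framed G -> (0 < k < d)%N -> exists c H, unit c /\ dcross k c G H.
Proof.
move=> [g [l r]] kd.
exists (l k / (l k.-1 * l k.+1)), (setf G k (W (bstep k.-1 z g) k)); split.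
  by case: r => _ ul _; rewrite unitrM unitrV unitrM !ul.
apply: (dcross_frep (a := 1) r kd); rewrite ?setfE ?scale1r //.
- by move=> i _; apply: setfN.
- by case: r => _ ul _; rewrite divrK ?mul1r // unitrM !ul.
Qed.

(** Read backwards a crossing changes the sign of its value, since the vector used is then a
    multiple of g_m, wedged after z g_m + g_{m+1} instead of before. *)
Lemma dcross_sym G k c H : framed G -> (0 < k < d)%N -> unit c -> dcross k c G H ->
  dcross k (- c) H G.
Proof.
move=> [g [l [uT ul e]]] /andP[]; case: k => // m _ kd uc h.
have kd' := ltnW kd; have md := ltnW kd'.
have [z [l' [[_ ul' e'] eN ek]]] := frep_dcross (And3 uT ul e) (kd : (0 < m.+1 < d)%N) uc h.
case: h => eH _; split=> [i id im|]; first by rewrite eH.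
have Hm : H m = l m *: W g m by rewrite eH ?e // ltn_eqF.
have Hm2 : H m.+2 = l m.+2 *: W g m.+2 by rewrite eH ?e // gtn_eqF.
exists ((l m.+1 / l m) *: g m); split.
  by rewrite /= Hm e // rwZl rwZr scalerA mulrC divrK.
rewrite e' // Hm2 W_bstep_eq /= rwZl rwZr rwDr rwDl rwZr rwZl rw_sq scaler0 add0r rwC.
rewrite -/(W g m.+1) -/(W g m.+2) !scalerN !scalerA -scaleNr; congr (_ *: _).
by have h := divrr (ul m); move: ek => /= ek; ring: h ek.
Qed.

Lemma frep_bstep g l G k z a H : frep g l G -> (0 < k <= d)%N -> unit a ->
  (forall i, (i <= d)%N -> i != k -> H i = G i) ->
  H k = a *: W (bstep k.-1 z g) k ->
  (k < d)%N -> frep (bstep k.-1 z g) (fun i => if i == k then a else l i) H.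
Proof.
move=> [uT ul e] /andP[]; case: k => // m _ _ ua eH eHk kd; split=> [|i|i id].
- by rewrite W_bstep // gtn_eqF.
- by case: (i =P m.+1).
- by case: (eqVneq i m.+1) => [->|im]; rewrite ?eHk // eH // e // W_bstep.
Qed.

(** The new line at level k is z2 ((z1 - 1/z2) g_{k-1} + g_k) when z2 is invertible, again a braid
    step. So z2 is the only obstruction at a trivalent vertex. *)
Lemma tri_step g l U M N k c1 c2 : frep g l U -> (0 < k < d)%N -> unit c1 -> unit c2 ->
  dcross k c1 U M -> dcross k c2 M N ->
  exists z1 z2 t, [/\ unit t,
      N k = t *: rw (W g k.-1) ((z2 * z1) *: g k.-1 + z2 *: g k - g k.-1)
    & unit z2 -> exists2 c, unit c & dcross k c U N].
Proof.
move=> r kd u1 u2 h1 h2; have [z1 [l1 [r1 _ _]]] := frep_dcross r kd u1 h1.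
have [z2 [l2 [[_ ul2 e2] _ _]]] := frep_dcross r1 kd u2 h2.
have kd' : (k <= d)%N by case/andP: kd => _ /ltnW.
have eN : N k = l2 k *: rw (W g k.-1) ((z2 * z1) *: g k.-1 + z2 *: g k - g k.-1).
  rewrite e2 //; case: k kd {h1 h2 r1 e2 kd'} => // m _ /=; rewrite W_bstep_eq W_bstep ?ltn_eqF //.
  by rewrite /bstep eqxx gtn_eqF // eqxx scalerDr scalerA.
exists z1, z2, (l2 k); split=> // uz.
case: (r) => _ ul _.
exists (l2 k * z2 * l k / (l k.-1 * l k.+1)).
  by rewrite !(unitrM, unitrV) ul2 uz !ul.
apply: (dcross_frep (z := z1 - z2^-1) (a := l2 k * z2) r kd) => [i id ik||].
- by rewrite (proj1 h2) // (proj1 h1).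
- rewrite eN; case: k kd {h1 h2 r1 e2 kd' eN} => // m _; rewrite W_bstep_eq /= -[RHS]scalerA.
  congr (_ *: _); rewrite -rwZr scalerDr scalerA mulrBr divrr // scalerBl scale1r.
  by rewrite addrAC.
- by rewrite divrK // unitrM !ul.
Qed.

(** A step of parameter z is a step of parameter z+1 followed by one of parameter 1, as z1 - 1/z2 =
    z for these values. *)
Lemma tri_insert G N k c : framed G -> (0 < k < d)%N -> unit c -> dcross k c G N ->
  exists M c1 c2, [/\ unit c1, unit c2, dcross k c1 G M & dcross k c2 M N].
Proof.
move=> [g [l r]] kd uc h; have [z [l' [r' _ _]]] := frep_dcross r kd uc h.
have /andP[k0 kd1] := kd; have kd2 := ltnW kd1.
pose M := setf G k (W (bstep k.-1 (z + 1) g) k).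
have eM i : (i <= d)%N -> i != k -> M i = G i by move=> _; apply: setfN.
have eMk : M k = 1 *: W (bstep k.-1 (z + 1) g) k by rewrite /M setfE scale1r.
have rM := frep_bstep r (introT andP (conj k0 kd2)) (unitr1 K) eM eMk kd1.
case: (r) => _ ul _; case: (r') => _ ul' e'.
exists M, (l k / (l k.-1 * l k.+1)), (l' k / (l k.-1 * l k.+1)); split.
- by rewrite !(unitrM, unitrV) !ul.
- by rewrite !(unitrM, unitrV) ul' !ul.
- by apply: (dcross_frep r kd eM eMk); rewrite divrK ?mul1r // unitrM !ul.
apply: (dcross_frep (z := 1) (a := l' k) rM kd) => [i id ik||].
- by rewrite eM // (proj1 h).
- rewrite e' //; congr (_ *: _).
  case: k k0 {h r' kd kd1 kd2 M eM eMk rM e'} => // m _; rewrite !W_bstep_eq W_bstep ?ltn_eqF //=.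
  by rewrite /bstep eqxx gtn_eqF // eqxx scale1r scalerDl scale1r addrAC addrK.
- rewrite eqxx mulr1 !ifN ?divrK ?unitrM ?ul //.
    by rewrite gtn_eqF.
  by rewrite ltn_eqF // prednK.
Qed.

Lemma four_step i j a b G0 G1 G2 : (0 < i < d)%N -> (0 < j < d)%N ->
  (i.+1 < j)%N || (j.+1 < i)%N ->
  dcross i a G0 G1 -> dcross j b G1 G2 ->
  dcross j b G0 (setf G0 j (G2 j)) /\ dcross i a (setf G0 j (G2 j)) G2.
Proof.
move=> id jd ij [e1 [v [h1 h1']]] [e2 [w [h2 h2']]].
have N m : (m <= d)%N -> m != i -> G1 m = G0 m by apply: e1.
split; split.
- by move=> m _ mj; rewrite setfN.
- exists w; rewrite setfE -(N j) -?(N j.-1) -?(N j.+1); [by []|lia|lia|lia|lia|lia|lia].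
- move=> m md mi; case: (eqVneq m j) => [->|mj]; rewrite ?setfE // setfN // -N // e2 //.
- have e i' : i' <> j -> setf G0 j (G2 j) i' = G0 i' by move/eqP => h; rewrite setfN.
  by exists v; rewrite !e ?e2 //; lia.
Qed.

Definition adjacent i j := (j == i.+1) || (i == j.+1).

Lemma bstep_adj i j z1 z2 z3 g p : (0 < i)%N -> (0 < j)%N -> adjacent i j ->
  bstep i.-1 z3 (bstep j.-1 z2 (bstep i.-1 z1 g)) p =
  bstep j.-1 z1 (bstep i.-1 (z1 * z3 - z2) (bstep j.-1 z3 g)) p.
Proof.
case: i => // m _; case: j => // q _ /orP[/eqP[->]|/eqP[->]] /=.
  exact: bstep_braid.
by rewrite bstep_braid [z3 * z1]mulrC opprB addrC subrK.
Qed.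

Lemma W_bstepN k m z g : (0 < k)%N -> m != k -> W (bstep k.-1 z g) m = W g m.
Proof. by case: k => // k _ /= h; apply: W_bstep. Qed.

(** The scalar part of [six_step]: the relations between crossing values and scalars along the upper
    path, together with the two product relations, give those along the lower path. *)
Lemma six_alg (li l1 l3 lj l2 o r mu a f e b c D : K) :
  unit l1 -> unit lj -> unit o -> unit c ->
  li * l1 = a * (o * lj) -> lj * l2 = f * (l1 * r) -> l1 * l3 = e * (o * l2) ->
  mu * lj = b * (li * r) -> b * c = f * e -> c * D = a * f ->
  c * (o * mu) = l3 * li /\ D * (l3 * r) = l2 * mu.
Proof.
move=> u1 uj uo uc ha hf he hm hbc hcD.
have g1 : c * (o * mu) = l3 * li.
  apply: (mulIr (_ : unit (lj * l1))); first by rewrite unitrM uj.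
  transitivity (c * o * l1 * (mu * lj)); first by ring.
  rewrite hm; transitivity ((b * c) * (o * l1 * li * r)); first by ring.
  rewrite hbc; transitivity (e * o * li * (f * (l1 * r))); first by ring.
  rewrite -hf; transitivity (li * lj * (e * (o * l2))); first by ring.
  by rewrite -he; ring.
split=> //; apply: (mulIr (_ : unit (lj * c * o))); first by rewrite !unitrM uj uc.
transitivity ((c * D) * (l3 * r * lj * o)); first by ring.
rewrite hcD; transitivity (f * l3 * r * (a * (o * lj))); first by ring.
rewrite -ha; transitivity ((l3 * li) * (f * (l1 * r))); first by ring.
by rewrite -g1 -hf; ring.
Qed.

(** By the braid relation the lower path exists; the scale of its new level j is free, so [b] is
    arbitrary, and then [c] and [D] are determined by the two products. These are the relations b +
    c = f + e and c + d = a + f that cycle weights satisfy at a 6-valent vertex. *)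
Lemma six_step i j (a f e b c D : K) G0 G1 G2 G3 : framed G0 ->
  (0 < i < d)%N -> (0 < j < d)%N -> adjacent i j ->
  unit a -> unit f -> unit e -> unit b ->
  dcross i a G0 G1 -> dcross j f G1 G2 -> dcross i e G2 G3 ->
  b * c = f * e -> c * D = a * f ->
  exists G, [/\ dcross j b G0 G, dcross i c G (setf G3 j (G j))
    & dcross j D (setf G3 j (G j)) G3].
Proof.
move=> [g [l r]] hi hj ij ua uf ue ub h1 h2 h3 hbc hcD.
have /andP[i0 id] := hi; have /andP[j0 jd] := hj; have id' := ltnW id; have jd' := ltnW jd.
have nij : i != j by move: ij; rewrite /adjacent; lia.
have nji : j != i by rewrite eq_sym.
have [z1 [l1 [r1 n1 k1]]] := frep_dcross r hi ua h1.
have [z2 [l2 [r2 n2 k2]]] := frep_dcross r1 hj uf h2.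
have [z3 [l3 [r3 n3 k3]]] := frep_dcross r2 hi ue h3.
case: (r) (r1) (r2) (r3) => _ ul _ [_ ul1 _] [_ ul2 _] [_ ul3 e3].
pose mu := b * (l j.-1 * l j.+1) / l j.
have umu : unit mu by rewrite !(unitrM, unitrV) ub !ul.
have hmu : mu * l j = b * (l j.-1 * l j.+1) by rewrite divrK.
have uc : unit c.
  have := unitrM b c; rewrite hbc unitrM uf ue /= => /esym/andP[] //.
pose G := setf G0 j (mu *: W (bstep j.-1 z3 g) j).
have eG m : (m <= d)%N -> m != j -> G m = G0 m by move=> _; apply: setfN.
have eGj : G j = mu *: W (bstep j.-1 z3 g) j by rewrite /G setfE.
have rG := frep_bstep r (introT andP (conj j0 jd')) umu eG eGj jd.
have eG3 m : (m <= d)%N -> m != i -> m != j -> G3 m = G0 m.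
  by move=> md mi mj; rewrite (proj1 h3) // (proj1 h2) // (proj1 h1).
pose G' := setf G3 j (G j).
have eG' m : (m <= d)%N -> m != i -> G' m = G m.
  move=> md mi; rewrite /G'; case: (eqVneq m j) => [->|mj]; first by rewrite setfE.
  by rewrite setfN // eG3 // eG.
have eW m : W (bstep i.-1 z3 (bstep j.-1 z2 (bstep i.-1 z1 g))) m =
    W (bstep j.-1 z1 (bstep i.-1 (z1 * z3 - z2) (bstep j.-1 z3 g))) m.
  by apply: eq_W => p _; apply: bstep_adj.
have eG'i : G' i = l3 i *: W (bstep i.-1 (z1 * z3 - z2) (bstep j.-1 z3 g)) i.
  by rewrite /G' setfN // e3 // eW W_bstepN.
have rG' := frep_bstep rG (introT andP (conj i0 id')) (ul3 i) eG' eG'i id.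
have e3G m : (m <= d)%N -> m != j -> G3 m = G' m by move=> md mj; rewrite /G' setfN.
have e3j : G3 j = l2 j *: W (bstep j.-1 z1 (bstep i.-1 (z1 * z3 - z2) (bstep j.-1 z3 g))) j.
  by rewrite e3 // eW n3.
have key : c * ((if i.-1 == j then mu else l i.-1) * (if i.+1 == j then mu else l i.+1)) = l3 i * l i /\
   D * ((if j.-1 == i then l3 i else l j.-1) * (if j.+1 == i then l3 i else l j.+1)) = l2 j * mu.
  move: ij => /orP[/eqP ej|/eqP ei].
    have q1 : (i.-1 == j) = false by lia.
    have q2 : (i.+1 == j) by lia.
    have q3 : (j.-1 == i) by lia.
    have q4 : (j.+1 == i) = false by lia.
    rewrite q1 q2 q3 q4.
    have := @six_alg (l i) (l1 i) (l3 i) (l j) (l2 j) (l i.-1) (l j.+1) mu a f e b c D.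
    apply; rewrite ?ul ?ul1 //.
    - by rewrite k1 -ej.
    - by rewrite -n1 // k2 (eqP q3) [l1 j.+1]n1 // q4.
    - by rewrite -(n2 i) // k3 (eqP q2) n2 ?n1 //; lia.
    - by rewrite hmu (eqP q3).
  have q1 : (i.-1 == j) by lia.
  have q2 : (i.+1 == j) = false by lia.
  have q3 : (j.-1 == i) = false by lia.
  have q4 : (j.+1 == i) by lia.
  rewrite q1 q2 q3 q4 [mu * _]mulrC [l j.-1 * _]mulrC.
  have := @six_alg (l i) (l1 i) (l3 i) (l j) (l2 j) (l i.+1) (l j.-1) mu a f e b c D.
  apply; rewrite ?ul ?ul1 //.
  - by rewrite k1 (eqP q1) mulrC [l j * _]mulrC mulrC.
  - by rewrite -n1 // k2 (eqP q4) [l1 j.-1]n1 ?q3 // [l1 i * _]mulrC.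
  - rewrite -(n2 i) // k3 (eqP q1) [l2 i.+1]n2 ?q2 // [l1 i.+1]n1 ?[l2 j * _]mulrC //.
    by rewrite gtn_eqF.
  - by rewrite hmu (eqP q4) [l i * _]mulrC.
exists G; rewrite -/G'; split.
- exact: (dcross_frep r hj eG eGj (esym hmu)).
- by apply: (dcross_frep rG hi eG' eG'i); rewrite /= (negPf nij); case: key.
- have e1 : (j.-1 == j) = false by lia.
  have e2 : (j.+1 == j) = false by lia.
  by apply: (dcross_frep rG' hj e3G e3j); rewrite /= e1 e2 eqxx (negPf nji); case: key.
Qed.

Lemma rw_cycle x u v w : rw (rw (rw x w) u) v = rw (rw (rw x u) v) w.
Proof. by rewrite [rw (rw x w) u]rwC rwNl rwC opprK. Qed.

(** With m the smaller of i-1 and j-1, the level is W_m /\ (y2 g_m + y1 g_{m+1} + g_{m+2}) or W_m /\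
    (y1 g_m + g_{m+1}) /\ (g_{m+2} - y2 g_m). A coefficient equal to 1 forces a = 1, and another one
    then shows y1. *)
Lemma six_unique_aux i j g (y1 y2 y1' y2' a : K) : unit (topc (W g d)) ->
  (0 < i < d)%N -> (0 < j < d)%N -> adjacent i j ->
  W (bstep i.-1 y2' (bstep j.-1 y1' g)) i = a *: W (bstep i.-1 y2 (bstep j.-1 y1 g)) i ->
  y1' = y1.
Proof.
move=> uT /andP[i0 id] /andP[j0 jd] /orP[] /eqP e.
  case: i i0 id e => // m _ id ej; subst j; rewrite !W_bstep_eq /=.
  rewrite !(W_bstep _ _ (_ : m != m.+2)) ?ltn_eqF //.
  rewrite !bstep0 !(bstepN _ _ (_ : m != m.+1)) ?ltn_eqF // => e.
  have R c : c *: W g m.+3 = 0 -> c = 0 by apply: W_reg.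
  have S b c : b *: W g m.+3 = c *: W g m.+3 -> b = c.
    by move=> h; apply/eqP; rewrite -subr_eq0; apply/eqP/R; rewrite scalerBl h subrr.
  have V : rw (rw (rw (W g m) (g m)) (g m)) (g m.+1) = 0 by rewrite rw_sq rw0l.
  have V2 : rw (rw (rw (W g m) (g m)) (g m)) (g m.+2) = 0 by rewrite rw_sq rw0l.
  have V3 : rw (rw (rw (W g m) (g m.+1)) (g m)) (g m.+1) = 0 by rewrite rwC rw_sq rw0l oppr0.
  have V4 : rw (rw (rw (W g m) (g m.+2)) (g m)) (g m.+2) = 0 by rewrite rwC rw_sq rw0l oppr0.
  have V5 : rw (rw (rw (W g m) (g m.+2)) (g m)) (g m.+1) = W g m.+3 by rewrite rw_cycle.
  have V6 : rw (rw (rw (W g m) (g m.+1)) (g m)) (g m.+2) = - W g m.+3.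
    by rewrite [rw (rw (W g m) (g m.+1)) (g m)]rwC rwNl.
  have a1 : a = 1.
    apply/esym/S; have := congr1 (fun x => rw (rw x (g m)) (g m.+1)) e.
    by rewrite !(rwDr, rwZr, rwDl, rwZl) V V3 V5 !(scaler0, add0r) scale1r.
  have := congr1 (fun x => rw (rw x (g m)) (g m.+2)) e.
  rewrite a1 scale1r !(rwDr, rwZr, rwDl, rwZl) V2 V4 V6 !(scaler0, add0r, addr0) !scalerN.
  by move/oppr_inj/S.
case: j j0 jd e => // m _ jd ei; subst i; rewrite !W_bstep_eq /=.
rewrite !bstep1 !(bstepN _ _ (_ : m.+2 != m)) ?gtn_eqF // => e.
have S b c : b *: W g m.+3 = c *: W g m.+3 -> b = c.
  move=> h; apply/eqP; rewrite -subr_eq0; apply/eqP/(W_reg uT id).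
  by rewrite scalerBl h subrr.
have V1 : rw (rw (rw (W g m) (g m)) (- g m)) (g m.+1) = 0 by rewrite rwNr rw_sq oppr0 rw0l.
have V2 : rw (rw (rw (W g m) (g m.+1)) (- g m)) (g m.+1) = 0.
  by rewrite rwNr rwNl rwC rw_sq rw0l !oppr0.
have V3 : rw (rw (rw (W g m) (g m.+1)) (g m.+2)) (g m.+1) = 0 by rewrite rwC rw_sq rw0l oppr0.
have V4 : rw (rw (rw (W g m) (g m)) (g m.+2)) (g m.+1) = - W g m.+3 by rewrite rwC.
have V5 : rw (rw (rw (W g m) (g m)) (- g m)) (g m) = 0 by rewrite rwNr rw_sq oppr0 rw0l.
have V6 : rw (rw (rw (W g m) (g m.+1)) (- g m)) (g m) = 0 by rewrite rwNr rwNl rw_sq oppr0.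
have V7 : rw (rw (rw (W g m) (g m)) (g m.+2)) (g m) = 0 by rewrite rwC rw_sq rw0l oppr0.
have V8 : rw (rw (rw (W g m) (g m.+1)) (g m.+2)) (g m) = W g m.+3.
  by rewrite -rw_cycle.
have a1 : a = 1.
  apply/esym/S; have := congr1 (fun x => rw x (g m)) e.
  by rewrite !(rwDr, rwZr, rwDl, rwZl) V5 V6 V7 V8 !(scaler0, add0r) scale1r.
have := congr1 (fun x => rw x (g m.+1)) e.
rewrite a1 scale1r !(rwDr, rwZr, rwDl, rwZl) V1 V2 V3 V4 !(scaler0, add0r, addr0) !scalerN.
by move/oppr_inj/S.
Qed.

(** The last crossing has color j, so level i of the middle flags is visible in the last flag; it
    determines the parameter of the first step and hence its level j up to scale. *)
Lemma six_unique i j (a b c a' b' c' : K) G0 G1 G2 G3 H0 H1 H2 H3 :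
  (0 < i < d)%N -> (0 < j < d)%N -> adjacent i j ->
  unit a -> unit b -> unit c -> unit a' -> unit b' -> unit c' ->
  framed G0 -> propto G0 H0 -> propto G3 H3 ->
  dcross j a G0 G1 -> dcross i b G1 G2 -> dcross j c G2 G3 ->
  dcross j a' H0 H1 -> dcross i b' H1 H2 -> dcross j c' H2 H3 ->
  exists2 t, unit t & H1 j = t *: G1 j.
Proof.
move=> hi hj ij ua ub uc ua' ub' uc' [g [l r]] p0 p3 h1 h2 h3 k1 k2 k3.
have /andP[i0 id] := hi; have /andP[j0 jd] := hj; have id' := ltnW id; have jd' := ltnW jd.
have nij : i != j by move: ij; rewrite /adjacent; lia.
have [l' r'] := frep_propto r p0.
have [y1 [l1 [r1 _ _]]] := frep_dcross r hj ua h1.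
have [y2 [l2 [[_ ul2 e2] _ _]]] := frep_dcross r1 hi ub h2.
have [y1' [l1' [r1' _ _]]] := frep_dcross r' hj ua' k1.
have [y2' [l2' [[_ ul2' e2'] _ _]]] := frep_dcross r1' hi ub' k2.
have [t ut et] := p3 i id'.
have e3 : H2 i = t *: G2 i by rewrite -(proj1 h3) // -(proj1 k3).
rewrite e2 // e2' // scalerA in e3.
have e4 := congr1 (fun x => (l2' i)^-1 *: x) e3.
rewrite !scalerA mulVr // scale1r in e4.
case: (r) => uT _ _.
have ey := six_unique_aux uT hi hj ij e4.
case: r1 => _ ul1 e1; case: r1' => _ ul1' e1'.
exists (l1' j / l1 j); first by rewrite unitrM unitrV ul1' ul1.
by rewrite e1 // e1' // ey scalerA divrK.
Qed.

(** Before the letter of color m+1 the levels up to m are those of Y and the higher ones those of X.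
    So its vector v satisfies both Y^{m+1} = Y^m /\ v and X^{m+1} /\ v = c_m X^{m+2}, and appending
    v to X^1 /\ Y^m gives the induction. *)
Lemma col_black X Y (Z : nat -> nat -> E) (c : nat -> K) : (0 < d)%N ->
  Z 0%N = X -> Z d.-1 = Y ->
  (forall m, (m < d.-1)%N -> dcross m.+1 (c m) (Z m) (Z m.+1)) ->
  Y 0%N = one K d ->
  forall k, (k < d)%N -> wdg (X 1%N) (Y k) = (\prod_(m < k) c m) *: X k.+1.
Proof.
move=> d0 Z0 Zd h Y0.
have lX m : (m <= d.-1)%N -> forall i, (m < i <= d)%N -> Z m i = X i.
  elim: m => [|m IH] md i /andP[mi id]; first by rewrite Z0.
  by rewrite (proj1 (h m md)) ?IH ?(ltnW mi) ?(ltnW md) // gtn_eqF.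
have lY n m : (m + n = d.-1)%N -> forall i, (i <= m)%N -> Z m i = Y i.
  elim: n m => [|n IH] m e i im; first by rewrite -Zd -e addn0.
  have md : (m < d.-1)%N by rewrite -e addnS ltnS leq_addr.
  have id : (i <= d)%N by apply: leq_trans im (leq_trans (ltnW md) (leq_pred _)).
  by rewrite -(proj1 (h m md)) ?(IH m.+1) //; lia.
elim=> [|k IH] kd; first by rewrite Y0 wdg1r big_ord0 scale1r.
have kd1 : (k < d.-1)%N by lia.
have [v [e1 e2]] := proj2 (h k kd1).
have e3 : Y k.+1 = rw (Y k) v.
  by rewrite -(lY (d.-1 - k.+1)%N k.+1) ?subnKC // e1 /= (lY (d.-1 - k)%N k) ?subnKC // ltnW.
rewrite e3 wdg_rw (IH (ltnW kd)) rwZl big_ord_recr /= -scalerA; congr (_ *: _).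
by rewrite -!(lX k) ?e2 ?(lX k) //; lia.
Qed.

(** The hypothesis says that the hyperplane of X is the kernel of [f]; all proper levels lie in it
    and contract to zero. *)
Lemma ctr_flag0 f X a : (0 < d)%N -> framed X -> ctr f (X d) = a *: X d.-1 ->
  forall i, (i < d)%N -> ctr f (X i) = 0.
Proof.
move=> d0 [g [l [uT ul e]]] h; set n := d.-1 in h.
have dn : n.+1 = d by rewrite prednK.
have nd : (n <= d)%N by rewrite -dn.
have Wd : rw (W g n) (g n) = W g d by have -> : rw (W g n) (g n) = W g n.+1 by []; rewrite dn.
have [b hb] : exists b, rw (ctr f (W g n)) (g n) = b *: W g n.
  have hd : ctr f (W g d) = (a * l n / l d) *: W g n.
    have := congr1 (fun x => (l d)^-1 *: x) h; rewrite !e // ctrZ !scalerA mulVr // scale1r.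
    by move=> ->; congr (_ *: _); ring.
  exists (pair_cv f (g n) - a * l n / l d); rewrite scalerBl -hd -Wd.
  by rewrite ctr_rw opprB addrC subrK.
have f0 i : (i < n)%N -> pair_cv f (g i) = 0.
  move=> im; have h1 : rw (ctr f (W g n)) (g i) = pair_cv f (g i) *: W g n.
    have := ctr_rw f (W g n) (g i); rewrite W_mem // ctr0 => /esym/eqP.
    by rewrite subr_eq0 => /eqP.
  have := congr1 (fun x => rw x (g n)) h1; rewrite /= rwC hb rwZl rwZl W_mem // scaler0 oppr0 Wd.
  by move/esym/(W_reg uT (leqnn d)).
have c0 i : (i <= n)%N -> ctr f (W g i) = 0.
  elim: i => [|i IH] im; first exact: ctr_one.
  have -> : W g i.+1 = rw (W g i) (g i) by [].
  by rewrite ctr_rw f0 // (IH (ltnW im)) rw0l scale0r subr0.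
by move=> i im; rewrite e ?(ltnW im) // ctrZ c0 ?scaler0 //; lia.
Qed.

(* Contraction lowers the levels of [Y] to those of [X]: the hyperplane of [X]
   is the kernel of [f], and the levels of [X] are cut out by it. *)
Lemma col_white f X Y (Z : nat -> nat -> E) (c : nat -> K) (kap : K) : (0 < d)%N ->
  framed X -> Z 0%N = X -> Z d.-1 = Y ->
  (forall m, (m < d.-1)%N -> dcross (d.-1 - m) (c m) (Z m) (Z m.+1)) ->
  ctr f (X d) = kap *: X d.-1 ->
  forall k, (k < d)%N -> ctr f (Y k.+1) = (kap * \prod_(m < d.-1 - k) c m) *: X k.
Proof.
move=> d0 fX Z0 Zd h hk; set n := d.-1.
have dn : n.+1 = d by rewrite prednK.
have lX m : (m <= n)%N -> forall i, (i <= n - m)%N -> Z m i = X i.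
  elim: m => [|m IH] md i im; first by rewrite Z0.
  by rewrite (proj1 (h m md)) ?IH ?(ltnW md) //; lia.
have lY p m : (m + p = n)%N -> forall i, (n - m < i <= d)%N -> Z m i = Y i.
  elim: p m => [|p IH] m e i im; first by rewrite -Zd -/n -e addn0.
  have md : (m < n)%N by lia.
  by rewrite -(proj1 (h m md)) ?(IH m.+1) //; lia.
have lX' m : (m <= n)%N -> Z m d = X d.
  elim: m => [|m IH] md; first by rewrite Z0.
  by rewrite (proj1 (h m md)) ?IH ?(ltnW md) //; lia.
have c0 := ctr_flag0 d0 fX hk.
have main m : (m <= n)%N -> ctr f (Y (n - m).+1) = (kap * \prod_(i < m) c i) *: X (n - m)%N.
  elim: m => [|m IH] md.
    rewrite subn0 big_ord0 mulr1 -hk dn; congr ctr.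
    by rewrite -(lX' n) // Zd.
  have [v [e1 e2]] := proj2 (h m md).
  rewrite -/n in e1 e2; have em : (n - m = (n - m.+1).+1)%N by lia.
  have md' := ltnW md.
  rewrite (lX m md') // in e2.
  have e2' : rw (X (n - m)%N) v = c m *: Y (n - m).+1.
    by rewrite e2 (lY (n - m)%N m) ?subnKC //; lia.
  have e1' : Y (n - m)%N = rw (X (n - m.+1)%N) v.
    by rewrite -(lY (n - m.+1)%N m.+1) ?subnKC ?e1 ?(lX m md') //; [congr (rw (X _) _)| |]; lia.
  (* Contracting X^{n-m} /\ v, whose first factor is killed by [f], leaves f(v) X^{n-m}, while the
     level above is known by induction; this computes f(v). *)
  have fv : pair_cv f v = kap * \prod_(i < m.+1) c i.
    have := congr1 (ctr f) e2'; rewrite ctr_rw c0 ?rw0l ?subr0 ?ctrZ ?(IH md') ?scalerA //; last by lia.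
    move/(framed_lreg fX); rewrite big_ord_recr /= => -> //; last by lia.
    by rewrite mulrCA [c m * _]mulrC.
  by rewrite -em e1' ctr_rw c0 ?rw0l ?subr0 ?fv //; lia.
move=> k kd; have kn : (k <= n)%N by lia.
by have := main (n - k)%N (leq_subr _ _); rewrite subKn.
Qed.

End Flags.

(** * Transport of the constructions along relations between rings *)

Section RingRelations.
Variables (K K' : comUnitRingType) (d : nat) (R : K -> K' -> Prop).

(** Two instances are needed: the graph of the residue map, and the relation of having a given value
    at a point, which is not an everywhere defined function. *)
Record ring_rel : Prop := RingRel {
  ring_rel0 : R 0 0; ring_rel1 : R 1 1;
  ring_relD : forall a a' b b', R a a' -> R b b' -> R (a + b) (a' + b');
  ring_relN : forall a a', R a a' -> R (- a) (- a');
  ring_relM : forall a a' b b', R a a' -> R b b' -> R (a * b) (a' * b') }.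

Hypothesis RR : ring_rel.

Definition ext_rel (x : extK K d) (y : extK K' d) := forall S, R (x S) (y S).
Definition vec_rel (u : 'rV[K]_d) (v : 'rV[K']_d) := forall i, R (u 0 i) (v 0 i).

Lemma rel_sum (I : Type) (r : seq I) (P : pred I) (G : I -> K) (G' : I -> K') :
  (forall i, P i -> R (G i) (G' i)) ->
  R (\sum_(i <- r | P i) G i) (\sum_(i <- r | P i) G' i).
Proof. by move=> h; elim/big_rec2: _ => [|i a b Pi]; [apply: ring_rel0|apply: ring_relD => //; apply: h]. Qed.

Lemma rel_nat n : R n%:R n%:R.
Proof.
elim: n => [|n IH]; first exact: ring_rel0.
by rewrite !mulrS; apply: ring_relD => //; apply: ring_rel1.
Qed.

Lemma rel_sh_sign (A B : {set 'I_d}) : R (sh_sign K A B) (sh_sign K' A B).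
Proof.
rewrite /sh_sign; elim: #|_| => [|n IH]; rewrite ?expr0 ?exprS; first exact: ring_rel1.
by apply: ring_relM => //; apply: ring_relN => //; apply: ring_rel1.
Qed.

Lemma ext_rel_base (S : {set 'I_d}) : ext_rel (base K S) (base K' S).
Proof. by move=> T; rewrite !ffunE; apply: rel_nat. Qed.

Lemma ext_rel0 : ext_rel 0 0.
Proof. by move=> T; rewrite !ffunE; apply: ring_rel0. Qed.

Lemma ext_relZ a a' x y : R a a' -> ext_rel x y -> ext_rel (a *: x) (a' *: y).
Proof. by move=> h h' T; rewrite !ffunE; apply: ring_relM. Qed.

Lemma ext_rel_iv u v : vec_rel u v -> ext_rel (iv u) (iv v).
Proof.
move=> h S; rewrite !ffunE; apply: rel_sum => i _.
by apply: ring_relM => //; apply: rel_nat.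
Qed.

Lemma ext_rel_wdg x x' y y' : ext_rel x x' -> ext_rel y y' -> ext_rel (wdg x y) (wdg x' y').
Proof.
move=> h h' S; rewrite !ffunE; apply: rel_sum => A _.
by do !apply: ring_relM => //; apply: rel_sh_sign.
Qed.

Lemma ext_rel_rw x x' u u' : ext_rel x x' -> vec_rel u u' -> ext_rel (rw x u) (rw x' u').
Proof. by move=> h h'; apply: ext_rel_wdg => //; apply: ext_rel_iv. Qed.

Lemma rel_pair_cv f f' u u' : vec_rel f f' -> vec_rel u u' -> R (pair_cv f u) (pair_cv f' u').
Proof. by move=> h h'; apply: rel_sum => i _; apply: ring_relM. Qed.

Lemma ext_rel_ctr f f' x x' : vec_rel f f' -> ext_rel x x' -> ext_rel (ctr f x) (ctr f' x').
Proof.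
move=> h h' S; rewrite !ffunE; apply: rel_sum => i _.
by do !apply: ring_relM => //; apply: rel_sh_sign.
Qed.

End RingRelations.

(** * Replacing a factor of a word *)

Section Splicing.
Variable T : Type.
Implicit Types (s new : seq T) (k n : nat).

Definition rep k n new s := take k s ++ new ++ drop (k + n) s.

Lemma size_rep k n new s : (k + n <= size s)%N ->
  size (rep k n new s) = (size s - n + size new)%N.
Proof. by move=> h; rewrite !size_cat size_take size_drop; case: ifP => ?; lia. Qed.

Lemma nth_rep x0 k n new s e : (k + n <= size s)%N ->
  nth x0 (rep k n new s) e = if (e < k)%N then nth x0 s e
    else if (e < k + size new)%N then nth x0 new (e - k)
    else nth x0 s (e - size new + n)%N.
Proof.
move=> h; rewrite /rep !nth_cat size_take.
have -> : (if (k < size s)%N then k else size s) = k by case: ifP => //; lia.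
case: ltnP => ek; first by rewrite nth_take.
case: ltnP => e1; case: ltnP => e2 //; try lia.
by rewrite nth_drop; congr (nth _ _ _); lia.
Qed.

Lemma rep_rep k n new old s : (k + n <= size s)%N -> size old = n ->
  take n (drop k s) = old -> rep k (size new) old (rep k n new s) = s.
Proof.
move=> h so eo; rewrite /rep take_size_cat ?size_takel; last by lia.
rewrite drop_cat size_takel; last by lia.
rewrite ifN ?addKn; last by lia.
rewrite drop_size_cat // -eo -drop_drop drop_drop -{4}(cat_take_drop k s); congr (_ ++ _).
  by rewrite addnC -drop_drop cat_take_drop.
by [].
Qed.

End Splicing.

Lemma replace_windowE (m : vertex_kind * nat) (new s : seq nat) :
  replace_window m new s = rep m.2 (in_valency m.1) new s.
Proof. by []. Qed.

Definition vok (w : seq nat) (m : vertex_kind * nat) : Prop :=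
  vertex_letters m.1 (window m w) <> None.

Variant vok_spec (w : seq nat) (k : nat) : vertex_kind -> seq nat -> Prop :=
| VokTri i of window (Trivalent, k) w = [:: i; i] :
    vok_spec w k Trivalent [:: i]
| VokFour i j of window (Fourvalent, k) w = [:: i; j]
    & (i.+1 < j)%N || (j.+1 < i)%N : vok_spec w k Fourvalent [:: j; i]
| VokSix i j of window (Sixvalent, k) w = [:: i; j; i]
    & adjacent i j : vok_spec w k Sixvalent [:: j; i; j].

Lemma vokP w v k : vok w (v, k) ->
  vok_spec w k v (odflt [::] (vertex_letters v (window (v, k) w))).
Proof.
rewrite /vok; case: v => /=; set s := window _ w;
  case e: s => [|i [|j [|l [|? ?]]]] //=.
- by case: (eqVneq i j) => // ij _; constructor; rewrite -/s e ij.
- by case: ifP => // ij _; constructor.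
- case: ifP => // /andP[/eqP il ij] _; subst l; constructor=> //.
  by move: ij; rewrite /adjacent eq_sym [X in _ || X]eq_sym.
Qed.

Lemma window_size w m : vok w m -> size (window m w) = in_valency m.1.
Proof.
by case: m => v k /vokP; case=> [i e|i j e _|i j e _] /=; rewrite e.
Qed.

Lemma vok_bound w m : vok w m -> (m.2 + in_valency m.1 <= size w)%N.
Proof.
move=> h; have := window_size h; rewrite /window size_take size_drop.
by case: m.1 => /=; case: ifP; lia.
Qed.

Lemma nth_window w m e : (e < in_valency m.1)%N -> nth 0%N (window m w) e = nth 0%N w (m.2 + e).
Proof. by move=> h; rewrite nth_take // nth_drop. Qed.

Lemma out_letters w v k : vok w (v, k) ->
  size (odflt [::] (vertex_letters v (window (v, k) w))) = out_valency v.
Proof. by move/vokP; case. Qed.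

Lemma vok_tri w k : vok w (Trivalent, k) ->
  nth 0%N w k.+1 = nth 0%N w k /\
  word_step w (Trivalent, k) = rep k 2 [:: nth 0%N w k] w.
Proof.
move=> h; have n0 := @nth_window w (Trivalent, k) 0 isT; have n1 := @nth_window w (Trivalent, k) 1 isT.
rewrite /= addn0 in n0; rewrite /= addn1 in n1; rewrite -n0 -n1.
rewrite /word_step replace_windowE; move: h; rewrite /vok /=.
by case: (window _ w) => [|i [|j [|? ?]]] //=; case: (eqVneq i j) => // -> _.
Qed.

(** * Chains of flags along a word and their passage through a vertex *)

Section Chains.
Variables (K : comUnitRingType) (d : nat).
Local Notation E := (extK K d).
Local Notation unit c := (c \is a GRing.unit).
Local Notation flagK := (nat -> E).

Definition chain (w : seq nat) (fl : nat -> flagK) (c : nat -> K) :=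
  forall k, (k < size w)%N -> unit (c k) /\ dcross (nth 0%N w k) (c k) (fl k) (fl k.+1).

Lemma chain_framed w fl c : letters_in d w -> chain w fl c -> framed (fl 0%N) ->
  forall g, (g <= size w)%N -> framed (fl g).
Proof.
move=> /all_nthP hw hc f0; elim=> // g IH gw.
have [u h] := hc g gw; exact: (framed_dcross (IH (ltnW gw)) (hw 0%N g gw) u h).
Qed.

(** [spl] splices a local sequence indexed by gaps, [spe] one indexed by letters; the gap at
    position k belongs to both the old and the new sequence, which explains the weak inequality. *)
Definition spl (T : Type) (k n n' : nat) (loc f : nat -> T) : nat -> T := fun g =>
  if (g <= k)%N then f g else if (g < k + n')%N then loc (g - k)%N
  else f (g - n' + n)%N.

Definition spe (T : Type) (k n n' : nat) (loc f : nat -> T) : nat -> T := fun e =>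
  if (e < k)%N then f e else if (e < k + n')%N then loc (e - k)%N
  else f (e - n' + n)%N.

Lemma chain_rep w fl c k n new loc newc : (k + n <= size w)%N -> (0 < size new)%N ->
  chain w fl c -> chain new loc newc -> loc 0%N = fl k -> loc (size new) = fl (k + n)%N ->
  chain (rep k n new w) (spl k n (size new) loc fl) (spe k n (size new) newc c).
Proof.
move=> kn n0 hc hl l0 l1 e; rewrite size_rep // => es.
rewrite nth_rep // /spe /spl.
case: ltnP => ek.
  by rewrite (ltnW ek); apply: hc; lia.
case: ltnP => e2.
  have -> : (if (e <= k)%N then fl e else loc (e - k)%N) = loc (e - k)%N.
    by case: leqP => // ek'; rewrite (_ : e = k) ?subnn ?l0 //; lia.
  have -> : (if (e.+1 < k + size new)%N then loc (e.+1 - k)%N else fl (e.+1 - size new + n)%N) =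
      loc (e - k).+1.
    case: ltnP => h; first by congr loc; lia.
    by rewrite (_ : (e - k).+1 = size new) ?l1; [congr fl|]; lia.
  by apply: hl; lia.
have -> : (e <= k)%N = false by lia.
have -> : (e.+1 < k + size new)%N = false by lia.
have -> : (e.+1 - size new + n = (e - size new + n).+1)%N by lia.
by apply: hc; lia.
Qed.

Definition carry (m : vertex_kind * nat) (w : seq nat) (fl fl' : nat -> flagK) :=
  (forall g, (g <= m.2)%N -> fl' g = fl g) /\
  (forall g, (m.2 + in_valency m.1 + g <= size w)%N ->
     fl' (m.2 + out_valency m.1 + g)%N = fl (m.2 + in_valency m.1 + g)%N).

Lemma spl_left T k n n' (loc f : nat -> T) g : (g <= k)%N -> spl k n n' loc f g = f g.
Proof. by rewrite /spl => ->. Qed.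

Lemma spl_right T k n n' (loc f : nat -> T) g : (0 < n')%N ->
  spl k n n' loc f (k + n' + g) = f (k + n + g)%N.
Proof.
by move=> h; rewrite /spl ifN ?ifN; [congr f| |]; lia.
Qed.

Lemma letters_step w m : vok w m -> letters_in d w -> letters_in d (word_step w m).
Proof.
move=> hm hw; rewrite /word_step /letters_in all_cat; apply/andP; split.
  by apply/allP=> i /mem_take; apply: (allP hw).
rewrite all_cat; apply/andP; split; last by apply/allP=> i /mem_drop; apply: (allP hw).
have hwin i : i \in window m w -> (0 < i < d)%N.
  by move/mem_take/mem_drop; apply: (allP hw).
case: m hm hwin => v k hm; case: (vokP hm) => [i e|i j e ij|i j e ij] hwin /=;
  rewrite e in hwin.
- by rewrite hwin // inE eqxx.
- by rewrite !hwin // !inE eqxx ?orbT.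
- by rewrite !hwin // !inE eqxx ?orbT.
Qed.

(* Going up through a vertex is always possible. *)
Lemma chain_up w m fl' c' : (1 < d)%N -> vok w m -> letters_in d w ->
  chain (word_step w m) fl' c' -> framed (fl' 0%N) ->
  exists fl c, chain w fl c /\ carry m w fl fl'.
Proof.
move=> d1 hm hw hc f0.
have hb := vok_bound hm; have hw' := letters_step hm hw.
have fr := chain_framed hw' hc f0.
case: m hm hb hw' hc fr => v k hm /= hb hw' hc fr.
set new := odflt [::] (vertex_letters v (window (v, k) w)).
have sn : size new = out_valency v := out_letters hm.
have sw : size (word_step w (v, k)) = (size w - in_valency v + out_valency v)%N.
  by rewrite /word_step replace_windowE size_rep // sn.
have ew : rep k (out_valency v) (window (v, k) w) (word_step w (v, k)) = w.
  by rewrite /word_step replace_windowE -sn rep_rep // window_size.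
have sW := window_size hm; rewrite /= in sW.
have o0 : (0 < out_valency v)%N by case: (v).
have i0 : (0 < in_valency v)%N by case: (v).
have nw e : (e < out_valency v)%N -> nth 0%N (word_step w (v, k)) (k + e) = nth 0%N new e.
  move=> h; rewrite /word_step replace_windowE nth_rep //= -/new sn.
  by rewrite (ltnNge _ k) leq_addr /= ltn_add2l h addKn.
have hne e : (e < out_valency v)%N ->
    unit (c' (k + e)%N) /\ dcross (nth 0%N new e) (c' (k + e)%N) (fl' (k + e)%N) (fl' (k + e).+1).
  by move=> h; rewrite -nw //; apply: hc; rewrite sw; lia.
suff [loc [nc [hl l0 l1]]] : exists loc nc, [/\ chain (window (v, k) w) loc nc,
    loc 0%N = fl' k & loc (in_valency v) = fl' (k + out_valency v)%N].
  exists (spl k (out_valency v) (in_valency v) loc fl'),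
    (spe k (out_valency v) (in_valency v) nc c'); split.
    rewrite -{1}ew -{1 2}sW; apply: chain_rep; rewrite ?sW //.
    by rewrite sw; lia.
  split=> g /= h; first by rewrite spl_left.
  by rewrite spl_right.
have fk : framed (fl' k) by apply: fr; rewrite sw; lia.
have hwin i : i \in window (v, k) w -> (0 < i < d)%N.
  by move/mem_take/mem_drop; apply: (allP hw).
rewrite {}/new in sn nw hne *; clear ew sw hb hc fr nw hw'.
case: (vokP hm) hne sW hwin => [i e|i j e ij|i j e ij] /= hne sW hwin; rewrite {}e in sW hwin *.
- have [] := hne 0%N isT; rewrite addn0 /= => u h.
  have id : (0 < i < d)%N by apply: hwin; rewrite inE eqxx.
  have [M [c1 [c2 [u1 u2 h1 h2]]]] := tri_insert fk id u h.
  exists (fun g => nth (fl' k) [:: fl' k; M; fl' k.+1] g), (fun e => nth 1 [:: c1; c2] e).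
  by split=> //=; [case=> [|[|]] //|rewrite addn1].
- have [] := hne 0%N isT; have [] := hne 1%N isT; rewrite addn0 addn1 addn2 /= => u1 h1 u0 h0.
  have id : (0 < i < d)%N by apply: hwin; rewrite inE eqxx.
  have jd : (0 < j < d)%N by apply: hwin; rewrite !inE eqxx orbT.
  have ji : (j.+1 < i)%N || (i.+1 < j)%N by rewrite orbC.
  have [h2 h3] := four_step jd id ji h0 h1.
  exists (fun g => nth (fl' k) [:: fl' k; setf (fl' k) i (fl' k.+2 i); fl' k.+2] g),
    (fun e => nth 1 [:: c' k.+1; c' k] e).
  by split=> //=; case=> [|[|]].
- have [] := hne 0%N isT; have [] := hne 1%N isT; have [] := hne 2%N isT.
  rewrite addn0 addn1 addn2 /= => u2 h2 u1 h1 u0 h0.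
  have id : (0 < i < d)%N by apply: hwin; rewrite inE eqxx.
  have jd : (0 < j < d)%N by apply: hwin; rewrite !inE eqxx orbT.
  have ji : adjacent j i by rewrite /adjacent orbC.
  (* In the upward direction the flags matter but not the values: the first upper value is chosen so
     that the first product relation is trivial, and the third is then forced by the second. *)
  have eD : c' k.+2 * (c' k * c' k.+1 / c' k.+2) = c' k * c' k.+1 by rewrite mulrC divrK.
  have [G [g1 g2 g3]] := six_step fk jd id ji u0 u1 u2 u1 h0 h1 h2 (erefl _) eD.
  exists (fun g => nth (fl' k) [:: fl' k; G; setf (fl' k.+3) i (G i); fl' k.+3] g),
    (fun e => nth 1 [:: c' k.+1; c' k.+2; c' k * c' k.+1 / c' k.+2] e).
  split=> //=; last by rewrite addn3.
  by case=> [|[|[|]]] //= _; rewrite !(unitrM, unitrV) u0 u1 u2.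
Qed.

End Chains.

Section ChainsDown.
Variables (K : comUnitRingType) (d : nat).
Local Notation E := (extK K d).
Local Notation unit c := (c \is a GRing.unit).
Local Notation flagK := (nat -> E).

Lemma is_weave_cons w m ms w' :
  is_weave w (m :: ms) w' <-> vok w m /\ is_weave (word_step w m) ms w'.
Proof.
split=> [[h e]|[h0 [h e]]].
  by split; [exact: (h 0%N)|split=> // t ht; exact: (h t.+1)].
by split=> // -[|t] ht; [exact: h0|exact: (h t)].
Qed.

(** Going up meets no obstruction, even at trivalent vertices; this is what makes a base point
    available for every weave. *)
Lemma chain_lift w ms w' (fl' : nat -> flagK) c' : (1 < d)%N -> letters_in d w ->
  is_weave w ms w' -> chain w' fl' c' -> framed (fl' 0%N) ->
  exists H C, [/\ forall t, (t <= size ms)%N ->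
      chain (slice w ms t) (H t) (C t) /\ framed (H t 0%N),
    forall t, (t < size ms)%N -> carry (nth move0 ms t) (slice w ms t) (H t) (H t.+1)
    & H (size ms) = fl'].
Proof.
move=> d1; elim: ms w => [|m ms IH] w hw.
  move=> [_ <-] hc f0; by exists (fun=> fl'), (fun=> c').
move=> /is_weave_cons[hm hW] hc f0.
have [H [C [h1 h2 h3]]] := IH _ (letters_step hm hw) hW hc f0.
have [hc1 f1] := h1 0%N isT; rewrite /slice take0 /= in hc1.
have [fl [c [hc0 hcar]]] := chain_up d1 hm hw hc1 f1.
exists (fun t => if t is t'.+1 then H t' else fl), (fun t => if t is t'.+1 then C t' else c).
split=> // [[|t] ht|[|t] ht]; [|exact: (h1 t)| |exact: (h2 t)].
  by split; [rewrite /slice|rewrite -(proj1 hcar)].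
by rewrite /slice.
Qed.

(** What has to be known to go down: the relative position of the outer flags at a trivalent vertex,
    and the two product relations at a 6-valent one. *)
Definition out_ok (w : seq nat) (m : vertex_kind * nat) (fl : nat -> flagK) (c nc : nat -> K) :=
  match m.1 with
  | Trivalent => unit (nc 0%N) /\ dcross (nth 0%N w m.2) (nc 0%N) (fl m.2) (fl m.2.+2)
  | Fourvalent => nc 0%N = c m.2.+1 /\ nc 1%N = c m.2
  | Sixvalent => [/\ unit (nc 0%N), nc 0%N * nc 1%N = c m.2.+1 * c m.2.+2
      & nc 1%N * nc 2%N = c m.2 * c m.2.+1]
  end.

Lemma chain_down w m (fl : nat -> flagK) c nc : vok w m -> letters_in d w ->
  chain w fl c -> framed (fl 0%N) -> out_ok w m fl c nc ->
  exists fl', chain (word_step w m) fl' (spe m.2 (in_valency m.1) (out_valency m.1) nc c) /\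
    carry m w fl fl'.
Proof.
move=> hm hw hc f0.
have hb := vok_bound hm; have fr := chain_framed hw hc f0.
case: m hm hb => v k hm /= hb hok.
have o0 : (0 < out_valency v)%N by case: (v).
have nw e : (e < in_valency v)%N -> nth 0%N w (k + e) = nth 0%N (window (v, k) w) e.
  by move=> h; rewrite nth_window.
have hne e : (e < in_valency v)%N -> unit (c (k + e)%N) /\
    dcross (nth 0%N (window (v, k) w) e) (c (k + e)%N) (fl (k + e)%N) (fl (k + e).+1).
  by move=> h; rewrite -nw //; apply: hc; lia.
have fk : framed (fl k) by apply: fr; lia.
have hwin i : i \in window (v, k) w -> (0 < i < d)%N.
  by move/mem_take/mem_drop; apply: (allP hw).
suff [loc [hl l0 l1]] : exists loc,
    [/\ chain (odflt [::] (vertex_letters v (window (v, k) w))) loc nc,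
    loc 0%N = fl k & loc (out_valency v) = fl (k + in_valency v)%N].
  exists (spl k (in_valency v) (out_valency v) loc fl); split.
    rewrite /word_step replace_windowE /= -{1 2}(out_letters hm).
    by apply: chain_rep; rewrite ?(out_letters hm).
  split=> g /= h; first by rewrite spl_left.
  by rewrite spl_right.
have k0 : nth 0%N w k = nth 0%N (window (v, k) w) 0.
  by rewrite -nw ?addn0 //; case: (v).
clear nw; move: hok; rewrite /out_ok /= k0.
case: (vokP hm) hne hwin => [i e|i j e ij|i j e ij] /= hne hwin; rewrite {}e in hne hwin *.
- move=> [u h]; exists (fun g => nth (fl k) [:: fl k; fl k.+2] g).
  by split=> //=; [case=> [|[|]] //|rewrite addn2].
- move=> [n0 n1]; have [] := hne 0%N isT; have [] := hne 1%N isT.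
  rewrite addn0 addn1 /= => u1 h1 u0 h0.
  have id : (0 < i < d)%N by apply: hwin; rewrite inE eqxx.
  have jd : (0 < j < d)%N by apply: hwin; rewrite !inE eqxx orbT.
  have [h2 h3] := four_step id jd ij h0 h1.
  exists (fun g => nth (fl k) [:: fl k; setf (fl k) j (fl k.+2 j); fl k.+2] g).
  split=> //=; last by rewrite addn2.
  by case=> [|[|[|]]] //=; rewrite ?n0 ?n1.
- move=> [un e1 e2]; have [] := hne 0%N isT; have [] := hne 1%N isT; have [] := hne 2%N isT.
  rewrite addn0 addn1 addn2 /= => u2 h2 u1 h1 u0 h0.
  have id : (0 < i < d)%N by apply: hwin; rewrite inE eqxx.
  have jd : (0 < j < d)%N by apply: hwin; rewrite !inE eqxx orbT.
  have un1 : unit (nc 1%N).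
    by have := unitrM (nc 0%N) (nc 1%N); rewrite e1 unitrM u1 u2 => /esym/andP[].
  have un2 : unit (nc 2%N).
    by have := unitrM (nc 1%N) (nc 2%N); rewrite e2 unitrM u1 u0 => /esym/andP[].
  have [G [g1 g2 g3]] := six_step fk id jd ij u0 u1 u2 un h0 h1 h2 e1 e2.
  exists (fun g => nth (fl k) [:: fl k; G; setf (fl k.+3) j (G j); fl k.+3] g).
  by split=> //=; [case=> [|[|[|]]]|rewrite addn3].
Qed.

(* The flags below a vertex are determined, up to scalars, by those above. *)
Lemma chain_unique w m (fl fl' h h' : nat -> flagK) c c' b b' : vok w m -> letters_in d w ->
  framed (fl 0%N) ->
  chain w fl c -> chain (word_step w m) fl' c' -> carry m w fl fl' ->
  chain w h b -> chain (word_step w m) h' b' -> carry m w h h' ->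
  (forall g, (g <= size w)%N -> propto (fl g) (h g)) ->
  forall g, (g <= size (word_step w m))%N -> propto (fl' g) (h' g).
Proof.
move=> hm hw f0 cf cf' kf ch ch' kh hp g.
have hb := vok_bound hm; have fr := chain_framed hw cf f0.
case: m hm hb cf' kf ch' kh => v k hm /= hb cf' [kf1 kf2] ch' [kh1 kh2].
have sw : size (word_step w (v, k)) = (size w - in_valency v + out_valency v)%N.
  by rewrite /word_step replace_windowE size_rep // out_letters.
rewrite sw => gs.
have [gk|gk] := leqP g k; first by rewrite kf1 // kh1 //; apply: hp; lia.
have [go|go] := leqP (k + out_valency v) g.
  have -> : g = (k + out_valency v + (g - (k + out_valency v)))%N by lia.
  by rewrite kf2 ?kh2; [apply: hp| |] => /=; lia.
set new := odflt [::] (vertex_letters v (window (v, k) w)).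
have sn : size new = out_valency v := out_letters hm.
have nw e : (e < out_valency v)%N -> nth 0%N (word_step w (v, k)) (k + e) = nth 0%N new e.
  move=> he; rewrite /word_step replace_windowE nth_rep //= -/new sn.
  by rewrite (ltnNge _ k) leq_addr /= ltn_add2l he addKn.
have hne e : (e < out_valency v)%N ->
    unit (c' (k + e)%N) /\ dcross (nth 0%N new e) (c' (k + e)%N) (fl' (k + e)%N) (fl' (k + e).+1).
  by move=> he; rewrite -nw //; apply: cf'; rewrite sw; lia.
have hnh e : (e < out_valency v)%N ->
    unit (b' (k + e)%N) /\ dcross (nth 0%N new e) (b' (k + e)%N) (h' (k + e)%N) (h' (k + e).+1).
  by move=> he; rewrite -nw //; apply: ch'; rewrite sw; lia.
have hwin i : i \in window (v, k) w -> (0 < i < d)%N.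
  by move/mem_take/mem_drop; apply: (allP hw).
have p0 : propto (fl' k) (h' k) by rewrite kf1 // kh1 //; apply: hp; lia.
have pe : propto (fl' (k + out_valency v)%N) (h' (k + out_valency v)%N).
  have q : (k + in_valency v + 0 <= size w)%N by rewrite addn0.
  by have := kf2 0%N q; have := kh2 0%N q; rewrite !addn0 => -> ->; apply: hp.
have fk : framed (fl' k) by rewrite kf1 //; apply: fr; lia.
have gk1 : exists e, (g = k + e.+1)%N by exists (g - k.+1)%N; lia.
case: gk1 => e eg; subst g; rewrite {gk gs}/new in hne hnh nw sn *.
rewrite ltn_add2l in go; clear nw sn sw hb kf2 kh2.
case: (vokP hm) hne hnh hwin pe go => [i ew|i j ew ij|i j ew ij] /= hne hnh hwin pe go;
  rewrite {}ew in hne hnh hwin.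
- by case: e go.
- have {go} -> : e = 0%N by lia.
  have [_ [h1 _]] := hne 0%N isT; have [_ [h2 _]] := hne 1%N isT.
  have [_ [h3 _]] := hnh 0%N isT; have [_ [h4 _]] := hnh 1%N isT.
  rewrite /= addn0 addn1 in h1 h2 h3 h4; rewrite addn1 => l ld; rewrite addn2 in pe.
  case: (eqVneq l j) => [->|lj]; last by rewrite h1 // h3 //; apply: p0.
  have jd : (0 < j < d)%N by apply: hwin; rewrite !inE eqxx orbT.
  have jd' : (j <= d)%N by lia.
  have ji : j != i by lia.
  by rewrite -h2 // -h4 //; apply: pe.
- have id : (0 < i < d)%N by apply: hwin; rewrite inE eqxx.
  have jd : (0 < j < d)%N by apply: hwin; rewrite !inE eqxx orbT.
  have [u1 h1] := hne 0%N isT; have [u2 h2] := hne 1%N isT; have [u3 h3] := hne 2%N isT.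
  have [v1 k1] := hnh 0%N isT; have [v2 k2] := hnh 1%N isT; have [v3 k3] := hnh 2%N isT.
  rewrite /= addn0 addn1 addn2 in u1 u2 u3 v1 v2 v3 h1 h2 h3 k1 k2 k3.
  rewrite addn3 in pe.
  have [t ut et] := six_unique id jd ij u1 u2 u3 v1 v2 v3 fk p0 pe h1 h2 h3 k1 k2 k3.
  have jd' : (j <= d)%N by lia.
  have ji : j != i by move: ij; rewrite /adjacent; lia.
  have {go} : e = 0%N \/ e = 1%N by lia.
  case=> ->; rewrite ?addn1 ?addn2 => l ld.
    case: (eqVneq l j) => [->|lj]; first by exists t.
    by rewrite (proj1 h1) // (proj1 k1) //; apply: p0.
  case: (eqVneq l j) => [->|lj]; first by exists t; rewrite // (proj1 h2) // (proj1 k2).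
  by rewrite -(proj1 h3) // -(proj1 k3) //; apply: pe.
Qed.

Lemma chain_ends w ms w' (H : nat -> nat -> flagK) : is_weave w ms w' ->
  (forall t, (t < size ms)%N -> carry (nth move0 ms t) (slice w ms t) (H t) (H t.+1)) ->
  H 0%N 0%N = H (size ms) 0%N /\ H 0%N (size w) = H (size ms) (size w').
Proof.
elim: ms w H => [|m ms IH] w H; first by move=> [_ <-].
move=> /is_weave_cons[hm hW] hc.
have [e1 e2] := IH _ (fun t => H t.+1) hW (fun t ht => hc t.+1 ht).
have [c1 c2] := hc 0%N isT; rewrite /slice /= in c1 c2.
have hb := vok_bound hm; split; first by rewrite /= -e1 c1.
rewrite /= -e2 /word_step replace_windowE size_rep //.
case: m hm hb {hc hW IH e1 e2} c1 c2 => v k hm hb c1 c2; rewrite out_letters //= in hb c2 *.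
have := c2 (size w - (k + in_valency v))%N; rewrite subnKC // => <- //.
by congr (H _ _); lia.
Qed.

End ChainsDown.

(** * Reduction of flags along a ring morphism *)

Section Residue.
Variables (A F : comUnitRingType) (d : nat) (pi : {rmorphism A -> F}).
Local Notation unit c := (c \is a GRing.unit).

Definition ext_map (x : extK A d) : extK F d := [ffun S => pi (x S)].
Definition vec_map (u : 'rV[A]_d) : 'rV[F]_d := map_mx pi u.

Lemma ring_rel_map : ring_rel (fun a b => pi a = b).
Proof.
split; rewrite ?rmorph0 ?rmorph1 //.
- by move=> a a' b b' <- <-; rewrite rmorphD.
- by move=> a a' <-; rewrite rmorphN.
- by move=> a a' b b' <- <-; rewrite rmorphM.
Qed.

Lemma ext_mapP x y : ext_rel (fun a b => pi a = b) x y -> ext_map x = y.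
Proof. by move=> h; apply/ffunP=> S; rewrite ffunE h. Qed.

Lemma ext_map_rel x : ext_rel (fun a b => pi a = b) x (ext_map x).
Proof. by move=> S; rewrite ffunE. Qed.

Lemma vec_map_rel u : vec_rel (fun a b => pi a = b) u (vec_map u).
Proof. by move=> i; rewrite mxE. Qed.

Lemma ext_map_rw x u : ext_map (rw x u) = rw (ext_map x) (vec_map u).
Proof.
exact: ext_mapP (ext_rel_rw ring_rel_map (ext_map_rel x) (vec_map_rel u)).
Qed.

Lemma ext_mapZ a x : ext_map (a *: x) = pi a *: ext_map x.
Proof. by apply/ffunP=> S; rewrite !ffunE rmorphM. Qed.

Lemma ext_map_one : ext_map (one A d) = one F d.
Proof. by apply/ffunP=> S; rewrite !ffunE rmorph_nat. Qed.

Lemma ext_map_ctr f x : ext_map (ctr f x) = ctr (vec_map f) (ext_map x).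
Proof.
exact: ext_mapP (ext_rel_ctr ring_rel_map (vec_map_rel f) (ext_map_rel x)).
Qed.

Lemma ext_map_W g k : ext_map (W g k) = W (vec_map \o g) k.
Proof.
elim: k => [|k IH]; first exact: ext_map_one.
by rewrite [LHS]ext_map_rw IH.
Qed.

Lemma frep_map g l G : frep g l G ->
  frep (vec_map \o g) (pi \o l) (fun i => ext_map (G i) : extK F d).
Proof.
move=> [uT ul e]; split=> [|i|i id].
- by rewrite -ext_map_W /topc ffunE rmorph_unit.
- exact: rmorph_unit.
- by rewrite e // ext_mapZ ext_map_W.
Qed.

Lemma framed_map (G : nat -> extK A d) : framed G -> framed (fun i => ext_map (G i)).
Proof. by move=> [g [l /frep_map r]]; exists (vec_map \o g), (pi \o l). Qed.

Lemma dcross_map k c (G H : nat -> extK A d) : dcross k c G H ->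
  dcross k (pi c) (fun i => ext_map (G i)) (fun i => ext_map (H i)).
Proof.
move=> [e [v [h1 h2]]]; split=> [i id ik|]; first by rewrite e.
by exists (vec_map v); rewrite h1 -!ext_map_rw h2 ext_mapZ.
Qed.

Lemma chain_map w fl c : @chain A d w fl c ->
  chain w (fun g i => ext_map (fl g i)) (pi \o c).
Proof.
by move=> h k kw; have [u hk] := h k kw; split; [exact: rmorph_unit|exact: dcross_map].
Qed.

Lemma carry_map m w fl fl' : @carry A d m w fl fl' ->
  carry m w (fun g i => ext_map (fl g i)) (fun g i => ext_map (fl' g i)).
Proof. by move=> [h1 h2]; split=> g hg /=; [rewrite h1|rewrite h2]. Qed.

End Residue.

(** By [tri_step] only the invertibility of z2 is at stake. If z2 had residue zero, the outer flags
    would have proportional levels i in the residue field; but there they are proportional to the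
    flags [h], which do pass below the vertex with an invertible crossing value. *)
Lemma tri_nondegenerate (A : comUnitRingType) (F : fieldType) d (pi : {rmorphism A -> F})
    w k (fl : nat -> nat -> extK A d) c (h h' : nat -> nat -> extK F d) b b' :
  (forall a, pi a != 0 -> a \is a GRing.unit) ->
  vok w (Trivalent, k) -> letters_in d w -> framed (fl 0%N) -> framed (h 0%N) ->
  chain w fl c -> chain w h b -> chain (word_step w (Trivalent, k)) h' b' ->
  carry (Trivalent, k) w h h' ->
  (forall g, (g <= size w)%N -> propto (fun i => ext_map pi (fl g i)) (h g)) ->
  exists2 c0, c0 \is a GRing.unit & dcross (nth 0%N w k) c0 (fl k) (fl k.+2).
Proof.
move=> loc hm hw f0 fh cf ch ch' [kh1 kh2] hp.
have hb := vok_bound hm; rewrite /= in hb kh1 kh2.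
have [e1 estep] := vok_tri hm; move e0: (nth 0%N w k) e1 estep => i e1 estep.
have id : (0 < i < d)%N by rewrite -e0; apply: (all_nthP 0%N hw); lia.
have kw : (k < size w)%N by lia.
have k1w : (k.+1 < size w)%N by lia.
have [u0 h0] := cf k kw; have [u1 h1] := cf k.+1 k1w.
rewrite e0 in h0; rewrite e1 in h1.
have [g [l r]] := chain_framed hw cf f0 (ltnW kw).
have [z1 [z2 [t [ut eN nd]]]] := tri_step r id u0 u1 h0 h1.
apply/nd/loc/eqP => z20.
have [id' id''] : (i <= d)%N /\ (i.-1 <= d)%N by lia.
have i0 : (0 < i)%N by lia.
have sw : size (word_step w (Trivalent, k)) = (size w - 2 + 1)%N.
  by rewrite estep size_rep.
have e2 : nth 0%N (word_step w (Trivalent, k)) k = i.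
  by rewrite estep nth_rep // ltnn addn1 ltnSn subnn.
have [|v0 hh] := ch' k; first by rewrite sw; lia.
rewrite e2 in hh.
have := kh2 0%N; rewrite !addn0 addn1 addn2 => /(_ k1w) ek2.
rewrite kh1 // ek2 in hh; have [_ [v [q1 q2]]] := hh.
have [a ua ea] := hp k (ltnW kw) i id'.
have [a' ua' ea'] := hp k.+2 k1w i id'.
case: (frep_map pi r) => _ ul e.
have pr : ext_map pi (fl k.+2 i) = - (pi t / pi (l i)) *: ext_map pi (fl k i).
  rewrite eN ext_mapZ ext_map_rw [ext_map pi (fl k i)]e // scalerA mulNr divrK ?ul //.
  rewrite ext_map_W scaleNr -scalerN; congr (_ *: _).
  have -> : W (vec_map pi \o g) i = rw (W (vec_map pi \o g) i.-1) ((vec_map pi \o g) i.-1).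
    by rewrite -{1}(prednK i0).
  rewrite -rwNr; congr (rw _ _); apply/rowP=> j; rewrite !mxE.
  by rewrite !(rmorphB, rmorphD, rmorphM) z20 !mul0r add0r sub0r.
have e3 : h k.+2 i = (a' * (- (pi t / pi (l i))) / a) *: h k i.
  by rewrite ea' pr ea !scalerA -[_ / a * a]mulrA mulVr // mulr1.
set be := (_ / a) in e3.
have e4 : rw (h k.+2 i) v = 0 by rewrite q1 rw_sq.
have fr := chain_framed hw ch fh.
have be0 : be * b' k = 0.
  apply: (framed_reg (fr k (ltnW kw)) (_ : i.+1 <= d)%N); first by lia.
  by rewrite -scalerA -q2 -rwZl -e3.
have b0 : be = 0 by rewrite -[be]mulr1 -(divrr v0) mulrA be0 mul0r.
have := @framed_reg _ _ _ _ 1 (fr k.+2 k1w) id'.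
by rewrite e3 b0 scale0r scaler0 => /(_ erefl)/eqP; rewrite oner_eq0.
Qed.

(** * Weights of cycles and the monomials they define *)

Section Weights.
Variables (mw : mword) (ms : weave) (w' : seq nat).
Hypothesis hweave : is_weave (unzip1 mw) ms w'.
Local Notation w := (unzip1 mw).
Local Notation cyc := (cycles mw ms).
Local Notation mv t := (nth move0 ms t).

Lemma slice_step t : (t < size ms)%N -> slice w ms t.+1 = word_step (slice w ms t) (mv t).
Proof. by move=> h; rewrite /slice (take_nth move0) // -cats1 foldl_cat. Qed.

Lemma slice_vok t : (t < size ms)%N -> vok (slice w ms t) (mv t).
Proof. exact: (proj1 hweave). Qed.

Lemma size_slice_step t : (t < size ms)%N -> size (slice w ms t.+1) =
  (size (slice w ms t) - in_valency (mv t).1 + out_valency (mv t).1)%N.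
Proof.
move=> h; have hv := slice_vok h; rewrite slice_step // /word_step replace_windowE.
rewrite size_rep ?vok_bound //; case: (mv t) hv => v k hv; by rewrite out_letters.
Qed.

Lemma mem_cycles c : (c \in cyc) = (c.1 == 0%N) && ((c.2 < size mw)%N && (nth (0%N, false) mw c.2).2)
  || ((0 < c.1)%N && (c.1 <= size ms)%N && is_trivalent (mv c.1.-1).1 && (c.2 == (mv c.1.-1).2)).
Proof.
case: c => t k /=; rewrite mem_cat; congr (_ || _).
  apply/mapP/idP => [[k' ]|/andP[/eqP-> /andP[kw hk]]].
    by rewrite mem_filter mem_iota => /andP[hk /= kw] [-> ->]; rewrite eqxx kw.
  by exists k => //; rewrite mem_filter mem_iota hk.
apply/mapP/idP => [[t']|].
  by rewrite mem_filter mem_iota => /andP[ht /= tw] [-> ->] /=; rewrite tw ht eqxx.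
case: t => //= t /andP[/andP[tw ht] /eqP->].
by exists t => //; rewrite mem_filter mem_iota ht.
Qed.

Lemma uniq_cycles : uniq cyc.
Proof.
rewrite cat_uniq; apply/and3P; split.
- by rewrite map_inj_uniq ?filter_uniq ?iota_uniq // => a b [].
- apply/hasPn => c /mapP[t _ ->]; apply/mapP => -[k _] [] //.
- by rewrite map_inj_uniq ?filter_uniq ?iota_uniq // => a b [].
Qed.

Lemma weights_lt c t : (t < c.1)%N -> weights mw ms c t = nseq (size (slice w ms t)) 0%N.
Proof. by rewrite /weights => ->. Qed.

Lemma weights_eq c t : c.1 = t -> weights mw ms c t =
  mkseq (fun k => nat_of_bool (k == c.2)) (size (slice w ms t)).
Proof.
by move=> <-; rewrite /weights ltnn drop_oversize // size_take; case: ifP => // /negbT; rewrite -leqNgt.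
Qed.

Lemma weights_step c t : (t < size ms)%N -> (c.1 <= t)%N ->
  weights mw ms c t.+1 = weight_step (weights mw ms c t) (mv t).
Proof.
move=> ht ct; rewrite /weights !ltnNge ct (leqW ct) /= (take_nth move0) //.
rewrite -cats1 drop_cat size_takel ?(ltnW ht) //; case: ltnP => h.
  by rewrite foldl_cat.
have -> : c.1 = t by lia.
by rewrite subnn drop0 drop_oversize ?size_takel ?(ltnW ht).
Qed.

Lemma size_vertex_weights v s : size s = in_valency v ->
  size (vertex_weights v s) = out_valency v.
Proof. by case: v; case: s => [|a [|b [|c [|? ?]]]]. Qed.

Lemma size_window_gen m (s : seq nat) : (m.2 + in_valency m.1 <= size s)%N ->
  size (window m s) = in_valency m.1.
Proof. by move=> h; rewrite size_takel // size_drop; lia. Qed.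

Lemma size_weights c t : (t <= size ms)%N -> size (weights mw ms c t) = size (slice w ms t).
Proof.
elim: t => [|t IH] ht.
  case: (ltnP 0 c.1) => h; first by rewrite weights_lt // size_nseq.
  by rewrite weights_eq ?size_mkseq //; lia.
case: (ltngtP t.+1 c.1) => h.
- by rewrite weights_lt // size_nseq.
- rewrite weights_step // /weight_step replace_windowE size_slice_step //.
  have hb := vok_bound (slice_vok ht).
  rewrite size_rep IH ?(ltnW ht) //; congr (_ + _)%N.
  by rewrite size_vertex_weights // size_window_gen // IH // ltnW.
- by rewrite weights_eq ?size_mkseq.
Qed.

Definition wt t e c := nth 0%N (weights mw ms c t) e.

Definition nwt v (g : nat -> nat) : nat -> nat :=
  match v with
  | Trivalent => fun _ => minn (g 0) (g 1)
  | Fourvalent => fun e => if e == 0 then g 1 else g 0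
  | Sixvalent => fun e => if e == 0 then g 1 + g 2 - minn (g 0) (g 2)
      else if e == 1 then minn (g 0) (g 2) else g 0 + g 1 - minn (g 0) (g 2)
  end%N.

Lemma nwt0 v e : nwt v (fun=> 0%N) e = 0%N.
Proof. by case: v => /=; case: e => [|[|]]. Qed.

Lemma nth_vertex_weights v s e : size s = in_valency v -> (e < out_valency v)%N ->
  nth 0%N (vertex_weights v s) e = nwt v (nth 0%N s) e.
Proof.
by case: v; case: s => [|a [|b [|c [|? ?]]]] //= _; case: e => [|[|[|]]].
Qed.

Lemma eq_nwt v g g' e : (forall i, (i < in_valency v)%N -> g i = g' i) -> nwt v g e = nwt v g' e.
Proof.
by case: v => /= h; rewrite ?(h 0%N) ?(h 1%N) ?(h 2%N).
Qed.

(** The indicator accounts for the cycle born at this vertex: it vanishes above, and its value on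
    the outgoing edge is prescribed instead of being computed from the incoming edges. *)
Lemma wt_step t e c : (t < size ms)%N -> c \in cyc -> (e < size (slice w ms t.+1))%N ->
  wt t.+1 e c = (spe (mv t).2 (in_valency (mv t).1) (out_valency (mv t).1)
     (nwt (mv t).1 (fun i => wt t ((mv t).2 + i) c)) (fun i => wt t i c) e
   + ((c == (t.+1, (mv t).2)) && (e == (mv t).2)))%N.
Proof.
move=> ht hc he; have hb := vok_bound (slice_vok ht).
case: (ltngtP t.+1 c.1) => h; rewrite /wt.
- rewrite weights_lt // nth_nseq he.
  have -> : (c == (t.+1, (mv t).2)) = false by apply/eqP => hc'; rewrite hc' ltnn in h.
  rewrite addn0 /spe; case: ifP => _; [|case: ifP => _].
  + by rewrite weights_lt ?(ltnW h) // nth_nseq if_same.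
  + rewrite (@eq_nwt _ _ (fun=> 0%N)) ?nwt0 // => i _.
    by rewrite weights_lt ?(ltnW h) // nth_nseq if_same.
  + by rewrite weights_lt ?(ltnW h) // nth_nseq if_same.
- have -> : (c == (t.+1, (mv t).2)) = false by apply/eqP => hc'; rewrite hc' ltnn in h.
  rewrite addn0 weights_step // /weight_step replace_windowE.
  have hs : size (weights mw ms c t) = size (slice w ms t) by rewrite size_weights // ltnW.
  have sv : size (vertex_weights (mv t).1 (window (mv t) (weights mw ms c t))) = out_valency (mv t).1.
    by rewrite size_vertex_weights // size_window_gen // hs.
  rewrite nth_rep ?hs // sv /spe; case: ltnP => // ek; case: ltnP => // eo.
  rewrite nth_vertex_weights ?size_window_gen ?hs //; last by lia.
  by apply: eq_nwt => i hi; rewrite nth_window.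
- rewrite weights_eq // nth_mkseq //.
  have ec : c = (t.+1, (mv t).2).
    move: hc; rewrite mem_cycles -h /= => /andP[_ /eqP e2].
    by rewrite [c]surjective_pairing -h e2.
  rewrite -ec eqxx /= {1}ec /=.
  have z i : nth 0%N (weights mw ms c t) i = 0%N.
    by rewrite weights_lt -?h // nth_nseq if_same.
  have -> : spe (mv t).2 (in_valency (mv t).1) (out_valency (mv t).1)
     (nwt (mv t).1 (fun i => nth 0%N (weights mw ms c t) ((mv t).2 + i)))
     (fun i => nth 0%N (weights mw ms c t) i) e = 0%N; last by [].
  rewrite /spe; case: ifP => _; [exact: z|case: ifP => _; last exact: z].
  by rewrite (@eq_nwt _ _ (fun=> 0%N)) ?nwt0.
Qed.

Lemma wt0 e c : c \in cyc -> (e < size w)%N -> wt 0 e c = (c == (0%N, e)).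
Proof.
move=> hc he; rewrite /wt; case: (posnP c.1) => h.
  rewrite weights_eq // nth_mkseq /slice ?take0 //.
  by rewrite [in RHS](surjective_pairing c) h xpair_eqE eqxx /= eq_sym.
rewrite weights_lt // nth_nseq if_same; case: eqP => // ec.
by rewrite ec in h.
Qed.

Lemma wt_new t t' e k : (t' < t)%N -> wt t' e (t, k) = 0%N.
Proof. by move=> h; rewrite /wt weights_lt //= nth_nseq if_same. Qed.

Lemma wt_oversize t e c : (t <= size ms)%N -> (size (slice w ms t) <= e)%N -> wt t e c = 0%N.
Proof. by move=> ht he; rewrite /wt nth_default // size_weights. Qed.

Section Monomials.
Variables (K : comUnitRingType).
Implicit Types (x : nat * nat -> K).

Definition mono x t e : K := \prod_(c <- cyc) x c ^+ wt t e c.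

Lemma mono_unit x t e : (forall c, x c \is a GRing.unit) -> mono x t e \is a GRing.unit.
Proof.
move=> ux; apply: (big_ind (fun a => a \is a GRing.unit)) => [|a b ha hb|c _].
- exact: unitr1.
- by rewrite unitrM ha.
- exact/unitrX.
Qed.

(** Turns the additive relations between weights at a 6-valent vertex into the product relations of
    [six_step]. *)
Lemma mono_pair x t e t' e' (f f' : nat * nat -> nat) :
  (forall c, c \in cyc -> (wt t e c + wt t' e' c = f c + f' c)%N) ->
  mono x t e * mono x t' e' = (\prod_(c <- cyc) x c ^+ f c) * \prod_(c <- cyc) x c ^+ f' c.
Proof.
move=> h; rewrite /mono -!big_split /=; apply: eq_big_seq => c hc.
by rewrite -!exprD h.
Qed.

Lemma mono_delta x t e v : v \in cyc -> (forall c, c \in cyc -> wt t e c = (c == v)) ->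
  mono x t e = x v.
Proof.
move=> hv h; rewrite /mono (bigD1_seq v) ?uniq_cycles //= h // eqxx expr1.
rewrite big_seq_cond big1 ?mulr1 // => c /andP[hc cv].
by rewrite h // (negPf cv) expr0.
Qed.

Lemma mono_zero x t e : (forall c, c \in cyc -> wt t e c = 0%N) -> mono x t e = 1.
Proof. by move=> h; rewrite /mono big_seq big1 // => c hc; rewrite h // expr0. Qed.

End Monomials.
End Weights.

(** * Decorating a weave over a local ring *)

Section Decoration.
Variables (A : comUnitRingType) (F : fieldType) (d : nat) (pi : {rmorphism A -> F}).
Hypothesis pi_local : forall a, pi a != 0 -> a \is a GRing.unit.
Variables (mw : mword) (ms : weave) (w' : seq nat).
Hypothesis hweave : is_weave (unzip1 mw) ms w'.
Local Notation w := (unzip1 mw).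
Hypothesis hletters : letters_in d w.
Local Notation cyc := (cycles mw ms).
Local Notation mv t := (nth move0 ms t).
Local Notation unit c := (c \is a GRing.unit).
Local Notation mono := (mono mw ms).
Local Notation wt := (wt mw ms).

Lemma letters_slice t : (t <= size ms)%N -> letters_in d (slice w ms t).
Proof.
elim: t => [|t IH] ht; first by rewrite /slice take0.
rewrite slice_step //; apply: letters_step; last by apply: IH; exact: ltnW.
exact: (slice_vok hweave).
Qed.

Lemma eq_chain (K : comUnitRingType) s (fl : nat -> nat -> extK K d) c c' :
  (forall e, (e < size s)%N -> c e = c' e) -> chain s fl c -> chain s fl c'.
Proof. by move=> h hc k ks; rewrite -h //; apply: hc. Qed.

Variables (top : nat -> nat -> extK A d) (c0 : nat -> A).
Hypotheses (top_framed : framed (top 0%N)) (top_chain : chain w top c0).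
Hypothesis top_mark : forall k, (k < size mw)%N -> (nth (0%N, false) mw k).2 = false -> c0 k = 1.
Variables (H : nat -> nat -> nat -> extK F d) (C : nat -> nat -> F).
Hypothesis H_chain : forall t, (t <= size ms)%N ->
  chain (slice w ms t) (H t) (C t) /\ framed (H t 0%N).
Hypothesis H_carry : forall t, (t < size ms)%N ->
  carry (mv t) (slice w ms t) (H t) (H t.+1).
Hypothesis H_top : forall g, (g <= size w)%N ->
  propto (fun i => ext_map pi (top g i)) (H 0%N g).

(** The data of a [decoration] over the local ring, with invertible variables. Cycles serve directly
    as indices, so [x] is also given at pairs that are not cycles, where it is irrelevant. *)
Definition weave_data (x : nat * nat -> A) (fl : nat -> nat -> nat -> extK A d) :=
  [/\ forall c, unit (x c), fl 0%N = top,
      forall t, (t < size ms)%N -> carry (mv t) (slice w ms t) (fl t) (fl t.+1),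
      forall t, (t <= size ms)%N -> chain (slice w ms t) (fl t) (mono x t)
    & forall t g, (t <= size ms)%N -> (g <= size (slice w ms t))%N -> framed (fl t g)].

Lemma size_map_w : size w = size mw. Proof. by rewrite size_map. Qed.

Lemma mono_low (x y : nat * nat -> A) t e T : (t < T)%N -> (forall c, c.1 != T -> x c = y c) ->
  mono x t e = mono y t e.
Proof.
move=> tT h; apply: eq_big_seq => c _; case: (eqVneq c.1 T) => [cT|cT]; last by rewrite h.
by case: c cT => a b /= ->; rewrite wt_new ?expr0.
Qed.

(** Induction on slices, keeping the residues of the flags proportional to the reference chain [H].
    This invariant provides nondegeneracy at a trivalent vertex, and [chain_unique] restores it
    below each vertex. Four- and 6-valent vertices need no new variable, as the weights obey the
    required relations. *)
Lemma weave_data_exists : exists x fl, weave_data x fl.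
Proof.
suff [x [fl [ux f0 hc hch hp]]] : exists x fl, [/\ forall c, unit (x c), fl 0%N = top,
      forall t, (t < size ms)%N -> carry (mv t) (slice w ms t) (fl t) (fl t.+1),
      forall t, (t <= size ms)%N -> chain (slice w ms t) (fl t) (mono x t)
    & forall g, (g <= size (slice w ms (size ms)))%N ->
        propto (fun i => ext_map pi (fl (size ms) g i)) (H (size ms) g)].
  exists x, fl; split=> // t g ht; apply: (chain_framed (letters_slice ht) (hch t ht)).
  elim: t ht {hch hp} => [|t IH] ht; first by rewrite f0.
  by rewrite (proj1 (hc t ht)) //; apply: IH; exact: ltnW.
suff : forall T, (T <= size ms)%N -> exists x fl, [/\ forall c, unit (x c), fl 0%N = top,
      forall t, (t < T)%N -> carry (mv t) (slice w ms t) (fl t) (fl t.+1),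
      forall t, (t <= T)%N -> chain (slice w ms t) (fl t) (mono x t)
    & forall g, (g <= size (slice w ms T))%N ->
        propto (fun i => ext_map pi (fl T g i)) (H T g)].
  by apply.
elim=> [|T IH] hT.
  (* Marked top letters carry their crossing values as variables; the unmarked ones have crossing
     value 1, the empty monomial. *)
  exists (fun c => if (c.1 == 0%N) && (c.2 < size w)%N then c0 c.2 else 1), (fun=> top); split=> //.
  - by move=> c; case: ifP => [/andP[_ h]|_]; [case: (top_chain h)|exact: unitr1].
  - move=> t; rewrite leqn0 => /eqP->; rewrite /slice take0 /=.
    apply: eq_chain top_chain => e he.
    have ew c : c \in cyc -> wt 0 e c = (c == (0%N, e)) by move=> hcy; apply: wt0.
    case em : (nth (0%N, false) mw e).2.
      rewrite (mono_delta _ (v := (0%N, e))) //=; first by rewrite he.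
      by rewrite mem_cycles /= em -size_map_w he.
    rewrite mono_zero ?top_mark // -?size_map_w // => c hcy; rewrite ew //.
    case: eqP => // ec; move: hcy; rewrite ec mem_cycles /= em !andbF //.
  - by rewrite /slice take0.
have [x [fl [ux f0 hc hch hp]]] := IH (ltnW hT).
have hv := slice_vok hweave hT; set k := (mv T).2; set v := (mv T).1.
have hm : mv T = (v, k) by rewrite /v /k; case: (mv T).
have hb := vok_bound hv; rewrite -/v -/k in hb.
have ss := size_slice_step hweave hT; rewrite -/v in ss.
have hl := letters_slice (ltnW hT).
have fT : framed (fl T 0%N).
  have : forall t, (t <= T)%N -> framed (fl t 0%N).
    elim=> [|t IHt] ht; first by rewrite f0.
    by rewrite (proj1 (hc t ht)) //; apply: IHt; exact: ltnW.
  exact.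
have [hHc hHf] := H_chain (ltnW hT); have [hHc' hHf'] := H_chain hT.
have ws := fun e c => @wt_step mw ms w' hweave T e c hT; rewrite -/v -/k in ws.
have wk i c : c \in cyc -> (i < out_valency v)%N -> wt T.+1 (k + i) c =
    (nwt v (fun i => wt T (k + i) c) i + ((c == (T.+1, k)) && (i == 0)))%N.
  move=> hcy hi; rewrite ws // ?ss; last by lia.
  rewrite /spe ltnNge leq_addr /= ltn_add2l hi addKn; congr (_ + (_ && _)%B)%N.
  by rewrite -{2}[k]addn0 eqn_add2l.
have step1 : exists x', [/\ forall c, unit (x' c), (forall c, c.1 != T.+1 -> x' c = x c) &
    out_ok (slice w ms T) (mv T) (fl T) (mono x T) (fun i => mono x' T.+1 (k + i))].
  rewrite hm /out_ok /=; case ev : v; rewrite ev in hm wk.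
  - rewrite slice_step // hm in hHc'; rewrite hm in hv.
    have car := H_carry hT; rewrite hm in car.
    have [c1 u1 h1] := tri_nondegenerate pi_local hv hl fT hHf (hch T (leqnn T)) hHc hHc' car hp.
    pose v0 := (T.+1, k).
    have v0c : v0 \in cyc by rewrite mem_cycles /= hm /= eqxx hT.
    (* The cycle born here has weight 1 on the outgoing edge, so its variable is the crossing value
       divided by the contribution P of the older cycles. *)
    pose P := \prod_(c <- cyc | c != v0) x c ^+ wt T.+1 k c.
    have uP : unit P.
      rewrite /P; apply: (big_ind (fun a => unit a)) => [|a b ha hb'|c _].
      + exact: unitr1.
      + by rewrite unitrM ha.
      + exact/unitrX.
    exists (fun c => if c == v0 then c1 / P else x c); split.
    + by move=> c; case: ifP; rewrite ?unitrM ?unitrV ?u1.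
    + by move=> c; case: (c =P v0) => [->|//]; rewrite eqxx.
    have -> : mono (fun c => if c == v0 then c1 / P else x c) T.+1 (k + 0) = c1.
      rewrite addn0 /mono (bigD1_seq v0) ?uniq_cycles //= eqxx.
      have -> : wt T.+1 k v0 = 1%N.
        by have := wk 0%N v0 v0c isT; rewrite addn0 /= !(@wt_new _ _ _ T) // !eqxx.
      rewrite expr1 (eq_bigr (fun c => x c ^+ wt T.+1 k c)) ?divrK //.
      by move=> c /negPf->.
    by [].
  - have nc c : c \in cyc -> (c == (T.+1, k)) = false.
      by move=> hcy; apply/eqP => ec; move: hcy; rewrite ec mem_cycles /= hm /= andbF.
    exists x; split=> //; split; apply: eq_big_seq => c hcy; congr (_ ^+ _).
      by rewrite wk //= nc // addn0 addn1.
    by rewrite wk //= nc // !addn0.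
  - have nc c : c \in cyc -> (c == (T.+1, k)) = false.
      by move=> hcy; apply/eqP => ec; move: hcy; rewrite ec mem_cycles /= hm /= andbF.
    exists x; split=> //; split; first exact: mono_unit.
      rewrite (@mono_pair mw ms _ x _ _ _ _ (wt T k.+1) (wt T k.+2)) // => c hcy.
      rewrite !wk // !nc //= !addn0 addn1 addn2 subnK //.
      by apply: leq_trans (geq_minr _ _) (leq_addl _ _).
    rewrite (@mono_pair mw ms _ x _ _ _ _ (wt T k) (wt T k.+1)) // => c hcy.
    rewrite !wk // !nc //= !addn0 addn1 addn2 addnC subnK //.
    by apply: leq_trans (geq_minl _ _) (leq_addr _ _).
have [x' [ux' ex' ok']] := step1.
have [fl' [hch' hcar]] := chain_down hv hl (hch T (leqnn T)) fT ok'.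
exists x', (fun t => if (t <= T)%N then fl t else fl'); split=> //.
- move=> t tT1; case: (ltngtP t T) => [tT| |->]; [exact: hc|lia|by []].
- move=> t tT1; have [et|tT] : t = T.+1 \/ (t < T.+1)%N by lia.
    rewrite et ltnn slice_step //; apply: eq_chain hch' => e he.
    have he' : (e < size (slice w ms T.+1))%N by rewrite slice_step.
    rewrite -/v -/k /spe; case: ltnP => ek.
      rewrite (mono_low e (ltnSn T) (fun c hc => esym (ex' c hc))).
      apply: eq_big_seq => c hcy; congr (_ ^+ _); rewrite ws // /spe ek.
      by rewrite [e == k]ltn_eqF // andbF addn0.
    case: ltnP => eo; first by rewrite subnKC.
    rewrite (mono_low _ (ltnSn T) (fun c hc => esym (ex' c hc))).
    apply: eq_big_seq => c hcy; congr (_ ^+ _); rewrite ws // /spe ltnNge ek ltnNge eo /=.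
    have o0 : (0 < out_valency v)%N by case: (v).
    by rewrite [e == k]gtn_eqF ?andbF ?addn0 //; lia.
  rewrite -ltnS tT; apply: eq_chain (hch t _) => // e _.
  exact: (mono_low e (tT : (t < T.+1)%N) (fun c hc => esym (ex' c hc))).
- rewrite ltnn slice_step // => g hg.
  have cm := hch T (leqnn T).
  rewrite slice_step // in hHc'.
  exact: (chain_unique hv hl (framed_map pi fT) (chain_map pi cm) (chain_map pi hch')
    (carry_map pi hcar) hHc hHc' (H_carry hT) hp hg).
Qed.

End Decoration.

(** * The recursion satisfied by the flags F_j *)

Section Stops.
Variables (d n : nat) (sigma : signature n).
Hypotheses (d_gt1 : (1 < d)%N) (adm : admissible d sigma).
Implicit Types (j : int) (k m : nat).

Lemma stop_eq j k m : (k < d)%N -> hits d sigma j k m ->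
  (forall m', hits d sigma j k m' -> (m <= m')%N) -> stop d sigma j k = m.
Proof.
move=> kd hm hmin; have [h1 h2] := stopP j adm kd.
by apply/eqP; rewrite eqn_leq h2 // hmin.
Qed.

Lemma psumS j m : psum sigma j m.+1 = sgnc (sigma j) + psum sigma (j + 1) m.
Proof.
rewrite /psum big_ord_recl addr0; congr (_ + _); apply: eq_bigr => i _.
by rewrite -addrA; congr (sgnc (sigma (_ + _))); rewrite /bump /= -PoszD.
Qed.

Lemma psum0 j : psum sigma j 0 = sgnc (sigma j).
Proof. by rewrite /psum big_ord_recl big_ord0 !addr0. Qed.

Lemma hits0_black j k : sigma j -> (0 < k < d)%N -> hits d sigma j k 0 = (k == 1)%N.
Proof.
move=> sj /andP[k0 kd]; rewrite /hits psum0 sj /= !modz_small ?ltz_nat ?lez_nat //.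
by rewrite eqz_nat eq_sym.
Qed.

Lemma hits0_white j k : ~~ sigma j -> (0 < k < d)%N -> hits d sigma j k 0 = (k == d.-1)%N.
Proof.
move=> /negPf sj /andP[k0 kd]; rewrite /hits psum0 sj /=.
rewrite -(modzDr (-1) d) (_ : -1 + d%:Z = d.-1%:Z); last by lia.
rewrite !modz_small ?lez_nat //= ?ltz_nat ?gez0_abs //; first by rewrite eqz_nat eq_sym.
  by lia.
Qed.

Lemma hitsS j k k' m : sgnc (sigma j) + k'%:Z = k%:Z ->
  hits d sigma j k m.+1 = hits d sigma (j + 1) k' m.
Proof. by move=> e; rewrite /hits psumS -e eqz_modDl. Qed.

(** Splitting off the first term of the partial sums shifts the residue to be reached by
    sigma(j). *)
Lemma stop_step j k k' : (0 < k < d)%N -> (k' < d)%N -> sgnc (sigma j) + k'%:Z = k%:Z ->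
  ~~ hits d sigma j k 0 -> stop d sigma j k = (stop d sigma (j + 1) k').+1.
Proof.
move=> /andP[k0 kd] kd' e h0; have [h1 h2] := stopP (j + 1) adm kd'.
apply: stop_eq => //; first by rewrite (hitsS _ e).
case=> [|m]; first by move=> h; rewrite h in h0.
by rewrite (hitsS _ e); apply: h2.
Qed.

Lemma stop0 j k : (0 < k < d)%N -> hits d sigma j k 0 -> stop d sigma j k = 0%N.
Proof. by move=> /andP[_ kd] h; apply: stop_eq. Qed.

End Stops.

Section GenericFlags.
Variables (d n : nat) (sigma : signature n).
Hypotheses (d_gt1 : (1 < d)%N) (adm : admissible d sigma).
Variables (K : comUnitRingType) (uc : int -> 'rV[K]_d) (t : K).
Local Notation E := (extK K d).
Implicit Types (j : int) (k m : nat).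

Definition gprod1 j : E := if sigma j then iv (uc j) else ctr (uc j) (vol d t).

Fixpoint gprod j m : E :=
  if m is m'.+1 then
    if sigma j then wdg (iv (uc j)) (gprod (j + 1) m') else ctr (uc j) (gprod (j + 1) m')
  else gprod1 j.

(** The flag F_j over any ring, with contraction in place of the mixed wedge by a covector;
    [Fflag_gF] compares the two. Keeping the volume [t] a variable lets it be a constant of the
    local ring. *)
Definition gF j k : E :=
  if k == 0%N then one K d else if k == d then vol d t else gprod j (stop d sigma j k).

Lemma gF0 j : gF j 0 = one K d. Proof. by []. Qed.

Lemma gFd j : gF j d = vol d t.
Proof. by rewrite /gF eqxx ifN // -lt0n ltnW. Qed.

Lemma gFE j k : (0 < k < d)%N -> gF j k = gprod j (stop d sigma j k).
Proof. by move=> /andP[k0 kd]; rewrite /gF gtn_eqF // ltn_eqF. Qed.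

Lemma gF_black j k : sigma j -> (k.+1 < d)%N -> gF j k.+1 = wdg (iv (uc j)) (gF (j + 1) k).
Proof.
move=> sj kd; rewrite gFE //; case: k kd => [|k] kd.
  by rewrite stop0 ?hits0_black //= /gprod1 sj wdg1r.
rewrite (@stop_step d n sigma adm j k.+2 k.+1) ?hits0_black //; try lia.
  by rewrite /= sj gFE //; lia.
by rewrite sj /=; lia.
Qed.

Lemma gF_white j k : ~~ sigma j -> (0 < k < d)%N -> gF j k = ctr (uc j) (gF (j + 1) k.+1).
Proof.
move=> sj kd; rewrite gFE //; have [ek|ek] := eqVneq k d.-1.
  rewrite (stop0 adm kd) ?hits0_white ?ek //.
  rewrite -[gprod j 0]/(gprod1 j) /gprod1 (negPf sj).
    by rewrite prednK ?gFd //; lia.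
  by lia.
rewrite (@stop_step d n sigma adm j k k.+1) ?hits0_white //; try lia.
  by rewrite /= (negPf sj) gFE //; lia.
by rewrite (negPf sj) /=; lia.
Qed.

End GenericFlags.

Lemma rel_gF d n (sigma : signature n) (K K' : comUnitRingType) (R : K -> K' -> Prop)
    uc uc' t t' : ring_rel R -> (forall j, @vec_rel _ _ d R (uc j) (uc' j)) -> R t t' ->
  forall j k, ext_rel R (gF sigma uc t j k) (gF sigma uc' t' j k).
Proof.
move=> RR hu ht j k.
have hv : ext_rel R (vol d t) (vol d t') by apply: ext_relZ => //; apply: ext_rel_base.
rewrite /gF; case: ifP => _; first exact: ext_rel_base.
case: ifP => _ //; move: (stop d sigma j k) => m; elim: m j => [|m IH] j /=.
  by rewrite /gprod1; case: ifP => _; [exact: ext_rel_iv|exact: ext_rel_ctr].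
case: ifP => _; last exact: ext_rel_ctr.
by apply: ext_rel_wdg => //; apply: ext_rel_iv.
Qed.

(** * Decomposable elements, and the flags F_j over a local ring *)

Section Decomposable.
Variables (d : nat) (K : comUnitRingType).
Local Notation E := (extK K d).

Definition std i : 'rV[K]_d := \row_(j < d) (i == j :> nat)%:R.

Lemma W_std k : (k <= d)%N -> W std k = base K [set i : 'I_d | (i < k)%N].
Proof.
elim: k => [|k IH] kd.
  rewrite /W /one; congr base; apply/setP=> i; by rewrite !inE.
have -> : W std k.+1 = rw (W std k) (std k) by [].
rewrite IH; last exact: ltnW.
set S := [set i : 'I_d | (i < k)%N]; pose k' := Ordinal kd.
have eS : [set i : 'I_d | (i < k.+1)%N] = k' |: S.
  by apply/setP=> i; rewrite !inE ltnS leq_eqVlt -val_eqE.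
have kS : k' \notin S by rewrite inE ltnn.
have sg : sh_sign K S [set k'] = 1.
  rewrite sh_signE big1 // => a aS; rewrite big_set1 /=.
  by rewrite inE in aS; rewrite ltnNge (ltnW aS) expr0.
have sk : std k 0 k' = 1 by rewrite mxE eqxx.
apply/ffunP=> T; rewrite /rw wdg_ivE ffunE eS.
have [->|nT] := eqVneq T (k' |: S).
  rewrite big_setU1 //= setU1K // sg ffunE eqxx sk !mulr1 big1 ?addr0 // => i iS.
  rewrite mxE; have -> : (k == i) = false; last by rewrite mulr0.
  by apply/eqP => ki; move: iS; rewrite inE -ki ltnn.
rewrite big1 // => i iT; rewrite ffunE mxE.
case: (T :\ i =P S) => [eT|]; last by rewrite mulr0 mul0r.
case: (k =P i) => [ki|]; last by rewrite mulr0.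
by case/eqP: nT; rewrite -eT (_ : k' = i) ?setD1K //; apply: val_inj.
Qed.

Lemma W_std_top : W std d = vol d 1.
Proof.
rewrite W_std // /vol scale1r; congr base; apply/setP=> i; by rewrite !inE ltn_ord.
Qed.

Lemma framed_std : framed (W std : nat -> E).
Proof.
exists std, (fun=> 1); split=> [|i|i id]; rewrite ?unitr1 ?scale1r //.
by rewrite W_std_top /topc /vol !ffunE eqxx /GRing.scale /= mulr1 unitr1.
Qed.

Definition decomp k (x : E) := exists a s, size s = k /\ x = a *: rws (one K d) s.

Lemma homog_rws k x s : hdeg k x -> hdeg (k + size s) (rws x s : E).
Proof.
elim: s k x => [|v s IH] k x h /=; first by rewrite addn0.
by rewrite addnS -addSn; apply: IH; apply: homog_rw.
Qed.

Lemma decomp_homog k x : decomp k x -> hdeg k x.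
Proof.
by move=> [a [s [<- ->]]]; apply: homogZ; apply: (@homog_rws 0); apply: homog_one.
Qed.

Lemma decomp_vol t : decomp d (vol d t).
Proof.
exists t, [seq std i | i <- iota 0 d]; rewrite size_map size_iota; split=> //.
by rewrite -W_mkseq W_std_top /vol scale1r.
Qed.

(** Subtracting multiples of [y] from the factors changes nothing once [y] is wedged in: this brings
    all factors but one into the kernel of a covector. *)
Lemma rws_shift x s (c : 'rV[K]_d -> K) y :
  rw (rws x [seq z - c z *: y | z <- s]) y = rw (rws x s) y :> E.
Proof.
elim: s x => [|z s IH] x //=; rewrite IH rwBr rwZr -scaleN1r scalerA rwsD rwsZ rwDl rwZl.
by rewrite [rws (rw x y) s]rws_rw rwZl rw_sq !scaler0 addr0.
Qed.

Lemma ctr_rws0 f x s : (forall z, z \in s -> pair_cv f z = 0) -> ctr f x = 0 ->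
  ctr f (rws x s) = 0 :> E.
Proof.
elim: s x => //= z s IH x h hx; apply: IH => [y ys|]; first by rewrite h // inE ys orbT.
by rewrite ctr_rw hx rw0l subr0 h ?inE ?eqxx // scale0r.
Qed.

Lemma pair_cvD (f : 'rV[K]_d) u v : pair_cv f (u + v) = pair_cv f u + pair_cv f v.
Proof. by rewrite /pair_cv -big_split; apply: eq_bigr => i _; rewrite mxE mulrDr. Qed.

Lemma pair_cvZ (f : 'rV[K]_d) c u : pair_cv f (c *: u) = c * pair_cv f u.
Proof. by rewrite /pair_cv mulr_sumr; apply: eq_bigr => i _; rewrite mxE mulrCA. Qed.

End Decomposable.

Section LocalRing.
Variables (A : comUnitRingType) (F : fieldType) (d : nat) (pi : {rmorphism A -> F}).
Hypothesis pi_local : forall a, pi a != 0 -> a \is a GRing.unit.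

(* A vector of the decomposable element outside the kernel of [f] splits off. *)
Lemma decomp_ctr f k x : decomp k.+1 x -> ext_map pi (ctr f x) != 0 ->
  decomp k (ctr f x) /\ exists w : 'rV[A]_d, x = rw (ctr f x) w.
Proof.
move=> [a [s [ss ->]]] hx.
(* If all pairings with [f] had residue zero, the residue of the contraction would vanish; so one of
   them is a unit, the ring being local. *)
have [y ys uy] : exists2 y, y \in s & pair_cv f y \is a GRing.unit.
  have : has (fun y => pi (pair_cv f y) != 0) s.
    apply: contraNT hx => /hasPn h; rewrite ctrZ ext_mapZ ext_map_ctr.
    have -> : ext_map pi (rws (one A d) s) = rws (one F d) [seq vec_map pi z | z <- s].
      have : ext_map pi (one A d) = one F d by apply: ext_map_one.
      elim: s (one A d) (one F d) {ss h} => [|z s IH] x0 x1 //= e.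
      by apply: IH; rewrite ext_map_rw e.
    rewrite ctr_rws0 ?scaler0 //; last exact: ctr_one.
    move=> z /mapP[z' zs ->]; have := h _ zs; rewrite negbK => /eqP <-.
    by rewrite /pair_cv rmorph_sum; apply: eq_bigr => i _; rewrite !mxE rmorphM.
  by case/hasP=> y ys /pi_local uy; exists y.
move: ss hx; case/splitPr: ys => s1 s2 ss hx.
pose c z := pair_cv f z / pair_cv f y.
pose s' := [seq z - c z *: y | z <- s1 ++ s2].
have es : rws (one A d) (s1 ++ y :: s2) = (-1) ^+ size s2 *: rw (rws (one A d) s') y.
  rewrite rws_shift /rws !foldl_cat /= -!/(rws _ _) -/(rws (rw _ y) s2).
  exact: rws_rw.
have c0 : ctr f (rws (one A d) s') = 0.
  apply: ctr_rws0; last exact: ctr_one.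
  move=> z /mapP[z' _ ->]; rewrite -scaleNr pair_cvD pair_cvZ /c mulNr divrK //.
  by rewrite subrr.
set b := (-1) ^+ size s2 in es.
have ex : ctr f (a *: rws (one A d) (s1 ++ y :: s2)) = (a * b * pair_cv f y) *: rws (one A d) s'.
  by rewrite ctrZ es ctrZ ctr_rw c0 rw0l subr0 !scalerA.
split.
  rewrite ex; exists (a * b * pair_cv f y), s'; split=> //.
  by move: ss; rewrite size_map !size_cat /= addnS => -[].
exists ((pair_cv f y)^-1 *: y); rewrite ex rwZl rwZr es !scalerA.
by rewrite -[_ * _ / _]mulrA divrr // mulr1.
Qed.

Variables (n : nat) (sigma : signature n).
Hypotheses (d_gt1 : (1 < d)%N) (adm : admissible d sigma).
Variables (uc : int -> 'rV[A]_d) (t : A).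
Hypothesis unit_t : t \is a GRing.unit.
Local Notation gF := (gF sigma uc t).
Hypothesis gF_neq0 : forall j k, (k <= d)%N -> ext_map pi (gF j k) != 0.

Let gB j k (sj : sigma j) : (k.+1 < d)%N ->
  gF j k.+1 = wdg (iv (uc j)) (gF (j + 1) k).
Proof. exact: gF_black. Qed.

Let gW j k (sj : ~~ sigma j) : (0 < k < d)%N -> gF j k = ctr (uc j) (gF (j + 1) k.+1).
Proof. exact: gF_white. Qed.

(** Wedging with a vector preserves decomposability; contraction does so because the result has
    nonzero residue, by [decomp_ctr]. *)
Lemma gF_decomp j k : (0 < k <= d)%N -> decomp k (gF j k).
Proof.
move=> /andP[k0]; rewrite leq_eqVlt => /orP[/eqP->|kd].
  by rewrite gFd //; apply: decomp_vol.
move em: (stop d sigma j k) => m; elim: m j k k0 kd em => [|m IH] j k k0 kd em.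
  have [sj|sj] := boolP (sigma j).
    have /(stopP j adm)[] := kd; rewrite em hits0_black ?k0 // => /eqP-> _.
    rewrite gF_black // gF0 wdg1r; exists 1, [:: uc j]; split=> //.
    by rewrite /= /rw wdg1l scale1r.
  have hk : (0 < k < d)%N by rewrite k0.
  have /(stopP j adm)[] := kd; rewrite em hits0_white // => /eqP ek _.
  have e := gF_white d_gt1 adm uc t sj hk.
  have ek' : k.+1 = d by lia.
  rewrite ek' gFd // in e; rewrite e; apply: (proj1 (decomp_ctr _ _)).
    by rewrite ek'; apply: decomp_vol.
  by rewrite -e gF_neq0 // ltnW.
have hk : (0 < k < d)%N by rewrite k0.
have [sj|sj] := boolP (sigma j).
  have k1 : (k != 1)%N.
    by apply/eqP => ek; move: em; rewrite stop0 // hits0_black // ek.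
  have e : stop d sigma (j + 1) k.-1 = m.
    by apply/eq_add_S; rewrite -em (@stop_step d n sigma adm j k k.-1) ?hits0_black ?sj //=; lia.
  have [k0' kd'] : (0 < k.-1)%N /\ (k.-1 < d)%N by lia.
  have [a [s [ss es]]] := IH (j + 1) k.-1 k0' kd' e.
  rewrite -(prednK k0) gF_black ?prednK // es wdgZr wdg_rws wdg1r.
  exists a, (uc j :: s); rewrite /= ss prednK //; split=> //.
  by rewrite /rw wdg1l.
have k1 : (k != d.-1)%N.
  by apply/eqP => ek; move: em; rewrite stop0 // hits0_white // ek.
have e : stop d sigma (j + 1) k.+1 = m.
  apply/eq_add_S; rewrite -em (@stop_step d n sigma adm j k k.+1) ?hits0_white ?(negPf sj) //=; lia.
have kd' : (k.+1 < d)%N by lia.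
have [a [s [ss es]]] := IH (j + 1) k.+1 isT kd' e.
rewrite gF_white //; apply: (proj1 (decomp_ctr _ _)); first by exists a, s.
by rewrite -gF_white // gF_neq0 // ltnW.
Qed.

Lemma gF_homog j k : (k <= d)%N -> hdeg k (gF j k).
Proof.
case: k => [_|k kd]; first exact: homog_one.
by apply: decomp_homog; apply: gF_decomp.
Qed.

(** Induction on the number of factors of level k: at a black label the vector for F_{j+1} works for
    F_j, at a white one it is corrected. Levels 0 and d, given by convention, are treated apart. *)
Lemma gF_succ j k : (k < d)%N -> exists v, gF j k.+1 = rw (gF j k) v.
Proof.
have P0 j' : exists v, gF j' 1 = rw (gF j' 0) v.
  have [v ev] := homog1 (@gF_homog j' 1 (ltnW d_gt1)); exists v.
  by rewrite ev gF0 /rw wdg1l.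
(* Level d is prescribed, not computed. Some coordinate of level d-1 is invertible, and a multiple
   of the complementary basis vector completes it to the volume form. *)
have Pd j' : exists v, gF j' d = rw (gF j' d.-1) v.
  have d1 : (d.-1 <= d)%N by lia.
  have [S hS] : exists S, pi (gF j' d.-1 S) != 0.
    apply/existsP; apply: contraNT (gF_neq0 j' d1) => /existsPn h; apply/eqP/ffunP=> S.
    by rewrite !ffunE; apply/eqP; have := h S; rewrite negbK.
  have cS : #|S| = d.-1.
    by apply: (@gF_homog j' _ d1); apply: contraNneq hS => ->; rewrite rmorph0.
  have [i ei] : exists i, S = [set: 'I_d] :\ i.
    have : #|~: S| = 1%N by rewrite cardsCs setCK card_ord cS; lia.
    by move/eqP/cards1P => [i ei]; exists i; rewrite -(setCK S) ei setTD.
  set x := gF j' d.-1 in hS *.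
  have ux := pi_local hS; pose b := sh_sign A S [set i] * x S.
  have ub : b \is a GRing.unit.
    rewrite unitrM ux andbT; apply/unitrP; exists (sh_sign A S [set i]).
    by rewrite sh_sign_sq.
  exists ((t / b) *: delta_mx 0 i); rewrite gFd //.
  have hx : hdeg d (rw x ((t / b) *: delta_mx 0 i)).
    rewrite -{2}(_ : d.-1.+1 = d)%N; last by lia.
    by apply: homog_rw; apply: gF_homog.
  rewrite (homog_top hx); congr vol; rewrite /topc /rw wdg_ivE (bigD1 i) ?inE //=.
  rewrite -ei -/b !mxE !eqxx mulr1 big1 => [|j0 /andP[_ j0i]].
    by rewrite addr0 mulrC divrK.
  by rewrite !mxE (negPf j0i) andbF !mulr0.
move=> kd; move em: (stop d sigma j k) => m; elim: m j k kd em => [|m IH] j k kd em.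
  have [->|k0] := posnP k; first exact: P0.
  have [ek|ek] := eqVneq k d.-1; first by rewrite ek prednK ?Pd //; lia.
  have hk : (0 < k < d)%N by rewrite k0.
  have [sj|sj] := boolP (sigma j); have /(stopP j adm)[] := kd; rewrite em.
    rewrite hits0_black // => /eqP ek1 _; have [v ev] := P0 (j + 1).
    rewrite -(prednK k0) !(gB sj) ?prednK //; try lia.
    by exists v; rewrite ek1 ev wdg_rw.
  by rewrite hits0_white // (negPf ek).
have [->|k0] := posnP k; first exact: P0.
have [ek|ek] := eqVneq k d.-1; first by rewrite ek prednK ?Pd //; lia.
have hk : (0 < k < d)%N by rewrite k0.
have [sj|sj] := boolP (sigma j).
  have k1 : (k != 1)%N.
    by apply/eqP => ek1; move: em; rewrite stop0 // hits0_black // ek1.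
  have e : stop d sigma (j + 1) k.-1 = m.
    by apply/eq_add_S; rewrite -em (@stop_step d n sigma adm j k k.-1) ?hits0_black ?sj //=; lia.
  have kd1 : (k.-1 < d)%N by lia.
  have [v ev] := IH (j + 1) k.-1 kd1 e.
  rewrite prednK // in ev; exists v.
  rewrite (gB sj) ?ev ?wdg_rw; last by lia.
  by rewrite -[in RHS](prednK k0) (gB sj) ?prednK.
have e : stop d sigma (j + 1) k.+1 = m.
  apply/eq_add_S; rewrite -em (@stop_step d n sigma adm j k k.+1) ?hits0_white ?(negPf sj) //=; lia.
have kd1 : (k.+1 < d)%N by lia.
have [v ev] := IH (j + 1) k.+1 kd1 e.
rewrite !(gW sj) //; try lia.
have [_ [w ew]] : decomp k (ctr (uc j) (gF (j + 1) k.+1)) /\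
    exists w : 'rV[A]_d, gF (j + 1) k.+1 = rw (ctr (uc j) (gF (j + 1) k.+1)) w.
  apply: decomp_ctr; first by apply: gF_decomp; lia.
  by rewrite -(gW sj) // gF_neq0 // ltnW.
(* For x = F_{j+1}^{k+1} and contraction x', one has ctr(x /\ v) = f(v) x - x' /\ v and x = x' /\
   w. *)
exists (pair_cv (uc j) v *: w - v).
by rewrite ev ctr_rw rwBr rwZr -ew.
Qed.

Lemma gF_framed j : framed (gF j).
Proof.
have h k : exists v, (k < d)%N -> gF j k.+1 = rw (gF j k) v.
  by case: (ltnP k d) => [/(gF_succ j)[v ev]|_]; [exists v|exists 0].
have [g hg] := boolp.choice h.
have eW k : (k <= d)%N -> gF j k = W g k.
  elim: k => [|k IH] kd //; rewrite hg // IH //; exact: ltnW.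
exists g, (fun=> 1); split=> [|i|i id]; rewrite ?unitr1 ?scale1r ?eW //.
by rewrite -eW // gFd // /topc /vol !ffunE eqxx /GRing.scale /= mulr1.
Qed.

End LocalRing.

(** * The top word and its decoration *)

Section Blocks.
Variables (T : Type) (x0 : T) (f : nat -> seq T) (b : nat).
Hypothesis size_f : forall j, size (f j) = b.

Lemma size_blocks p m : size (flatten [seq f j | j <- iota p m]) = (m * b)%N.
Proof. by elim: m p => //= m IH p; rewrite size_cat size_f IH mulSn. Qed.

Lemma nth_blocks p m a r : (r < b)%N -> (a < m)%N ->
  nth x0 (flatten [seq f j | j <- iota p m]) (a * b + r) = nth x0 (f (p + a)%N) r.
Proof.
move=> rb; elim: m p a => // m IH p [|a] am /=; rewrite nth_cat size_f.
  by rewrite mul0n add0n rb addn0.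
by rewrite mulSn -addnA ltnNge leq_addr /= addKn IH // addSnnS.
Qed.

End Blocks.

Section Words.
Variables (d n : nat) (sigma : signature n).
Hypothesis d_gt1 : (1 < d)%N.

Definition column (j : int) : mword :=
  zip (if sigma j then iota 1 d.-1 else rev (iota 1 d.-1)) (rcons (nseq d.-2 false) true).

Definition letter (j : int) r : nat := if sigma j then r.+1 else (d.-1 - r)%N.

Lemma size_column j : size (column j) = d.-1.
Proof.
rewrite size_zip size_rcons size_nseq.
by case: ifP; rewrite ?size_rev size_iota => _; lia.
Qed.

Lemma nth_column j r : (r < d.-1)%N ->
  nth (0%N, false) (column j) r = (letter j r, r == d.-2).
Proof.
move=> rd; rewrite /column nth_zip; last first.
  by rewrite size_rcons size_nseq; case: ifP; rewrite ?size_rev size_iota => _; lia.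
rewrite nth_rcons size_nseq nth_nseq if_same /letter; congr (_, _).
  case: ifP => _; first by rewrite nth_iota.
  rewrite nth_rev ?size_iota // nth_iota; lia.
by case: ltngtP => // h; lia.
Qed.

Lemma letter_bound j r : (r < d.-1)%N -> (0 < letter j r < d)%N.
Proof. by rewrite /letter; case: ifP => _; lia. Qed.

Definition bword p m : mword := flatten [seq column j%:Z | j <- iota p m].

Lemma size_bword p m : size (bword p m) = (m * d.-1)%N.
Proof. by apply: (size_blocks (f := fun j => column j%:Z)) => j; apply: size_column. Qed.

Lemma nth_bword p m a r : (r < d.-1)%N -> (a < m)%N ->
  nth (0%N, false) (bword p m) (a * d.-1 + r) = (letter (p + a)%N%:Z r, r == d.-2).
Proof.
move=> rd am; rewrite (nth_blocks _ (f := fun j => column j%:Z)) ?nth_column // => j.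
exact: size_column.
Qed.

Lemma bword_decomp m g : (g < m * d.-1)%N -> exists a r,
  [/\ g = (a * d.-1 + r)%N, (a < m)%N, (r < d.-1)%N, (g %/ d.-1)%N = a & (g %% d.-1)%N = r].
Proof.
move=> h; have d0 : (0 < d.-1)%N by lia.
exists (g %/ d.-1)%N, (g %% d.-1)%N; split=> //; first exact: divn_eq.
  by rewrite ltn_divLR.
by rewrite ltn_mod.
Qed.

Lemma letters_bword p m : letters_in d (unzip1 (bword p m)).
Proof.
apply/(all_nthP 0%N) => g; rewrite size_map size_bword => gm.
rewrite (nth_map (0%N, false)) ?size_bword //.
have [a [r [-> am rd _ _]]] := bword_decomp gm.
by rewrite nth_bword // letter_bound.
Qed.

Lemma nth_unzip_bword p m a r : (r < d.-1)%N -> (a < m)%N ->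
  nth 0%N (unzip1 (bword p m)) (a * d.-1 + r) = letter (p + a)%N%:Z r.
Proof.
move=> rd am; rewrite (nth_map (0%N, false)) ?nth_bword // size_bword.
have : (a.+1 * d.-1 <= m * d.-1)%N by rewrite leq_mul2r am orbT.
by rewrite mulSn; lia.
Qed.

End Words.

Lemma dcross_ext (K : comUnitRingType) d k c (G H G' H' : nat -> extK K d) : (0 < k < d)%N ->
  (forall i, (i <= d)%N -> G i = G' i) -> (forall i, (i <= d)%N -> H i = H' i) ->
  dcross k c G H -> dcross k c G' H'.
Proof.
move=> kd eG eH [h1 [v [h2 h3]]]; split=> [i id ik|].
  by rewrite -eG // -eH // h1.
by exists v; rewrite -!eG -?eH //; lia.
Qed.

Section TopChain.
Variables (A : comUnitRingType) (F : fieldType) (d : nat) (pi : {rmorphism A -> F}).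
Hypothesis pi_local : forall a, pi a != 0 -> a \is a GRing.unit.
Variables (n : nat) (sigma : signature n).
Hypotheses (d_gt2 : (2 < d)%N) (adm : admissible d sigma).
Variables (uc : int -> 'rV[A]_d) (t : A).
Hypothesis unit_t : t \is a GRing.unit.
Local Notation gF := (gF sigma uc t).

(** The crossing value at the marked letter of rho_j: u_j /\ F_{j+1}^{d-1} measured against the
    volume, or the value of the covector u_j on F_{j+1}^1. *)
Definition gmark j : A := if sigma j then topc (wdg (iv (uc j)) (gF (j + 1) d.-1)) / t
  else ctr (uc j) (gF (j + 1) 1%N) set0.

Hypothesis gF_neq0 : forall j k, (k <= d)%N -> ext_map pi (gF j k) != 0.
Hypothesis gmark_neq0 : forall j, pi (gmark j) != 0.

Let d_gt1 : (1 < d)%N := ltnW d_gt2.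

Definition gFm j k : nat -> extK A d := fun i =>
  if (if sigma j then k <= i else i <= d - k)%N then gF j i else gF (j + 1) i.

Lemma gFm_first j i : (i <= d)%N -> gFm j 1 i = gF j i.
Proof.
move=> id; rewrite /gFm; case: (sigma j); case: leqP => // h.
  by have -> : i = 0%N by lia.
by rewrite (_ : i = d) ?gFd //; lia.
Qed.

Lemma gFm_last j i : (i <= d)%N -> gFm j d i = gF (j + 1) i.
Proof.
move=> id; rewrite /gFm; case: (sigma j); case: leqP => // h.
  by rewrite (_ : i = d) ?gFd //; lia.
by have -> : i = 0%N by lia.
Qed.

(** In a black column the vector extending F_{j+1}^r to the next level also extends F_j^{r+1} = u_j
    /\ F_{j+1}^r; in a white one the vector is the one that recovers a level of F_{j+1} from its
    contraction. The recursion gives the value 1 until the last letter, where it meets the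
    normalised level d, or 0, and leaves [gmark]. *)
Lemma gFm_cross j r : (r < d.-1)%N ->
  dcross (letter d sigma j r) (if r == d.-2 then gmark j else 1) (gFm j r.+1) (gFm j r.+2).
Proof.
move=> rd; have hsucc := gF_succ pi_local d_gt1 adm unit_t gF_neq0.
have hhom := gF_homog pi_local d_gt1 adm unit_t gF_neq0.
have hdec := gF_decomp pi_local d_gt1 adm unit_t gF_neq0.
rewrite /letter /gFm /gmark; have [sj|sj] := boolP (sigma j).
  have gB := fun k => @gF_black d n sigma d_gt1 adm A uc t j k sj.
  split=> [i id ir|]; first by congr (if _ then _ else _); lia.
  have rd2 : (r < d)%N by lia.
  have [v ev] := hsucc (j + 1) r rd2.
  exists v; rewrite /= !ltnn ltnSn leqnSn; split=> //.
  have [er|er] := eqVneq r d.-2; last first.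
    by rewrite scale1r !gB -?wdg_rw ?ev //; lia.
  rewrite gB -?wdg_rw -?ev; last by lia.
  have -> : r.+2 = d by lia.
  have -> : r.+1 = d.-1 by lia.
  rewrite gFd // /vol scalerA divrK //.
  have hd : hdeg d (wdg (iv (uc j)) (gF (j + 1) d.-1)).
    rewrite -{2}(_ : 1 + d.-1 = d)%N; last by lia.
    by apply: homog_wdg; [exact: homog_iv|apply: hhom; lia].
  by rewrite {1}(homog_top hd).
have gW := fun k => @gF_white d n sigma d_gt1 adm A uc t j k sj.
set m := (d.-1 - r)%N; have [m0 md] : (0 < m)%N /\ (m < d)%N by lia.
have -> : (d - r.+1 = m)%N by lia.
have -> : (d - r.+2 = m.-1)%N by lia.
split=> [i id im|]; first by congr (if _ then _ else _); lia.
have q : (m <= m.-1)%N = false by lia.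
have -> : (r == d.-2) = (m == 1)%N by lia.
rewrite q leq_pred leqnn ltnn.
have [v ev] := hsucc (j + 1) m md.
case: (eqVneq m 1%N) => [em|em]; last first.
  have hm : (0 < m.-1 < d)%N by lia.
  have e1 := gW _ hm; rewrite prednK // in e1.
  have [_ [w ew]] : decomp m.-1 (ctr (uc j) (gF (j + 1) m)) /\
      exists w : 'rV[A]_d, gF (j + 1) m = rw (ctr (uc j) (gF (j + 1) m)) w.
    apply: (decomp_ctr pi_local); first by rewrite prednK //; apply: hdec; lia.
    by rewrite -e1 gF_neq0 //; lia.
  exists w; rewrite e1 -ew; split=> //.
  rewrite (gW m) ?m0 // ev ctr_rw -scaleN1r rwDl rwZl rwZl scale1r.
  rewrite [X in rw X w]ew rw_sq scaler0 add0r rwC -ew.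
  by rewrite scalerN scaleN1r opprK.
rewrite em /= in ev md *.
have [y ey] := homog1 (hhom (j + 1) 1%N (ltnW d_gt1)).
have ey' : gF (j + 1) 1 = rw (one A d) y by rewrite /rw wdg1l.
exists y; split=> //.
have -> : ctr (uc j) (gF (j + 1) 1) set0 = pair_cv (uc j) y.
  by rewrite ey' ctr_rw ctr_one rw0l subr0 !ffunE eqxx /GRing.scale /= mulr1.
rewrite (gW 1%N) // ev ey' ctr_rw ctr_rw ctr_one rw0l subr0 -scaleN1r rwDl rwZl rwZl rwZl rw_sq.
by rewrite scaler0 add0r rwZl rwC scalerN scaleN1r opprK.
Qed.

Definition gtop p m : nat -> nat -> extK A d := fun g =>
  if (g < m * d.-1)%N then gFm (p + g %/ d.-1)%N%:Z (g %% d.-1).+1 else gF (p + m)%N%:Z.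

Definition gcoef p : nat -> A := fun g =>
  if (g %% d.-1 == d.-2)%N then gmark (p + g %/ d.-1)%N%:Z else 1.

Lemma gmark_unit j : gmark j \is a GRing.unit.
Proof. exact/pi_local. Qed.

Lemma gtop_chain p m : chain (unzip1 (bword d sigma p m)) (gtop p m) (gcoef p).
Proof.
move=> g; rewrite size_map (size_bword _ d_gt1) => gm.
have [a [r [eg am rd ea er]]] := bword_decomp d_gt1 gm.
rewrite /gcoef er ea; split; first by case: ifP => _; rewrite ?unitr1 ?gmark_unit.
rewrite [in nth _ _ _]eg nth_unzip_bword //.
apply: (dcross_ext _ _ _ (gFm_cross _ rd)); first exact: letter_bound.
  by move=> i id; rewrite /gtop gm ea er.
move=> i id; rewrite /gtop; have [r1|r1] := ltnP r.+1 d.-1.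
  have e1 : g.+1 = (a * d.-1 + r.+1)%N by rewrite eg addnS.
  have -> : (g.+1 < m * d.-1)%N.
    have : (a.+1 * d.-1 <= m * d.-1)%N by rewrite leq_mul2r am orbT.
    by rewrite mulSn; lia.
  by rewrite e1 divnMDl ?modnMDl; [rewrite divn_small ?modn_small ?addn0|lia].
have er' : r.+1 = d.-1 by lia.
have e1 : g.+1 = (a.+1 * d.-1)%N by rewrite eg mulSn; lia.
have -> : r.+2 = d by lia.
rewrite gFm_last // e1 modnMl mulnK; last by lia.
rewrite ltn_mul2r; have -> : (0 < d.-1)%N by lia.
have ej : (p + a)%N%:Z + 1 = (p + a.+1)%N%:Z by rewrite addnS -addn1 PoszD.
rewrite ej /=; case: ltnP => am'; first by rewrite gFm_first.
by have -> : a.+1 = m by lia.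
Qed.

Lemma gtop_framed p m : framed (gtop p m 0).
Proof.
have h := gF_framed pi_local d_gt1 adm unit_t gF_neq0.
rewrite /gtop; case: ifP => _; last exact: h.
have [g [l [uT ul e]]] := h (p + 0 %/ d.-1)%N%:Z.
by exists g, l; split=> // i id; rewrite mod0n gFm_first // e.
Qed.

End TopChain.

(** * Points read off from closed chains of flags *)

Section ColumnPaths.
Variables (K : comUnitRingType) (d n : nat) (sigma : signature n).
Local Notation E := (extK K d).
Local Notation unit c := (c \is a GRing.unit).
Hypothesis d_gt1 : (1 < d)%N.

Definition col_path j (Z : nat -> nat -> E) (c : nat -> K) :=
  forall r, (r < d.-1)%N -> unit (c r) /\ dcross (letter d sigma j r) (c r) (Z r) (Z r.+1).

Lemma col_levels j Z c : col_path j Z c -> forall r i, (r < d)%N -> (i <= d)%N ->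
  Z r i = if (if sigma j then r < i else i <= d - r.+1)%N then Z 0%N i else Z d.-1 i.
Proof.
move=> h r i rd id.
have step q : (q < d.-1)%N -> i != letter d sigma j q -> Z q.+1 i = Z q i.
  by move=> qd iq; have [_ [e _]] := h q qd; rewrite e.
have up q : (forall q', (q' < q)%N -> i != letter d sigma j q') -> (q <= d.-1)%N -> Z q i = Z 0%N i.
  elim: q => // q IH hq qd; rewrite step ?hq // IH //; last exact: ltnW.
  by move=> q' q'q; apply: hq; apply: leqW.
have dn q m : (q + m = d.-1)%N -> (forall q', (q <= q' < d.-1)%N -> i != letter d sigma j q') ->
    Z q i = Z d.-1 i.
  elim: m q => [|m IH] q e hq; first by rewrite -e addn0.
  rewrite -step ?hq ?leqnn //=; try lia.
  by apply: IH; [rewrite addSnnS|move=> q' hq'; apply: hq; lia].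
have [sj|sj] := boolP (sigma j); case: ltnP => hi.
- by apply: up => [q' hq'|]; rewrite /letter ?sj; lia.
- by apply: (dn r (d.-1 - r)%N) => [|q' hq']; rewrite /letter ?sj; lia.
- apply: (dn r (d.-1 - r)%N) => [|q' hq']; rewrite /letter ?(negPf sj); lia.
- by apply: up => [q' hq'|]; rewrite /letter ?(negPf sj); lia.
Qed.

End ColumnPaths.

Section ClosedChains.
Variables (F : fieldType) (d n : nat) (sigma : signature n).
Local Notation E := (extK F d).
Local Notation unit c := (c \is a GRing.unit).
Hypotheses (d_gt2 : (2 < d)%N) (adm : admissible d sigma).
Let d_gt1 : (1 < d)%N := ltnW d_gt2.

(** The normalised coordinate along the last frame vector, whose kernel is the hyperplane of G. *)
Lemma covector_exists (G : nat -> E) t : t != 0 -> framed G ->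
  exists f k, k != 0 /\ ctr f (vol d t) = k *: G d.-1.
Proof.
move=> t0 [g [l [uT ul e]]]; set tau := topc (W g d) in uT.
have dd : (d.-1 < d)%N by lia.
pose f : 'rV[F]_d := \row_j (dual g d.-1 (delta_mx 0 j) / tau).
have fE y : pair_cv f y = dual g d.-1 y / tau.
  rewrite [y in RHS]row_sum_delta dual_sum mulr_suml; apply: eq_bigr => j _.
  by rewrite !mxE mulrC mulrA.
have f0 i : (i < d.-1)%N -> pair_cv f (g i) = 0.
  by move=> hi; rewrite fE dual_frame ?gtn_eqF ?mul0r //; lia.
have c0 i : (i <= d.-1)%N -> ctr f (W g i) = 0.
  elim: i => [|i IH] hi; first exact: ctr_one.
  have -> : W g i.+1 = rw (W g i) (g i) by [].
  by rewrite ctr_rw f0 // (IH (ltnW hi)) rw0l scale0r subr0.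
exists f, (t / tau / l d.-1); split.
  by rewrite !mulf_neq0 ?invr_eq0 // -?unitfE.
have -> : vol d t = (t / tau) *: W g d.
  rewrite (homog_top (@homog_W _ _ g d)) /vol scalerA divfK //.
  by rewrite -unitfE.
have Wd : W g d = rw (W g d.-1) (g d.-1).
  by have -> : rw (W g d.-1) (g d.-1) = W g d.-1.+1 by []; rewrite prednK // ltnW.
rewrite ctrZ Wd ctr_rw c0 // rw0l subr0 fE dual_frame // eqxx divrr // scale1r.
by rewrite e ?leq_pred // scalerA divfK // -unitfE.
Qed.

Variables (H : int -> nat -> E) (uc : int -> 'rV[F]_d) (t : F).
Hypotheses (t_neq0 : t != 0) (H_framed : forall j, framed (H j)).
Hypotheses (H0 : forall j, H j 0%N = one F d) (Hd : forall j, H j d = vol d 1).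
Hypothesis H_path : forall j, exists Z c,
  [/\ col_path sigma j Z c, forall i, (i <= d)%N -> Z 0%N i = H j i
    & forall i, (i <= d)%N -> Z d.-1 i = H (j + 1) i].
Hypothesis uc_black : forall j, sigma j -> iv (uc j) = H j 1%N.
Hypothesis uc_white : forall j, ~~ sigma j ->
  exists k, k != 0 /\ ctr (uc j) (vol d t) = k *: H j d.-1.
Local Notation gF := (gF sigma uc t).

Lemma H_black j k : sigma j -> (k < d)%N ->
  exists2 a, a != 0 & wdg (iv (uc j)) (H (j + 1) k) = a *: H j k.+1.
Proof.
move=> sj kd; have [Z [c [h e0 e1]]] := H_path j.
exists (\prod_(m < k) c m).
  apply/prodf_neq0 => i _; rewrite -unitfE; apply: (proj1 (h i _)).
  by have := ltn_ord i; lia.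
rewrite uc_black // -e0 ?(ltnW d_gt1) // -e1 ?(ltnW kd) // -e0 //.
apply: (col_black (ltnW d_gt1) (erefl _) (erefl _)) => [m md|//|//].
  by have [_] := h m md; rewrite /letter sj.
by rewrite e1.
Qed.

Lemma H_white j k : ~~ sigma j -> (k < d)%N ->
  exists2 a, a != 0 & ctr (uc j) (H (j + 1) k.+1) = a *: H j k.
Proof.
move=> sj kd; have [Z [c [h e0 e1]]] := H_path j; have [b [b0 eb]] := uc_white sj.
exists (b / t * \prod_(m < d.-1 - k) c m).
  rewrite !mulf_neq0 ?invr_eq0 //; apply/prodf_neq0 => i _; rewrite -unitfE.
  by apply: (proj1 (h i _)); have := ltn_ord i; lia.
rewrite -e1 // -e0 ?(ltnW kd) //.
apply: (@col_white F d (uc j) (Z 0%N) (Z d.-1) Z c) => //; first exact: ltnW.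
- have [g [l [uT ul e]]] := H_framed j; exists g, l; split=> // i id.
  by rewrite e0 // e.
- by move=> m md; have [_] := h m md; rewrite /letter (negPf sj).
rewrite !e0 ?leq_pred // Hd.
have -> : vol d 1 = t^-1 *: vol d t :> E by rewrite /vol scalerA mulVf.
by rewrite ctrZ eb scalerA mulrC.
Qed.

(** By [col_black] and [col_white], arbitrary flags H_j joined by column paths satisfy the recursion
    defining F_j up to nonzero factors, as soon as u_j is the line or defines the hyperplane of H_j.
    The claim follows by induction on the stopping time. *)
Lemma gF_propto j : propto (gF j) (H j).
Proof.
suff h : forall k, (k <= d)%N -> exists2 a, a != 0 & H j k = a *: gF j k.
  by move=> k /h[a a0 e]; exists a; rewrite // unitfE.
have main m : forall j k, (0 < k < d)%N -> stop d sigma j k = m ->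
    exists2 a, a != 0 & gF j k = a *: H j k.
  elim: m => [|m IH] j' k hk em; have /andP[k0 kd] := hk.
    have [sj|sj] := boolP (sigma j'); have /(stopP j' adm)[] := kd; rewrite em.
      rewrite hits0_black // => /eqP-> _; exists 1; rewrite ?oner_eq0 //.
      by rewrite gF_black // gF0 wdg1r scale1r uc_black.
    rewrite hits0_white // => /eqP ek _; have [b [b0 eb]] := uc_white sj.
    exists b => //; have e := gF_white d_gt1 adm uc t sj hk.
    have ek' : k.+1 = d by lia.
    by rewrite e ek' gFd // eb ek.
  have [sj|sj] := boolP (sigma j').
    have k1 : (k != 1)%N.
      by apply/eqP => ek; move: em; rewrite stop0 // hits0_black // ek.
    have e : stop d sigma (j' + 1) k.-1 = m.
      by apply/eq_add_S; rewrite -em (@stop_step d n sigma adm j' k k.-1) ?hits0_black ?sj //=; lia.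
    have kd1 : (0 < k.-1 < d)%N by lia.
    have [a a0 ea] := IH (j' + 1) k.-1 kd1 e.
    have kd2 : (k.-1 < d)%N by lia.
    have [b b0 eb] := H_black sj kd2.
    exists (a * b); first by rewrite mulf_neq0.
    by rewrite -(prednK k0) gF_black ?prednK // ea wdgZr eb scalerA prednK.
  have k1 : (k != d.-1)%N.
    by apply/eqP => ek; move: em; rewrite stop0 // hits0_white // ek.
  have e : stop d sigma (j' + 1) k.+1 = m.
    apply/eq_add_S; rewrite -em (@stop_step d n sigma adm j' k k.+1) ?hits0_white ?(negPf sj) //=; lia.
  have kd1 : (0 < k.+1 < d)%N by lia.
  have [a a0 ea] := IH (j' + 1) k.+1 kd1 e.
  have [b b0 eb] := H_white sj kd.
  exists (a * b); first by rewrite mulf_neq0.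
  by rewrite gF_white // ea ctrZ eb scalerA.
move=> k kd; have [->|k0] := posnP k.
  by exists 1; rewrite ?oner_eq0 // H0 gF0 scale1r.
have [->|kd'] := eqVneq k d.
  exists t^-1; first by rewrite invr_eq0.
  by rewrite Hd gFd // /vol scalerA mulVf.
have [|a a0 ea] := main _ j k _ (erefl _); first by rewrite k0 ltn_neqAle kd'.
exists a^-1; first by rewrite invr_eq0.
by rewrite ea scalerA mulVf // scale1r.
Qed.

Lemma H_neq0 j k : (k <= d)%N -> H j k != 0.
Proof.
move=> kd; apply/eqP => h; have := @framed_reg _ _ _ _ 1 (H_framed j) kd.
by rewrite h scaler0 => /(_ erefl)/eqP; rewrite oner_eq0.
Qed.

Lemma gF_nonzero j k : (k <= d)%N -> gF j k != 0.
Proof.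
move=> kd; have [a _ e] := gF_propto j kd; apply: contraNneq (H_neq0 j kd) => h.
by rewrite e h scaler0.
Qed.

Lemma gmark_nonzero j : gmark sigma uc t j != 0.
Proof.
rewrite /gmark; case: ifPn => sj.
  have d1 : (d.-1 < d)%N by lia.
  have [a a0 ea] := H_black sj d1; have [b ub eb] := propto_sym (gF_propto (j + 1)) (ltnW d1).
  rewrite eb wdgZr ea prednK ?(ltnW d_gt1) // Hd /topc /vol !ffunE eqxx /GRing.scale /= !mulr1.
  by rewrite !mulf_neq0 ?invr_eq0 // -unitfE.
have [a a0 ea] := H_white sj (ltnW d_gt1).
have [b ub eb] := propto_sym (gF_propto (j + 1)) (ltnW d_gt1).
rewrite eb ctrZ ea H0 !ffunE eqxx /GRing.scale /= mulr1 mulf_neq0 //.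
by rewrite -unitfE.
Qed.

End ClosedChains.

(** * Chains along the bottom word *)

Section BottomChains.
Variables (F : comUnitRingType) (d : nat).
Local Notation E := (extK F d).
Local Notation unit c := (c \is a GRing.unit).
Hypothesis d_gt1 : (1 < d)%N.

Lemma chain_from w (G : nat -> E) : letters_in d w -> framed G ->
  exists fl c, chain w fl c /\ fl 0%N = G.
Proof.
elim: w G => [|i w IH] G.
  by move=> _ _; exists (fun=> G), (fun=> 1); split.
move=> /andP[id hw] fG; have [c0 [M [u0 h0]]] := dcross_exists 0 fG id.
have [fl [c [hc e]]] := IH M hw (framed_dcross fG id u0 h0).
exists (fun g => if g is g'.+1 then fl g' else G), (fun k => if k is k'.+1 then c k' else c0).
by split=> // -[|k] kw /=; [rewrite e|exact: hc].
Qed.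

(** The signs come from [dcross_sym]. *)
Lemma chain_rev w (fl : nat -> nat -> E) c : letters_in d w -> framed (fl 0%N) -> chain w fl c ->
  chain (rev w) (fun g => fl (size w - g)%N) (fun k => - c (size w - k.+1)%N).
Proof.
move=> hw f0 hc k; rewrite size_rev => kw.
have h1 : (size w - k.+1 < size w)%N by lia.
have [u h] := hc _ h1; split; first by rewrite unitrN.
rewrite nth_rev // (_ : (size w - k = (size w - k.+1).+1)%N); last by lia.
apply: dcross_sym => //; first by apply: (chain_framed hw hc f0); exact: ltnW.
by apply: (all_nthP 0%N hw).
Qed.

Lemma chain_level w (fl : nat -> nat -> E) c i : letters_in d w -> chain w fl c ->
  (i == 0)%N || (i == d) -> forall g, (g <= size w)%N -> fl g i = fl 0%N i.
Proof.
move=> hw hc hi; elim=> // g IH gw; have [_ [e _]] := hc g gw.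
have := all_nthP 0%N hw g gw => hl.
by rewrite e ?IH ?(ltnW gw) //; lia.
Qed.

End BottomChains.

Local Close Scope ring_scope.

(** * Rewriting words by the moves of Demazure weaves *)

Section Reachability.
Implicit Types (w a b x y win new : seq nat) (m : vertex_kind * nat) (ms : weave).

Variant basic : seq nat -> seq nat -> Prop :=
| BasicTri i : basic [:: i; i] [:: i]
| BasicFour i j of (i.+1 < j)%N || (j.+1 < i)%N : basic [:: i; j] [:: j; i]
| BasicSix i j of adjacent i j : basic [:: i; j; i] [:: j; i; j].

Lemma basic_rev win new : basic win new -> basic (rev win) (rev new).
Proof.
case=> [i|i j ij|i j ij]; rewrite /rev /=; [exact: BasicTri|apply: BasicFour|exact: BasicSix].
by rewrite orbC.
Qed.

Lemma vok_basic w m : vok w m -> exists a win new b,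
  [/\ w = a ++ win ++ b, word_step w m = a ++ new ++ b & basic win new].
Proof.
case: m => v k h; exists (take k w), (window (v, k) w),
  (odflt [::] (vertex_letters v (window (v, k) w))), (drop (k + in_valency v) w).
split=> //; last by case: (vokP h) => [i ->|i j -> ij|i j -> ij]; constructor.
by rewrite /window /= addnC -drop_drop cat_take_drop cat_take_drop.
Qed.

Lemma basic_weave a win new b : basic win new ->
  exists m, vok (a ++ win ++ b) m /\ word_step (a ++ win ++ b) m = a ++ new ++ b.
Proof.
have W v : forall s, size s = in_valency v -> window (v, size a) (a ++ s ++ b) = s.
  by move=> s ss; rewrite /window /= drop_size_cat // take_size_cat.
have R v : forall s t, size s = in_valency v ->
    replace_window (v, size a) t (a ++ s ++ b) = a ++ t ++ b.
  move=> s t ss; rewrite /replace_window /= take_size_cat // -ss -size_cat.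
  by rewrite [a ++ s ++ b]catA drop_size_cat.
case=> [i|i j ij|i j ij].
- exists (Trivalent, size a); rewrite /vok /word_step W // /= eqxx; split=> //.
  by rewrite (R Trivalent [:: i; i]).
- exists (Fourvalent, size a); rewrite /vok /word_step W // /= ij; split=> //.
  by rewrite (R Fourvalent [:: i; j]).
- exists (Sixvalent, size a); rewrite /vok /word_step W // /= eqxx.
  have -> : (i.+1 == j) || (j.+1 == i) by move: ij; rewrite /adjacent; lia.
  by split=> //; rewrite (R Sixvalent [:: i; j; i]).
Qed.

Lemma is_weave_nil w : is_weave w [::] w.
Proof. by []. Qed.

Lemma is_weave_cat w ms1 w1 ms2 w2 :
  is_weave w ms1 w1 -> is_weave w1 ms2 w2 -> is_weave w (ms1 ++ ms2) w2.
Proof.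
elim: ms1 w => [|m ms1 IH] w; first by case=> _ <-.
move=> /is_weave_cons[h1 h2] h3; apply/is_weave_cons; split=> //.
exact: IH h2 h3.
Qed.

Definition reach w w' := exists ms, is_weave w ms w'.

Lemma reach_refl w : reach w w.
Proof. by exists [::]. Qed.

Lemma reach_trans w w1 w2 : reach w w1 -> reach w1 w2 -> reach w w2.
Proof. by move=> [ms1 h1] [ms2 h2]; exists (ms1 ++ ms2); apply: is_weave_cat h1 h2. Qed.

Lemma basic_reach a win new b : basic win new -> reach (a ++ win ++ b) (a ++ new ++ b).
Proof.
move=> h; have [m [h1 h2]] := basic_weave a b h.
by exists [:: m]; apply/is_weave_cons; split=> //; rewrite h2.
Qed.

Lemma reach_ind (P : seq nat -> seq nat -> Prop) :
  (forall w, P w w) ->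
  (forall a win new b w, basic win new -> P (a ++ new ++ b) w -> P (a ++ win ++ b) w) ->
  forall w w', reach w w' -> P w w'.
Proof.
move=> h0 h1 w w' [ms]; elim: ms w => [|m ms IH] w; first by case=> _ <-.
move=> /is_weave_cons[hm hw]; have [a [win [new [b [e1 e2 hb]]]]] := vok_basic hm.
by rewrite e1; apply: h1 hb _; rewrite -e2; apply: IH.
Qed.

Lemma reach_ctx a b w w' : reach w w' -> reach (a ++ w ++ b) (a ++ w' ++ b).
Proof.
move: w w'; apply: reach_ind => [w|c win new e w hb h]; first exact: reach_refl.
apply: reach_trans h; have := @basic_reach (a ++ c) win new (e ++ b) hb.
by rewrite !catA.
Qed.

Lemma reach_rev w w' : reach w w' -> reach (rev w) (rev w').
Proof.
move: w w'; apply: reach_ind => [w|c win new e w hb h]; first exact: reach_refl.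
apply: reach_trans h; rewrite !rev_cat -!catA; apply: basic_reach.
exact: basic_rev.
Qed.

Definition far i := all (fun j => (i.+1 < j)%N || (j.+1 < i)%N).

Lemma far_left s i : far i s -> reach (s ++ [:: i]) (i :: s).
Proof.
elim/last_ind: s => [|s j IH]; first by move=> _; exact: reach_refl.
rewrite /far all_rcons => /andP[ij /IH h].
rewrite -!cats1 -catA /=; apply: (@reach_trans _ (s ++ [:: i; j])).
  have := @basic_reach s [:: j; i] [:: i; j] [::]; rewrite !cats0; apply.
  by apply: BasicFour; rewrite orbC.
by have := reach_ctx [::] [:: j] h; rewrite /= -catA.
Qed.

(** The letter commutes left until it meets i, i+1; the braid move i (i+1) i to (i+1) i (i+1) raises
    it, and i+1 commutes with the rest. *)
Lemma iota_pass lo k i : (lo <= i)%N -> (i.+1 < lo + k)%N ->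
  reach (iota lo k ++ [:: i]) (i.+1 :: iota lo k).
Proof.
move=> h1 h2; have e : iota lo k = iota lo (i - lo) ++ [:: i; i.+1] ++ iota i.+2 (lo + k - i.+2).
  have ek : k = ((i - lo) + (2 + (lo + k - i.+2)))%N by lia.
  by rewrite {1}ek iotaD subnKC // iotaD addn2.
rewrite {1}e -!catA; apply: (@reach_trans _ (iota lo (i - lo) ++ [:: i; i.+1] ++ i :: iota i.+2 (lo + k - i.+2))).
  have := @reach_ctx (iota lo (i - lo) ++ [:: i; i.+1]) [::] _ _ (@far_left (iota i.+2 (lo + k - i.+2)) i _).
  rewrite !cats0 -!catA; apply.
  by apply/allP => j; rewrite mem_iota => /andP[? _]; lia.
apply: (@reach_trans _ (iota lo (i - lo) ++ [:: i.+1; i; i.+1] ++ iota i.+2 (lo + k - i.+2))).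
  apply: (@basic_reach (iota lo (i - lo)) [:: i; i.+1; i]).
  by apply: BasicSix; rewrite /adjacent eqxx.
rewrite e; have := @reach_ctx [::] ([:: i; i.+1] ++ iota i.+2 (lo + k - i.+2)) _ _ (@far_left (iota lo (i - lo)) i.+1 _).
rewrite /= -catA; apply.
by apply/allP => j; rewrite mem_iota => /andP[? ?]; lia.
Qed.

Definition between lo r := all (fun i => (lo <= i < lo + r)%N).

(** Append letters one at a time. A letter inside the run passes through it and is raised by one,
    the last letter of the run is absorbed, the next one prolongs the run, and a larger one commutes
    with it; so the letters leaving the run exceed [lo]. *)
Lemma split_word lo r x : between lo r.+1 x -> exists y k,
  [/\ reach x (y ++ iota lo k), between lo.+1 r y & (k <= r.+1)%N].
Proof.
elim/last_ind: x => [|x i IH]; first by move=> _; exists [::], 0%N; split=> //; exact: reach_refl.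
rewrite /between all_rcons => /andP[hi /IH[y [k [h1 h2 h3]]]].
have h4 : reach (rcons x i) (y ++ iota lo k ++ [:: i]).
  by rewrite -cats1; have := reach_ctx [::] [:: i] h1; rewrite /= -catA.
have by_ j : (lo < j < lo.+1 + r)%N -> between lo.+1 r (y ++ [:: j]).
  by move=> hj; rewrite /between all_cat /= andbT; apply/andP; split.
have [h|h] := ltnP i.+1 (lo + k).
  exists (y ++ [:: i.+1]), k; split=> //; last by apply: by_; lia.
  apply: reach_trans h4 _; rewrite -catA.
  have := reach_ctx y [::] (@iota_pass lo k i _ h); rewrite !cats0; apply; lia.
have [ei|ei] := eqVneq i.+1 (lo + k)%N.
  exists y, k; split=> //; apply: reach_trans h4 _.
  have k0 : (0 < k)%N by lia.
  have -> : iota lo k = iota lo k.-1 ++ [:: i].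
    by rewrite -{1}(prednK k0) -addn1 iotaD; congr (_ ++ [:: _]); lia.
  have := @basic_reach (y ++ iota lo k.-1) [:: i; i] [:: i] [::] (BasicTri i).
  by rewrite !cats0 -!catA.
have [ek|ek] := eqVneq i (lo + k)%N.
  exists y, k.+1; split=> //; last by lia.
  by apply: reach_trans h4 _; rewrite -[k.+1]addn1 iotaD -ek; exact: reach_refl.
exists (y ++ [:: i]), k; split=> //; last by apply: by_; lia.
apply: reach_trans h4 _; rewrite -catA.
have := reach_ctx y [::] (@far_left (iota lo k) i _); rewrite !cats0; apply.
by apply/allP => j; rewrite mem_iota => /andP[? ?]; lia.
Qed.

(** The normal form of the symmetric group given by coset representatives: one increasing run for
    each starting letter. [top_word] is the one with all runs maximal. *)
Fixpoint is_nf r lo w : Prop := if r is r'.+1 then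
  exists y k, [/\ w = y ++ iota lo k, is_nf r' lo.+1 y & (k <= r)%N] else w = [::].

Lemma reach_nf r lo x : between lo r x -> exists2 y, reach x y & is_nf r lo y.
Proof.
elim: r lo x => [|r IH] lo x hx.
  exists x; first exact: reach_refl.
  by case: x hx => //= i x /andP[hi _]; lia.
have [y [k [h1 h2 h3]]] := split_word hx; have [z hz1 hz2] := IH _ _ h2.
exists (z ++ iota lo k); last by exists z, k.
by apply: reach_trans h1 _; apply: (reach_ctx [::]).
Qed.

Fixpoint top_word r lo : seq nat :=
  if r is r'.+1 then top_word r' lo.+1 ++ iota lo r else [::].

End Reachability.

(** * The 0-Hecke action by sorting, and completion to the longest element *)

Section SortingAction.
Implicit Types (f g : nat -> nat) (w : seq nat).

(* The 0-Hecke monoid acts by sorting neighbours into decreasing order. *)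
Definition sact f i : nat -> nat := fun p =>
  if p == i.-1 then maxn (f i.-1) (f i) else if p == i then minn (f i.-1) (f i) else f p.

Definition act f w := foldl sact f w.

Lemma eq_sact f g i : f =1 g -> sact f i =1 sact g i.
Proof. by move=> h p; rewrite /sact !h. Qed.

Lemma eq_act f g w : f =1 g -> act f w =1 act g w.
Proof. by elim: w f g => //= i w IH f g h; apply: IH; apply: eq_sact. Qed.

Lemma act_cat f w w' : act f (w ++ w') = act (act f w) w'.
Proof. exact: foldl_cat. Qed.

(** The sorting operators satisfy the relations of the 0-Hecke monoid, so the action is an invariant
    of Demazure weaves. *)
Lemma act_basic f win new : all (fun i => 0 < i)%N win -> basic win new -> act f win =1 act f new.
Proof.
move=> hw hb p; case: hb hw => [i|i j ij|i j ij] /=.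
- move=> /and3P[i0 _ _]; rewrite /sact.
  have e : (i == i.-1) = false by lia.
  by rewrite !eqxx e; case: (p =P i.-1) => [_|?]; [|case: (p =P i) => ?]; lia.
- move=> /and3P[i0 j0 _]; rewrite /sact.
  have e1 : (j.-1 == i.-1) = false by lia.
  have e2 : (j.-1 == i) = false by lia.
  have e3 : (j == i.-1) = false by lia.
  have e4 : (j == i) = false by lia.
  have e5 : (i.-1 == j) = false by lia.
  rewrite ![i.-1 == j.-1]eq_sym ![i == j.-1]eq_sym ![i == j]eq_sym e1 e2 e3 e4 e5.
  case: (p =P i.-1) => [->|?]; first by rewrite ![i.-1 == _]eq_sym e1 e3.
  by case: (p =P i) => [->|?]; rewrite // ![i == _]eq_sym e2 e4.
- case/orP: ij => /eqP e; subst.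
    case: i => // i _; rewrite /sact /=.
    have e1 : (i == i.+1) = false by lia.
    have e2 : (i.+1 == i) = false by lia.
    have e3 : (i.+2 == i) = false by lia.
    have e4 : (i.+2 == i.+1) = false by lia.
    have e5 : (i.+1 == i.+2) = false by lia.
    have e6 : (i == i.+2) = false by lia.
    rewrite !(e1, e2, e3, e4, e5, e6, eqxx).
    case: (p =P i) => ?; case: (p =P i.+1) => ?; case: (p =P i.+2) => ?; lia.
  case: j => // j.
  move=> _; rewrite /sact /=.
  have e1 : (j == j.+1) = false by lia.
  have e2 : (j.+1 == j) = false by lia.
  have e3 : (j.+2 == j) = false by lia.
  have e4 : (j.+2 == j.+1) = false by lia.
  have e5 : (j.+1 == j.+2) = false by lia.
  have e6 : (j == j.+2) = false by lia.
  rewrite !(e1, e2, e3, e4, e5, e6, eqxx).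
  by case: (p =P j) => ?; case: (p =P j.+1) => ?; case: (p =P j.+2) => ?; lia.
Qed.

Lemma basic_pos win new : all (fun i => 0 < i)%N win -> basic win new -> all (fun i => 0 < i)%N new.
Proof. by move=> h hb; case: hb h => [i|i j _|i j _] /=; lia. Qed.

Lemma act_reach w w' : reach w w' -> all (fun i => 0 < i)%N w -> forall f, act f w =1 act f w'.
Proof.
move: w w'; apply: reach_ind => // a win new b w hb IH.
rewrite !all_cat => /and3P[ha hw hb'] f p; rewrite -IH; last first.
  by rewrite !all_cat ha hb' (basic_pos hw hb).
by rewrite !act_cat; apply: eq_act; apply: act_basic.
Qed.

Definition sorted_on lo r f := forall p q, (lo <= p)%N -> (p < q)%N -> (q <= lo + r)%N -> (f q <= f p)%N.

Lemma act_low f w p lo : all (fun i => lo < i)%N w -> (p < lo)%N -> act f w p = f p.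
Proof.
elim: w f => //= i w IH f /andP[il hw] pl; rewrite IH // /sact.
case: (p =P i.-1) => [?|_]; first by lia.
by case: (p =P i) => [?|_]; first by lia.
Qed.

Lemma act_gt f w c lo r : between lo.+1 r w ->
  (forall p, (lo <= p <= lo + r)%N -> (c < f p)%N) ->
  forall p, (lo <= p <= lo + r)%N -> (c < act f w p)%N.
Proof.
elim: w f => //= i w IH f /andP[hi hw] hf; apply: IH => // p hp.
have h1 : (c < f i.-1)%N by apply: hf; lia.
have h2 : (c < f i)%N by apply: hf; lia.
have h3 := hf p hp; rewrite /sact.
by case: ifP => _; [|case: ifP => _]; lia.
Qed.

Lemma act_iota f lo k : (forall i, (i < k)%N -> (f lo < f (lo + i.+1))%N) ->
  forall p, act f (iota lo.+1 k) p =
    if (p < lo)%N then f p else if (p < lo + k)%N then f p.+1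
    else if p == (lo + k)%N then f lo else f p.
Proof.
elim: k => [|k IH] h p.
  rewrite /= addn0; case: ltngtP => // ->; by [].
rewrite -[k.+1]addn1 iotaD act_cat [act _ (iota _ 1)]/= /sact addSn [(lo + k).+1.-1]/=.
have h' i : (i < k)%N -> (f lo < f (lo + i.+1))%N by move=> ik; apply: h; exact: leqW.
rewrite !(IH h') ltnn eqxx (ltnNge (lo + k) lo) leq_addr /=.
have e1 : ((lo + k).+1 < lo)%N = false by lia.
have e2 : ((lo + k).+1 < lo + k)%N = false by lia.
have e3 : ((lo + k).+1 == lo + k)%N = false by lia.
have := h k (ltnSn k); rewrite e1 e2 e3 addnS => hk.
case: (p =P (lo + k)%N) => [->|n1].
  have -> : (lo + k < lo)%N = false by lia.
  have -> : (lo + k < lo + (k + 1))%N by lia.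
  by lia.
case: (p =P (lo + k).+1) => [->|n2].
  have -> : ((lo + k).+1 < lo + (k + 1))%N = false by lia.
  have -> : ((lo + k).+1 == lo + (k + 1))%N by lia.
  by rewrite e1; lia.
have -> : (p < lo + (k + 1))%N = (p < lo + k)%N by lia.
by have -> : (p == lo + (k + 1))%N = false by lia.
Qed.

Lemma is_nf_between r lo w : is_nf r lo w -> between lo r w.
Proof.
elim: r lo w => [|r IH] lo w /=; first by move=> ->.
move=> [y [k [-> /IH hy kr]]]; rewrite /between all_cat; apply/andP; split.
  by apply: sub_all hy => i; lia.
by apply/allP => i; rewrite mem_iota; lia.
Qed.

(** The earlier runs do not touch the first position, so the last run carries the minimum, and in a
    decreasing result it must reach the last position. Hence this run is maximal, and the induction
    continues on the other positions. *)
Lemma is_nf_top r lo w f : is_nf r lo.+1 w ->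
  (forall p q, (lo <= p)%N -> (p < q)%N -> (q <= lo + r)%N -> (f p < f q)%N) ->
  sorted_on lo r (act f w) -> w = top_word r lo.+1.
Proof.
elim: r lo w => [|r IH] lo w /=; first by move=> ->.
move=> [y [k [-> hy kr]]] hf; rewrite act_cat => hs.
have hb := is_nf_between hy.
have f1lo : act f y lo = f lo.
  apply: (act_low _ _ (ltnSn lo)); apply: sub_all hb => i; lia.
have f1gt p : (lo.+1 <= p <= lo.+1 + r)%N -> (f lo < act f y p)%N.
  by move=> hp; apply: (act_gt hb) hp => p' hp'; apply: hf; lia.
have hio := @act_iota (act f y) lo k.
have hk i : (i < k)%N -> (act f y lo < act f y (lo + i.+1))%N.
  by move=> ik; rewrite f1lo; apply: f1gt; lia.
have {}hio := hio hk.
have ek : k = r.+1.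
  apply/eqP; rewrite eqn_leq kr leqNgt; apply/negP => kr'.
  have := hs (lo + k)%N (lo + k).+1 (leq_addr _ _) (ltnSn _) (ltac:(lia)).
  rewrite !hio eqxx ltnn.
  have -> : ((lo + k).+1 < lo)%N = false by lia.
  have -> : ((lo + k).+1 < lo + k)%N = false by lia.
  have -> : ((lo + k).+1 == lo + k)%N = false by lia.
  have -> : (lo + k < lo)%N = false by lia.
  by rewrite f1lo leqNgt f1gt //; lia.
subst k; rewrite (IH lo.+1 y) // => [p q h1 h2 h3|p q h1 h2 h3]; first by apply: hf; lia.
have := hs p.-1 q.-1; rewrite !hio.
have -> : (p.-1 < lo)%N = false by lia.
have -> : (q.-1 < lo)%N = false by lia.
have -> : (p.-1 < lo + r.+1)%N by lia.
have -> : (q.-1 < lo + r.+1)%N by lia.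
by rewrite !prednK; [apply| |]; lia.
Qed.

End SortingAction.

Section ColumnSorting.
Variable d : nat.
Hypothesis d_gt1 : (1 < d)%N.
Implicit Types (f g : nat -> nat) (cs : seq bool).

Definition colw cs : seq nat :=
  flatten [seq if c then iota 1 d.-1 else rev (iota 1 d.-1) | c : bool <- cs].

Lemma rev_colw cs : rev (colw cs) = colw (rev [seq ~~ c | c <- cs]).
Proof.
elim: cs => //= c cs IH; rewrite /colw /= rev_cat -/(colw cs) IH rev_cons map_rcons flatten_rcons.
by case: c; rewrite ?revK.
Qed.

Lemma between_basic lo r win new : between lo r win -> basic win new -> between lo r new.
Proof. by move=> h hb; case: hb h => [i|i j _|i j _] /=; lia. Qed.

Lemma between_reach lo r w w' : reach w w' -> between lo r w -> between lo r w'.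
Proof.
move: w w'; apply: reach_ind => // a win new b w hb IH.
rewrite /between !all_cat => /and3P[ha hw hb']; apply: IH.
by rewrite /between !all_cat ha hb' [all _ new](between_basic hw hb).
Qed.

Lemma between_colw cs : between 1 d.-1 (colw cs).
Proof.
elim: cs => // c cs IH; rewrite /between /colw /= all_cat; apply/andP; split; last exact: IH.
by case: c; rewrite ?all_rev; apply/allP => i; rewrite mem_iota.
Qed.

(** The first [b] positions are settled for good, holding values at least as large as all later
    ones; [high_sorted] is the same for the last [a] positions. *)
Definition low_sorted b f := forall p q, (p < b)%N -> (p < q)%N -> (q < d)%N -> (f q <= f p)%N.
Definition high_sorted a f := forall p q, (d <= q + a)%N -> (p < q)%N -> (q < d)%N -> (f q <= f p)%N.

Lemma low_sact b f i : (0 < i < d)%N -> low_sorted b f -> low_sorted b (sact f i).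
Proof.
move=> hi h p q pb pq qd.
have h1 := h p q pb pq qd; have h2 := h p i.-1 pb; have h3 := h p i pb.
have h4 := h i.-1 i; have h5 := h i.-1 q; have h6 := h i q.
rewrite /sact; case: (q =P i.-1) => e1; case: (q =P i) => e2;
  case: (p =P i.-1) => e3; case: (p =P i) => e4; subst; try lia.
Qed.

Lemma high_sact a f i : (0 < i < d)%N -> high_sorted a f -> high_sorted a (sact f i).
Proof.
move=> hi h p q qa pq qd.
have h1 := h p q qa pq qd; have h2 := h i.-1 q qa; have h3 := h i q qa.
have h4 := h i.-1 i; have h5 := h p i.-1; have h6 := h p i.
rewrite /sact; case: (q =P i.-1) => e1; case: (q =P i) => e2;
  case: (p =P i.-1) => e3; case: (p =P i) => e4; subst; try lia.
Qed.

Lemma low_act b f w : between 1 d.-1 w -> low_sorted b f -> low_sorted b (act f w).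
Proof.
elim: w f => //= i w IH f /andP[hi hw] h; apply: IH => //; apply: low_sact => //; lia.
Qed.

Lemma high_act a f w : between 1 d.-1 w -> high_sorted a f -> high_sorted a (act f w).
Proof.
elim: w f => //= i w IH f /andP[hi hw] h; apply: IH => //; apply: high_sact => //; lia.
Qed.

(** An increasing column is one pass of bubble sort to the right: it settles one more of the last
    positions. A decreasing column settles one more of the first ones, see [low_white]. *)
Lemma high_black a f : high_sorted a f -> high_sorted a.+1 (act f (iota 1 d.-1)).
Proof.
move=> h; have [ad|ad] := leqP d a.
  have hh : high_sorted a (act f (iota 1 d.-1)) by apply: high_act => //; have := between_colw [:: true]; rewrite /colw /= cats0.
  by move=> p q _ pq qd; apply: hh => //; lia.
set s := (d.-1 - a)%N; have ed : d.-1 = (s + a)%N by lia.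
have main i : (i <= d.-1)%N -> forall l, (l < i)%N -> (act f (iota 1 i) i <= act f (iota 1 i) l)%N.
  elim: i => // i IH hi l li; rewrite -[X in iota 1 X]addn1 iotaD act_cat [act _ (iota _ 1)]/=.
  have := IH (ltnW hi) l; rewrite /sact add1n /= eqxx gtn_eqF //.
  by case: (l =P i) => [->|?]; [lia|rewrite ltn_eqF //; lia].
rewrite {1}ed iotaD act_cat; apply: high_act.
  by apply/allP => i; rewrite mem_iota; lia.
have hs : between 1 d.-1 (iota 1 s) by apply/allP => i; rewrite mem_iota; lia.
move=> p q qa pq qd; have [es|es] := eqVneq q s.
  by subst q; apply: main => //; lia.
by apply: (high_act hs h) => //; lia.
Qed.

Lemma low_white b f : low_sorted b f -> low_sorted b.+1 (act f (rev (iota 1 d.-1))).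
Proof.
move=> h; have [bd|bd] := leqP d b.
  have hh : low_sorted b (act f (rev (iota 1 d.-1))) by apply: low_act => //; have := between_colw [:: false]; rewrite /colw /= cats0.
  by move=> p q _ pq qd; apply: hh => //; lia.
have main m : forall i, (i + m = d.-1)%N -> forall l, (i < l < d)%N ->
    (act f (rev (iota i.+1 m)) l <= act f (rev (iota i.+1 m)) i)%N.
  elim: m => [|m IH] i e l hl; first by lia.
  rewrite /= rev_cons -cats1 act_cat /=.
  have := IH i.+1 _ l; rewrite addSnnS => /(_ e).
  rewrite /sact /= eqxx gtn_eqF; last by lia.
  by case: (l =P i.+1) => [->|?]; lia.
have eb : iota 1 d.-1 = iota 1 b ++ iota b.+1 (d.-1 - b).
  have {1}-> : d.-1 = (b + (d.-1 - b))%N by lia.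
  by rewrite iotaD.
rewrite eb rev_cat act_cat; apply: low_act.
  by rewrite /between all_rev; apply/allP => i; rewrite mem_iota; lia.
have hs : between 1 d.-1 (rev (iota b.+1 (d.-1 - b))).
  by rewrite /between all_rev; apply/allP => i; rewrite mem_iota; lia.
move=> p q pb pq qd; have [es|es] := eqVneq p b.
  by subst p; apply: main => //; lia.
by apply: (low_act hs h) => //; lia.
Qed.

(** Each column settles one position at one of the two ends, whatever its color, and a sequence of d
    values is sorted once d-1 are settled. *)
Lemma colw_sorted cs f : (d.-1 <= size cs)%N -> sorted_on 0 d.-1 (act f (colw cs)).
Proof.
have : high_sorted 0 f by move=> p q; lia.
have : low_sorted 0 f by move=> p q.
suff main a b : (d.-1 <= a + b + size cs)%N -> low_sorted b f -> high_sorted a f ->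
    sorted_on 0 d.-1 (act f (colw cs)).
  by move=> hl hh hs; apply: (main 0%N 0%N).
elim: cs f a b => [|c cs IH] f a b /=.
  rewrite addn0 => hab hl hh p q _ pq hq.
  have [pb|pb] := ltnP p b; first by apply: hl => //; lia.
  by apply: hh => //; lia.
move=> hab hl hh; rewrite /colw /= act_cat -/(colw cs).
have hb1 : between 1 d.-1 (iota 1 d.-1) by have := between_colw [:: true]; rewrite /colw /= cats0.
have hb2 : between 1 d.-1 (rev (iota 1 d.-1)) by rewrite /between all_rev.
case: c.
  apply: (IH _ a.+1 b); [lia|exact: low_act|exact: high_black].
apply: (IH _ a b.+1); [lia|exact: low_white|exact: high_act].
Qed.

(** The moves preserve the action, so a normal form of [w] still sorts the identity sequence and has
    to be [top_word]. *)
Lemma reach_top cs w : (d.-1 <= size cs)%N -> reach (colw cs) w -> reach w (top_word d.-1 1).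
Proof.
move=> hcs hr; have hw := between_reach hr (between_colw cs).
have [y hy hn] := reach_nf hw.
rewrite -(@is_nf_top d.-1 0 y id hn) //.
have pos s : between 1 d.-1 s -> all (fun i => 0 < i)%N s by apply: sub_all => i; lia.
have e := act_reach (reach_trans hr hy) (pos _ (between_colw cs)) id.
by move=> p q h1 h2 h3; rewrite -!e; apply: colw_sorted.
Qed.

(** Reversal respects the moves and turns columns into columns of the other color. *)
Lemma reach_top_rev cs w : (d.-1 <= size cs)%N -> reach (colw cs) w ->
  reach w (rev (top_word d.-1 1)).
Proof.
move=> hcs /reach_rev; rewrite rev_colw => /reach_top.
rewrite size_rev size_map => /(_ hcs) /reach_rev.
by rewrite revK.
Qed.

End ColumnSorting.

(** * The canonical word is reduced *)

Section ReducedWords.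
Variable d : nat.
Local Open Scope group_scope.

Lemma simple_refl_nat i (x : 'I_d) : (0 < i < d)%N ->
  simple_refl d i x = (if x == i.-1 :> nat then i else if x == i :> nat then i.-1 else x) :> nat.
Proof.
move=> /andP[i0 id]; have id' : (i.-1 < d)%N by lia.
rewrite /simple_refl !insubT /=; case: tpermP => [->|->|/eqP h1 /eqP h2] /=.
- by rewrite eqxx.
- by rewrite eqxx gtn_eqF // prednK.
- by rewrite -val_eqE /= in h1; rewrite -val_eqE /= in h2; rewrite (negPf h1) (negPf h2).
Qed.

Lemma simple_refl_inv i : (simple_refl d i)^-1 = simple_refl d i.
Proof.
rewrite /simple_refl; case: insub => [x|]; last by rewrite invg1.
by case: insub => [y|]; rewrite ?invg1 ?tpermV.
Qed.

Lemma word_perm_rev w : word_perm d (rev w) = (word_perm d w)^-1.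
Proof.
rewrite /word_perm; elim: w => [|i w IH]; first by rewrite big_nil invg1.
by rewrite rev_cons -cats1 big_cat big_seq1 big_cons IH invMg simple_refl_inv.
Qed.

Lemma word_perm_cat w w' : word_perm d (w ++ w') = word_perm d w * word_perm d w'.
Proof. by rewrite /word_perm big_cat. Qed.

Lemma reduced_rev w : reduced_word d w -> reduced_word d (rev w).
Proof.
move=> [hl hr]; split; first by rewrite /letters_in all_rev.
move=> w' hl' e; rewrite size_rev -(size_rev w'); apply: hr; first by rewrite /letters_in all_rev.
by rewrite word_perm_rev e word_perm_rev invgK.
Qed.

Definition inversions (s : 'S_d) := [set xy : 'I_d * 'I_d | (xy.1 < xy.2)%N && (s xy.2 < s xy.1)%N].

(** The only pair that can become an inversion is the one sent to the two exchanged places. *)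
Lemma inversions_step (s : 'S_d) i : (0 < i < d)%N ->
  (#|inversions (s * simple_refl d i)| <= #|inversions s|.+1)%N.
Proof.
move=> hi; have hi1 : (i.-1 < d)%N by lia.
have hi2 : (i < d)%N by lia.
pose x0 := s^-1 (Ordinal hi1); pose y0 := s^-1 (Ordinal hi2).
apply: leq_trans (subset_leq_card _) (leq_trans (leq_card_setU _ [set (x0, y0)]) _); last first.
  by rewrite cards1 addn1.
apply/subsetP => -[x y]; rewrite !inE !permM !simple_refl_nat //= => /andP[xy h].
rewrite xy /=; move: h; set a : nat := s x; set b : nat := s y => h.
have ex : a = i.-1 -> x = x0.
  move=> e; rewrite /x0 -[x in LHS](permK s); congr (_ _); exact/val_inj.
have ey : b = i -> y = y0.
  move=> e; rewrite /y0 -[y in LHS](permK s); congr (_ _); exact/val_inj.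
have ab : a <> b by move=> e; have /perm_inj exy : s x = s y by [apply: val_inj]; move: xy; rewrite exy ltnn.
case: (a =P i.-1) h => [ea|na]; case: (b =P i) => [eb|nb].
- by move=> _; rewrite -(ex ea) -(ey eb) eqxx orbT.
- by case: (b =P i.-1) => ? h; apply/orP; left; lia.
- case: (a =P i) => ?; case: (b =P i.-1) => ? h; apply/orP; left; lia.
- by case: (a =P i) => ?; case: (b =P i.-1) => ? h; apply/orP; left; lia.
Qed.

Lemma inversions_word w : letters_in d w -> (#|inversions (word_perm d w)| <= size w)%N.
Proof.
elim/last_ind: w => [|w i IH].
  rewrite /word_perm big_nil => _; rewrite leqn0 cards_eq0; apply/eqP/setP => -[x y].
  by rewrite !inE !perm1 /=; case: ltngtP.
rewrite /letters_in all_rcons => /andP[hi /IH h].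
rewrite -cats1 word_perm_cat size_cat addn1.
have -> : word_perm d [:: i] = simple_refl d i by rewrite /word_perm big_seq1.
by apply: leq_trans (inversions_step _ hi) _.
Qed.

Lemma word_perm_iota lo k (x : 'I_d) : (lo + k < d)%N -> (lo <= x)%N ->
  word_perm d (iota lo.+1 k) x = (if x == lo :> nat then lo + k
    else if (x <= lo + k)%N then x.-1 else x) :> nat.
Proof.
elim: k => [|k IH] hk lox.
  by rewrite /word_perm big_nil perm1 addn0; case: ltngtP lox => //; lia.
rewrite -[k.+1]addn1 iotaD word_perm_cat permM.
have -> : word_perm d (iota (lo.+1 + k) 1) = simple_refl d (lo + k).+1 by rewrite /word_perm big_seq1.
rewrite simple_refl_nat ?IH //=; try lia.
move: (nat_of_ord x) lox => y lox {IH}.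
case: (y =P lo) => [_|n1]; first by rewrite eqxx; lia.
case: (leqP y (lo + k)) => h2.
  have -> : (y.-1 == lo + k)%N = false by lia.
  have -> : (y.-1 == (lo + k).+1)%N = false by lia.
  by have -> : (y <= lo + (k + 1))%N by lia.
have -> : (y == lo + k)%N = false by lia.
case: (y =P (lo + k).+1) => h3.
  have -> : (y <= lo + (k + 1))%N by lia.
  by lia.
by have -> : (y <= lo + (k + 1))%N = false by lia.
Qed.

Lemma word_perm_low lo w (x : 'I_d) : letters_in d w -> all (fun i => lo < i)%N w -> (x < lo)%N ->
  word_perm d w x = x.
Proof.
elim: w x => [|i w IH] x; first by rewrite /word_perm big_nil perm1.
move=> /andP[hi hw] /andP[hlo hw'] xlo.
rewrite /word_perm big_cons permM -/(word_perm d w).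
have -> : simple_refl d i x = x; last exact: IH.
by apply: val_inj; rewrite /= simple_refl_nat // !ltn_eqF //; lia.
Qed.

Lemma top_word_between r lo : between lo r (top_word r lo).
Proof.
elim: r lo => //= r IH lo; rewrite /between all_cat; apply/andP; split.
  by apply: sub_all (IH lo.+1) => i; lia.
by apply/allP => i; rewrite -[lo :: _]/(iota lo r.+1) mem_iota.
Qed.

Lemma word_perm_top r lo (x : 'I_d) : (lo + r < d)%N -> (lo <= x <= lo + r)%N ->
  word_perm d (top_word r lo.+1) x = (lo + lo + r - x)%N :> nat.
Proof.
elim: r lo x => [|r IH] lo x hr hx.
  by rewrite /word_perm big_nil perm1; lia.
rewrite [top_word _ _]/= -[lo.+1 :: _]/(iota lo.+1 r.+1) word_perm_cat permM.
have hl : letters_in d (top_word r lo.+2).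
  by apply: sub_all (top_word_between r lo.+2) => i; lia.
have [ex|nx] := eqVneq (x : nat) lo.
  have h1 : all (fun i => lo.+1 < i)%N (top_word r lo.+2).
    by apply: sub_all (top_word_between r lo.+2) => i; lia.
  rewrite (word_perm_low hl h1) ?ex // word_perm_iota ?ex ?eqxx //; lia.
have h : word_perm d (top_word r lo.+2) x = (lo.+1 + lo.+1 + r - x)%N :> nat by apply: IH; lia.
rewrite word_perm_iota ?h //; last by lia.
have -> : (lo.+1 + lo.+1 + r - x == lo)%N = false by lia.
by have -> : (lo.+1 + lo.+1 + r - x <= lo + r.+1)%N; lia.
Qed.

Lemma size_top_word r lo : size (top_word r lo) = (\sum_(i < r.+1) i)%N.
Proof.
elim: r lo => [|r IH] lo; first by rewrite big_ord_recr big_ord0.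
by rewrite /= size_cat IH /= size_iota [in RHS]big_ord_recr /=.
Qed.

Lemma card_ltn_pairs : #|[set xy : 'I_d * 'I_d | (xy.1 < xy.2)%N]| = (\sum_(i < d) i)%N.
Proof.
rewrite -sum1_card (eq_bigl (fun xy : 'I_d * 'I_d => (xy.1 < xy.2)%N)); last first.
  by move=> xy; rewrite inE.
rewrite -(pair_big_dep xpredT (fun x y : 'I_d => (x < y)%N) (fun _ _ => 1%N)) /=.
rewrite (exchange_big_dep xpredT) //=; apply: eq_bigr => y _.
have inj : injective (widen_ord (ltnW (ltn_ord y))).
  by move=> a b /(congr1 val) /= /val_inj.
rewrite sum1_card -[RHS](card_ord y) -(card_imset _ inj).
apply: eq_card => x; apply/idP/imsetP => [xy|[z _ ->]]; last exact: (ltn_ord z).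
by exists (Ordinal (xy : (x < y)%N)) => //; apply: val_inj.
Qed.

(** It represents the order-reversing permutation, and has as many letters as there are pairs, all
    of which are inversions. *)
Lemma top_word_reduced : (0 < d)%N -> reduced_word d (top_word d.-1 1).
Proof.
move=> d0; have hl : letters_in d (top_word d.-1 1).
  by apply: sub_all (top_word_between d.-1 1) => i; lia.
split=> // w' hl' e; apply: leq_trans (inversions_word hl'); rewrite e size_top_word prednK //.
rewrite -card_ltn_pairs; apply: subset_leq_card; apply/subsetP => -[x y]; rewrite !inE /= => xy.
have hx := ltn_ord x; have hy := ltn_ord y.
rewrite xy !word_perm_top //; lia.
Qed.

End ReducedWords.

(** * Weaves confined to a part of the word *)

Section Bounded.
Implicit Types (w a c s : seq nat) (m : vertex_kind * nat) (ms : weave).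

(* All vertices lie at positions at least [l], and at least [r] letters away
   from the right end of the word. *)
Definition within l r w ms := forall t, (t < size ms)%N ->
  (l <= (nth move0 ms t).2)%N /\
  ((nth move0 ms t).2 + in_valency (nth move0 ms t).1 + r <= size (slice w ms t))%N.

Lemma within_nil l r w : within l r w [::].
Proof. by []. Qed.

Lemma slice_cat w ms1 ms2 w1 t : slice w ms1 (size ms1) = w1 ->
  slice w (ms1 ++ ms2) (size ms1 + t) = slice w1 ms2 t.
Proof.
by move=> <-; rewrite /slice take_size -foldl_cat take_cat ltnNge leq_addr /= addKn.
Qed.

Lemma slice_catl w ms1 ms2 t : (t <= size ms1)%N -> slice w (ms1 ++ ms2) t = slice w ms1 t.
Proof. by move=> h; rewrite /slice takel_cat. Qed.

Lemma within_cat l r w ms1 ms2 w1 : slice w ms1 (size ms1) = w1 ->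
  within l r w ms1 -> within l r w1 ms2 -> within l r w (ms1 ++ ms2).
Proof.
move=> e h1 h2 t; rewrite size_cat => ht; rewrite nth_cat; case: ltnP => h.
  by rewrite slice_catl ?(ltnW h) //; apply: h1.
rewrite -(subnKC h) (slice_cat _ _ e) addKn; apply: h2; lia.
Qed.

Lemma within_weak l l' r r' w ms : (l' <= l)%N -> (r' <= r)%N -> within l r w ms -> within l' r' w ms.
Proof. by move=> hl hr h t ht; have := h t ht; lia. Qed.

Lemma carry_within (T : Type) (fl : nat -> nat -> T) l r w ms w1 :
  is_weave w ms w1 -> within l r w ms ->
  (forall t, (t < size ms)%N -> let m := nth move0 ms t in
    (forall g, (g <= m.2)%N -> fl t.+1 g = fl t g) /\
    (forall g, (m.2 + in_valency m.1 + g <= size (slice w ms t))%N ->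
       fl t.+1 (m.2 + out_valency m.1 + g)%N = fl t (m.2 + in_valency m.1 + g)%N)) ->
  (forall g, (g <= l)%N -> fl (size ms) g = fl 0%N g) /\
  (forall g, (g <= r)%N -> fl (size ms) (size w1 - g)%N = fl 0%N (size w - g)%N).
Proof.
elim: ms w fl => [|m ms IH] w fl; first by case=> _ <-.
move=> /is_weave_cons[hm hW] hb hc.
have hb' : within l r (word_step w m) ms by move=> t ht; apply: (hb t.+1).
have [i1 i2] := IH _ (fun t => fl t.+1) hW hb' (fun t ht => hc t.+1 ht).
have [c1 c2] := hc 0%N isT; have [b1 b2] := hb 0%N isT; rewrite /slice /= in c1 c2 b1 b2.
split=> g hg /=; first by rewrite i1 // c1 //; lia.
rewrite i2 // /word_step replace_windowE size_rep ?vok_bound //.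
case: m hm b2 c2 {hW hb hb' i1 i2 hc c1 b1} => v k hm; rewrite out_letters //= => b2 c2.
have := c2 (size w - g - (k + in_valency v))%N; rewrite subnKC; last by lia.
move=> /(_ (leq_subr _ _)) <-; congr (fl _ _); lia.
Qed.

End Bounded.

(** * Passing letters leftwards through a column *)

Section Moves.
Implicit Types (a c s p q : seq nat) (ms : weave).

(** The 4-valent vertices that carry the letter at position [lo + cnt] to position [lo], the
    rightmost one first. *)
Definition lmoves lo cnt : weave := rev [seq (Fourvalent, l) | l <- iota lo cnt].

Lemma lmovesS lo cnt : lmoves lo cnt.+1 = (Fourvalent, (lo + cnt)%N) :: lmoves lo cnt.
Proof. by rewrite /lmoves -[cnt.+1]addn1 iotaD map_cat rev_cat. Qed.

Lemma rep_mid a win new c : rep (size a) (size win) new (a ++ win ++ c) = a ++ new ++ c.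
Proof. by rewrite /rep take_size_cat // addnC -drop_drop drop_size_cat // drop_size_cat. Qed.

Lemma weight_four a u e c :
  weight_step (a ++ [:: u; e] ++ c) (Fourvalent, size a) = a ++ [:: e; u] ++ c.
Proof.
rewrite /weight_step replace_windowE /window /= drop_size_cat //= take0.
exact: (rep_mid a [:: u; e]).
Qed.

Lemma word_four a u e c : (u.+1 < e)%N || (e.+1 < u)%N ->
  vok (a ++ [:: u; e] ++ c) (Fourvalent, size a) /\
  word_step (a ++ [:: u; e] ++ c) (Fourvalent, size a) = a ++ [:: e; u] ++ c.
Proof.
move=> h; rewrite /vok /word_step replace_windowE /window /= drop_size_cat //= take0 h; split=> //.
exact: (rep_mid a [:: u; e]).
Qed.

Lemma weight_lmoves a s e c :
  foldl weight_step (a ++ s ++ e :: c) (lmoves (size a) (size s)) = a ++ e :: s ++ c.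
Proof.
elim/last_ind: s c => [|s u IH] c; first by [].
rewrite size_rcons lmovesS /=.
have -> : a ++ rcons s u ++ e :: c = (a ++ s) ++ [:: u; e] ++ c by rewrite -cats1 -!catA.
by rewrite -size_cat weight_four -catA IH cat_rcons.
Qed.

Lemma word_lmoves a s e c : far e s ->
  is_weave (a ++ s ++ e :: c) (lmoves (size a) (size s)) (a ++ e :: s ++ c) /\
  within (size a) (size c) (a ++ s ++ e :: c) (lmoves (size a) (size s)).
Proof.
elim/last_ind: s c => [|s u IH] c; first by move=> _; split; [exact: is_weave_nil|exact: within_nil].
rewrite /far all_rcons => /andP[hu hs]; rewrite size_rcons lmovesS.
have -> : a ++ rcons s u ++ e :: c = (a ++ s) ++ [:: u; e] ++ c by rewrite -cats1 -!catA.
rewrite -size_cat.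
have [h1 h2] := @word_four (a ++ s) u e c ltac:(by rewrite orbC).
have [i1 i2] := IH (u :: c) hs; split.
  by apply/is_weave_cons; split=> //; rewrite h2 -catA cat_rcons.
case=> [_|t ht] /=.
  by rewrite /slice take0 /= !size_cat /=; lia.
have := i2 t ht; rewrite /slice /= h2 -catA /=; lia.
Qed.

Lemma weight_six a u v e c : weight_step (a ++ [:: u; v; e] ++ c) (Sixvalent, size a) =
  a ++ [:: v + e - minn u e; minn u e; u + v - minn u e]%N ++ c.
Proof.
rewrite /weight_step replace_windowE /window /= drop_size_cat //= take0.
exact: (rep_mid a [:: u; v; e]).
Qed.

Lemma word_six a i j c : adjacent i j ->
  vok (a ++ [:: i; j; i] ++ c) (Sixvalent, size a) /\
  word_step (a ++ [:: i; j; i] ++ c) (Sixvalent, size a) = a ++ [:: j; i; j] ++ c.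
Proof.
move=> h; rewrite /vok /word_step replace_windowE /window /= drop_size_cat //= take0 eqxx /=.
have -> : (i.+1 == j) || (j.+1 == i) by move: h; rewrite /adjacent; lia.
by split=> //; exact: (rep_mid a [:: i; j; i]).
Qed.

Lemma weight_tri a u e c : weight_step (a ++ [:: u; e] ++ c) (Trivalent, size a) =
  a ++ minn u e :: c.
Proof.
rewrite /weight_step replace_windowE /window /= drop_size_cat //= take0.
exact: (rep_mid a [:: u; e]).
Qed.

Lemma word_tri a i c : vok (a ++ [:: i; i] ++ c) (Trivalent, size a) /\
  word_step (a ++ [:: i; i] ++ c) (Trivalent, size a) = a ++ i :: c.
Proof.
rewrite /vok /word_step replace_windowE /window /= drop_size_cat //= take0 eqxx; split=> //.
exact: (rep_mid a [:: i; i]).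
Qed.

(* Passing the letter [b i] to the left through the block [b 0, ..., b (N-1)]
   turns it into [b i.+1] and leaves the block unchanged. *)
Definition pass_ms P i N : weave :=
  lmoves (P + i + 2) (N - i - 2) ++ (Sixvalent, (P + i)%N) :: lmoves P i.

Lemma split_block (bw : seq nat) i : (i.+1 < size bw)%N ->
  bw = take i bw ++ [:: nth 0 bw i; nth 0 bw i.+1] ++ drop i.+2 bw.
Proof.
move=> h; rewrite -{1}(cat_take_drop i bw) (drop_nth 0) ?(drop_nth 0 h) //; exact: ltnW.
Qed.

(** Only the 6-valent vertex acts on values: with incoming 0, u, e it gives u + e, 0, u. So the
    block keeps its weights as long as the one at position [i] is zero. *)
Lemma weight_pass p bw e q i : (i.+1 < size bw)%N -> nth 0 bw i = 0 ->
  foldl weight_step (p ++ bw ++ e :: q) (pass_ms (size p) i (size bw)) =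
  p ++ (nth 0 bw i.+1 + e)%N :: bw ++ q.
Proof.
move=> hi h0; have eb := split_block hi; rewrite h0 in eb.
set u := nth 0 bw i.+1 in eb *; set s1 := take i bw in eb; set s2 := drop i.+2 bw in eb.
have z1 : size s1 = i by rewrite size_takel //; lia.
have z2 : size s2 = (size bw - i - 2)%N by rewrite size_drop; lia.
rewrite /pass_ms foldl_cat -z2 {1}eb.
have -> : p ++ (s1 ++ [:: 0; u] ++ s2) ++ e :: q = (p ++ s1 ++ [:: 0; u]) ++ s2 ++ e :: q.
  by rewrite -!catA.
have -> : (size p + i + 2 = size (p ++ s1 ++ [:: 0; u]))%N by rewrite !size_cat z1 /=; lia.
rewrite weight_lmoves [foldl _ _ _]/=.
have -> : (p ++ s1 ++ [:: 0; u]) ++ e :: s2 ++ q = (p ++ s1) ++ [:: 0; u; e] ++ (s2 ++ q).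
  by rewrite -!catA.
have -> : (size p + i = size (p ++ s1))%N by rewrite size_cat z1.
rewrite weight_six min0n subn0 add0n subn0.
have -> : (p ++ s1) ++ [:: u + e; 0; u]%N ++ s2 ++ q = p ++ s1 ++ (u + e)%N :: ([:: 0; u] ++ s2 ++ q).
  by rewrite -!catA.
by rewrite -z1 weight_lmoves eb -!catA.
Qed.

Variables (N : nat) (b : nat -> nat).
Hypothesis b_adj : forall i, (i.+1 < N)%N -> adjacent (b i) (b i.+1).
Hypothesis b_far : forall i j, (i.+1 < j)%N -> (j < N)%N -> ((b i).+1 < b j)%N || ((b j).+1 < b i)%N.
Hypothesis N_gt0 : (0 < N)%N.

Definition wblock := mkseq b N.

Lemma size_block : size wblock = N. Proof. exact: size_mkseq. Qed.

Lemma word_pass p q i : (i.+1 < N)%N ->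
  is_weave (p ++ wblock ++ b i :: q) (pass_ms (size p) i N) (p ++ b i.+1 :: wblock ++ q) /\
  within (size p) (size q) (p ++ wblock ++ b i :: q) (pass_ms (size p) i N).
Proof.
move=> hi; have hi' : (i.+1 < size wblock)%N by rewrite size_block.
have eb := split_block hi'; rewrite !nth_mkseq ?(ltnW hi) // in eb.
set s1 := take i wblock in eb; set s2 := drop i.+2 wblock in eb.
have z1 : size s1 = i by rewrite size_takel ?size_block //; lia.
have z2 : size s2 = (N - i - 2)%N by rewrite size_drop size_block; lia.
have f2 : far (b i) s2.
  apply/allP => x /(nthP 0)[k hk <-]; rewrite z2 in hk.
  rewrite nth_drop nth_mkseq; [|lia]; apply: b_far; lia.
have f1 : far (b i.+1) s1.
  apply/allP => x /(nthP 0)[k hk <-]; rewrite z1 in hk.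
  rewrite nth_take // nth_mkseq; [|lia]; rewrite orbC; apply: b_far; lia.
have e1 : p ++ wblock ++ b i :: q = (p ++ s1 ++ [:: b i; b i.+1]) ++ s2 ++ b i :: q.
  by rewrite {1}eb -!catA.
have [h1 w1] := word_lmoves (p ++ s1 ++ [:: b i; b i.+1]) q f2.
have [h2 h2'] := word_six (p ++ s1) (s2 ++ q) (b_adj hi).
have [h3 w3] := word_lmoves p (b i :: b i.+1 :: s2 ++ q) f1.
have ez : (size p + i + 2 = size (p ++ s1 ++ [:: b i; b i.+1]))%N by rewrite !size_cat z1 /=; lia.
have ez2 : (size p + i = size (p ++ s1))%N by rewrite size_cat z1.
have e2 : (p ++ s1 ++ [:: b i; b i.+1]) ++ b i :: s2 ++ q =
    (p ++ s1) ++ [:: b i; b i.+1; b i] ++ s2 ++ q by rewrite -!catA.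
have e3 : (p ++ s1) ++ [:: b i.+1; b i; b i.+1] ++ s2 ++ q =
    p ++ s1 ++ b i.+1 :: [:: b i, b i.+1 & s2 ++ q] by rewrite -!catA.
have e4 : p ++ b i.+1 :: s1 ++ [:: b i, b i.+1 & s2 ++ q] = p ++ b i.+1 :: wblock ++ q.
  by rewrite {1}eb -!catA.
rewrite e2 in h1; rewrite e3 in h2'; rewrite e4 in h3.
rewrite z1 in h3 w3; rewrite z2 -ez in h1 w1; rewrite -ez2 in h2 h2'.
have k1 : is_weave ((p ++ s1) ++ [:: b i; b i.+1; b i] ++ s2 ++ q)
    ((Sixvalent, (size p + i)%N) :: lmoves (size p) i) (p ++ b i.+1 :: wblock ++ q).
  by apply/is_weave_cons; split=> //; rewrite h2'.
split; first by rewrite e1 /pass_ms; apply: is_weave_cat h1 k1.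
rewrite e1 /pass_ms; apply: within_cat (proj2 h1) _ _.
  apply: within_weak w1 => //; lia.
case=> [_|t ht] /=.
  by rewrite /slice take0 /= !size_cat /= size_cat; lia.
have := w3 t ht; rewrite /slice /= h2' /= !size_cat; lia.
Qed.

End Moves.

Section Passing.
Implicit Types (pre post y p q : seq nat) (ms : weave) (mw : mword).

Lemma mem_cycles_cat mw ms ms2 c : c \in cycles mw (ms ++ ms2) ->
  c \in cycles mw ms \/ [/\ (size ms < c.1)%N, (c.1 <= size ms + size ms2)%N,
    is_trivalent (nth move0 ms2 (c.1 - (size ms).+1)).1 &
    c.2 = (nth move0 ms2 (c.1 - (size ms).+1)).2].
Proof.
rewrite !mem_cycles => /orP[->|]; first by left.
move=> /andP[/andP[/andP[h0 h1] h2] h3]; rewrite size_cat in h1.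
rewrite nth_cat in h2 h3; case: (ltnP c.1.-1 (size ms)) h2 h3 => h h2 h3.
  by left; apply/orP; right; rewrite h2 h3 !andbT h0; move: h h0; clear; case: c.1.
right; rewrite (_ : c.1 - (size ms).+1 = c.1.-1 - size ms)%N; last by lia.
split=> //; [by lia|exact/eqP].
Qed.

Lemma cycles_catl mw ms ms2 c : c \in cycles mw ms -> c \in cycles mw (ms ++ ms2).
Proof.
rewrite !mem_cycles => /orP[->//|/andP[/andP[/andP[h0 h1] h2] h3]].
apply/orP; right; rewrite h0 size_cat (leq_trans h1 (leq_addr _ _)) nth_cat.
by rewrite (_ : c.1.-1 < size ms = true) ?h2; last by lia.
Qed.

Lemma cycles_bound mw ms c : c \in cycles mw ms -> (c.1 <= size ms)%N.
Proof. by rewrite mem_cycles => /orP[/andP[/eqP->]|/andP[/andP[/andP[]]]]. Qed.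

Lemma weights_catl mw ms ms2 c t : (t <= size ms)%N -> weights mw (ms ++ ms2) c t = weights mw ms c t.
Proof.
move=> h; rewrite /weights /wslice slice_catl //; case: ltnP => // hc.
by rewrite slice_catl ?(leq_trans hc) // takel_cat.
Qed.

Lemma weights_cat mw ms ms2 c : (c.1 <= size ms)%N ->
  weights mw (ms ++ ms2) c (size (ms ++ ms2)) = foldl weight_step (weights mw ms c (size ms)) ms2.
Proof.
move=> h; rewrite /weights /wslice !ltnNge h size_cat (leq_trans h (leq_addr _ _)) /= -size_cat.
by rewrite !take_size slice_catl // drop_cat; case: ltngtP h => // [_ _|-> _];
  rewrite ?foldl_cat // subnn drop0 drop_size.
Qed.

Variables (N : nat) (b : nat -> nat).
Hypothesis b_adj : forall i, (i.+1 < N)%N -> adjacent (b i) (b i.+1).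
Hypothesis b_far : forall i j, (i.+1 < j)%N -> (j < N)%N -> ((b i).+1 < b j)%N || ((b j).+1 < b i)%N.
Hypothesis N_gt0 : (0 < N)%N.
Local Notation blk := (wblock N b).

Let bw x := rcons (nseq N.-1 0) x.

Let size_bw x : size (bw x) = N.
Proof. by rewrite size_rcons size_nseq prednK. Qed.

Lemma block_last : blk = mkseq b N.-1 ++ [:: b N.-1].
Proof. by rewrite /wblock -{1}(prednK N_gt0) /mkseq -{1}addn1 iotaD map_cat. Qed.

Lemma word_absorb p q :
  is_weave (p ++ blk ++ b N.-1 :: q) [:: (Trivalent, size p + N.-1)] (p ++ blk ++ q) /\
  within (size p) (size q) (p ++ blk ++ b N.-1 :: q) [:: (Trivalent, size p + N.-1)].
Proof.
have [h1 h2] := word_tri (p ++ mkseq b N.-1) (b N.-1) q.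
rewrite size_cat size_mkseq in h1 h2; rewrite block_last.
have e1 : (p ++ mkseq b N.-1) ++ [:: b N.-1; b N.-1] ++ q =
  p ++ (mkseq b N.-1 ++ [:: b N.-1]) ++ b N.-1 :: q by rewrite -!catA.
rewrite e1 in h1 h2; split.
  by apply/is_weave_cons; split=> //; rewrite h2 -!catA; exact: is_weave_nil.
case=> // _; rewrite /slice take0 /= !size_cat /= size_mkseq; lia.
Qed.

(* The block sits between [pre] and [post]; the only cycle with a nonzero value
   on it is [v], which has value 1 on its last letter and vanishes on [post]. *)
Definition passing mw ms pre post v := [/\ is_weave (unzip1 mw) ms (pre ++ blk ++ post),
  v \in cycles mw ms & forall c, c \in cycles mw ms -> exists p q,
  [/\ weights mw ms c (size ms) = p ++ bw (c == v) ++ q, size p = size pre,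
      size q = size post & c = v -> q = nseq (size post) 0]].

(** On the block only the last weight can be nonzero, and [i] is not the last position, so
    [weight_pass] applies. *)
Lemma passing_step mw ms pre i post v : (i.+1 < N)%N -> passing mw ms pre (b i :: post) v ->
  passing mw (ms ++ pass_ms (size pre) i N) (rcons pre (b i.+1)) post v.
Proof.
move=> hi [hW hv hc]; have [h1 _] := word_pass b_adj b_far N_gt0 pre post hi; split.
- by rewrite cat_rcons; apply: is_weave_cat hW h1.
- exact: cycles_catl.
move=> c /mem_cycles_cat[hcy|[h2 h3 h4 _]]; last first.
  have nt : all (fun m => ~~ is_trivalent m.1) (pass_ms (size pre) i N).
    have nl lo cnt : all (fun m => ~~ is_trivalent m.1) (lmoves lo cnt).
      by rewrite all_rev all_map; apply/allP.
    by rewrite all_cat nl /= nl.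
  have h : (c.1 - (size ms).+1 < size (pass_ms (size pre) i N))%N by lia.
  by have := all_nthP move0 nt _ h; rewrite h4.
have [p [[|x q] [e1 e2 e3 e4]]] := hc c hcy; first by [].
exists (rcons p (nth 0 (bw (c == v)) i.+1 + x)), q.
rewrite !size_rcons e2; split=> //; first 1 last.
- by case: e3.
- by move=> /e4 [_].
rewrite weights_cat ?(cycles_bound hcy) // e1 -e2 -(size_bw (c == v)) weight_pass ?size_bw ?cat_rcons //.
by rewrite /bw nth_rcons size_nseq nth_nseq if_same (_ : (i == N.-1) = false) ?if_same //; lia.
Qed.

(** On the outgoing edge of the trivalent vertex every older cycle gets 0: the minimum has a zero on
    the block side unless the cycle is [v], and [v] vanishes on [post]. The cycle born there takes
    over the role of [v]. *)
Lemma passing_absorb mw ms pre post v : passing mw ms pre (b N.-1 :: post) v ->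
  passing mw (rcons ms (Trivalent, size pre + N.-1)) pre post ((size ms).+1, size pre + N.-1).
Proof.
rewrite -cats1 => -[hW hv hc]; have [h1 _] := word_absorb pre post.
have hW' := is_weave_cat hW h1; set m := (Trivalent, _) in hW' *; set v' := (_, _).
have hv' : v' \in cycles mw (ms ++ [:: m]).
  by rewrite mem_cycles size_cat addn1 ltnSn /= nth_cat ltnn subnn /= eqxx.
split=> // c /mem_cycles_cat[hcy|[h2 h3 h4 h5]].
  have hb := cycles_bound hcy.
  have nv : c != v' by apply: contraTneq hb => ->; rewrite -ltnNge.
  have [p [[|x q] [e1 e2 e3 e4]]] := hc c hcy; first by [].
  exists p, q; split=> //; [|by case: e3|by move/eqP: nv].
  rewrite weights_cat // e1 (negPf nv) /bw -!cats1 -!catA /= catA.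
  have -> : m = (Trivalent, size (p ++ nseq N.-1 0)) by rewrite size_cat size_nseq e2.
  rewrite (weight_tri _ (c == v) x) -!catA /=; do 2!congr (_ ++ _); congr (_ :: _).
  case: (c =P v) => [/e4[-> _]|_]; by rewrite ?minn0 ?min0n.
have ec : c = v'.
  have c1 : c.1 = (size ms).+1 by move: h3; rewrite addn1; lia.
  by rewrite [c]surjective_pairing h5 c1 subnn.
exists (nseq (size pre) 0), (nseq (size post) 0); rewrite !size_nseq; split=> //.
rewrite ec eqxx weights_eq ?size_cat ?addn1 //.
have -> : slice (unzip1 mw) (ms ++ [:: m]) (size ms).+1 = pre ++ blk ++ post.
  by have := proj2 hW'; rewrite size_cat addn1.
apply: (@eq_from_nth _ 0) => [|k]; rewrite size_mkseq !size_cat ?size_nseq ?size_bw size_block //.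
move=> hk; rewrite nth_mkseq ?size_cat ?size_block // !nth_cat !size_nseq size_bw !nth_nseq !if_same.
rewrite /bw nth_rcons size_nseq nth_nseq if_same /v' /=.
by case: ltnP => h; [lia|case: ltnP => h'; [|lia]; case: ltngtP; lia].
Qed.

(** Passing through the block produces letters [b k.+1] only, hence never its first letter. *)
Lemma b_neq0 i : (0 < i < N)%N -> b i != b 0.
Proof.
case: i => // -[|i] hi; first by have := b_adj hi; rewrite /adjacent; lia.
by have := @b_far 0 i.+2 isT hi; lia.
Qed.

(** Each letter of [y] occurs in the block, so it either passes or is absorbed. That [b 0] is
    missing from [y'] is what keeps the line or hyperplane of the flag left of the block. *)
Lemma passing_all mw ms pre y post v : passing mw ms pre (y ++ post) v -> all (mem blk) y ->
  exists ms2 y' v', [/\ passing mw (ms ++ ms2) (pre ++ y') post v',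
    within (size pre) (size post) (pre ++ blk ++ y ++ post) ms2 & all (fun i => i != b 0) y'].
Proof.
elim: y ms pre v => [|i y IH] ms pre v.
  by move=> hp _; exists [::], [::], v; rewrite !cats0; split=> //; exact: within_nil.
move=> hp /andP[/mapP[k]]; rewrite mem_iota /= => hk ei hy; subst i; rewrite cat_cons in hp *.
case: (ltnP k.+1 N) => hk1.
  have [h1 w1] := word_pass b_adj b_far N_gt0 pre (y ++ post) hk1.
  have [ms2 [y' [v' [p2 w2 hy']]]] := IH _ _ _ (passing_step hk1 hp) hy.
  exists (pass_ms (size pre) k N ++ ms2), (b k.+1 :: y'), v'; split.
  - by rewrite catA -cat_rcons.
  - apply: (within_cat (proj2 h1)); first by apply: within_weak w1; rewrite ?size_cat ?leq_addl.
    by rewrite -cat_rcons; apply: within_weak w2; rewrite ?size_rcons.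
  - by rewrite /= hy' b_neq0.
have ek : k = N.-1 by lia.
rewrite ek in hp *; have [h1 w1] := word_absorb pre (y ++ post).
have [ms2 [y' [v' [p2 w2 hy']]]] := IH _ _ _ (passing_absorb hp) hy.
exists ((Trivalent, size pre + N.-1) :: ms2), y', v'; split=> //; first by rewrite -cat_rcons.
rewrite -cat1s; apply: (within_cat (proj2 h1)) => //.
by apply: within_weak w1; rewrite ?size_cat ?leq_addl.
Qed.

(* Vertices to the right of the block do not affect it. *)
Lemma passing_start mw ms pre post : is_weave (unzip1 mw) ms (pre ++ blk ++ post) ->
  within (size pre + N) 0 (unzip1 mw) ms -> (size pre + N <= size mw)%N ->
  (forall i, (i < N)%N -> (nth (0, false) mw (size pre + i)).2 = (i == N.-1)) ->
  passing mw ms pre post (0, size pre + N.-1).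
Proof.
move=> hW hw hs hm; set v := (0, _); set L := (size pre + N)%N in hw hs.
have hv : v \in cycles mw ms.
  by rewrite mem_cycles /= hm ?eqxx ?andbT; lia.
have sz : size (unzip1 mw) = size mw by rewrite size_map.
have szL t : (t <= size ms)%N -> (L <= size (slice (unzip1 mw) ms t))%N.
  case: t => [|t] ht; first by rewrite /slice take0 /= sz.
  have := hw t ht; rewrite (size_slice_step hW ht).
  by case: (nth move0 ms t).1 => /=; lia.
(* Left of L no vertex occurs and weights stay initial; [v] stays zero to the right of L because it
   vanishes on all incoming edges of every vertex there. *)
have loc c : c \in cycles mw ms -> forall t, (t <= size ms)%N ->
    (forall e, (e < L)%N -> wt mw ms t e c = (c == (0, e))) /\
    (c = v -> forall e, (L <= e)%N -> wt mw ms t e c = 0).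
  move=> hc; elim=> [|t IH] ht.
    split=> [e he|ec e he]; first by apply: (wt0 hc); lia.
    case: (ltnP e (size mw)) => h; last by rewrite (wt_oversize hW) // /slice take0 /= sz.
    rewrite (wt0 hc) ?sz // ec /v; case: eqP => // -[]; lia.
  have [i1 i2] := IH (ltnW ht); have [w1 _] := hw t ht; split=> [e he|ec e he].
    rewrite (wt_step hW ht hc) ?(leq_trans he (szL _ ht)) // /spe (leq_trans he w1) i1 //.
    by rewrite [X in _ && X]ltn_eqF ?(leq_trans he w1) // andbF addn0.
  case: (ltnP e (size (slice (unzip1 mw) ms t.+1))) => h; last exact: (wt_oversize hW).
  have nc k : (c == (t.+1, k)) = false by rewrite ec.
  rewrite (wt_step hW ht hc h) nc addn0 /spe.
  case: ifP => _; first exact: i2.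
  case: ifP => _; last by apply: i2 => //; move: w1; case: (nth move0 ms t).1 => /=; lia.
  by rewrite (@eq_nwt _ _ (fun=> 0)) ?nwt0 // => i _; apply: i2 => //; lia.
split=> // c hc; have [l1 l2] := loc c hc _ (leqnn _).
pose g := weights mw ms c (size ms).
have sg : size g = (size pre + (N + size post))%N.
  by rewrite /g (size_weights hW) // (proj2 hW) !size_cat size_block.
exists (take (size pre) g), (drop L g); split.
- rewrite -[LHS](cat_take_drop (size pre)); congr (_ ++ _).
  rewrite -/g -[LHS](cat_take_drop N) drop_drop addnC; congr (_ ++ _).
  have sB : size (take N (drop (size pre) g)) = N by rewrite size_takel // size_drop sg; lia.
  apply: (@eq_from_nth _ 0); rewrite sB ?size_rcons ?size_nseq ?prednK // => i hN.
  rewrite nth_take // nth_drop [LHS]l1 ?ltn_add2l //.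
  rewrite /bw nth_rcons size_nseq nth_nseq if_same /v; case: ltngtP => h; last by rewrite h.
    case: eqP => // ec; move: hc; rewrite ec mem_cycles /= hm //; lia.
  by lia.
- by rewrite size_takel // sg leq_addr.
- by rewrite size_drop sg; lia.
- move=> ec; have sD : size (drop L g) = size post by rewrite size_drop sg; lia.
  apply: (@eq_from_nth _ 0); rewrite sD ?size_nseq // => i hi.
  rewrite nth_drop nth_nseq if_same; apply: l2 => //; lia.
Qed.

End Passing.

(** * Reading the decoration at an intermediate slice *)

Section Transport.
Variables (K : comUnitRingType) (d : nat).
Implicit Types (mw : mword) (ms : weave) (x : nat * nat -> K).

Lemma is_weave_catr w ms1 ms2 w1 w2 :
  is_weave w ms1 w1 -> is_weave w (ms1 ++ ms2) w2 -> is_weave w1 ms2 w2.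
Proof.
elim: ms1 w => [|m ms1 IH] w; first by case=> _ <-.
by move=> /is_weave_cons[_ h1] /is_weave_cons[_ h2]; apply: IH h1 h2.
Qed.

Variables (mw : mword) (ms ms2 ms3 : weave) (top : nat -> nat -> extK K d).
Variables (x : nat * nat -> K) (fl : nat -> nat -> nat -> extK K d).
Hypothesis hdata : weave_data mw (ms ++ ms2 ++ ms3) top x fl.

Lemma weave_data_within w1 w2 l r :
  is_weave (unzip1 mw) ms w1 -> is_weave w1 ms2 w2 -> within l r w1 ms2 ->
  (forall g, (g <= l)%N -> fl (size (ms ++ ms2)) g = fl (size ms) g) /\
  (forall g, (g <= r)%N -> fl (size (ms ++ ms2)) (size w2 - g)%N = fl (size ms) (size w1 - g)%N).
Proof.
move=> h1 h2 hw; have [_ _ hc _ _] := hdata.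
have hc' t : (t < size ms2)%N ->
    carry (nth move0 ms2 t) (slice w1 ms2 t) (fl (size ms + t)) (fl (size ms + t).+1).
  move=> ht; have := hc (size ms + t)%N; rewrite !size_cat ltn_add2l (ltn_addr _ ht) => /(_ isT).
  rewrite nth_cat ltnNge leq_addr /= addKn nth_cat ht (slice_cat _ _ (proj2 h1)).
  by rewrite slice_catl // ltnW.
have := @carry_within _ (fun t => fl (size ms + t)%N) l r w1 ms2 w2 h2 hw.
by rewrite size_cat addn0 => h; apply: h => t ht; have := hc' t ht; rewrite addnS.
Qed.

Lemma weave_data_chain w2 : is_weave (unzip1 mw) (ms ++ ms2) w2 ->
  chain w2 (fl (size (ms ++ ms2))) (mono mw (ms ++ ms2 ++ ms3) x (size (ms ++ ms2))) /\
  forall g, (g <= size w2)%N -> framed (fl (size (ms ++ ms2)) g).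
Proof.
move=> [_ hW]; have [_ _ _ hch hfr] := hdata; rewrite catA in hch hfr *.
have hs : slice (unzip1 mw) ((ms ++ ms2) ++ ms3) (size (ms ++ ms2)) = w2.
  by rewrite slice_catl.
have ht : (size (ms ++ ms2) <= size ((ms ++ ms2) ++ ms3))%N by rewrite [in leqRHS]size_cat leq_addr.
split=> [|g hg]; first by have := hch _ ht; rewrite hs.
by apply: hfr; rewrite ?hs.
Qed.

(** Cycles born below this slice do not contribute, and of the others only [v] meets the block, on
    its last letter. *)
Lemma passing_mono N b pre post v : (0 < N)%N -> passing N b mw (ms ++ ms2) pre post v ->
  forall i, (i < N)%N -> mono mw (ms ++ ms2 ++ ms3) x (size (ms ++ ms2)) (size pre + i)
    = if i == N.-1 then x v else 1%R.
Proof.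
move=> N0 [_ hv hc] i hi; rewrite catA.
have hwt c : c \in cycles mw ((ms ++ ms2) ++ ms3) ->
    wt mw ((ms ++ ms2) ++ ms3) (size (ms ++ ms2)) (size pre + i) c = (i == N.-1) && (c == v).
  move=> /mem_cycles_cat[hcy|[h _ _ _]]; last first.
    rewrite [c]surjective_pairing wt_new //; case: eqP => // -[]; rewrite ?andbF //.
    by case: (_ =P v) => [e|]; rewrite ?andbF //; have := cycles_bound hv; rewrite -e /= leqNgt h.
  have [p [q [e1 e2 _ _]]] := hc c hcy.
  rewrite /wt weights_catl // e1 nth_cat e2 ltnNge leq_addr /= addKn nth_cat size_rcons size_nseq.
  rewrite prednK // hi nth_rcons size_nseq nth_nseq if_same.
  by case: (ltngtP i N.-1) => // h; lia.
case: (i =P N.-1) => [e|/eqP/negPf e].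
  by apply: mono_delta => [|c hcy]; [exact: cycles_catl|rewrite hwt // e eqxx].
by apply: mono_zero => c hcy; rewrite hwt // e.
Qed.

End Transport.

(** * The special weave that produces the iterated product *)

Section Words.
Variables (d n : nat) (sigma : signature n).
Hypothesis d_gt2 : (2 < d)%N.
Let d_gt1 : (1 < d)%N := ltnW d_gt2.
Local Notation N := d.-1.
Variables (p m : nat).
Local Notation w := (unzip1 (bword d sigma p m)).

Lemma size_unzip_bword : size w = (m * N)%N.
Proof. by rewrite size_map size_bword. Qed.

Lemma letter_adj j i : (i.+1 < N)%N -> adjacent (letter d sigma j i) (letter d sigma j i.+1).
Proof. by rewrite /letter /adjacent; case: ifP => _; lia. Qed.

Lemma letter_far j i k : (i.+1 < k)%N -> (k < N)%N ->
  ((letter d sigma j i).+1 < letter d sigma j k)%N || ((letter d sigma j k).+1 < letter d sigma j i)%N.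
Proof. by rewrite /letter; case: ifP => _; lia. Qed.

Lemma mem_block j i : (0 < i < d)%N -> i \in wblock N (letter d sigma j).
Proof.
move=> hi; apply/mapP; exists (if sigma j then i.-1 else N - i)%N.
  by rewrite mem_iota; case: (sigma j); lia.
by rewrite /letter; case: (sigma j); lia.
Qed.

Lemma bword_split a : (a < m)%N -> w = take (a * N) w ++
  wblock N (letter d sigma (p + a)%N%:Z) ++ drop (a.+1 * N) w.
Proof.
move=> am; have hm : (a.+1 * N <= m * N)%N by rewrite leq_mul2r am orbT.
rewrite mulSn in hm *; rewrite -{1}(cat_take_drop (a * N) w); congr (_ ++ _).
rewrite -{1}(cat_take_drop N (drop (a * N) w)) drop_drop; congr (_ ++ _).
have sB : size (take N (drop (a * N) w)) = N.
  by rewrite size_takel // size_drop size_unzip_bword; lia.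
apply: (@eq_from_nth _ 0); rewrite sB ?size_block // => i hi.
by rewrite nth_take // nth_drop nth_unzip_bword // nth_mkseq.
Qed.

(* The weave [ms] has not touched the first [a] columns of the word; [rest]
   starts to the right of the region under consideration. *)
Definition stage ms a y rest := [/\ is_weave w ms (take (a * N) w ++ y ++ rest),
  within (a * N) 0 w ms & (a <= m)%N].

Lemma stage_init a : (a <= m)%N -> stage [::] a [::] (drop (a * N) w).
Proof. by move=> am; split=> //; rewrite cat_take_drop; exact: is_weave_nil. Qed.

(** The column [a'] is still intact, so it can serve as block; everything between it and [rest] is
    passed through it, and the block itself joins the part no longer touched. *)
Lemma stage_next ms a y rest a' : stage ms a y rest -> (a' < a)%N ->
  let j := ((p + a')%N%:Z)%R in let B := wblock N (letter d sigma j) in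
  exists ms2 y' v, [/\ stage (ms ++ ms2) a' y' (B ++ rest),
    passing N (letter d sigma j) (bword d sigma p m) (ms ++ ms2) (take (a' * N) w ++ y') rest v,
    all (fun i => i != letter d sigma j 0) y',
    is_weave (take (a * N) w ++ y ++ rest) ms2 (take (a' * N) w ++ y' ++ B ++ rest)
    & within (a' * N) (size rest) (take (a * N) w ++ y ++ rest) ms2].
Proof.
move=> [hW hw am] a'a j B; have a'm := leq_trans a'a am.
have N0 : (0 < N)%N by lia.
have hN : (a'.+1 * N <= a * N)%N by rewrite leq_mul2r a'a orbT.
have hm : (a * N <= m * N)%N by rewrite leq_mul2r am orbT.
have ss : size (take (a' * N) w) = (a' * N)%N.
  by rewrite size_takel // size_unzip_bword leq_mul2r (ltnW a'm) orbT.
set y0 := drop (a'.+1 * N) (take (a * N) w).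
have e0 : take (a * N) w = take (a' * N) w ++ B ++ y0.
  have := bword_split a'm; rewrite -/B => e.
  have eA : take (a'.+1 * N) w = take (a' * N) w ++ B.
    have sz : size (take (a' * N) w ++ B) = (a'.+1 * N)%N by rewrite size_cat ss size_block mulSn addnC.
    by rewrite [in LHS]e catA take_cat -sz ltnn subnn take0 cats0.
  rewrite -{1}(cat_take_drop (a'.+1 * N) (take (a * N) w)) take_takel //.
  by rewrite eA -catA.
have e1 : take (a * N) w ++ y ++ rest = take (a' * N) w ++ B ++ (y0 ++ y) ++ rest.
  by rewrite e0 -!catA.
rewrite e1 in hW *.
have hp : passing N (letter d sigma j) (bword d sigma p m) ms (take (a' * N) w)
    ((y0 ++ y) ++ rest) (0%N, (size (take (a' * N) w) + N.-1)%N).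
  apply: passing_start => //.
  - by apply: within_weak hw => //; rewrite ss; lia.
  - by rewrite ss size_bword //; lia.
  - by move=> i hi; rewrite ss nth_bword //= (_ : d.-2 = N.-1).
have hl : all (mem B) (y0 ++ y).
  have := letters_slice hW (letters_bword sigma d_gt1 p m) (leqnn _).
  rewrite (proj2 hW) /letters_in all_cat => /andP[_]; rewrite all_cat => /andP[_].
  rewrite all_cat => /andP[h _]; move: h.
  by apply: sub_all => i; apply: mem_block.
have [ms2 [y' [v [h1 h2 h3]]]] := passing_all (@letter_adj j) (@letter_far j) N0 hp hl.
have hW2 : is_weave w (ms ++ ms2) (take (a' * N) w ++ y' ++ B ++ rest).
  by case: h1; rewrite -!catA.
exists ms2, y', v; split=> //.
- split=> //; last by lia.
  apply: (within_cat (proj2 hW)); first by apply: within_weak hw; lia.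
  by apply: within_weak h2; rewrite ?ss.
- exact: is_weave_catr hW hW2.
- by rewrite -{1}ss.
Qed.

End Words.

Section Run.
Variables (d n : nat) (sigma : signature n).
Hypotheses (d_gt2 : (2 < d)%N) (adm : admissible d sigma).
Let d_gt1 : (1 < d)%N := ltnW d_gt2.
Variables (p m : nat).
Local Notation N := d.-1.
Local Notation mw := (bword d sigma p m).
Local Notation w := (unzip1 mw).

Lemma gtop_column (K : comUnitRingType) (uc : int -> 'rV[K]_d) t a : t \is a GRing.unit -> (a <= m)%N ->
  forall i, (i <= d)%N -> gtop sigma uc t p m (a * N)%N i = gF sigma uc t ((p + a)%N%:Z)%R i.
Proof.
move=> ut am i id; rewrite /gtop ltn_mul2r; have -> : (0 < N)%N by lia.
rewrite mulnK ?modnMl; last by lia.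
rewrite andTb; case: ltnP => h; first by rewrite gFm_first.
by rewrite (_ : a = m) //; lia.
Qed.

Lemma prod_last (K : comUnitRingType) (y : K) M k : (k <= M.+1)%N ->
  (\prod_(q < k) (if q == M :> nat then y else 1) = if k == M.+1 then y else 1)%R.
Proof.
move=> kM; case: (k =P M.+1) => [->|h]; last first.
  rewrite big1 // => i _; rewrite ltn_eqF //; have := ltn_ord i; lia.
by rewrite big_ord_recr /= eqxx big1 ?mul1r // => i _; rewrite ltn_eqF.
Qed.

Variables (c : bool).

(* Left action of a vector, resp. of a covector, on the levels of a flag. *)
Definition lact (K : comUnitRingType) (u : 'rV[K]_d) z := if c then wdg (iv u) z else ctr u z.
Arguments lact {K} u z.
(** To obtain level k after r factors one starts from level k-r when wedging with vectors and from
    level k+r when contracting; the end level, d or 0, is where the result becomes a scalar. *)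
Definition src k r := if c then (k - r)%N else (k + r)%N.
Definition inrange k r := if c then (r <= k < d)%N else (0 < k)%N && (k + r <= d)%N.
Definition endlevel := if c then d else 0%N.
Definition endvalue (K : comUnitRingType) (t : K) := if c then vol d t else one K d.

(** X and Y are the flags on the two sides of the block after the moves; Y was already there before
    them. Since the crossing values along the block are 1, ..., 1, x_v, the column formulas give the
    new levels of X, and the variable of [v] at the end level. *)
Lemma stage_flag ms a y rest : stage d sigma p m ms a y rest ->
  forall a', (a' < a)%N -> sigma ((p + a')%N%:Z)%R = c ->
  exists ms2 y' rest' v, [/\ stage d sigma p m (ms ++ ms2) a' y' rest', v \in cycles mw (ms ++ ms2) &
   forall (K : comUnitRingType) (uc : int -> 'rV[K]_d) t, t \is a GRing.unit ->
   forall ms3 x fl, weave_data mw (ms ++ ms2 ++ ms3) (gtop sigma uc t p m) x fl ->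
     let X := fl (size (ms ++ ms2)) (a' * N + size y')%N in
     let Y := fl (size ms) (a * N + size y)%N in
     (forall k, inrange k 1 -> lact (uc ((p + a')%N%:Z)%R) (Y (src k 1)) = X k) /\
     lact (uc ((p + a')%N%:Z)%R) (Y (src endlevel 1)) = (x v *: endvalue t)%R].
Proof.
move=> hs a' a'a ca'; have [hW0 _ am] := hs; have [ms2 [y' [v [h1 h2 h3 h4 h5]]]] := stage_next d_gt2 hs a'a.
set B := wblock _ _ in h1 h4; set j := ((p + a')%N%:Z)%R in ca' h2 h3 B h1 h4 *.
exists ms2, y', (B ++ rest), v; split=> // [|K uc t unit_t ms3 x fl hd]; first by case: h2.
cbv zeta.
have [hW1 hwi a'm] := h1; have N0 : (0 < N)%N by lia.
have sP : size (take (a' * N) w) = (a' * N)%N.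
  by rewrite size_takel // size_unzip_bword // leq_mul2r a'm orbT.
have [hch hfr] := weave_data_chain hd hW1; have hmono := passing_mono ms3 x N0 h2.
rewrite [size (_ ++ y')]size_cat sP in hmono; set s := size y' in hmono *; pose g0 := (a' * N + s)%N.
set T1 := size (ms ++ ms2) in hch hfr hmono *; set T0 := size ms; set Y := fl T0 _; pose X := fl T1 g0.
have [_ c2] := weave_data_within hd hW0 h4 h5; rewrite -/T1 -/T0 in c2.
have hl : letters_in d (take (a' * N) w ++ y' ++ B ++ rest).
  have := letters_slice hW1 (letters_bword sigma d_gt1 p m) (leqnn _).
  by rewrite (proj2 hW1).
have hd1 : weave_data mw ([::] ++ (ms ++ ms2) ++ ms3) (gtop sigma uc t p m) x fl by rewrite -catA.
have [b1 _] := weave_data_within hd1 (is_weave_nil _) hW1 hwi; rewrite -/T1 in b1.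
have [_ f0 _ _ _] := hd; rewrite /= f0 in b1.
set w1 := _ ++ _ in hch hl hfr.
have sw1 : size w1 = (g0 + N + size rest)%N by rewrite !size_cat sP size_block /g0; lia.
have nth_y q : (q < s)%N -> nth 0 w1 (a' * N + q) = nth 0 y' q.
  by move=> h; rewrite nth_cat sP ltnNge leq_addr /= addKn nth_cat h.
have nth_B q : (q < N)%N -> nth 0 w1 (g0 + q) = letter d sigma j q.
  move=> h; rewrite /w1 catA nth_cat size_cat sP -/s -/g0 ltnNge leq_addr /= addKn.
  by rewrite nth_cat size_block h nth_mkseq.
(* Walking from F_j across the letters of [y'] changes only the levels named by these letters; the
   first letter of the column is not among them. *)
have hX i : (i <= d)%N -> i \notin y' -> X i = gF sigma uc t j i.
  move=> id iy; rewrite -gtop_column // -b1 //.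
  suff h q : (q <= s)%N -> fl T1 (a' * N + q)%N i = fl T1 (a' * N)%N i by apply: h.
  elim: q => [|q IH] qs; first by rewrite addn0.
  have hq : (a' * N + q < size w1)%N by lia.
  rewrite addnS -IH; last exact: ltnW.
  have [_ [e _]] := hch _ hq; rewrite e // nth_y //.
  by apply: contraNneq iy => ->; apply: mem_nth.
have hy i : ~~ (0 < i < d)%N -> i \notin y'.
  move: hl; rewrite /w1 /letters_in all_cat => /andP[_]; rewrite all_cat => /andP[/allP h _].
  by apply: contra => /h.
have hy0 : letter d sigma j 0 \notin y'.
  by apply/negP => /(allP h3); rewrite eqxx.
pose Z q := fl T1 (g0 + q)%N; pose cf q := if q == N.-1 then x v else 1%R.
have Z0 : Z 0%N = X by rewrite /Z addn0.
have ZN : Z N = Y.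
  rewrite /Z /Y; have := c2 (size rest) (leqnn _); rewrite -/w1 sw1 addnK => ->.
  congr (fl _ _); rewrite !size_cat size_takel ?size_unzip_bword ?leq_mul2r ?am ?orbT //; lia.
have hcr q : (q < N)%N -> dcross (letter d sigma j q) (cf q) (Z q) (Z q.+1).
  move=> h; have hg : (g0 + q < size w1)%N by lia.
  by have [_] := hch _ hg; rewrite nth_B // hmono // /Z addnS.
have prodc k : (k <= N)%N -> (\prod_(q < k) cf q = if k == N then x v else 1)%R.
  by have := @prod_last K (x v) N.-1 k; rewrite prednK //; apply.
have Y0 : Y 0%N = one K d.
  rewrite -ZN /Z (chain_level d_gt1 hl hch) //; last by lia.
  by rewrite -(chain_level d_gt1 hl hch (isT : (0 == 0)%N || _) (_ : g0 <= size w1)%N) -?/X ?hX ?hy //; lia.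
have Xd : X d = vol d t by rewrite hX ?hy ?ltnn ?andbF // gFd.
have d0 : (0 < d)%N by lia.
rewrite /lact /inrange /src /endlevel /endvalue; move: ca' hcr hy0; rewrite /letter; case: c => sj hcr hy0.
  rewrite sj in hcr hy0; have X1 : X 1%N = iv (uc j).
    by rewrite hX // (gF_black d_gt1 adm) ?gF0 ?wdg1r.
  have hB := col_black d0 Z0 ZN hcr Y0.
  split=> [k /andP[k0 kd]|].
    rewrite -X1 hB; last by lia.
    by rewrite prodc; [rewrite ltn_eqF ?scale1r ?subn1 ?prednK //; lia|lia].
  by rewrite -X1 hB ?prodc ?subn1 ?eqxx ?prednK ?Xd ?leqnn.
have sj' : ~~ sigma j by rewrite sj.
rewrite sj subn0 in hcr hy0.
have XN : ctr (uc j) (X d) = (1 *: X N)%R.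
  have hk : (0 < N < d)%N by lia.
  by rewrite Xd scale1r (hX N) ?leq_pred // (gF_white d_gt1 adm) // prednK // !gFd.
have fX : framed X by apply: hfr; rewrite sw1 -addnA leq_addr.
have hB := col_white d0 fX Z0 ZN hcr XN.
split=> [k /andP[k0 kd]|]; rewrite ?addn1 ?hB; try lia.
  by rewrite mul1r prodc; [rewrite ltn_eqF ?scale1r //; lia|lia].
rewrite mul1r prodc ?leq_subr // subn0 eqxx hX // ?hy ?ltnn //.
Qed.

(** The labels are treated from right to left, each call of [stage_flag] adding one factor on the
    left. The weave and its cycle are chosen before the ring, because the local ring depends on a
    base point found only for the completed weave. *)
Lemma stage_run s a : (a <= m)%N -> sorted ltn (rcons s a) ->
  all (fun b => sigma ((p + b)%N%:Z)%R == c) s -> exists ms y rest,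
  [/\ stage d sigma p m ms (head a s) y rest,
    forall (K : comUnitRingType) (uc : int -> 'rV[K]_d) t, t \is a GRing.unit ->
    forall ms3 x fl, weave_data mw (ms ++ ms3) (gtop sigma uc t p m) x fl -> forall k, inrange k (size s) ->
    fl (size ms) (head a s * N + size y)%N k =
    foldr lact (gF sigma uc t ((p + a)%N%:Z)%R (src k (size s))) [seq uc ((p + b)%N%:Z)%R | b <- s] &
    s != [::] -> (size s <= d)%N -> exists2 v, v \in cycles mw ms & forall (K : comUnitRingType) (uc : int -> 'rV[K]_d) t, t \is a GRing.unit ->
    forall ms3 x fl, weave_data mw (ms ++ ms3) (gtop sigma uc t p m) x fl ->
    foldr lact (gF sigma uc t ((p + a)%N%:Z)%R (src endlevel (size s))) [seq uc ((p + b)%N%:Z)%R | b <- s] =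
    (x v *: endvalue t)%R].
Proof.
move=> am; elim: s => [|b s IH] /=.
  move=> _ _; exists [::], [::], (drop (a * N) w); split=> // [|K uc t ut ms3 x fl [_ e0 _ _ _] k]; first exact: stage_init.
  rewrite e0 addn0 /inrange /src => hk; rewrite gtop_column //; last by move: hk; case: c; lia.
  by case: c; rewrite ?subn0 ?addn0.
move=> hs /andP[/eqP cb ha]; have [ms [y [rest [h1 h2 _]]]] := IH (path_sorted hs) ha.
have hb : (b < head a s)%N by case: (s) hs => /= [|b' s'] /andP[].
have [ms2 [y' [rest' [v [k1 k2 k3]]]]] := stage_flag h1 hb cb.
have hY (K : comUnitRingType) (uc : int -> 'rV[K]_d) t ms3 x fl : t \is a GRing.unit ->
    weave_data mw ((ms ++ ms2) ++ ms3) (gtop sigma uc t p m) x fl -> forall k, inrange k (size s) ->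
    fl (size ms) (head a s * N + size y)%N k =
    foldr lact (gF sigma uc t ((p + a)%N%:Z)%R (src k (size s))) [seq uc ((p + b)%N%:Z)%R | b <- s].
  by rewrite -catA => ut; exact: h2.
exists (ms ++ ms2), y', rest'; split=> // [K uc t ut ms3 x fl hd k hk|_ sd].
  have hd' := hd; rewrite -catA in hd'; have [e _] := k3 K uc t ut ms3 x fl hd'; rewrite -e; last first.
    by move: hk; clear; rewrite /inrange; case: c; lia.
  rewrite (hY K uc t ms3 x fl ut hd); last by move: hk; rewrite /inrange /src; case: c; lia.
  by congr (lact _ (foldr _ (gF _ _ _ _ _) _)); rewrite /src; case: c; lia.
exists v => // K uc t ut ms3 x fl hd; have hd' := hd; rewrite -catA in hd'.
have [_ <-] := k3 K uc t ut ms3 x fl hd'.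
rewrite (hY K uc t ms3 x fl ut hd); last by rewrite /inrange /src /endlevel; case: c; lia.
by congr (lact _ (foldr _ (gF _ _ _ _ _) _)); rewrite /src /endlevel; case: c; lia.
Qed.

Lemma special_weave s a : (a <= m)%N -> sorted ltn (rcons s a) ->
  all (fun b => sigma ((p + b)%N%:Z)%R == c) s -> (0 < size s <= d)%N ->
  exists ms0 v, v \in cycles mw ms0 /\ exists w1, is_weave w ms0 w1 /\ 
    forall (K : comUnitRingType) (uc : int -> 'rV[K]_d) t, t \is a GRing.unit ->
    forall ms3 x fl, weave_data mw (ms0 ++ ms3) (gtop sigma uc t p m) x fl ->
    foldr lact (gF sigma uc t ((p + a)%N%:Z)%R (src endlevel (size s))) [seq uc ((p + b)%N%:Z)%R | b <- s] =
    (x v *: endvalue t)%R.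
Proof.
move=> am hs hc /andP[s0 sd]; have [ms [y [rest [[h1 _ _] _ h3]]]] := stage_run am hs hc.
have [|v hv h] := h3 _ sd; first by case: (s) s0.
by exists ms, v; split=> //; exists (take (head a s * N) w ++ y ++ rest).
Qed.

End Run.

Local Open Scope ring_scope.

(** * Rational functions, their values and the local ring at a point *)

Lemma fraction_repr (R : idomainType) (f : {fraction R}) :
  exists a b : R, b != 0 /\ f = tofrac a / tofrac b.
Proof.
set r := generic_quotient.repr f; exists (frac r).1, (frac r).2; split; first exact: denom_ratioP.
suff e : f * tofrac (frac r).2 = tofrac (frac r).1.
  by rewrite -e mulfK // tofrac_eq0 denom_ratioP.
rewrite -[f in LHS]reprK -/r; unlock tofrac; rewrite -[LHS]FracField.pi_mul.
apply/eqP; rewrite FracField.equivf_def /FracField.mulf !numden_Ratio ?mulf_neq0 ?denom_ratioP ?oner_eq0 //.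
by rewrite !mulr1 mulrC.
Qed.

Section Fractions.
Variable R : idomainType.
Implicit Types a b : R.

Lemma fraction_add a b a' b' : b != 0 -> b' != 0 ->
  tofrac a / tofrac b + tofrac a' / tofrac b' = tofrac (a * b' + a' * b) / tofrac (b * b').
Proof. by move=> h h'; rewrite tofracD !tofracM addf_div ?tofrac_eq0. Qed.

Lemma fraction_mul a b a' b' :
  tofrac a / tofrac b * (tofrac a' / tofrac b') = tofrac (a * a') / tofrac (b * b').
Proof. by rewrite !tofracM mulf_div. Qed.

Lemma fraction_opp a b : - (tofrac a / tofrac b) = tofrac (- a) / tofrac b.
Proof. by rewrite tofracN mulNr. Qed.

Lemma fraction_inv a b : (tofrac a / tofrac b)^-1 = tofrac b / tofrac a.
Proof. exact: invf_div. Qed.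

Lemma fraction_neq0 a b : a != 0 -> b != 0 -> tofrac a / tofrac b != 0.
Proof. by move=> h h'; rewrite mulf_neq0 ?invr_eq0 ?tofrac_eq0. Qed.

Lemma fraction_eq a b a' b' : b != 0 -> b' != 0 ->
  tofrac a / tofrac b = tofrac a' / tofrac b' -> a * b' = a' * b.
Proof.
move=> h h' /eqP; rewrite eqr_div ?tofrac_eq0 // -!tofracM tofrac_eq => /eqP e; exact: e.
Qed.

End Fractions.

Lemma pair_inv (K1 K2 : fieldType) (g : K1) (y : K2) : ((g, y) : K1 * K2)%type \is a GRing.unit ->
  y != 0 /\ ((g, y) : K1 * K2)%type^-1 = (g^-1, y^-1).
Proof.
move=> h; have /andP[_ /= uy] := h; rewrite -unitfE; split=> //.
by rewrite /GRing.inv /= /pair_invr ifT.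
Qed.

Lemma pair_unit_fst (K1 K2 : fieldType) (x : (K1 * K2)%type) : x \is a GRing.unit -> x.1 != 0.
Proof. by move=> /andP[h _]; rewrite -unitfE. Qed.

Lemma pair_unit (K1 K2 : fieldType) (g : K1) (y : K2) : g != 0 -> y != 0 ->
  ((g, y) : K1 * K2)%type \is a GRing.unit.
Proof. by move=> hg hy; apply/andP; split; rewrite /= unitfE. Qed.

Section Values.
Variables (F : fieldType) (V : vectType F) (n : nat) (sigma : signature n).
Local Notation Q := (ratfun V n).
Local Notation pt := (point V sigma).
Implicit Types (f g : Q) (u : pt).

Lemma evalpM (a b : coord_ring V n) u : @evalp F V n sigma (a * b) u = evalp a u * evalp b u.
Proof. exact: mevalM. Qed.

Lemma evalpD (a b : coord_ring V n) u : @evalp F V n sigma (a + b) u = evalp a u + evalp b u.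
Proof. exact: mevalD. Qed.

Lemma evalpN (a : coord_ring V n) u : @evalp F V n sigma (- a) u = - evalp a u.
Proof. exact: mevalN. Qed.

Lemma value_tofrac a u : has_value (tofrac a : Q) u (evalp a u).
Proof. by exists a, 1; split; rewrite ?tofrac1 ?divr1 // /evalp meval1 ?oner_eq0 ?divr1. Qed.

Lemma evalp_neq0 (b : coord_ring V n) u : @evalp F V n sigma b u != 0 -> b != 0.
Proof. by apply: contraNneq => ->; rewrite /evalp meval0. Qed.

Lemma den_neq0 (b : coord_ring V n) u : @evalp F V n sigma b u != 0 -> tofrac b != 0 :> Q.
Proof. by move=> h; rewrite tofrac_eq0 (evalp_neq0 h). Qed.

Lemma valueD f g u x y : has_value f u x -> has_value g u y -> has_value (f + g) u (x + y).
Proof.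
move=> [a [b [-> hb ->]]] [a' [b' [-> hb' ->]]]; exists (a * b' + a' * b), (b * b'); split.
- by apply: fraction_add; [exact: (evalp_neq0 hb)|exact: (evalp_neq0 hb')].
- by rewrite (evalpM b b') mulf_neq0.
- rewrite (evalpD (a * b') (a' * b)) (evalpM a b') (evalpM a' b) (evalpM b b'). exact: addf_div.
Qed.

Lemma valueN f u x : has_value f u x -> has_value (- f) u (- x).
Proof.
move=> [a [b [-> hb ->]]]; exists (- a), b.
by split; rewrite ?(evalpN a) ?mulNr //; exact: fraction_opp.
Qed.

Lemma valueM f g u x y : has_value f u x -> has_value g u y -> has_value (f * g) u (x * y).
Proof.
move=> [a [b [-> hb ->]]] [a' [b' [-> hb' ->]]]; exists (a * a'), (b * b'); split.
- exact: fraction_mul.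
- by rewrite (evalpM b b') mulf_neq0.
- by rewrite (evalpM a a') (evalpM b b') mulf_div.
Qed.

Lemma value_unique f u x y : has_value f u x -> has_value f u y -> x = y.
Proof.
move=> [a [b [-> hb ->]]] [a' [b' [e hb' ->]]].
have h := fraction_eq (evalp_neq0 hb) (evalp_neq0 hb') e.
by apply/eqP; rewrite eqr_div // -(evalpM a b') -(evalpM a' b) h.
Qed.

Lemma value_neq0 f u x : has_value f u x -> x != 0 -> f != 0.
Proof.
move=> [a [b [-> hb ->]]]; rewrite mulf_eq0 negb_or => /andP[ha _].
by apply: fraction_neq0; [exact: (evalp_neq0 ha)|exact: (evalp_neq0 hb)].
Qed.

Lemma valueV f u x : has_value f u x -> x != 0 -> has_value f^-1 u x^-1.
Proof.
move=> [a [b [-> hb ->]]] hx; have ha : evalp a u != 0 by apply: contraNneq hx => ->; rewrite mul0r.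
by exists b, a; split; rewrite ?(invf_div (evalp a u)) //; exact: fraction_inv.
Qed.

Lemma value0 u : has_value (0 : Q) u 0.
Proof. by have := value_tofrac 0 u; rewrite tofrac0 /evalp meval0. Qed.

Lemma value1 u : has_value (1 : Q) u 1.
Proof. by have := value_tofrac 1 u; rewrite tofrac1 /evalp meval1. Qed.

Section LocalRing.
Variable u : pt.

(** The local ring is realised as the ring of pairs of a rational function and its value at [u], so
    that the residue map is the second projection. *)
Definition regular_at : pred (Q * F)%type := fun fx => boolp.asbool (has_value fx.1 u fx.2).

Lemma regular_divring : divring_closed regular_at.
Proof.
split=> [|[f x] [g y] /boolp.asboolP hf /boolp.asboolP hg|[f x] [g y] /boolp.asboolP hf /boolp.asboolP hg].
- by apply/boolp.asboolP; apply: value1.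
- by apply/boolp.asboolP; apply: valueD => //; apply: valueN.
have [ug|ug] := boolP ((g, y) \is a GRing.unit); last first.
  by rewrite invr_out //; apply/boolp.asboolP; apply: valueM.
have [y0 e] := pair_inv ug; rewrite e.
by apply/boolp.asboolP; apply: valueM => //; apply: valueV.
Qed.

HB.instance Definition _ := GRing.isDivringClosed.Build (Q * F)%type regular_at regular_divring.

Record local_ring := LocalRing { local_val :> (Q * F)%type; _ : local_val \in regular_at }.
HB.instance Definition _ := [isSub for local_val].
HB.instance Definition _ := [Choice of local_ring by <:].
HB.instance Definition _ := [SubChoice_isSubComUnitRing of local_ring by <:].

Definition residue : {rmorphism local_ring -> F} := (snd \o val).

(** If f = a/b has a nonzero value then [a] does not vanish at [u] either, and b/a is regular
    there. *)
Lemma residue_local (a : local_ring) : residue a != 0 -> a \is a GRing.unit.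
Proof.
move=> ha; have hf : (val a).1 != 0.
  by apply: (@value_neq0 _ u (val a).2) => //; case: a {ha} => a /= /boolp.asboolP.
have ua : val a \is a GRing.unit.
  by have := pair_unit hf ha; rewrite -surjective_pairing.
have hV : (val a)^-1 \in regular_at by rewrite rpredV; case: a {ha hf ua}.
apply/unitrP; exists (LocalRing hV).
by split; apply: val_inj; rewrite rmorphM rmorph1 /= ?mulVr ?mulrV.
Qed.

Lemma residueP (a : local_ring) : has_value (val a).1 u (residue a).
Proof. by case: a => a /= /boolp.asboolP. Qed.

Lemma local_ring_exists f x : has_value f u x -> exists a : local_ring, (val a).1 = f.
Proof. by move=> /boolp.asboolP h; exists (LocalRing (h : (f, x) \in regular_at)). Qed.

End LocalRing.

(** * Generic properties and specialisation *)

Section Generic.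
Implicit Types P : pt -> Prop.

Lemma generically_and P1 P2 : generically P1 -> generically P2 -> generically (fun u => P1 u /\ P2 u).
Proof.
move=> [f f0 hf] [g g0 hg]; exists (f * g); first by rewrite mulf_neq0.
by move=> u; rewrite evalpM mulf_eq0 negb_or => /andP[/hf ? /hg].
Qed.

Lemma generically_sub P1 P2 : (forall u, P1 u -> P2 u) -> generically P1 -> generically P2.
Proof. by move=> h [f f0 hf]; exists f => // u /hf/h. Qed.

Lemma generically_true P : (forall u, P u) -> generically P.
Proof. by move=> h; exists 1 => [|u _]; rewrite ?oner_eq0. Qed.

Lemma generically_seq (I : eqType) (s : seq I) (P : I -> pt -> Prop) :
  (forall i, i \in s -> generically (P i)) -> generically (fun u => forall i, i \in s -> P i u).
Proof.
elim: s => [|i s IH] h; first exact: generically_true.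
have hi := h i (mem_head i s); have hs := IH (fun j hj => h j (mem_behead (s := i :: s) hj)).
apply: generically_sub (generically_and hi hs) => u [h1 h2] j.
by rewrite inE => /orP[/eqP->|/h2].
Qed.

Lemma generically_all (I : finType) (P : I -> pt -> Prop) :
  (forall i, generically (P i)) -> generically (fun u => forall i, P i u).
Proof.
move=> h; apply: generically_sub (generically_seq (s := enum I) (fun i _ => h i)) => u hu i.
by apply: hu; rewrite mem_enum.
Qed.

Lemma generically_lt m (P : nat -> pt -> Prop) :
  (forall i, (i < m)%N -> generically (P i)) -> generically (fun u => forall i, (i < m)%N -> P i u).
Proof.
move=> h; have := @generically_seq _ (iota 0 m) P.
move=> /(_ _)/generically_sub; apply=> [u hu i im|i].
  by apply: hu; rewrite mem_iota.
by rewrite mem_iota => /h.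
Qed.

(** The value at [u], and 0 where the function is not regular. *)
Definition spec (u : pt) f : F :=
  if boolp.pselect (exists y, has_value f u y) is left h then projT1 (boolp.cid h) else 0.

Lemma specP f u y : has_value f u y -> spec u f = y.
Proof.
move=> h; rewrite /spec; case: boolp.pselect => [h'|[]]; last by exists y.
by case: boolp.cid => z /= hz; apply: value_unique hz h.
Qed.

Definition rel_at u f y := has_value f u y.

Lemma generically_regular f : generically (fun u => has_value f u (spec u f)).
Proof.
have [a [b [b0 ->]]] := fraction_repr f; exists b => // u hb.
have h : has_value (tofrac a / tofrac b) u (evalp a u / evalp b u) by exists a, b.
by rewrite (specP h).
Qed.

Lemma generically_neq0 f : f != 0 -> generically (fun u => spec u f != 0).
Proof.
have [a [b [b0 ->]]] := fraction_repr f => h0.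
have a0 : a != 0 by apply: contraNneq h0 => ->; rewrite tofrac0 mul0r.
exists (a * b); first by rewrite mulf_neq0.
move=> u; rewrite evalpM mulf_eq0 negb_or => /andP[ha hb].
have h : has_value (tofrac a / tofrac b) u (evalp a u / evalp b u) by exists a, b.
by rewrite (specP h) mulf_neq0 ?invr_eq0.
Qed.

End Generic.

Section Specialization.
Variables (d : nat) (u0 : pt).
Local Notation A := (local_ring u0).
Implicit Types (a b : A).

Definition value_at u a y := has_value (val a).1 u y.

Lemma ring_rel_value u : ring_rel (value_at u).
Proof.
split=> [||a x b y|a x|a x b y]; rewrite /value_at.
- by rewrite raddf0; apply: value0.
- by rewrite rmorph1; apply: value1.
- by rewrite raddfD; apply: valueD.
- by rewrite raddfN; apply: valueN.
- by rewrite rmorphM; apply: valueM.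
Qed.

Definition aspec u a := spec u (val a).1.
Definition xspec u (x : extK A d) : extK F d := [ffun S => aspec u (x S)].

Lemma aspecP u a y : value_at u a y -> aspec u a = y.
Proof. exact: specP. Qed.

Lemma xspecP u (x : extK A d) y : ext_rel (value_at u) x y -> xspec u x = y.
Proof. by move=> h; apply/ffunP=> S; rewrite ffunE; apply: aspecP. Qed.

Lemma generically_value a : generically (fun u => value_at u a (aspec u a)).
Proof. exact: generically_regular. Qed.

Lemma generically_xvalue (x : extK A d) : generically (fun u => ext_rel (value_at u) x (xspec u x)).
Proof.
apply: generically_all => S; apply: generically_sub (generically_value (x S)) => u.
by rewrite ffunE.
Qed.

Lemma generically_vvalue (v : 'rV[A]_d) :
  generically (fun u => vec_rel (value_at u) v (\row_i aspec u (v 0 i))).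
Proof.
apply: generically_all => i; apply: generically_sub (generically_value (v 0 i)) => u.
by rewrite mxE.
Qed.

Lemma generically_unit a : a \is a GRing.unit -> generically (fun u => aspec u a != 0).
Proof.
move=> ua; apply: generically_neq0.
by apply: (@pair_unit_fst _ _ (val a)); apply: rmorph_unit.
Qed.

Lemma aspec_prod u (I : eqType) (r : seq I) (x : I -> A) (f : I -> nat) :
  (forall i, i \in r -> value_at u (x i) (aspec u (x i))) ->
  value_at u (\prod_(i <- r) x i ^+ f i) (\prod_(i <- r) aspec u (x i) ^+ f i).
Proof.
have R := ring_rel_value u; elim: r => [|i r IH] h.
  by rewrite !big_nil; apply: (ring_rel1 R).
rewrite !big_cons; apply: (ring_relM R); last by apply: IH => j jr; apply: h; rewrite inE jr orbT.
elim: (f i) => [|m IHm]; rewrite ?expr0 ?exprS; first exact: (ring_rel1 R).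
by apply: (ring_relM R) => //; apply: h; exact: mem_head.
Qed.

(** A crossing is witnessed by finitely many elements of the local ring, and their identities
    persist wherever all of them are regular. *)
Lemma generically_dcross k c (G H : nat -> extK A d) : dcross k c G H ->
  generically (fun u => dcross k (aspec u c) (fun i => xspec u (G i)) (fun i => xspec u (H i))).
Proof.
move=> [h [v [e1 e2]]].
have := generically_and (generically_and (generically_xvalue (G k.-1)) (generically_xvalue (G k)))
  (generically_and (generically_and (generically_value c) (generically_xvalue (G k.+1))) (generically_vvalue v)).
apply: generically_sub => u [[h1 h2] [[h3 h4] h5]]; have R := ring_rel_value u; split=> [i id ik|].
  by rewrite h.
exists (\row_i aspec u (v 0 i)); split.
  by apply: xspecP; rewrite e1; apply: ext_rel_rw.
have := xspecP (ext_rel_rw R h2 h5); rewrite e2 => <-.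
by apply: xspecP; apply: ext_relZ.
Qed.

Lemma ext_rel_W u (g : nat -> 'rV[A]_d) (g' : nat -> 'rV[F]_d) k :
  (forall i, (i < k)%N -> vec_rel (value_at u) (g i) (g' i)) -> ext_rel (value_at u) (W g k) (W g' k).
Proof.
have R := ring_rel_value u; elim: k => [|k IH] h; first exact: ext_rel_base.
by apply: ext_rel_rw => //; [apply: IH => i ik; apply: h; exact: leqW|exact: h].
Qed.

Lemma generically_framed (G : nat -> extK A d) : framed G ->
  generically (fun u => framed (fun i => xspec u (G i))).
Proof.
move=> [g [l [ut ul e]]].
have := generically_and (generically_and (generically_unit ut) (generically_value (topc (W g d))))
 (generically_and
   (generically_lt (m := d.+1) (fun i _ => generically_and (generically_unit (ul i)) (generically_value (l i))))
   (generically_lt (m := d) (fun i _ => generically_vvalue (g i)))).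
apply: generically_sub => u [[h1 h2] [h3 h4]]; have R := ring_rel_value u.
exists (fun k => \row_i aspec u (g k 0 i)), (fun i => if (i <= d)%N then aspec u (l i) else 1).
split=> [|i|i id].
- have hW := ext_rel_W h4; have := aspecP (hW [set: 'I_d]).
  by rewrite /topc => <-; rewrite unitfE.
- by case: ifP => id; rewrite ?unitr1 // unitfE; apply: (proj1 (h3 _ _)).
rewrite id; apply: xspecP; rewrite e //; apply: ext_relZ => //.
  by apply: (proj2 (h3 _ _)).
by apply: ext_rel_W => j ji; apply: h4; apply: leq_trans ji id.
Qed.

End Specialization.
End Values.

(** * Comparison with the mixed wedge and the given flags *)

Section Contraction.
Variables (K : comUnitRingType) (d : nat).
Hypothesis d_odd : odd d.

Lemma sh_sign_swap (i : 'I_d) (T : {set 'I_d}) : i \notin T ->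
  sh_sign K [set i] T = (-1) ^+ #|T| * sh_sign K T [set i].
Proof.
move=> iT; rewrite !sh_signE big_set1 -sum1_card -prodrXr -big_split /=.
apply: eq_bigr => j jT; rewrite big_set1; case: ltngtP => [_|_|/val_inj e].
- by rewrite expr0 expr1 mulr1.
- by rewrite expr1 expr0 mulrNN mulr1.
- by rewrite -e jT in iT.
Qed.

(** Moving one index past the d-1 others costs no sign because d is odd; so contractions from the
    left and from the right agree on the top degree. *)
Lemma sh_sign_compl (i : 'I_d) : sh_sign K [set i] (~: [set i]) = sh_sign K (~: [set i]) [set i].
Proof.
rewrite sh_sign_swap ?inE ?eqxx // cardsC1 card_ord -signr_odd.
by rewrite (_ : odd d.-1 = false) ?expr0 ?mul1r //; case: d d_odd i => // d' /= /negPf-> _.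
Qed.

End Contraction.

Section Bridge.
Variables (F : fieldType) (V : vectType F) (n : nat) (sigma : signature n) (e : ext V).
Local Notation d := (\dim (fullv : {vspace V})).
Hypotheses (d_gt2 : (2 < d)%N) (d_odd : odd d) (vol_e : volume_form e) (adm : admissible d sigma).
Let d_gt1 : (1 < d)%N := ltnW d_gt2.
Local Notation et := (e [set: 'I_d]).

Definition pcoords (u : point V sigma) (j : int) : 'rV[F]_d :=
  \row_k factor_coord (u (factor_index sigma j)) k.

Lemma e_vol : e = vol d et.
Proof. by apply: homog_top; case: vol_e. Qed.

Lemma et_neq0 : et != 0.
Proof.
case: vol_e => _; apply: contraNneq => h; rewrite e_vol h /vol scale0r //.
Qed.

Lemma inV_iv (v : V) : inV v = iv (\row_k coord (vbasis fullv) k v).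
Proof. by rewrite ivE; apply: eq_bigr => i _; rewrite mxE. Qed.

Lemma psi_ctr (f : 'Hom(V, F^o)) : psi e f = ctr (\row_k (f (vbasis fullv)`_k : F)) e.
Proof.
apply/ffunP => S; rewrite /psi sum_ffunE ffunE {2}e_vol.
rewrite [RHS]big_mkcond /=; apply: eq_bigr => i _; rewrite !ffunE mxE.
rewrite /GRing.scale /= -[shsgn _ _]/(sh_sign F _ _) sh_sign_compl //.
have [-> | nS] := eqVneq S (~: [set i]).
  have -> : i \notin ~: [set i] by rewrite !inE eqxx.
  by rewrite setUCr eqxx; ring.
rewrite mulr0; case: ifP => // iS.
have [h|] := eqVneq (i |: S) setT; last by rewrite !mulr0.
case/eqP: nS; apply/setP => x; have := in_setT x; rewrite -h !inE.
by case: (eqVneq x i) => [->|_ /= ->] //; rewrite (negPf iS).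
Qed.

(** For the term b_S with S the complement of i, the subset placed first must be complementary to
    the support of [y] in V; removing it from S leaves that support without i. The signs then
    combine to the one of [ctr]. *)
Lemma cap_psi (f : 'Hom(V, F^o)) (y : ext V) :
  cap e (psi e f) y = ctr (\row_k (f (vbasis fullv)`_k : F)) y.
Proof.
have dE A : det e (wedge (eb A) y) = sh_sign F A (~: A) * y (~: A) / et.
  rewrite /det ffunE (bigD1 A) ?subsetT //= ffunE eqxx setTD mulr1 big1 ?addr0 // => B /andP[_ BA].
  by rewrite ffunE (negPf BA) mulr0 mul0r.
pose c (i : 'I_d) : F := sh_sign F [set i] (~: [set i]) * f (vbasis fullv)`_i * et.
have psiE S : psi e f S = \sum_i c i * (S == ~: [set i])%:R.
  by rewrite /psi sum_ffunE; apply: eq_bigr => i _; rewrite !ffunE.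
pose g (S A : {set 'I_d}) : F := sh_sign F A (S :\: A) * (sh_sign F A (~: A) * y (~: A) / et).
apply/ffunP => T; rewrite ffunE /cap sum_ffunE.
transitivity (\sum_i c i * \sum_(A : {set 'I_d} | A \subset ~: [set i])
    g (~: [set i]) A * (T == ~: [set i] :\: A)%:R).
  transitivity (\sum_S \sum_i c i * (S == ~: [set i])%:R *
      (\sum_(A : {set 'I_d} | A \subset S) g S A * (T == S :\: A)%:R)).
    apply: eq_bigr => S _; rewrite sum_ffunE -mulr_suml -psiE mulr_sumr; apply: eq_bigr => A _.
    by rewrite !ffunE dE /GRing.scale /= /g !mulrA.
  rewrite exchange_big; apply: eq_bigr => i _ /=; rewrite (bigD1 (~: [set i])) //= eqxx mulr1.
  rewrite [X in _ + X]big1 ?addr0 // => S /negPf->; by rewrite mulr0 mul0r.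
rewrite [RHS]big_mkcond /=; apply: eq_bigr => i _; rewrite mxE; case: ifPn => iT; last first.
  rewrite big1 ?mulr0 // => A _; case: eqP => [h|]; last by rewrite mulr0.
  by rewrite negbK h !inE eqxx andbF in iT.
have iT' : T \subset ~: [set i] by rewrite subsetC sub1set inE.
set A0 := ~: [set i] :\: T; have eA : ~: [set i] :\: A0 = T by rewrite setDDr setDv set0U (setIidPr iT').
rewrite (bigD1 A0) ?subsetDl //= eA eqxx mulr1 big1 ?addr0 => [|A /andP[hA AA]]; last first.
  case: eqP => [h|]; last by rewrite mulr0.
  by case/eqP: AA; rewrite /A0 h setDDr setDv set0U (setIidPr hA).
have eC : ~: A0 = i |: T by rewrite setCD setCK setUC.
have iA0 : i \notin A0 by rewrite !inE eqxx andbF.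
have d1 : [disjoint [set i] & T] by rewrite disjoints1.
have d2 : [disjoint A0 & T].
  by rewrite -setI_eq0; apply/eqP/setP => x; rewrite !inE; case: (x \in T); rewrite ?andbF.
have eI : ~: [set i] = A0 :|: T by rewrite -{1}(setID (~: [set i]) T) (setIidPr iT') setUC.
have cA : (#|A0| + #|T|)%N = d.-1.
  by have := cardsC1 i; rewrite card_ord eI cardsU (disjoint_setI0 d2) cards0 subn0 => <-.
(* The two parts have d-1 elements in all, an even number. *)
have sg : (-1) ^+ #|A0| * (-1) ^+ #|T| = 1 :> F.
  rewrite -exprD cA -signr_odd (_ : odd d.-1 = false) ?expr0 //.
  by have := d_odd; rewrite -{1}(prednK (ltnW d_gt1)) /= => /negPf.
rewrite /g /c eA eC eI sh_signUr // sh_signUr // !sh_sign_swap //.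
have s1 := sh_sign_sq F A0 [set i]; have s2 := sh_sign_sq F A0 T.
move: sg s1 s2 et_neq0; move: (sh_sign F A0 [set i]) (sh_sign F A0 T) (sh_sign F T [set i]) => a b c0.
move: (y _) (_ ^+ #|A0|) (_ ^+ #|T|) (f _) et => Y m1 m2 fi t1 sg s1 s2 t0.
transitivity (a * a * (b * b) * (m1 * m2) * (fi * c0 * Y)); first by field.
by rewrite s1 s2 sg !mul1r.
Qed.

Lemma color_mod (j q : int) : sigma (j + q * n%:Z) = sigma j.
Proof.
have h m i : sigma (i + (m * n)%N%:Z) = sigma i.
  elim: m i => [|m IH] i; first by rewrite mul0n addr0.
  by rewrite mulSn PoszD addrA IH color_periodic.
case: q => m; first by rewrite -PoszM h.
by rewrite -(h m.+1) NegzE mulNr -PoszM subrK.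
Qed.

Lemma factor_index_label (j : int) : exists q : int, (factor_index sigma j).+1%:Z = j + q * n%:Z.
Proof.
exists (- ((j - 1) %/ n%:Z)%Z); have n0 : (0 < n)%N by apply: leq_trans (signature_size sigma).
rewrite /= -addn1 PoszD gez0_abs ?modz_ge0 //; last by rewrite -lt0n.
by rewrite {1}/modz; ring.
Qed.

Lemma color_factor_index (j : int) : sigma (factor_index sigma j).+1%:Z = sigma j.
Proof. by have [q ->] := factor_index_label j; apply: color_mod. Qed.

Lemma factor_index_mod (j q : int) : factor_index sigma (j + q * n%:Z) = factor_index sigma j.
Proof. by apply: val_inj => /=; rewrite addrAC modzDr modzMDr || rewrite addrAC addrC modzMDl. Qed.

Lemma pcoords_mod u (j q : int) : pcoords u (j + q * n%:Z) = pcoords u j.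
Proof. by rewrite /pcoords factor_index_mod. Qed.

Lemma mwedge_factor c (x : factor V c) k (y : ext V) : (k < d)%N -> (if c then k.+1 < d else true)%N ->
  mwedge e (factor_ext e x) (k, y) =
    if c then (k.+1, wdg (iv (\row_i factor_coord x i)) y)
    else if k == 0%N then (d.-1, wdg (ctr (\row_i factor_coord x i) e) y)
    else (k.-1, ctr (\row_i factor_coord x i) y).
Proof.
case: c x => x kd ck; rewrite /mwedge /=; first by rewrite add1n ck inV_iv.
have [-> | k0] := posnP k; first by rewrite addn0 ifT ?psi_ctr //; lia.
by rewrite ifF ?cap_psi; [congr (_, _)|]; lia.
Qed.

Variable u : point V sigma.
Local Notation uc := (pcoords u).

Lemma mixed_productS (j : int) m : mixed_product e u j m.+1 =
  mwedge e (factor_ext e (u (factor_index sigma j))) (mixed_product e u (j + 1) m).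
Proof.
have e1 : iota 0 m.+2 = 0%N :: map (addn 1) (iota 0 m.+1) by rewrite -iotaDl.
rewrite /mixed_product e1; move: (iota 0 m.+1) => s; rewrite /= addr0; congr mwedge.
by elim: s => //= i s ->; rewrite PoszD addrA.
Qed.

(** The degree is tracked along with the value: it is the residue still to be reached by the
    remaining factors, so identifying degree d with degree 0 agrees with the recursion of [stop]. *)
Lemma mixed_product_gprod m j k : (0 < k < d)%N -> stop d sigma j k = m ->
  mixed_product e u j m = (k, gprod sigma uc et j m).
Proof.
have fE j' k' (y : ext V) := @mwedge_factor _ (u (factor_index sigma j')) k' y.
elim: m j k => [|m IH] j k hk em; have /andP[k0 kd] := hk.
  rewrite /mixed_product /= addr0 fE; [|exact: ltnW d_gt1|by case: (sigma _)].
  rewrite -/(pcoords u j) color_factor_index /= /gprod1.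
  have [sj|sj] := boolP (sigma j); have /(stopP j adm)[] := kd; rewrite em.
    by rewrite hits0_black // => /eqP-> _; rewrite wdg1r.
  by rewrite hits0_white // => /eqP-> _; rewrite wdg1r -e_vol.
have [sj|sj] := boolP (sigma j).
  have k1 : (k != 1)%N.
    by apply/eqP => ek; move: em; rewrite stop0 // hits0_black // ek.
  have es : stop d sigma (j + 1) k.-1 = m.
    by apply/eq_add_S; rewrite -em (@stop_step d n sigma adm j k k.-1) ?hits0_black ?sj //=; lia.
  rewrite mixed_productS (IH (j + 1) k.-1) //; last by lia.
  rewrite fE; [|lia|by rewrite color_factor_index sj prednK].
  by rewrite -/(pcoords u j) color_factor_index /= sj prednK.
have k1 : (k != d.-1)%N.
  by apply/eqP => ek; move: em; rewrite stop0 // hits0_white // ek.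
have es : stop d sigma (j + 1) k.+1 = m.
  apply/eq_add_S; rewrite -em (@stop_step d n sigma adm j k k.+1) ?hits0_white ?(negPf sj) //=; lia.
rewrite mixed_productS (IH (j + 1) k.+1) //; last by lia.
rewrite fE; [|lia|by rewrite color_factor_index (negPf sj)].
by rewrite -/(pcoords u j) color_factor_index /= (negPf sj).
Qed.

Lemma Fflag_gF j k : (k <= d)%N -> Fflag e u j k = gF sigma uc et j k.
Proof.
rewrite /Fflag /gF leq_eqVlt => hk; case: posnP => // k0; case: eqVneq hk => /= [_ _|kd hk].
  exact: e_vol.
by rewrite (@mixed_product_gprod _ j k) // k0.
Qed.

Lemma Fmid_gFm j k i : (i <= d)%N -> Fmid e u j k i = gFm sigma uc et j k i.
Proof. by move=> id; rewrite /Fmid /gFm !Fflag_gF. Qed.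

Lemma beta_bword p q : beta V sigma p q = bword d sigma p (q - p).
Proof. by []. Qed.

Lemma size_beta_flags p q : size (beta_flags e u p q) = ((q - p) * d.-1).+1.
Proof.
by rewrite size_rcons (size_blocks (f := fun j => [seq Fmid e u j%:Z k | k <- iota 1 d.-1]) (b := d.-1)) // => j;
  rewrite size_map size_iota.
Qed.

Lemma nth_beta_flags p q g i : (p <= q)%N -> (g <= (q - p) * d.-1)%N -> (i <= d)%N ->
  nth (fun=> 0) (beta_flags e u p q) g i = gtop sigma uc et p (q - p) g i.
Proof.
move=> pq hg id; have sb : forall j, size [seq Fmid e u j%:Z k | k <- iota 1 d.-1] = d.-1.
  by move=> j; rewrite size_map size_iota.
rewrite /gtop nth_rcons (size_blocks (f := fun j => [seq Fmid e u j%:Z k | k <- iota 1 d.-1]) (b := d.-1)) //.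
case: ltnP => h; last by rewrite eqn_leq hg h /= subnKC // Fflag_gF.
have [a [r [eg am rd ea er]]] := bword_decomp d_gt1 h.
rewrite ea er eg (nth_blocks _ (f := fun j => [seq Fmid e u j%:Z k | k <- iota 1 d.-1])) //.
by rewrite (nth_map 0%N) ?size_iota // nth_iota // Fmid_gFm.
Qed.

Lemma vdet_wdg (s : seq int) : all sigma s ->
  vdet e [seq vec u j | j <- s] = topc (foldr (fun v x => wdg (iv v) x) (one F d) [seq uc j | j <- s]) / et.
Proof.
move=> hs; rewrite /vdet /det; congr (_ / _); congr (topc _); move: hs.
elim: s => //= j s IH /andP[sj hs]; rewrite IH // inV_iv; congr (wdg (iv _) _).
apply/rowP => k; rewrite !mxE /vec; move: (u (factor_index sigma j)).
by rewrite color_factor_index sj.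
Qed.

Lemma pairing_cv (i j : int) : sigma i -> ~~ sigma j ->
  covec u j (vec u i) = pair_cv (uc j) (uc i) :> F.
Proof.
move=> si sj; rewrite /covec /vec.
have -> : pair_cv (uc j) (uc i) = \sum_k factor_coord (u (factor_index sigma j)) k * factor_coord (u (factor_index sigma i)) k.
  by apply: eq_bigr => k _; rewrite !mxE.
move: (u (factor_index sigma j)) (u (factor_index sigma i)); rewrite !color_factor_index si (negPf sj) /= => f v.
rewrite {1}(coord_vbasis (memvf v)) linear_sum; apply: eq_bigr => k _.
by rewrite linearZ mulrC.
Qed.

End Bridge.

(** * Iterated contractions of the volume form as determinants *)

Section CovectorDeterminant.
Variable K : comUnitRingType.

(** The inclusion of the exterior algebra of the coordinate hyperplane that omits the basis vector
    [c]. *)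
Definition emb d (c : 'I_d.+1) (x : extK K d) : extK K d.+1 :=
  [ffun S : {set 'I_d.+1} => if c \in S then 0 else x (lift c @^-1: S)].

Lemma big_lift d (c : 'I_d.+1) (P : pred 'I_d.+1) (G : 'I_d.+1 -> K) :
  \sum_(i | P i) G i = (if P c then G c else 0) + \sum_(i | P (lift c i)) G (lift c i).
Proof.
by rewrite big_mkcond (bigD1_ord c) //= -big_mkcond.
Qed.

Lemma sh_sign_lift d (c : 'I_d.+1) (S : {set 'I_d.+1}) i : c \notin S ->
  sh_sign K S [set lift c i] = sh_sign K (lift c @^-1: S) [set i].
Proof.
move=> cS; have e : S = lift c @: (lift c @^-1: S).
  apply/setP => x; apply/idP/imsetP => [xS|[y]]; last by rewrite inE => h ->.
  case: (unliftP c x) => [y e|e]; last by rewrite -e xS in cS.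
  by exists y; rewrite // inE -e.
rewrite {1}e !sh_signE big_imset /=; last by move=> x y _ _; apply: lift_inj.
by apply: eq_bigr => a _; rewrite !big_set1 /= !ltnNge leq_bump2.
Qed.

Lemma ctr_emb d (c : 'I_d.+1) (f : 'rV[K]_d.+1) (x : extK K d) :
  ctr f (emb c x) = emb c (ctr (\row_i f 0 (lift c i)) x).
Proof.
apply/ffunP => S; rewrite !ffunE; case: ifPn => cS.
  by rewrite big1 // => i _; rewrite ffunE !inE cS orbT mulr0.
rewrite (big_lift c) cS ffunE setU11 mulr0 add0r.
apply: eq_big => [i|i iS]; first by rewrite inE.
rewrite mxE ffunE !inE (negPf cS) orbF (negPf (neq_lift _ _)) sh_sign_lift //.
congr (_ * x _); apply/setP => y; rewrite !inE (inj_eq (@lift_inj _ c)) //.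
Qed.

Lemma ctr_base_top d (f : 'rV[K]_d.+1) :
  ctr f (base K [set: 'I_d.+1]) = \sum_(c < d.+1) ((-1) ^+ (d + c) * f 0 c) *: emb c (base K [set: 'I_d]).
Proof.
apply/ffunP => S; rewrite sum_ffunE ffunE big_mkcond /=; apply: eq_bigr => c _.
rewrite !ffunE /GRing.scale /=; case: (boolP (c \in S)) => cS /=; first by rewrite mulr0.
have -> : (c |: S == setT) = (lift c @^-1: S == setT).
  apply/eqP/eqP => /setP h; apply/setP => x; rewrite in_setT.
    by have := h (lift c x); rewrite !inE (eq_sym _ c) (negPf (neq_lift _ _)).
  by case: (unliftP c x) => [y ->|->]; rewrite !inE ?eqxx //; have := h y; rewrite !inE => ->; rewrite orbT.
case: eqP => [h|]; rewrite ?mulr0 // !mulr1 mulrC; congr (_ * _).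
have -> : S = ~: [set c].
  apply/setP => x; rewrite !inE; case: (unliftP c x) => [y ->|->]; last by rewrite (negPf cS) eqxx.
  by rewrite (eq_sym _ c) neq_lift; have := in_setT y; rewrite -h inE.
rewrite sh_signE (eq_bigr (fun a : 'I_d.+1 => (-1) ^+ (c < a)%N)) => [|a _]; last by rewrite big_set1.
have -> : \prod_(a in ~: [set c]) (-1 : K) ^+ (c < a)%N = \prod_(a < d) (-1) ^+ (c <= a)%N.
  rewrite big_mkcond (bigD1_ord c) //= !inE eqxx mul1r; apply: eq_bigr => a _.
  have -> : (c < lift c a)%N = (c <= a)%N by rewrite /= /bump; case: (leqP c a); lia.
  by rewrite !inE (eq_sym _ c) neq_lift.
have -> : \prod_(a < d) (-1 : K) ^+ (c <= a)%N = (-1) ^+ (d - c).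
  rewrite prodrXr; congr (_ ^+ _); move: (nat_of_ord c) => c0; elim: (d) => [|m IH]; first by rewrite big_ord0.
  by rewrite big_ord_recr /= IH; case: (leqP c0 m); lia.
by rewrite -signr_odd -[RHS]signr_odd oddB ?oddD // -ltnS.
Qed.

Lemma ctr_sum (I : Type) (r : seq I) d (f : 'rV[K]_d) (x : I -> extK K d) :
  ctr f (\sum_(i <- r) x i) = \sum_(i <- r) ctr f (x i).
Proof. by elim: r => [|i r IH]; rewrite ?big_nil ?ctr0 // !big_cons ctrD IH. Qed.

Lemma ctrs_sum (I : Type) (r : seq I) d (s : seq 'rV[K]_d) (x : I -> extK K d) :
  foldr (@ctr K d) (\sum_(i <- r) x i) s = \sum_(i <- r) foldr (@ctr K d) (x i) s.
Proof. by elim: s => //= f s ->; rewrite ctr_sum. Qed.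

Lemma ctrsZ d (s : seq 'rV[K]_d) a (x : extK K d) :
  foldr (@ctr K d) (a *: x) s = a *: foldr (@ctr K d) x s.
Proof. by elim: s => //= f s ->; rewrite ctrZ. Qed.

Lemma ctrs_emb d c (s : seq 'rV[K]_d.+1) (x : extK K d) : foldr (@ctr K d.+1) (emb c x) s =
  emb c (foldr (@ctr K d) x [seq \row_i (f : 'rV[K]_d.+1) 0 (lift c i) | f <- s]).
Proof. by elim: s => //= f s ->; rewrite ctr_emb. Qed.

(** The last row is contracted first and yields its cofactor expansion by [ctr_base_top]; the
    remaining contractions take place in the coordinate hyperplanes. *)
Lemma ctrs_det d (M : 'M[K]_d) :
  foldr (@ctr K d) (base K setT) [seq row i M | i <- enum 'I_d] set0 = \det M.
Proof.
elim: d M => [|d IH] M.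
  rewrite det_mx00 (size0nil (_ : size (enum 'I_0) = 0)) ?size_enum_ord //= ffunE.
  by case: eqP => // -[]; apply/setP => -[].
rewrite enum_ordSr map_rcons foldr_rcons ctr_base_top ctrs_sum sum_ffunE (expand_det_row _ ord_max).
apply: eq_bigr => c _; rewrite ctrsZ ctrs_emb ffunE /GRing.scale /= ffunE inE.
rewrite [RHS]mulrA [M _ _ * _]mulrC !mxE; congr (_ * _).
rewrite -IH (_ : lift c @^-1: set0 = set0); last by apply/setP => x; rewrite !inE.
apply: (congr1 (fun s => foldr (@ctr K d) (base K setT) s set0)).
rewrite -2!map_comp; apply: eq_map => i /=; apply/rowP => k; rewrite !mxE.
by congr (M _ _); apply: val_inj; rewrite /= /bump leqNgt ltn_ord.
Qed.

End CovectorDeterminant.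

Section DualDeterminant.
Variables (F : fieldType) (V : vectType F) (n : nat) (sigma : signature n) (e : ext V).
Local Notation d := (\dim (fullv : {vspace V})).
Hypothesis (vol_e : volume_form e).

Lemma dual_det_ctr (u : point V sigma) (s : seq int) : all (fun j => ~~ sigma j) s -> size s = d ->
  dual_det e [seq covec u j | j <- s] =
  (foldr (@ctr F d) e [seq pcoords u j | j <- s] : ext V) set0.
Proof.
move=> hs sd; rewrite /dual_det -ctrs_det [in RHS](e_vol vol_e) /vol ctrsZ ffunE.
congr (_ * _); apply: (congr1 (fun s => foldr (@ctr F d) (base F setT) s set0)).
set M := (\matrix_(r, c) _); have sz : size [seq row i M | i <- enum 'I_d] = d by rewrite size_map size_enum_ord.
apply: (@eq_from_nth _ 0) => [|i]; rewrite sz; first by rewrite size_map sd.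
move=> id.
rewrite (nth_map (Ordinal id)) ?size_enum_ord // (nth_map 0) ?sd //.
have sj : ~~ sigma s`_i by have /all_nthP := hs; apply; rewrite sd.
apply/rowP => k; rewrite !mxE nth_enum_ord // (nth_map 0) ?sd // /covec.
by move: (u _); rewrite color_factor_index (negPf sj).
Qed.

End DualDeterminant.

(** * The generic point, and cluster variables from a decoration over the local ring *)

Section GenericPoint.
Variables (F : fieldType) (V : vectType F) (n : nat) (sigma : signature n) (e : ext V).
Local Notation d := (\dim (fullv : {vspace V})).
Hypotheses (d_gt2 : (2 < d)%N) (d_odd : odd d) (vol_e : volume_form e) (adm : admissible d sigma).
Let d_gt1 : (1 < d)%N := ltnW d_gt2.
Local Notation et := (e [set: 'I_d]).
Variable u0 : point V sigma.
Local Notation A := (local_ring u0).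

Fact gen_regular (a : coord_ring V n) : (tofrac a, evalp a u0) \in regular_at u0.
Proof. exact/boolp.asboolP/value_tofrac. Qed.

Definition gen (a : coord_ring V n) : A := LocalRing (gen_regular a).

Lemma value_gen u a : value_at u (gen a) (evalp a u).
Proof. exact: value_tofrac. Qed.

(** The tautological point: its coordinates are the coordinate functions, regarded in the local ring
    at u0. *)
Definition gcoords (j : int) : 'rV[A]_d :=
  \row_k gen 'X_(mxvec_index (factor_index sigma j) k).
Definition gvol : A := gen (mpolyC _ et).

Lemma value_gcoords u j : vec_rel (value_at u) (gcoords j) (pcoords u j).
Proof.
move=> k; rewrite !mxE; have := value_gen u 'X_(mxvec_index (factor_index sigma j) k).
by rewrite /evalp mevalXU /coords mxvecE mxE.
Qed.

Lemma value_gvol u : value_at u gvol et.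
Proof. by have := value_gen u (mpolyC _ et); rewrite /evalp mevalC. Qed.

Lemma value_gF u j k :
  ext_rel (value_at u) (gF sigma gcoords gvol j k) (gF sigma (pcoords u) et j k).
Proof.
apply: rel_gF; [exact: ring_rel_value|exact: value_gcoords|exact: value_gvol].
Qed.

Lemma value_gtop u p m g i :
  ext_rel (value_at u) (gtop sigma gcoords gvol p m g i) (gtop sigma (pcoords u) et p m g i).
Proof. by rewrite /gtop /gFm; do 2?[case: ifP => _]; exact: value_gF. Qed.

Lemma residue_value (a : A) y : value_at u0 a y -> residue u0 a = y.
Proof. by move=> h; apply: value_unique (residueP a) h. Qed.

Lemma ext_map_value x y : ext_rel (value_at u0) x y -> ext_map (residue u0) x = y :> extK F d.
Proof. by move=> h; apply/ffunP => S; rewrite ffunE; apply: residue_value. Qed.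

Lemma gvol_unit : gvol \is a GRing.unit.
Proof. by apply: residue_local; rewrite (residue_value (value_gvol u0)) (et_neq0 vol_e). Qed.

Lemma iv_inV (v : 'rV[F]_d) : exists y : V, inV y = iv v.
Proof.
exists (\sum_i v 0 i *: (vbasis fullv)`_i); rewrite inV_iv; congr iv; apply/rowP => k.
by rewrite mxE coord_sum_free ?(basis_free (vbasisP _)).
Qed.

Lemma framed_neq0 (G : nat -> extK F d) k : framed G -> (k <= d)%N -> G k != 0.
Proof.
move=> fG kd; apply/eqP => h; have := framed_reg (c := 1) fG kd.
by rewrite h scaler0 => /(_ erefl)/eqP; rewrite oner_eq0.
Qed.

Lemma framed_decorated (G : flag V) : framed (G : nat -> extK F d) ->
  G 0%N = one F d -> G d = vol d et -> decorated_flag e G.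
Proof.
move=> fG G0 Gd; have [g [l [_ ul hl]]] := fG; split=> // [|k /andP[_ kd]|k /andP[k0 kd]].
- by rewrite Gd [RHS](e_vol vol_e).
- split; last by apply: framed_neq0; rewrite // ltnW.
  by rewrite hl ?(ltnW kd) //; apply: homogZ; apply: homog_W.
have [k1 k2] : (k <= d)%N /\ (k.+1 <= d)%N by lia.
have [y ey] := iv_inV ((l k.+1 / l k) *: g k); exists y.
rewrite ey; change (G k.+1 = rw (G k) ((l k.+1 / l k) *: g k)).
by rewrite !hl // rwZr rwZl scalerA divrK.
Qed.

Lemma dcross_position k c (G H : flag V) : (0 < k < d)%N -> c != 0 -> framed (G : nat -> extK F d) ->
  framed (H : nat -> extK F d) -> dcross k c (G : nat -> extK F d) H ->
  relative_position k G H /\ crossing_value k G H c.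
Proof.
move=> /andP[k0 kd] c0 fG fH [h [v [e1 e2]]]; split; last first.
  by have [y ey] := iv_inV v; exists y; rewrite ey.
split=> [|a ea]; first by move=> i id ik; rewrite h.
have : a *: (c *: G k.+1) = 0 by rewrite -e2 -rwZl -ea e1 rw_sq.
move/eqP; rewrite scalerA scaler_eq0 (negPf (framed_neq0 fG kd)) orbF mulf_eq0 (negPf c0) orbF => /eqP a0.
by have := framed_neq0 fH (ltnW kd); rewrite ea a0 scale0r eqxx.
Qed.

Section Cluster.
Variables (p q : nat) (ms : weave) (w' : seq nat).
Hypothesis le_pq : (p <= q)%N.
Local Notation mw := (bword d sigma p (q - p)).
Local Notation w := (unzip1 mw).
Local Notation top := (gtop sigma gcoords gvol p (q - p)).
Hypothesis hweave : is_weave w ms w'.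
Variables (x : nat * nat -> A) (fl : nat -> nat -> nat -> extK A d).
Hypothesis hdata : weave_data mw ms top x fl.

(** A flag is a function on all of nat, and [decoration] asks for equality of such functions. Above
    level d the flags are therefore copied from a region of the top slice, and [origin] says which
    one. *)
Fixpoint origin t : nat -> nat :=
  if t is t'.+1 then
    let m := nth move0 ms t' in
    spl m.2 (in_valency m.1) (out_valency m.1) (fun=> 0%N) (origin t')
  else id.

(** Finitely many identities and units of the local ring are involved, so at a generic point all of
    them specialise and the units stay nonzero. The rational functions [D] may differ from the
    variables [x] as long as their values agree generically. *)
Lemma cluster_of_weave_data (D : nat * nat -> ratfun V n) :
  (forall c, c \in cycles mw ms -> generically (fun u => has_value (D c) u (aspec u (x c)))) ->
  @cluster_variables F V e n sigma p q ms (fun c => D (cycle_of c)).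
Proof.
move=> hD; have [ux f0 hcarry hchain hframed] := hdata.
have hl t : (t <= size ms)%N -> letters_in d (slice w ms t).
  exact: (letters_slice hweave (letters_bword sigma d_gt1 p (q - p))).
have hG1 : generically (fun u : point V sigma => forall c, c \in cycles mw ms ->
    has_value (D c) u (aspec u (x c)) /\ (aspec u (x c) != 0 /\ value_at u (x c) (aspec u (x c)))).
  apply: generically_seq => c hc; apply: generically_and; first exact: hD.
  by apply: generically_and; [exact: generically_unit|exact: generically_value].
have hG2 : generically (fun u : point V sigma => forall t, (t < (size ms).+1)%N ->
    forall k, (k < (size (slice w ms t)).+1)%N -> framed (fun i => xspec u (fl t k i)) /\
    ((k < size (slice w ms t))%N -> dcross (nth 0%N (slice w ms t) k)
      (aspec u (mono mw ms x t k)) (fun i => xspec u (fl t k i)) (fun i => xspec u (fl t k.+1 i)))).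
  apply: generically_lt => t ht; apply: generically_lt => k hk; apply: generically_and.
    by apply: generically_framed; apply: hframed.
  case: (ltnP k (size (slice w ms t))) => hk'; last first.
    exact: generically_true.
  have [_ hd] := hchain t ht k hk'.
  by apply: generically_sub (generically_dcross hd).
apply: generically_sub (generically_and hG1 hG2) => u [h1 h2].
have R := ring_rel_value u0 u.
have low t g i : (t <= size ms)%N -> (g <= size (slice w ms t))%N -> (i == 0%N) || (i == d) ->
    fl t g i = top 0%N i.
  move=> ht hg hi; rewrite (chain_level d_gt1 (hl t ht) (hchain t ht)) //.
  by elim: t ht {hg} => [|t IH] ht; [rewrite f0|rewrite (proj1 (hcarry t ht)) // IH // ltnW].
pose topu := nth (fun=> 0) (beta_flags e u p q).
exists (fun c => aspec u (x (cycle_of c))),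
  (fun t g k => if (k <= d)%N then xspec u (fl t g k) else topu (origin t g) k); split.
  by move=> c; have hc := h1 _ (mem_nth (0%N, 0%N) (ltn_ord c)); case: hc => ? [].
have frm t g : (t <= size ms)%N -> (g <= size (slice w ms t))%N ->
    framed (fun k => if (k <= d)%N then xspec u (fl t g k) else topu (origin t g) k : extK F d).
  move=> ht hg; have [g0 [l [uT ul hG]]] := proj1 (h2 t ht g hg).
  by exists g0, l; split=> // i id; rewrite id hG.
split.
- move=> g; rewrite (size_bword sigma d_gt1) => hg; apply: boolp.funext => k.
  case: ifP => // kd; rewrite nth_beta_flags // f0.
  by apply: xspecP; apply: value_gtop.
- move=> t ht; have [c1 c2] := hcarry t ht; case em : (nth move0 ms t) c1 c2 => [v k] /= c1 c2.
  split=> [g gk|g hg]; apply: boolp.funext => i; case: ifP => _.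
  + by rewrite c1.
  + by rewrite em spl_left.
  + by rewrite c2.
  + by rewrite em spl_right //; case: (v).
- move=> t g ht hg; apply: framed_decorated; first exact: frm.
    rewrite /= low //; apply: xspecP; rewrite (_ : one F d = gtop sigma (pcoords u) et p (q - p) 0 0).
      exact: value_gtop.
    by rewrite /gtop /gFm; do 2?case: ifP.
  rewrite leqnn low ?eqxx ?orbT //.
  rewrite (_ : vol d et = gtop sigma (pcoords u) et p (q - p) 0 d); first by apply: xspecP; apply: value_gtop.
  by rewrite /gtop /gFm; do 2?case: ifP => _; rewrite gFd.
move=> t k ht hk i; have hk' : (k <= size (slice w ms t))%N by exact: ltnW.
have hi : (0 < i < d)%N by have /all_nthP := hl t ht; apply.
have [_ /(_ hk) hdc] := h2 t ht k hk'.
have em : aspec u (mono mw ms x t k) =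
    \prod_(c < size (cycles mw ms)) aspec u (x (cycle_of c)) ^+ nth 0%N (weights mw ms (cycle_of c) t) k.
  rewrite (aspecP (@aspec_prod _ _ _ _ _ _ _ (cycles mw ms) x (wt mw ms t k) _)); first by rewrite (big_nth (0%N, 0%N)) big_mkord.
  by move=> c /h1[_ []].
rewrite -em; apply: dcross_position => //; [|exact: frm|exact: frm|].
  rewrite em; apply/prodf_neq0 => c _; apply: expf_neq0.
  by have [_ []] := h1 _ (mem_nth (0%N, 0%N) (ltn_ord c)).
apply: dcross_ext hdc => // j jd; by rewrite jd.
Qed.

End Cluster.
End GenericPoint.

(** * The base point common to both weaves *)

Section Windows.
Variables (F : fieldType) (d n : nat) (sigma : signature n).
Hypotheses (d_gt2 : (2 < d)%N) (adm : admissible d sigma).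
Let d_gt1 : (1 < d)%N := ltnW d_gt2.
Local Notation E := (extK F d).
Local Notation N := d.-1.

Lemma column_path p m (T : nat -> nat -> E) C a : chain (unzip1 (bword d sigma p m)) T C -> (a < m)%N ->
  col_path sigma (p + a)%N%:Z (fun r => T (a * N + r)%N) (fun r => C (a * N + r)%N).
Proof.
move=> hT am r hr; have hg : (a * N + r < size (unzip1 (bword d sigma p m)))%N.
  rewrite size_map (size_bword sigma d_gt1); have : (a.+1 * N <= m * N)%N by rewrite leq_mul2r am orbT.
  by rewrite mulSn; lia.
by have := hT _ hg; rewrite nth_unzip_bword // addnS.
Qed.

Variables (H : int -> nat -> E) (uc : int -> 'rV[F]_d) (t : F).
Hypothesis gF_H : forall j, propto (gF sigma uc t j) (H j).

(** Inside a column each level of a flag is that of one of the two ends, on both sides of the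
    comparison, so proportionality at the ends of the columns is enough. *)
Lemma window_propto p m (T : nat -> nat -> E) C : chain (unzip1 (bword d sigma p m)) T C ->
  (forall a, (a <= m)%N -> forall i, (i <= d)%N -> T (a * N)%N i = H (p + a)%N%:Z i) ->
  forall g, (g <= m * N)%N -> propto (gtop sigma uc t p m g) (T g).
Proof.
move=> hT hH g hg i id; rewrite /gtop; case: ltnP => h; last first.
  by rewrite (_ : g = m * N)%N; [rewrite hH //; apply: gF_H|lia].
have [a [r [eg am rd ea er]]] := bword_decomp d_gt1 h; rewrite ea er eg.
have hp := column_path hT am; have rd' : (r < d)%N by lia.
rewrite (col_levels d_gt1 hp rd' id) /gFm /= addn0.
have e : (p + a)%N%:Z + 1 = (p + a.+1)%N%:Z by rewrite addnS -addn1 PoszD.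
case: ifP => _; first by rewrite hH ?(ltnW am) //; apply: gF_H.
by rewrite e addnC -mulSn hH //; apply: gF_H.
Qed.

End Windows.

Section BasePoint.
Variables (F : fieldType) (V : vectType F) (n : nat) (sigma : signature n) (e : ext V).
Local Notation d := (\dim (fullv : {vspace V})).
Hypotheses (d_gt2 : (2 < d)%N) (d_odd : odd d) (vol_e : volume_form e) (adm : admissible d sigma).
Let d_gt1 : (1 < d)%N := ltnW d_gt2.
Local Notation et := (e [set: 'I_d]).
Local Notation N := d.-1.
Local Notation E := (extK F d).

Lemma factor_exists c (r : 'rV[F]_d) : exists x : factor V c, forall k, factor_coord x k = r 0 k.
Proof.
case: c.
  exists (\sum_i r 0 i *: (vbasis fullv)`_i : V) => k.
  by rewrite /= coord_sum_free ?(basis_free (vbasisP _)).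
exists (\sum_i r 0 i *: linfun (coord (vbasis fullv) i : V -> F^o)) => k /=.
rewrite sum_lfunE (bigD1 k) //= scale_lfunE lfunE /= coord_free ?(basis_free (vbasisP _)) // eqxx.
rewrite big1 ?addr0 => [|i ik]; first by rewrite /GRing.scale /= mulr1.
rewrite scale_lfunE lfunE /= coord_free ?(basis_free (vbasisP _)) //.
case: (_ =P _) => [h|_]; last by rewrite scaler0.
by move: ik; rewrite -val_eqE /= h eqxx.
Qed.

Lemma point_exists (r : 'I_n -> 'rV[F]_d) :
  exists u : point V sigma, forall j, pcoords u j = r (factor_index sigma j).
Proof.
exists (fun i : 'I_n => projT1 (boolp.cid (factor_exists (sigma i.+1%:Z) (r i)))) => j.
by apply/rowP => k; rewrite mxE; case: boolp.cid => x /=; apply.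
Qed.

Variables (p q : nat) (ms1 ms2 : weave) (b : seq nat).
Hypotheses (lt_pq : (p < q)%N) (lt_qp : (q < p + n)%N).
Local Notation m1 := (q - p)%N.
Local Notation m2 := (p + n - q)%N.
Hypotheses (hw1 : is_weave (unzip1 (bword d sigma p m1)) ms1 b)
           (hw2 : is_weave (unzip1 (bword d sigma q m2)) ms2 (rev b)).

(* The flags at the bottom of the second weave are those of the first one in
   reverse order, so that the flags at the two tops form a closed chain. *)
Lemma weaves_decorated : exists u0 : point V sigma,
  (exists x fl, weave_data (bword d sigma p m1) ms1
     (gtop sigma (gcoords u0) (gvol e u0) p m1) x fl) /\
  (exists x fl, weave_data (bword d sigma q m2) ms2
     (gtop sigma (gcoords u0) (gvol e u0) q m2) x fl).
Proof.
have hlb : letters_in d b.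
  have := letters_slice hw1 (letters_bword sigma d_gt1 p m1) (leqnn _).
  by rewrite (proj2 hw1).
have hlr : letters_in d (rev b) by rewrite /letters_in all_rev.
have [flb [cb [hcb eb]]] := chain_from hlb (framed_std d F).
have fb0 : framed (flb 0%N) by rewrite eb; exact: framed_std.
have fb2 : framed (flb (size b - 0)%N) by rewrite subn0; apply: (chain_framed hlb hcb).
have [H1 [C1 [h1 k1 e1]]] := chain_lift d_gt1 (letters_bword sigma d_gt1 p m1) hw1 hcb fb0.
have hcr := chain_rev d_gt1 hlb fb0 hcb.
have [H2 [C2 [h2 k2 e2]]] := chain_lift d_gt1 (letters_bword sigma d_gt1 q m2) hw2 hcr fb2.
have [a1 z1] := chain_ends hw1 k1; have [a2 z2] := chain_ends hw2 k2.
rewrite e1 (size_unzip_bword sigma d_gt2) in z1; rewrite e1 in a1.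
rewrite e2 size_rev subnn (size_unzip_bword sigma d_gt2) in z2; rewrite e2 subn0 in a2.
have [c1 f1] := h1 0%N (leq0n _); have [c2 f2] := h2 0%N (leq0n _).
rewrite /slice take0 /= in c1; rewrite /slice take0 /= in c2.
(* The offset of [j] from [p] modulo n; offsets below [m1] are served by the first top word, the
   others by the second. *)
pose r j := `|((j - p%:Z) %% n%:Z)%Z|%N.
pose H j := if (r j < m1)%N then H1 0%N (r j * N)%N else H2 0%N ((r j - m1) * N)%N.
have n0 : (0 < n)%N by lia.
have rn j : (r j < n)%N by rewrite -ltz_nat gez0_abs ?modz_ge0 ?ltz_pmod //; lia.
have rE j : exists k : int, j = (p + r j)%N%:Z + k * n%:Z.
  exists ((j - p%:Z) %/ n%:Z)%Z; rewrite PoszD gez0_abs ?modz_ge0 //; last by lia.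
  by have := divz_eq (j - p%:Z) n%:Z; lia.
have r_add a : (a < n)%N -> r (p + a)%N%:Z = a.
  by move=> an; rewrite /r PoszD addrAC subrr add0r modz_small //; lia.
have H_mod j k : H (j + k * n%:Z) = H j by rewrite /H /r addrAC modzDr || rewrite /H /r addrAC addrC modzMDl.
(* At [a = m1] the two tops meet: extreme flags are constant along a weave, and the right end of the
   first bottom is the left end of the second. *)
have HE1 a : (a <= m1)%N -> H (p + a)%N%:Z = H1 0%N (a * N)%N.
  move=> ha; rewrite /H r_add; last by lia.
  by case: ltnP => h //; rewrite (_ : a = m1) ?subnn ?z1 ?a2 //; lia.
have HE2 a : (a <= m2)%N -> H (q + a)%N%:Z = H2 0%N (a * N)%N.
  move=> ha; have [ha'|ha'] := ltnP a m2.
    rewrite (_ : (q + a)%N = (p + (m1 + a))%N); last by lia.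
    by rewrite /H r_add ?ltnNge ?leq_addr /= ?addKn //; lia.
  have -> : (q + a)%N%:Z = (p + 0)%N%:Z + 1 * n%:Z by lia.
  by rewrite H_mod HE1 // a1 (_ : a = m2) ?z2 //; lia.
have lw1 := letters_bword sigma d_gt1 p m1; have lw2 := letters_bword sigma d_gt1 q m2.
have bnd a m : (a <= m)%N -> (a * N <= m * N)%N by move=> h; rewrite leq_mul2r h orbT.
have Hlev j (i : nat) : (i == 0%N) || (i == d) -> H j i = flb 0%N i.
  move=> hi; rewrite /H; case: ltnP => h.
    by rewrite (chain_level d_gt1 lw1 c1 hi) ?a1 // (size_unzip_bword sigma d_gt2) bnd // ltnW.
  rewrite (chain_level d_gt1 lw2 c2 hi) ?(size_unzip_bword sigma d_gt2) ?bnd //; last by have := rn j; lia.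
  by rewrite a2 (chain_level d_gt1 hlb hcb hi).
have H_framed j : framed (H j).
  rewrite /H; case: ltnP => h.
    by apply: (chain_framed lw1 c1 f1); rewrite (size_unzip_bword sigma d_gt2) bnd // ltnW.
  apply: (chain_framed lw2 c2 f2); rewrite (size_unzip_bword sigma d_gt2) bnd //.
  by have := rn j; lia.
have H0 j : H j 0%N = one F d by rewrite Hlev // eb.
have Hd j : H j d = vol d 1 by rewrite Hlev ?eqxx ?orbT // eb W_std_top.
have H_path j : exists Z c, [/\ col_path sigma j Z c, forall i, (i <= d)%N -> Z 0%N i = H j i
    & forall i, (i <= d)%N -> Z N i = H (j + 1) i].
  have [k ej] := rE j; set a := r j in ej.
  have ej1 : j + 1 = (p + a.+1)%N%:Z + k * n%:Z by rewrite ej; lia.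
  have lt Z c : col_path sigma (p + a)%N%:Z Z c -> col_path sigma j Z c.
    by rewrite /col_path /letter ej color_mod.
  have [ha|ha] := ltnP a m1.
    exists (fun s => H1 0%N (a * N + s)%N), (fun s => C1 0%N (a * N + s)%N); split=> [|i _|i _].
    - by apply: lt; apply: (column_path d_gt2 c1).
    - by rewrite ej H_mod HE1 ?addn0 // ltnW.
    - by rewrite ej1 H_mod HE1 // mulSn addnC.
  have an := rn j; rewrite -/a in an.
  have e3 : (p + a)%N = (q + (a - m1))%N by lia.
  have e4 : (p + a.+1)%N = (q + (a - m1).+1)%N by lia.
  exists (fun s => H2 0%N ((a - m1) * N + s)%N), (fun s => C2 0%N ((a - m1) * N + s)%N); split=> [|i _|i _].
  - by apply: lt; rewrite e3; apply: (column_path d_gt2 c2); lia.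
  - by rewrite ej H_mod e3 HE2 ?addn0 //; lia.
  - by rewrite ej1 H_mod e4 HE2 ?mulSn 1?addnC //; lia.
have hv (i : 'I_n) : exists v : 'rV[F]_d, let j := i.+1%:Z in
    (sigma j -> iv v = H j 1%N) /\
    (~~ sigma j -> exists k, k != 0 /\ ctr v (vol d et) = k *: H j N).
  case: (boolP (sigma i.+1%:Z)) => sj.
    have [g [l [_ _ hl]]] := H_framed i.+1%:Z.
    have : hdeg 1 (H i.+1%:Z 1%N) by rewrite hl ?(ltnW d_gt1) //; apply: homogZ; apply: homog_W.
    by move=> /homog1[v ev]; exists v; rewrite /= sj -ev; split.
  by have [f [k hk]] := covector_exists d_gt2 (et_neq0 vol_e) (H_framed i.+1%:Z); exists f; rewrite /= (negPf sj); split=> // _; exists k.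
have [rr hrr] := boolp.choice hv; have [u0 hu0] := point_exists rr.
have Hfi j : H (factor_index sigma j).+1%:Z = H j by have [k ->] := factor_index_label sigma j; rewrite H_mod.
have uc_black j : sigma j -> iv (pcoords u0 j) = H j 1%N.
  by move=> sj; have [h _] := hrr (factor_index sigma j); rewrite hu0 h ?Hfi ?color_factor_index.
have uc_white j : ~~ sigma j -> exists k, k != 0 /\ ctr (pcoords u0 j) (vol d et) = k *: H j N.
  by move=> sj; have [_ h] := hrr (factor_index sigma j); have := h; rewrite Hfi color_factor_index hu0 => /(_ sj).
have et0 := et_neq0 vol_e.
have pr := gF_propto d_gt2 adm et0 H_framed H0 Hd H_path uc_black uc_white.
have gF0 j k : (k <= d)%N -> ext_map (residue u0) (gF sigma (gcoords u0) (gvol e u0) j k) != 0.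
  move=> kd; rewrite (ext_map_value (value_gF e u0 u0 j k)).
  exact: (gF_nonzero d_gt2 adm et0 H_framed H0 Hd H_path uc_black uc_white).
have gm0 j : residue u0 (gmark sigma (gcoords u0) (gvol e u0) j) != 0.
  have := gmark_nonzero d_gt2 adm et0 H_framed H0 Hd H_path uc_black uc_white j.
  have R := ring_rel_value u0 u0; rewrite /gmark; case: ifP => _; last first.
    move=> h; rewrite (residue_value (ext_rel_ctr R (value_gcoords u0 u0 j) (value_gF e u0 u0 (j + 1) 1) set0)).
    exact: h.
  rewrite rmorphM rmorphV ?(gvol_unit vol_e) // (residue_value (value_gvol e u0 u0)).
  rewrite /topc (residue_value (ext_rel_wdg R (ext_rel_iv R (value_gcoords u0 u0 j)) (value_gF e u0 u0 (j + 1) N) setT)).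
  by [].
have ut := gvol_unit vol_e u0; have loc := @residue_local _ _ _ _ u0.
have mark p' m k : (k < size (bword d sigma p' m))%N -> (nth (0%N, false) (bword d sigma p' m) k).2 = false ->
    gcoef sigma (gcoords u0) (gvol e u0) p' k = 1.
  rewrite (size_bword sigma d_gt1) => hk; have [a [s [ek am sd _ es]]] := bword_decomp d_gt1 hk.
  by rewrite ek nth_bword // /gcoef -ek es => /= ->.
have go p' m ms w1 Hw Cw : is_weave (unzip1 (bword d sigma p' m)) ms w1 ->
    (forall s, (s <= size ms)%N -> chain (slice (unzip1 (bword d sigma p' m)) ms s) (Hw s) (Cw s) /\ framed (Hw s 0%N)) ->
    (forall s, (s < size ms)%N -> carry (nth move0 ms s) (slice (unzip1 (bword d sigma p' m)) ms s) (Hw s) (Hw s.+1)) ->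
    (forall a, (a <= m)%N -> forall i, (i <= d)%N -> Hw 0%N (a * N)%N i = H (p' + a)%N%:Z i) ->
    exists x fl, weave_data (bword d sigma p' m) ms (gtop sigma (gcoords u0) (gvol e u0) p' m) x fl.
  move=> hw hch hca hH.
  apply: (weave_data_exists loc hw (letters_bword sigma d_gt1 p' m) (gtop_framed loc d_gt2 adm ut gF0 p' m)
    (gtop_chain loc d_gt2 adm ut gF0 gm0 (m := m)) (@mark p' m) hch hca) => g.
  rewrite (size_unzip_bword sigma d_gt2) => hg i id.
  have [hc0 _] := hch 0%N (leq0n _); rewrite /slice take0 /= in hc0.
  have [c cu ec] := window_propto d_gt2 pr hc0 hH hg id; exists c => //.
  by rewrite (ext_map_value (value_gtop e u0 u0 p' m g i)).
exists u0; split; first by apply: (go _ _ _ _ _ _ hw1 h1 k1) => a ha i _; rewrite HE1.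
by apply: (go _ _ _ _ _ _ hw2 h2 k2) => a ha i _; rewrite HE2.
Qed.

End BasePoint.

(** * Completing weaves and forming the amalgamated seed *)

Section Seeds.
Variables (F : fieldType) (V : vectType F) (n : nat) (sigma : signature n) (e : ext V).
Local Notation d := (\dim (fullv : {vspace V})).
Hypotheses (d_gt2 : (2 < d)%N) (d_odd : odd d) (vol_e : volume_form e) (adm : admissible d sigma).
Let d_gt1 : (1 < d)%N := ltnW d_gt2.
Local Notation et := (e [set: 'I_d]).
Local Notation N := d.-1.
Local Notation gtopA u0 := (gtop sigma (gcoords u0) (gvol e u0)).

Lemma bword_colw p m : unzip1 (bword d sigma p m) = colw d [seq sigma j%:Z | j <- iota p m].
Proof.
rewrite /bword /colw /unzip1 map_flatten -!map_comp; congr flatten; apply: eq_map => j /=.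
by rewrite -/(unzip1 (column d sigma j%:Z)) unzip1_zip // size_rcons size_nseq; case: ifP; rewrite ?size_rev size_iota => _; lia.
Qed.

Lemma complete_weave p m ms0 w0 w' : (d <= m)%N -> is_weave (unzip1 (bword d sigma p m)) ms0 w0 ->
  w' = top_word N 1 \/ w' = rev (top_word N 1) ->
  exists ms1, is_weave (unzip1 (bword d sigma p m)) (ms0 ++ ms1) w'.
Proof.
move=> dm hw hw'; have hr : reach (colw d [seq sigma j%:Z | j <- iota p m]) w0.
  by exists ms0; rewrite -bword_colw.
have hs : (N <= size [seq sigma j%:Z | j <- iota p m])%N by rewrite size_map size_iota; lia.
have [ms1 h1] : reach w0 w'.
  by case: hw' => ->; [exact: (reach_top d_gt1 hs hr)|exact: (reach_top_rev d_gt1 hs hr)].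
by exists ms1; apply: is_weave_cat hw h1.
Qed.

(* The regular function [I] is the variable of the cycle [v]. *)
Definition carries p m ms v (I : coord_ring V n) := v \in cycles (bword d sigma p m) ms /\
  forall (u0 : point V sigma) ms' x fl, weave_data (bword d sigma p m) (ms ++ ms') (gtopA u0 p m) x fl ->
  forall (u : point V sigma) y, value_at u (x v) y -> y = evalp I u.

Lemma carries_cat p m ms ms' v I : carries p m ms v I -> carries p m (ms ++ ms') v I.
Proof.
move=> [hv h]; split; first exact: cycles_catl.
by move=> u0 ms2 x fl; rewrite -catA => /h.
Qed.

Lemma carries_variable p m ms v I u0 x fl : carries p m ms v I ->
  weave_data (bword d sigma p m) ms (gtopA u0 p m) x fl ->
  generically (fun u : point V sigma => has_value (tofrac I) u (aspec u (x v))).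
Proof.
move=> [_ h] hd; rewrite -[ms]cats0 in hd.
apply: generically_sub (generically_value (x v)) => u hu.
by rewrite (h _ _ _ _ hd u _ hu); apply: value_tofrac.
Qed.

Variables (p q : nat).
Hypotheses (lt_pq : (p < q)%N) (lt_qp : (q < p + n)%N).

(** Of [c1] and [c2] one names the cycle carrying [I], so both positions of the special weave are
    treated at once. *)
Lemma seed_of_weaves ms1 ms2 :
  is_weave (unzip1 (bword d sigma p (q - p))) ms1 (top_word N 1) ->
  is_weave (unzip1 (bword d sigma q (p + n - q))) ms2 (rev (top_word N 1)) ->
  forall (c1 c2 : option (nat * nat)) I,
  (forall v, c1 = Some v -> carries p (q - p) ms1 v I) ->
  (forall v, c2 = Some v -> carries q (p + n - q) ms2 v I) -> c1 != c2 ->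
  exists S : seed (ratfun V n), is_seed_pq e sigma p q S /\ in_extended_cluster S (tofrac I).
Proof.
move=> hw1 hw2 c1 c2 I h1 h2 hc.
have [u0 [[x1 [fl1 hd1]] [x2 [fl2 hd2]]]] := weaves_decorated d_gt2 d_odd vol_e adm lt_pq lt_qp hw1 hw2.
(* The distinguished variable is taken to be [tofrac I] itself: [carries] only compares values at
   points, which over a finite field would not identify rational functions, and [cluster_variables]
   asks for values only. *)
pose D c (x : nat * nat -> local_ring u0) v := if c == Some v then tofrac I else (val (x v)).1.
have hD p' m ms c x fl : (forall v, c = Some v -> carries p' m ms v I) ->
    weave_data (bword d sigma p' m) ms (gtopA u0 p' m) x fl ->
    forall v, generically (fun u : point V sigma => has_value (D c x v) u (aspec u (x v))).
  move=> h hd v; rewrite /D; case: (c =P Some v) => [ec|_]; last exact: generically_value.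
  by apply: (carries_variable (h _ ec) hd).
pose z k : local_ring u0 := wdg (gF sigma (gcoords u0) (gvol e u0) p%:Z k)
  (gF sigma (gcoords u0) (gvol e u0) q%:Z (d - k)) setT * gen u0 (mpolyC _ et^-1).
pose Z := mkseq (fun k => (val (z k.+1)).1) N.
pose S1 := @weave_seed (ratfun V n) (beta V sigma p q) ms1 (fun c => D c1 x1 (cycle_of c)).
pose S2 := @weave_seed (ratfun V n) (beta V sigma q (p + n)) ms2 (fun c => D c2 x2 (cycle_of c)).
exists (amalgamation S1 S2 Z); split.
  exists ms1, ms2, (top_word N 1), (rev (top_word N 1)), (fun c => D c1 x1 (cycle_of c)),
    (fun c => D c2 x2 (cycle_of c)), Z; split=> //.
  - have hred : reduced_word d (top_word N 1) by apply: top_word_reduced; lia.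
    by split=> //; apply: reduced_rev.
  - by apply: (cluster_of_weave_data d_gt2 d_odd vol_e adm (ltnW lt_pq) hw1 hd1) => v _; apply: (hD _ _ _ _ _ _ h1 hd1).
  - by apply: (cluster_of_weave_data d_gt2 d_odd vol_e adm (ltnW lt_qp) hw2 hd2) => v _; apply: (hD _ _ _ _ _ _ h2 hd2).
  - split; first by rewrite size_mkseq.
    move=> k hk; apply: generically_true => u; rewrite nth_mkseq; last by lia.
    rewrite prednK; last by case/andP: hk.
    have R := ring_rel_value u0 u; apply: (ring_relM R).
      have := ext_rel_wdg R (value_gF e u0 u p%:Z k) (value_gF e u0 u q%:Z (d - k)%N).
      by have /andP[_ /ltnW kd] := hk; move=> /(_ setT); rewrite !Fflag_gF ?leq_subr.
    by have := value_gen u0 u (mpolyC _ et^-1); rewrite /evalp mevalC.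
have hv p' m ms v : carries p' m ms v I -> exists i : cycle_index (bword d sigma p' m) ms, cycle_of i = v.
  by move=> [hv _]; exists (Ordinal (etrans (index_mem _ _) hv)); rewrite /cycle_of /= nth_index.
case e1 : c1 => [v|].
  have [i ei] := hv _ _ _ _ (h1 v e1); exists (inl i : vertex (amalgamation S1 S2 Z)).
  by rewrite /= ei /D e1 eqxx.
case e2 : c2 => [v|]; last by rewrite e1 e2 in hc.
have [i ei] := hv _ _ _ _ (h2 v e2).
have vi : variable (i : vertex S2) = tofrac I by rewrite /= ei /D e2 eqxx.
(* If the vertex is identified with one of the first quiver, that vertex represents it and carries
   the same variable. *)
have [/existsP[j /andP[/eqP hj _]]|hn] := boolP [exists j, glued Z (j : vertex S1) (i : vertex S2)].
  by exists (inl j : vertex (amalgamation S1 S2 Z)); rewrite -vi -hj.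
by exists (inr (Sub (i : vertex S2) hn) : vertex (amalgamation S1 S2 Z)); rewrite /= -vi.
Qed.

End Seeds.

(** * Placing the labels in a window of the circle *)

Section Labels.
Variables (F : fieldType) (V : vectType F) (n : nat) (sigma : signature n) (e : ext V).
Local Notation d := (\dim (fullv : {vspace V})).
Hypotheses (d_gt2 : (2 < d)%N) (d_odd : odd d) (vol_e : volume_form e) (adm : admissible d sigma).
Let d_gt1 : (1 < d)%N := ltnW d_gt2.
Local Notation et := (e [set: 'I_d]).

Lemma rel_lact (u0 u : point V sigma) c (s : seq int) x y :
  ext_rel (value_at u) x y ->
  ext_rel (value_at u) (foldr (@lact d c (local_ring u0)) x [seq gcoords u0 j | j <- s])
    (foldr (@lact d c F) y [seq pcoords u j | j <- s]).
Proof.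
have R := ring_rel_value u0 u; move=> h; elim: s => //= j s IH; rewrite /lact.
by case: c IH => IH; [apply: ext_rel_wdg => //; apply: ext_rel_iv|apply: ext_rel_ctr] => //;
  apply: value_gcoords.
Qed.

(** The identity of [special_weave] holds over the local ring; comparing its values with the
    hypothesis at the coefficient of the end level isolates the variable. *)
Lemma carries_exists p m c s a I : (a <= m)%N -> sorted ltn (rcons s a) ->
  all (fun b => sigma (p + b)%N%:Z == c) s -> (0 < size s <= d)%N ->
  (forall u : point V sigma, foldr (@lact d c F) (gF sigma (pcoords u) et (p + a)%N%:Z
     (src c (endlevel d c) (size s))) [seq pcoords u j | j <- [seq (p + b)%N%:Z | b <- s]] =
     evalp I u *: endvalue d c et) ->
  exists ms0 v w0, is_weave (unzip1 (bword d sigma p m)) ms0 w0 /\ carries sigma e p m ms0 v I.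
Proof.
move=> am hs hc hz hI; have [ms0 [v [hv [w0 [hw h]]]]] := special_weave d_gt2 adm am hs hc hz.
exists ms0, v, w0; split=> //; split=> // u0 ms' x fl hd u y hy.
have := h _ (gcoords u0) (gvol e u0) (gvol_unit vol_e u0) _ _ _ hd.
have R := ring_rel_value u0 u.
have -> : [seq gcoords u0 (p + b)%N%:Z | b <- s] = [seq gcoords u0 j | j <- [seq (p + b)%N%:Z | b <- s]].
  by rewrite -map_comp.
move=> e1; have := rel_lact c [seq (p + b)%N%:Z | b <- s]
  (value_gF e u0 u (p + a)%N%:Z (src c (endlevel d c) (size s))).
rewrite e1 hI => e2.
have e3 : ext_rel (value_at u) (x v *: endvalue d c (gvol e u0)) (y *: endvalue d c et).
  apply: ext_relZ => //; rewrite /endvalue; case: (c).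
    by apply: ext_relZ; [exact: R|exact: value_gvol|exact: ext_rel_base].
  exact: ext_rel_base.
have e4 S := value_unique (e2 S) (e3 S).
have et0 := et_neq0 vol_e.
move: e4; rewrite /endvalue; case: (c) => e4.
  have := e4 setT; rewrite !ffunE eqxx /GRing.scale /= !mulr1 => h1.
  by apply/esym; apply: (mulIf et0).
by have := e4 set0; rewrite !ffunE eqxx /GRing.scale /= !mulr1.
Qed.

(** The columns are the labels [L], and the flag at [l] supplies the starting level; labels may
    exceed n, meaning that the window wraps around. *)
Lemma seed_of_labels c (L : seq nat) l I : (2 * d + 2 <= n)%N -> (0 < size L <= d)%N ->
  sorted ltn (rcons L l) -> (0 < head 0%N L <= n)%N -> (l + d.+1 <= head 0%N L + n)%N ->
  all (fun b : nat => sigma b%:Z == c) L ->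
  (forall u : point V sigma, foldr (@lact d c F) (gF sigma (pcoords u) et l%:Z
     (src c (endlevel d c) (size L))) [seq pcoords u b%:Z | b : nat <- L] =
     evalp I u *: endvalue d c et) ->
  exists (p q : nat) (S : seed (ratfun V n)), [/\ [&& 1 <= p, p <= q & q <= n]%N,
    (d + 1 <= minn (q - p) (n - (q - p)))%N, is_seed_pq e sigma p q S
    & in_extended_cluster S (tofrac I)].
Proof.
move=> hn hz hs /andP[s0 sn] hl hc hI; set p0 := head 0%N L in s0 sn hl.
have hp : all (fun b => p0 <= b)%N (rcons L l).
  case: L @p0 hz hs {s0 sn hl hc hI} => //= b L _ /(order_path_min ltn_trans) h.
  by rewrite leqnn; apply: sub_all h => i /ltnW.
move: (hp); rewrite all_rcons => /andP[pl pL].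
have hL : [seq (p0 + b)%N%:Z | b <- [seq (b - p0)%N | b <- L]] = [seq b%:Z | b : nat <- L].
  by rewrite -map_comp; apply/eq_in_map => b /(allP pL) h /=; rewrite subnKC.
(* The window must contain the labels and have length at least d+1; both bounds leave at least d+1
   for the complement. *)
pose m := maxn (l - p0) d.+1.
have [ms0 [v [w0 [hw hv]]]] : exists ms0 v w0,
    is_weave (unzip1 (bword d sigma p0 m)) ms0 w0 /\ carries sigma e p0 m ms0 v I.
  apply: (@carries_exists p0 m c [seq (b - p0)%N | b <- L] (l - p0)%N I); first exact: leq_maxl.
  - rewrite -map_rcons sorted_map; apply: (@sub_in_sorted _ (fun b => p0 <= b)%N ltn _ _ (rcons L l) hp hs).
    move=> x y hx _ xy; rewrite /= ltn_sub2r //; exact: leq_ltn_trans hx xy.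
  - by rewrite all_map; apply/allP => b hb /=; rewrite subnKC ?(allP pL) // (allP hc).
  - by rewrite size_map.
  - by move=> u; rewrite hL size_map subnKC // -hI -map_comp.
have [dm mn] : (d.+1 <= m)%N /\ (m + d.+1 <= n)%N by rewrite /m; lia.
(* If the window ends by n it is the first word, with p = p0; otherwise it wraps around and is the
   second word, with q = p0. *)
have [hq|hq] := leqP (p0 + m) n.
  have em : (p0 + m - p0 = m)%N by rewrite addKn.
  have [ms1 h1] := complete_weave d_gt2 d_odd (ltnW dm) hw (or_introl erefl).
  have dm2 : (d <= p0 + n - (p0 + m))%N by lia.
  have [ms2 h2] := @complete_weave F V n sigma d_gt2 d_odd (p0 + m)%N _ [::] _ (rev (top_word d.-1 1)) dm2 (is_weave_nil _) (or_intror erefl).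
  have lt1 : (p0 < p0 + m)%N by lia.
  have lt2 : (p0 + m < p0 + n)%N by lia.
  rewrite -em in h1 hv.
  have [S [hS hI']] := seed_of_weaves d_gt2 d_odd vol_e adm lt1 lt2 h1 h2 (c1 := Some v) (c2 := None) (I := I)
    (fun _ ev => let: erefl := ev in carries_cat _ hv) (fun _ => ltac:(done)) isT.
  by exists p0, (p0 + m)%N, S; split=> //; lia.
pose p := (p0 + m - n)%N; have em : (p + n - p0 = m)%N by rewrite /p; lia.
have [ms2 h2] := complete_weave d_gt2 d_odd (ltnW dm) hw (or_intror erefl).
have dm1 : (d <= p0 - p)%N by rewrite /p; lia.
have [ms1 h1] := @complete_weave F V n sigma d_gt2 d_odd p _ [::] _ (top_word d.-1 1) dm1 (is_weave_nil _) (or_introl erefl).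
have lt1 : (p < p0)%N by rewrite /p; lia.
have lt2 : (p0 < p + n)%N by rewrite /p; lia.
rewrite -em in h2 hv.
have [S [hS hI']] := seed_of_weaves d_gt2 d_odd vol_e adm lt1 lt2 h1 h2 (c1 := None) (c2 := Some v) (I := I)
  (fun _ => ltac:(done)) (fun _ ev => let: erefl := ev in carries_cat _ hv) isT.
by exists p, p0, S; split=> //; rewrite /p; lia.
Qed.

End Labels.

(** * Invariance under cyclic rotation *)

Section Rotation.
Variables (K : comUnitRingType) (d : nat) (c : bool) (t : K).
Local Notation V := 'rV[K]_d.

Local Notation lactb b := (@lact d b K).

Definition startvalue : extK K d := if c then one K d else vol d t.

Lemma ctrC (f g : V) (x : extK K d) : ctr f (ctr g x) = - ctr g (ctr f x).
Proof.
pose T (f g : V) S (i j : 'I_d) := f 0 i * g 0 j * (sh_sign K S [set i] * sh_sign K S [set j]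
  * sh_sign K [set i] [set j] * x (i |: (j |: S))).
have e f' g' S : ctr f' (ctr g' x) S = \sum_(i | i \notin S) \sum_(j | (j \notin S) && (i != j)) T f' g' S i j.
  rewrite ffunE; apply: eq_bigr => i iS; rewrite ffunE mulr_sumr; apply: eq_big => [j|j].
    by rewrite in_setU1 negb_or eq_sym andbC.
  rewrite in_setU1 negb_or => /andP[ji jS].
  have -> : sh_sign K (i |: S) [set j] = sh_sign K [set i] [set j] * sh_sign K S [set j].
    by rewrite sh_signUl // disjoints1.
  by rewrite /T setUCA; ring.
apply/ffunP => S; rewrite [RHS]ffunE !e (exchange_big_dep (fun j => j \notin S)) /= => [|i j iS /andP[]] //.
rewrite -sumrN; apply: eq_bigr => j jS; rewrite -sumrN; apply: eq_big => [i|i /andP[iS /andP[_ ij]]].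
  by rewrite jS /= eq_sym.
by rewrite /T sh_sign1C // setUCA; ring.
Qed.

Lemma wdg_vectors (s : seq V) z :
  foldr (lactb true) z s = wdg (foldr (lactb true) (one K d) s) z.
Proof. by elim: s => /= [|v s ->]; rewrite ?wdg1l // /lact wdgA. Qed.

Lemma wdg_vectors_comm (s : seq V) v : wdg (foldr (lactb true) (one K d) s) (iv v) =
  (-1) ^+ size s *: wdg (iv v) (foldr (lactb true) (one K d) s).
Proof.
elim: s => /= [|u s IH]; first by rewrite wdg1l wdg1r scale1r.
rewrite -wdgA IH wdgZr wdgA iv_wdgC wdgNl scalerN -scaleNr exprS mulN1r.
by rewrite -wdgA.
Qed.

Lemma ctr_covectors_comm (s : seq V) f z : ctr f (foldr (lactb false) z s) =
  (-1) ^+ size s *: foldr (lactb false) (ctr f z) s.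
Proof.
elim: s => /= [|g s IH]; first by rewrite scale1r.
by rewrite /lact ctrC -/(lact false g) IH ctrZ exprS mulN1r scaleNr.
Qed.

(** The moved factor passes an even number of vectors or covectors, with which it anticommutes. *)
Lemma lact_rot1 v s : ~~ odd (size s) ->
  foldr (lactb c) startvalue (rcons s v) = foldr (lactb c) startvalue (v :: s).
Proof.
rewrite foldr_rcons /startvalue => hs; have h : (-1) ^+ size s = 1 :> K by rewrite -signr_odd (negPf hs).
case: c; last by rewrite /= [RHS]ctr_covectors_comm h scale1r.
have e : lactb true v (one K d) = iv v by exact: wdg1r.
by rewrite e (wdg_vectors s (iv v)) wdg_vectors_comm h scale1r.
Qed.

Lemma lact_rot r s : odd (size s) -> (r <= size s)%N ->
  foldr (lactb c) startvalue (rot r s) = foldr (lactb c) startvalue s.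
Proof.
move=> hs; elim: r => [|r IH] hr; first by rewrite rot0.
rewrite rotS // -IH ?(ltnW hr) //.
have : odd (size (rot r s)) by rewrite size_rot.
by case: (rot r s) => //= v s' hs'; rewrite rot1_cons lact_rot1.
Qed.

Lemma homog_vectors (s : seq V) : hdeg (size s) (foldr (lactb true) (one K d) s).
Proof.
elim: s => [|v s IH] /=; first exact: homog_one.
by rewrite -add1n; apply: homog_wdg => //; apply: homog_iv.
Qed.

Lemma homog_covectors (s : seq V) k z : hdeg (size s + k) z -> hdeg k (foldr (lactb false) z s).
Proof.
by elim: s k => //= f s IH k hz; apply: homog_ctr; apply: IH; rewrite addnS.
Qed.

End Rotation.

(** * The three kinds of Weyl generators *)

(** If no consecutive difference exceeds g, the differences up to index k add up to at most k g. *)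
Lemma gap_exists (s : seq nat) g k : (k < size s)%N ->
  (exists2 r, (0 < r <= k)%N & (nth 0%N s r.-1 + g < nth 0%N s r)%N) \/ (nth 0%N s k <= nth 0%N s 0 + k * g)%N.
Proof.
elim: k => [|k IH] hk; first by right; rewrite mul0n addn0.
have [[r hr h]|h] := IH (ltnW hk); first by left; exists r => //; lia.
case: (ltnP (nth 0%N s k + g) (nth 0%N s k.+1)) => h'; first by left; exists k.+1; rewrite // ltnSn.
by right; rewrite mulSn; lia.
Qed.

Section Cases.
Variables (F : fieldType) (V : vectType F) (n : nat) (sigma : signature n) (e : ext V).
Local Notation d := (\dim (fullv : {vspace V})).
Hypotheses (d_gt2 : (2 < d)%N) (d_odd : odd d) (vol_e : volume_form e) (adm : admissible d sigma).
Hypothesis n_large : (d ^ 2 < n)%N.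
Let d_gt1 : (1 < d)%N := ltnW d_gt2.
Local Notation et := (e [set: 'I_d]).

Definition in_some_seed (I : coord_ring V n) := exists (p q : nat) (S : seed (ratfun V n)),
  [/\ [&& 1 <= p, p <= q & q <= n]%N, (d + 1 <= minn (q - p) (n - (q - p)))%N,
      is_seed_pq e sigma p q S & in_extended_cluster S (tofrac I)].

Lemma n_bound : (2 * d + 2 <= n)%N.
Proof. by have := n_large; rewrite expnS expn1; nia. Qed.

(** Cutting the circle before the r-th label: the earlier labels are shifted by n, which leaves the
    point unchanged. *)
Lemma rotated_labels (s : seq nat) r : sorted ltn s -> all (fun i => 0 < i <= n)%N s -> (r < size s)%N ->
  let L := drop r s ++ [seq (i + n)%N | i <- take r s] in
  [/\ sorted ltn L, head 0%N L = nth 0%N s r,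
      last 0%N L = if r == 0%N then last 0%N s else (nth 0%N s r.-1 + n)%N
    & forall u : point V sigma, [seq pcoords u b%:Z | b : nat <- L] = rot r [seq pcoords u b%:Z | b : nat <- s]].
Proof.
move=> hs hn hr L; split.
- move: hs; rewrite !(sorted_pairwise ltn_trans) -{1}(cat_take_drop r s) !pairwise_cat => /and3P[_ h1 h2].
  rewrite h2 /= pairwise_map; apply/andP; split; last first.
    by apply: sub_pairwise h1 => x y /=; rewrite ltn_add2r.
  apply/allrelP => x y /mem_drop xs /mapP[z /mem_take zs ->].
  by have := allP hn x xs; have := allP hn z zs; lia.
- by rewrite /L -nth0 nth_cat size_drop subn_gt0 hr nth_drop addn0.
- rewrite last_cat; case: posnP => [->|r0]; first by rewrite take0 drop0.
  rewrite -nth_last size_map size_takel ?(ltnW hr) //.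
  by rewrite (nth_map 0%N) ?size_takel ?(ltnW hr) ?prednK // nth_take ?prednK.
move=> u; rewrite /rot -map_drop -map_take map_cat -map_comp; congr (_ ++ _).
apply: eq_map => i /=; have := pcoords_mod u i%:Z 1.
by rewrite mul1r -PoszD.
Qed.

(** The labels are cut at a cyclic gap of at least d+1. The last one after the cut becomes the base
    flag and the other d-1 the columns; the rotation is undone by [lact_rot], d being odd. *)
Lemma det_in_seed c (s : seq nat) I : sorted ltn s -> size s = d ->
  all (fun i => (0 < i <= n)%N && (sigma i%:Z == c)) s ->
  (forall u : point V sigma, foldr (@lact d c F) (startvalue d c et) [seq pcoords u b%:Z | b : nat <- s] =
     evalp I u *: endvalue d c et) -> in_some_seed I.
Proof.
move=> hs sd hc hI; have hn := n_bound.
have hr0 : all (fun i => 0 < i <= n)%N s by apply: sub_all hc => i /andP[].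
have [r rd hr] : exists2 r, (r < d)%N &
    ((if r == 0%N then last 0%N s else (nth 0%N s r.-1 + n)%N) + d.+1 <= nth 0%N s r + n)%N.
  have hk : (d.-1 < size s)%N by rewrite sd; lia.
  have [[r hr h]|h] := gap_exists d hk.
    by exists r; [lia|rewrite gtn_eqF; lia].
  exists 0%N; first exact: ltnW d_gt1.
  (* Without an inner gap the labels span at most (d-1) d, so the gap across n is at least n - d^2 +
     d, which n > d^2 makes at least d+1. *)
  rewrite eqxx -nth_last sd; have := n_large; rewrite expnS expn1; nia.
have [|h1 h2 h3 h4] := rotated_labels hs hr0 (r := r); first by rewrite sd.
set L := _ ++ _ in h1 h2 h3 h4.
have hL : all (fun b : nat => sigma b%:Z == c) L.
  rewrite all_cat; apply/andP; split; apply/allP => x; first by move=> /mem_drop/(allP hc)/andP[].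
  move=> /mapP[z /mem_take/(allP hc)/andP[_ hz] ->].
  by rewrite PoszD color_periodic.
have sL : size L = d by rewrite /L size_cat size_map size_drop size_takel sd ?subnK // ltnW.
case: (lastP L) h1 h2 h3 h4 hL sL => [|L' l] h1 h2 h3 h4 hL sL.
  by have := d_gt2; rewrite -sL.
rewrite size_rcons in sL; rewrite last_rcons in h3.
have hL0 : (0 < size L')%N by lia.
have e0 : head 0%N L' = nth 0%N s r by rewrite -h2; case: (L') hL0.
rewrite all_rcons in hL; have /andP[/eqP hl hL'] := hL.
apply: (@seed_of_labels _ _ _ _ _ d_gt2 d_odd vol_e adm c L' l I) => //.
- by rewrite hL0; lia.
- by rewrite e0; apply: (all_nthP 0%N hr0); rewrite sd.
- by rewrite e0 h3.
move=> u; rewrite -hI.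
(* The level of F_l that is needed is 1 in the black and d-1 in the white case: the vector or
   covector with label [l]. *)
have -> : gF sigma (pcoords u) et l%:Z (src c (endlevel d c) (size L')) = lact c (pcoords u l%:Z) (startvalue d c et).
  rewrite /src /endlevel /lact /startvalue; move: hl; case: (c) => hl.
    by rewrite (_ : d - size L' = 1)%N ?(gF_black d_gt1 adm) ?gF0 //; lia.
  rewrite add0n (gF_white d_gt1 adm) ?hl //; last by lia.
  by rewrite sL gFd.
rewrite -foldr_rcons -map_rcons h4 lact_rot ?size_map ?sd //; exact: ltnW.
Qed.

Lemma pcoords_vec (u : point V sigma) j : sigma j ->
  \row_k coord (vbasis fullv) k (vec u j) = pcoords u j.
Proof.
move=> sj; apply/rowP => k; rewrite !mxE /vec; move: (u (factor_index sigma j)).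
by rewrite color_factor_index sj.
Qed.

Lemma pcoords_covec (u : point V sigma) j : ~~ sigma j ->
  \row_k (covec u j (vbasis fullv)`_k : F) = pcoords u j.
Proof.
move=> /negPf sj; apply/rowP => k; rewrite !mxE /covec; move: (u (factor_index sigma j)).
by rewrite color_factor_index sj.
Qed.

(** One column suffices, in two ways: a vector wedged with F_b^{d-1} at a white b, or a covector
    contracted with F_b^1 at a black b. This gives freedom to run along either arc between the
    labels, and since n is at least 2d+2 one arc leaves a complement of length at least d+1. *)
Lemma pairing_in_seed (i j : nat) I : (0 < i <= n)%N -> (0 < j <= n)%N -> sigma i%:Z -> ~~ sigma j%:Z ->
  (forall u : point V sigma, evalp I u = covec u j%:Z (vec u i%:Z)) -> in_some_seed I.
Proof.
move=> hi hj si sj hI; have hn := n_bound.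
have ij : i != j by apply: contraNneq sj => <-.
have one_step c (a b : nat) : (0 < a <= n)%N -> (a < b)%N -> (b + d.+1 <= a + n)%N -> sigma a%:Z = c ->
    (forall u : point V sigma, lact c (pcoords u a%:Z) (gF sigma (pcoords u) et b%:Z (src c (endlevel d c) 1)) =
     evalp I u *: endvalue d c et) -> in_some_seed I.
  move=> ha ab hb sa h; apply: (@seed_of_labels _ _ _ _ _ d_gt2 d_odd vol_e adm c [:: a] b I) => //=.
  - exact: ltnW d_gt1.
  - by rewrite ab.
  - by rewrite sa eqxx.
have black b (u : point V sigma) : b = j%:Z \/ b = j%:Z + 1 * n%:Z ->
    lact true (pcoords u i%:Z) (gF sigma (pcoords u) et b (src true (endlevel d true) 1)) =
    evalp I u *: endvalue d true et.
  move=> hb; have [sb eb] : ~~ sigma b /\ pcoords u b = pcoords u j%:Z.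
    by case: hb => ->; rewrite ?pcoords_mod ?color_mod.
  rewrite /src /endlevel subn1 (gF_white d_gt1 adm) //; last by lia.
  rewrite prednK ?gFd //; last by lia.
  rewrite eb hI /endvalue -(e_vol vol_e) -psiP // psi_ctr // /lact inV_iv.
  by rewrite pcoords_vec // pcoords_covec.
have white b (u : point V sigma) : b = i%:Z \/ b = i%:Z + 1 * n%:Z ->
    lact false (pcoords u j%:Z) (gF sigma (pcoords u) et b (src false (endlevel d false) 1)) =
    evalp I u *: endvalue d false et.
  move=> hb; have [sb eb] : sigma b /\ pcoords u b = pcoords u i%:Z.
    by case: hb => ->; rewrite ?pcoords_mod ?color_mod.
  rewrite /src /endlevel add0n (gF_black d_gt1 adm) // gF0 wdg1r eb hI /endvalue /lact pairing_cv //.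
  have -> : iv (pcoords u i%:Z) = rw (one F d) (pcoords u i%:Z) by rewrite /rw wdg1l.
  by rewrite ctr_rw ctr_one rw0l subr0.
have shift (a : nat) : (a + n)%N%:Z = a%:Z + 1 * n%:Z by rewrite mul1r PoszD.
have [lt_ij|le_ji] := ltnP i j.
  have [h|h] := leqP (j + d.+1) (i + n).
    by apply: (one_step true i j) => // u; apply: black; left.
  apply: (one_step false j (i + n)%N) => //; [lia|lia|exact: negPf|].
  by move=> u; apply: white; right; apply: shift.
have {le_ji} lt_ji : (j < i)%N by lia.
have [h|h] := leqP (i + d.+1) (j + n).
  apply: (one_step false j i) => //; [exact: negPf|].
  by move=> u; apply: white; left.
apply: (one_step true i (j + n)%N) => //; [lia|lia|].
by move=> u; apply: black; right; apply: shift.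
Qed.

Lemma weyl_in_seed I : weyl_generator sigma e I -> in_some_seed I.
Proof.
have et0 := et_neq0 vol_e.
case=> [[s /and3P[hs /eqP hz hc] hI]|[s /and3P[hs /eqP hz hc] hI]|[[i j] /and4P[/= hi hj si sj] hI]].
- have hcs : all sigma [seq i%:Z | i : nat <- s] by rewrite all_map; apply: sub_all hc => i /andP[].
  apply: (@det_in_seed true s I hs hz); first by apply: sub_all hc => i /andP[-> ->].
  move=> u; have := vdet_wdg e u hcs; rewrite -!map_comp -hI => ->.
  have hh : hdeg d (foldr (@lact d true F) (one F d) [seq pcoords u b%:Z | b : nat <- s]).
    by rewrite -[X in hdeg X _]hz -(size_map (fun b : nat => pcoords u b%:Z)); apply: homog_vectors.
  rewrite /startvalue [LHS](homog_top hh) /endvalue /vol scalerA divfK //.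
- have hcs : all (fun j => ~~ sigma j) [seq i%:Z | i : nat <- s].
    by rewrite all_map; apply: sub_all hc => i /andP[].
  apply: (@det_in_seed false s I hs hz); first by apply: sub_all hc => i /andP[-> /negPf->].
  have hz' : size [seq i%:Z | i : nat <- s] = d by rewrite size_map.
  move=> u; have := dual_det_ctr vol_e u hcs hz'; rewrite -!map_comp -hI => ->.
  have hh : hdeg 0 (foldr (@lact d false F) (startvalue d false et) [seq pcoords u b%:Z | b : nat <- s]).
    by apply: homog_covectors; rewrite addn0 size_map hz; apply: homog_vol.
  by rewrite [LHS](homog0 hh) /endvalue /startvalue -(e_vol vol_e).
- by apply: (pairing_in_seed hi hj si sj).
Qed.

End Cases.

Local Close Scope ring_scope.

Theorem corollary4p50 (R : realType) (V : vectType R[i]) (e : ext V)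
    (n : nat) (sigma : signature n) (I : coord_ring V n) :
  (2 < \dim {:V})%N -> odd (\dim {:V}) -> volume_form e ->
  admissible (\dim {:V}) sigma -> ((\dim {:V}) ^ 2 < n)%N ->
  SL_invariant sigma I -> weyl_generator sigma e I ->
  exists (p q : nat) (S : seed (ratfun V n)),
    [/\ [&& 1 <= p, p <= q & q <= n]%N,
        (\dim {:V} + 1 <= minn (q - p) (n - (q - p)))%N,
        is_seed_pq e sigma p q S
      & in_extended_cluster S (tofrac I)].
Proof.
move=> d_gt2 d_odd vol_e adm n_large _ hI.
exact: (weyl_in_seed d_gt2 d_odd vol_e adm n_large hI).
Qed.
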